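(* Let $\xi\in(0,1)$ and let $\nu$ be either a real number with $0\le\nu<\frac12$ or a purely imaginary number. Let $\mathsf{K}_{\nu,\xi}$ be the correlation kernel of the point process $\mathbf{P}_{\nu,\xi}$ on $\mathbb{Z}_{>0}$ (see context). Then for all $x,y\in\mathbb{Z}_{>0}$ $$\begin{aligned}\frac{\mathsf{g}(-y)}{\mathsf{g}(-x)}\mathsf{K}_{\nu,\xi}(x,y)={}&\frac{\sqrt{xy}}{x+y}\,\frac{1-\xi}{(2\pi i)^2}\oint_{\{w_1\}}\oint_{\{w_2\}}\big(1-w_1\sqrt\xi\big)^{-\frac12+\nu+x}\Big(1-\frac{\sqrt\xi}{w_1}\Big)^{-\frac12+\nu-x}\\&\times\big(1-w_2\sqrt\xi\big)^{-\frac12-\nu+y}\Big(1-\frac{\sqrt\xi}{w_2}\Big)^{-\frac12-\nu-y}w_1^{-x}w_2^{-y}\,\frac{w_1w_2+1}{w_1w_2-1}\cdot\frac{dw_1dw_2}{w_1w_2}.\end{aligned}$$ Here the contours $\{w_1\}$ and $\{w_2\}$ go around $0$ and $\sqrt\xi$ in the positive direction leaving $1/\sqrt\xi$ outside, and the contour $\{w_1^{-1}\}$ lies in the interior of the contour $\{w_2\}$.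
   Context: $\mathbb{Z}_{>0}=\{1,2,\dots\}$. $\mathbf{P}_{\nu,\xi}$ is the probability measure on finite subsets of $\mathbb{Z}_{>0}$ given by $$\mathbf{P}_{\nu,\xi}(\{x_1,\dots,x_N\})=\mathit{const}\cdot\prod_{1\le i<j\le N}\Big(\frac{x_i-x_j}{x_i+x_j}\Big)^2\prod_{i=1}^N\psi_{\nu,\xi}(x_i),\qquad \psi_{\nu,\xi}(x)=\frac{\xi^x\cos(\pi\nu)}{2\pi}\frac{\Gamma(\frac12-\nu+x)\Gamma(\frac12+\nu+x)}{(x!)^2},$$ where $\mathit{const}$ is the normalizing constant (empty products equal $1$). This process is determinantal, i.e. the probability that the random configuration contains a given finite set $\{x_1,\dots,x_n\}$ of distinct points is $\det[\mathsf{K}_{\nu,\xi}(x_i,x_j)]_{i,j=1}^n$, with correlation kernel $\mathsf{K}_{\nu,\xi}=\mathsf{L}_{\nu,\xi}(1+\mathsf{L}_{\nu,\xi})^{-1}$, where $\mathsf{L}_{\nu,\xi}$ is the trace class operator in $\ell^2(\mathbb{Z}_{>0})$ with matrix $\mathsf{L}_{\nu,\xi}(x,y)=\frac{2\sqrt{xy\,\psi_{\nu,\xi}(x)\psi_{\nu,\xi}(y)}}{x+y}$. For $x\in\mathbb{Z}$, $\mathsf{g}(x)=\frac{\sqrt{\Gamma(\frac12+\nu+x)\Gamma(\frac12-\nu+x)}}{\Gamma(\frac12+\nu+x)}$ (the expression under the square root is positive). All complex powers are principal branches: $(1-w\sqrt\xi)^a$ is holomorphic off the cut $[1/\sqrt\xi,+\infty)$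 and $(1-\sqrt\xi/w)^a$ is holomorphic off the cut $[0,\sqrt\xi]$. The contours are simple closed curves avoiding both cuts. *)

(* Defs.v *)
From Stdlib Require Import Arith ZArith Reals ClassicalEpsilon.
From Coquelicot Require Import Coquelicot.

Open Scope C_scope.

Definition Cexp (z : C) : C :=
  (exp (Re z) * cos (Im z), exp (Re z) * sin (Im z))%R.

Definition Ccos (z : C) : C := (Cexp (Ci * z) + Cexp (- (Ci * z))) / 2.

(* Principal argument, in (-PI, PI] for z <> 0; cut along the negative reals. *)
Definition Carg (z : C) : R :=
  if Rle_dec 0 (Im z) then acos (Re z / Cmod z) else (- acos (Re z / Cmod z))%R.

Definition Clog (z : C) : C := (ln (Cmod z), Carg z).

(* Principal branch of z^a, for z <> 0. *)
Definition Cpowc (z a : C) : C := Cexp (a * Clog z).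

(* Applied only to positive real numbers, where it is the positive root. *)
Definition Csqrt (z : C) : C := Cpowc z (1 / 2).

Definition Clim_seq (u : nat -> C) : C :=
  (real (Lim_seq (fun n => Re (u n))), real (Lim_seq (fun n => Im (u n)))).

Definition Cseries (u : nat -> C) : C :=
  (Series (fun n => Re (u n)), Series (fun n => Im (u n))).

Fixpoint rising (z : C) (n : nat) : C :=
  match n with
  | O => 1
  | S m => rising z m * (z + INR m)
  end.

(* Euler-Gauss limit: Gamma z = lim n! n^z / (z (z + 1) ... (z + n)),
   valid at every z that is not one of 0, -1, -2, ... *)
Definition Gamma (z : C) : C :=
  Clim_seq (fun n =>
    INR (fact n) * Cexp (z * ln (INR n)) / rising z (S n)).

Definition psi (nu : C) (xi : R) (x : nat) : C :=
  (xi ^ x)%R * Ccos (PI * nu) / (2 * PI)%R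
  * (Gamma (1 / 2 - nu + INR x) * Gamma (1 / 2 + nu + INR x))
  / ((INR (fact x)) ^ 2)%R.

Definition gfun (nu : C) (x : Z) : C :=
  Csqrt (Gamma (1 / 2 + nu + IZR x) * Gamma (1 / 2 - nu + IZR x))
  / Gamma (1 / 2 + nu + IZR x).

(* Sequences indexed by the positive integers are functions on nat whose value
   at 0 is never used. *)
Definition ell2 (u : nat -> C) : Prop :=
  ex_series (fun n => (Cmod (u (S n)) ^ 2)%R).

Definition delta (y : nat) : nat -> C :=
  fun x => if Nat.eq_dec x y then 1 else 0.

(* The operator with matrix M: (M u)(x) = sum over y >= 1 of M(x,y) u(y). *)
Definition op_of_matrix (M : nat -> nat -> C) (u : nat -> C) : nat -> C :=
  fun x => Cseries (fun n => M x (S n) * u (S n)).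

Definition matrix_of_op (A : (nat -> C) -> nat -> C) : nat -> nat -> C :=
  fun x y => A (delta y) x.

Definition op_id_plus (A : (nat -> C) -> nat -> C) (u : nat -> C) : nat -> C :=
  fun x => u x + A u x.

(* A^{-1} f: the square-summable u such that A u = f (on positive indices). *)
Definition op_inv (A : (nat -> C) -> nat -> C) (f : nat -> C) : nat -> C :=
  epsilon (inhabits (fun _ => RtoC 0))
    (fun u => ell2 u /\ forall x : nat, (0 < x)%nat -> A u x = f x).

Definition Lmat (nu : C) (xi : R) (x y : nat) : C :=
  2 * Csqrt (INR x * INR y * psi nu xi x * psi nu xi y) / (INR x + INR y).

Definition Lop (nu : C) (xi : R) : (nat -> C) -> nat -> C :=
  op_of_matrix (Lmat nu xi).

(* The matrix of L (1 + L)^{-1}.  By Cauchy's determinant, det [L(x_i, x_j)] is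
   the product of ((x_i - x_j) / (x_i + x_j))^2 over i < j times the product of
   the psi(x_i), so this is the correlation kernel of the determinantal process
   on finite subsets {x_1, ..., x_N} weighted by that expression. *)
Definition Kker (nu : C) (xi : R) : nat -> nat -> C :=
  matrix_of_op (fun u => Lop nu xi (op_inv (op_id_plus (Lop nu xi)) u)).

(* g is continuously differentiable on the closed interval [a, b]. *)
Definition C1_on (g : R -> C) (a b : R) : Prop :=
  exists h dh : R -> C,
    (forall t : R, is_derive (K := R_AbsRing) (V := C_R_NormedModule) h t (dh t)) /\
    (forall t : R, continuous (U := C_UniformSpace) dh t) /\
    (forall t : R, (a <= t <= b)%R -> g t = h t).

Definition piecewise_C1 (g : R -> C) : Prop :=
  exists (n : nat) (s : nat -> R),
    s 0%nat = 0%R /\ s n = 1%R /\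
    forall i : nat, (i < n)%nat -> (s i < s (S i))%R /\ C1_on g (s i) (s (S i)).

(* Contours are parametrized by [0, 1]. *)
Definition simple_closed_contour (g : R -> C) : Prop :=
  piecewise_C1 g /\ g 0%R = g 1%R /\
  forall s t : R, (0 <= s)%R -> (s < t)%R -> (t < 1)%R -> g s <> g t.

Definition on_contour (g : R -> C) (p : C) : Prop :=
  exists t : R, (0 <= t <= 1)%R /\ g t = p.

(* At the finitely many corners (and at 0 and 1) Derive is junk; this does not
   affect the integral below. *)
Definition velocity (g : R -> C) (t : R) : C :=
  (Derive (fun s => Re (g s)) t, Derive (fun s => Im (g s)) t).

Definition contour_int (g : R -> C) (f : C -> C) : C :=
  RInt (V := C_R_CompleteNormedModule) (fun t => f (g t) * velocity g t) 0 1.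

Definition winding (g : R -> C) (p : C) : C :=
  / (2 * PI * Ci) * contour_int g (fun w => / (w - p)).

(* For a simple closed contour the winding number is constantly 1 or constantly
   -1, according to orientation, on the interior, and 0 on the exterior.  Thus
   "goes_around g p" says that g is positively oriented with p in its interior. *)
Definition goes_around (g : R -> C) (p : C) : Prop :=
  ~ on_contour g p /\ winding g p = 1.

Definition leaves_outside (g : R -> C) (p : C) : Prop :=
  ~ on_contour g p /\ winding g p = 0.

Definition avoids_cuts (xi : R) (g : R -> C) : Prop :=
  (forall r : R, (0 <= r <= sqrt xi)%R -> ~ on_contour g (RtoC r)) /\
  (forall r : R, (/ sqrt xi <= r)%R -> ~ on_contour g (RtoC r)).

Definition admissible_contour (xi : R) (g : R -> C) : Prop :=
  simple_closed_contour g /\ avoids_cuts xi g /\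
  goes_around g 0 /\ goes_around g (sqrt xi) /\ leaves_outside g (/ sqrt xi).

(* Main.v *)
Require Import Defs.
From Stdlib Require Import ZArith Reals Lra Lia FunctionalExtensionality ClassicalEpsilon Wf_nat.
From Coquelicot Require Import Coquelicot.

(** Write [a = 1/2 - nu] and [b = 1/2 + nu], so that [a + b = 1], and [s = sqrt xi]. The proof
    computes both sides as one and the same series of products of hypergeometric values.

    The kernel. Reflection for Gamma turns the weight into [2 x psi(x) = c_x xi^x] with
    [c_x = x (a)_x (b)_x / (x!)^2] ([psi_eval], [residue_coef_root_weight]). For the
    Euler-Gauss limit reflection amounts to a product formula for [cos (pi nu)], which follows from the recursion
    for the integrals of [cos^n t cos (2 nu t)] ([cosine_product_limit]). With
    [h(x) = sqrt (x psi(x))] one has [L(x,y) = 2 h(x) h(y) / (x + y)], and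
    [K(x,y) = h(x) h(y) k(x,y)] as soon as
    [k(x,y) + sum_z c_z xi^z k(z,y) / (x + z) = 2 / (x + y)]: the operator [1 + L] is injective
    because the Cauchy matrix [1 / (x + y)] is nonnegative ([resolvent_matrix]).

    The solution of this equation is
    [k(x,y) = 2 (1 - xi) / (x + y) * (U_0(x) V_0(y) + 2 sum_(k > 0) xi^k U_k(x) V_k(y))],
    where [U_k(x) = (a)_k / (x+1)_k * 2F1(a+k, a+x; x+k+1; xi)] and [V_k] is the same with [b].
    It is checked on formal power series in [xi]. Contiguous relations make the sum over [k]
    telescope under [2 theta + x + y], [theta] being the Euler operator, so that only the term
    [k = 0] is left ([kernel_ps_theta]). The coefficients [c_z] are the residues of [U_0(x)] as
    a function of [x] ([hyper_partial_fractions]). Hence the operator [2 theta + x + y] makes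
    the defect of the equation independent of [x], and a second use of the partial fractions
    expresses it through defects of lower order in [xi], with [a] and [b] exchanged; induction
    on the order shows that it vanishes ([kernel_ps_equation]). Geometric bounds, uniform in
    [x], [y] and [k], transport the identities to numbers ([kernel_val_equation] and
    [kernel_val_sum]).

    The contour integral. Its integrand is [f(w1) h(w2) (w1 w2 + 1) / (w1 w2 - 1)], with [f] and
    [h] holomorphic off the cuts. The inner contour goes around the pole [p = 1/w1], and the
    inner integral is [2 pi i (h_(-1) + 2 p h_+(p))], where [h_+] is the regular part of the
    Laurent series of [h] and [h_(-1)] its residue ([integral_with_pole]). Expanding the
    Cauchy kernel on a circle around [p], or on one leaving [p] outside, gives two expressions
    of [h_+], which make it holomorphic in the whole cut plane ([regular_part_holo1]). So the outer contour can be moved to the unit circle, where [h_+] is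
    a power series, and the double integral is
    [(2 pi i)^2 (f_(-1) h_(-1) + 2 sum_j f_j h_j)] ([double_contour]). Contours are moved by
    sliding each point along its ray to a circle, which never meets a cut
    ([homotopy_to_circle]).

    On the unit circle the binomial series give the Laurent coefficients of [f] and [h]: up to
    prefactors independent of the index they are [s^k U_k(x)] and [s^k V_k(y)]
    ([symbol_coefficient_hyper]). The two series agree, and the factor [g(-y)/g(-x)] turns
    [h(x) h(y)] into the product of the prefactors ([gauge_weight]). *)

Open Scope C_scope.

(** * Finite sums *)

Fixpoint Csum (u : nat -> C) (n : nat) : C :=
  match n with O => 0 | S m => Csum u m + u m end.

Lemma Csum_ext (u v : nat -> C) (n : nat) : (forall i, (i < n)%nat -> u i = v i) -> Csum u n = Csum v n.
Proof.
  induction n as [|n IH]; intros H; simpl; auto.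
  rewrite IH, H; auto.
Qed.

Lemma Csum_plus u v n : Csum (fun i => u i + v i) n = Csum u n + Csum v n.
Proof. induction n as [|n IH]; simpl; [ring|rewrite IH; ring]. Qed.

Lemma Csum_scal c u n : Csum (fun i => c * u i) n = c * Csum u n.
Proof. induction n as [|n IH]; simpl; [ring|rewrite IH; ring]. Qed.

Lemma Csum_zero (u : nat -> C) (n : nat) : (forall i, (i < n)%nat -> u i = 0) -> Csum u n = 0.
Proof.
  induction n as [|n IH]; intros H; simpl; auto.
  rewrite IH, H; auto; ring.
Qed.

Lemma Csum_first u n : Csum u (S n) = u O + Csum (fun i => u (S i)) n.
Proof.
  induction n as [|n IH]; [simpl; ring|].
  change (Csum u (S n) + u (S n) = u O + (Csum (fun i => u (S i)) n + u (S n))).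
  rewrite IH; ring.
Qed.

Lemma Csum_rev u n : Csum u (S n) = Csum (fun i => u (n - i)%nat) (S n).
Proof.
  induction n as [|n IH]; [reflexivity|].
  rewrite (Csum_first (fun i => u (S n - i)%nat)).
  change (Csum u (S n) + u (S n) = u (S n - 0)%nat + Csum (fun i => u (n - i)%nat) (S n)).
  rewrite <- IH, Nat.sub_0_r; ring.
Qed.

(** Fubini on a triangle; associativity of the convolution product rests on it. *)
Lemma Csum_triangle (a : nat -> nat -> C) n :
  Csum (fun i => Csum (fun j => a j (i - j)%nat) (S i)) (S n)
  = Csum (fun j => Csum (fun l => a j l) (S (n - j))) (S n).
Proof.
  induction n as [|n IH]; [reflexivity|].
  change (Csum (fun i => Csum (fun j => a j (i - j)%nat) (S i)) (S n)
     + Csum (fun j => a j (S n - j)%nat) (S (S n))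
   = Csum (fun j => Csum (fun l => a j l) (S (S n - j))) (S n)
     + Csum (fun l => a (S n) l) (S (S n - S n))).
  rewrite IH, Nat.sub_diag.
  change (Csum (fun j => a j (S n - j)%nat) (S (S n))) with
    (Csum (fun j => a j (S n - j)%nat) (S n) + a (S n) (S n - S n)%nat).
  rewrite (Csum_ext (fun j => Csum (fun l => a j l) (S (S n - j)))
     (fun j => Csum (fun l => a j l) (S (n - j)) + a j (S n - j)%nat)).
  - rewrite Csum_plus, Nat.sub_diag. simpl. ring.
  - intros i Hi. replace (S n - i)%nat with (S (n - i)) by lia. reflexivity.
Qed.

(** * Formal power series *)

Definition ps := nat -> C.
Definition psC (c : C) : ps := fun n => match n with O => c | _ => 0 end.
Arguments psC c%_C_scope.
Definition psX : ps := fun n => match n with 1%nat => 1 | _ => 0 end.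
Definition psD (f g : ps) : ps := fun n => f n + g n.
Definition psO (f : ps) : ps := fun n => - f n.
Definition psB (f g : ps) : ps := fun n => f n - g n.
Definition psM (f g : ps) : ps := fun n => Csum (fun i => f i * g (n - i)%nat) (S n).
(** The Euler operator [X d/dX]. *)
Definition theta (f : ps) : ps := fun n => INR n * f n.

Lemma psMC f g : psM f g = psM g f.
Proof.
  extensionality n. unfold psM. rewrite Csum_rev. apply Csum_ext.
  intros i Hi. replace (n - (n - i))%nat with i by lia. ring.
Qed.

Lemma psMA f g h : psM f (psM g h) = psM (psM f g) h.
Proof.
  extensionality n. unfold psM.
  transitivity (Csum (fun j => Csum (fun l => f j * g l * h (n - j - l)%nat) (S (n - j))) (S n)).
  - apply Csum_ext. intros i Hi. rewrite <- Csum_scal. apply Csum_ext. intros; ring.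
  - rewrite <- (Csum_triangle (fun j l => f j * g l * h (n - j - l)%nat)).
    apply Csum_ext. intros i Hi. rewrite (Cmult_comm (Csum _ _)), <- Csum_scal.
    apply Csum_ext. intros j Hj. replace (n - j - (i - j))%nat with (n - i)%nat by lia. ring.
Qed.

Lemma psCM c f n : psM (psC c) f n = c * f n.
Proof.
  unfold psM. rewrite Csum_first, Csum_zero; [simpl; rewrite Nat.sub_0_r; ring|].
  intros; simpl; ring.
Qed.

Lemma psXM0 f : psM psX f 0%nat = 0.
Proof. unfold psM; simpl; ring. Qed.

Lemma psXMS f n : psM psX f (S n) = f n.
Proof.
  unfold psM. rewrite Csum_first. rewrite Csum_first, Csum_zero.
  - simpl. rewrite Nat.sub_0_r. ring.
  - intros; simpl; ring.
Qed.

Lemma ps_ring : ring_theory (psC 0) (psC 1) psD psM psB psO eq.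
Proof.
  split; intros.
  - extensionality n. unfold psD. destruct n; simpl; ring.
  - extensionality n. unfold psD. ring.
  - extensionality n. unfold psD. ring.
  - extensionality n. rewrite psCM. ring.
  - apply psMC.
  - apply psMA.
  - extensionality n. unfold psD, psM. cbv beta.
    rewrite <- Csum_plus. apply Csum_ext. intros; ring.
  - extensionality n. unfold psD, psO, psB. ring.
  - extensionality n. unfold psD, psO. destruct n; simpl; ring.
Qed.
Add Ring ps_ring_inst : ps_ring.

Declare Scope ps_scope.
Delimit Scope ps_scope with ps.
Bind Scope ps_scope with ps.
Infix "+" := psD : ps_scope.
Infix "-" := psB : ps_scope.
Infix "*" := psM : ps_scope.

Lemma psC_plus c d : psC (c + d) = (psC c + psC d)%ps.
Proof. extensionality n. unfold psD. destruct n; simpl; ring. Qed.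

Lemma psC_minus c d : psC (c - d) = (psC c - psC d)%ps.
Proof. extensionality n. unfold psB. destruct n; simpl; ring. Qed.

Lemma thetaD f g : theta (f + g)%ps = (theta f + theta g)%ps.
Proof. extensionality n. unfold theta, psD. ring. Qed.

Lemma thetaB f g : theta (f - g)%ps = (theta f - theta g)%ps.
Proof. extensionality n. unfold theta, psB. ring. Qed.

Lemma thetaC c : theta (psC c) = psC 0.
Proof. extensionality n. unfold theta. destruct n; simpl; ring. Qed.

Lemma thetaX : theta psX = psX.
Proof. extensionality n. unfold theta. destruct n as [|[|n]]; simpl; ring. Qed.

Lemma thetaM f g : theta (f * g)%ps = (theta f * g + f * theta g)%ps.
Proof.
  extensionality n. unfold theta, psD, psM. cbv beta. rewrite <- Csum_plus, <- Csum_scal.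
  apply Csum_ext. intros i Hi. replace (INR n) with (INR i + INR (n - i))%R.
  - rewrite RtoC_plus. ring.
  - rewrite <- plus_INR. f_equal. lia.
Qed.

Fixpoint psXn (k : nat) : ps :=
  match k with O => psC 1 | S m => (psX * psXn m)%ps end.

Lemma psXnM k f n : (psXn k * f)%ps n = if Nat.leb k n then f (n - k)%nat else 0.
Proof.
  revert n; induction k as [|k IH]; intros n.
  - simpl. rewrite psCM, Nat.sub_0_r. ring.
  - change (psXn (S k)) with (psX * psXn k)%ps. rewrite <- psMA. destruct n as [|n].
    + apply psXM0.
    + rewrite psXMS, IH. reflexivity.
Qed.

Lemma theta_Xn k : theta (psXn k) = (psC (INR k) * psXn k)%ps.
Proof.
  induction k as [|k IH].
  - simpl. rewrite thetaC. ring.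
  - change (psXn (S k)) with (psX * psXn k)%ps.
    rewrite thetaM, IH, thetaX, S_INR, RtoC_plus, psC_plus. ring.
Qed.

(** Characteristic zero: the Euler operator kills only the constants. *)
Lemma ps_const f : theta f = psC 0 -> f = psC (f 0%nat).
Proof.
  intros H. extensionality n. destruct n as [|n]; [reflexivity|].
  assert (E : theta f (S n) = 0) by (rewrite H; reflexivity).
  unfold theta in E.
  destruct (Ceq_dec (f (S n)) 0) as [e|e]; [exact e|].
  exfalso. apply (Cmult_neq_0 (INR (S n)) (f (S n))) in e; auto.
  intros e'. apply RtoC_inj in e'. apply (not_0_INR (S n)); auto.
Qed.

Ltac psx := unfold psD, psB, psO; rewrite ?psCM, ?psXM0, ?psXMS.

(** * Hypergeometric power series *)

Lemma INRC_S n : RtoC (INR (S n)) = INR n + 1.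
Proof. rewrite S_INR, RtoC_plus. reflexivity. Qed.

Lemma INRC_add n m : RtoC (INR (n + m)) = INR n + INR m.
Proof. rewrite plus_INR, RtoC_plus. reflexivity. Qed.

Lemma INRC_pos_nz (r : R) : (0 < r)%R -> RtoC r <> 0.
Proof. intros H e. apply RtoC_inj in e. lra. Qed.

Lemma INRC_S_nz n : INR n + 1 <> 0.
Proof. rewrite <- INRC_S. apply INRC_pos_nz, lt_0_INR. lia. Qed.

Lemma INRC_add_nz n m : (0 < n + m)%nat -> INR n + INR m <> 0.
Proof. intros H. rewrite <- INRC_add. apply INRC_pos_nz, lt_0_INR. lia. Qed.

Lemma INRC_fact_nz n : RtoC (INR (fact n)) <> 0.
Proof. apply INRC_pos_nz, lt_0_INR, lt_O_fact. Qed.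

Lemma INRC_fact_S n : RtoC (INR (fact (S n))) = (INR n + 1) * INR (fact n).
Proof. rewrite fact_simpl, mult_INR, RtoC_mult, INRC_S. reflexivity. Qed.

Lemma rising_succ_fact x m : rising (INR x + 1) m * INR (fact x) = INR (fact (x + m)).
Proof.
  induction m as [|m IH].
  - rewrite Nat.add_0_r. simpl. ring.
  - rewrite <- plus_n_Sm, INRC_fact_S, <- IH, INRC_add. simpl. ring.
Qed.

Lemma rising_succ_nz x m : rising (INR x + 1) m <> 0.
Proof.
  intros e. pose proof (rising_succ_fact x m) as H. rewrite e in H.
  apply (INRC_fact_nz (x + m)). rewrite <- H. ring.
Qed.

Lemma rising_1 n : rising 1 n = INR (fact n).
Proof.
  pose proof (rising_succ_fact 0 n) as H. simpl in H.
  rewrite Cplus_0_l, Cmult_1_r in H. exact H.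
Qed.

Lemma rising_add z m n : rising z (m + n) = rising z m * rising (z + INR m) n.
Proof.
  induction n as [|n IH].
  - rewrite Nat.add_0_r. simpl. ring.
  - rewrite <- plus_n_Sm. simpl. rewrite IH, INRC_add. ring.
Qed.

(** Coefficients of [(a)_k/(x+1)_k * 2F1(a+k, a+x; x+k+1; X)]. *)
Definition hyper (a : C) (k x : nat) : ps := fun n =>
  rising a (k + n) * rising (a + INR x) n / (rising (INR x + 1) (k + n) * INR (fact n)).

(** The binomial series [(1-X)^(-a)]. *)
Definition negbin (a : C) : ps := fun n => rising a n / INR (fact n).

Lemma hyper_Sn a k x n :
  hyper a k x (S n) = hyper a k x n * ((a + INR k + INR n) * (a + INR x + INR n))
                   / ((INR x + 1 + INR k + INR n) * (INR n + 1)).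
Proof.
  unfold hyper. rewrite <- plus_n_Sm, INRC_fact_S. simpl. rewrite !INRC_add.
  field. repeat split; try apply INRC_S_nz; try apply INRC_fact_nz; try apply rising_succ_nz.
  replace (INR x + 1 + INR k + INR n) with (INR (x + k + n) + 1) by (rewrite !INRC_add; ring).
  apply INRC_S_nz.
Qed.

Lemma hyper_Sk a k x n :
  hyper a (S k) x n = hyper a k x n * (a + INR k + INR n) / (INR x + 1 + INR k + INR n).
Proof.
  unfold hyper. rewrite Nat.add_succ_l. simpl. rewrite !INRC_add.
  field. repeat split; try apply INRC_S_nz; try apply INRC_fact_nz; try apply rising_succ_nz.
  replace (INR x + 1 + INR k + INR n) with (INR (x + k + n) + 1) by (rewrite !INRC_add; ring).
  apply INRC_S_nz.
Qed.

Lemma xkn_nz x k n : INR x + 1 + INR k + INR n <> 0.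
Proof.
  replace (INR x + 1 + INR k + INR n) with (INR (x + k + n) + 1) by (rewrite !INRC_add; ring).
  apply INRC_S_nz.
Qed.

Section Contiguous.
Variables (a b : C).
Hypothesis Hab : a + b = 1.

Lemma b_eq : b = 1 - a.
Proof. rewrite <- Hab. ring. Qed.

Local Open Scope ps_scope.

(** Contiguous relations, in the two forms that make the sum defining the kernel telescope:
    this one eliminates the derivative, the next one trades the factor [x] for shifts of [k].
    All coefficients involved are rational multiples of [hyper a k x n]. *)
Lemma hyper_theta k x :
  (psC 1 - psX) * theta (hyper a k x)
  = psC (a + INR k) * (psX * hyper a k x) - psC (b + INR k) * (psX * hyper a (S k) x).
Proof.
  replace ((psC 1 - psX) * theta (hyper a k x)) with (theta (hyper a k x) - psX * theta (hyper a k x)) by ring.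
  extensionality n. unfold psB. destruct n as [|n].
  - rewrite !psCM; cbv beta; rewrite !psXM0. unfold theta. simpl. ring.
  - rewrite !psCM; cbv beta; rewrite !psXMS. unfold theta. rewrite hyper_Sk, hyper_Sn, INRC_S, b_eq.
    field. split; [apply xkn_nz|apply INRC_S_nz].
Qed.

Lemma hyper_shift k x :
  psC (INR x) * ((psC 1 - psX) * hyper a (S k) x)
  = psC (b + INR k + 1) * (psX * hyper a (S (S k)) x) + psC (a + INR k) * hyper a k x
    - psC (INR k + 1) * (hyper a (S k) x + psX * hyper a (S k) x).
Proof.
  replace ((psC 1 - psX) * hyper a (S k) x) with (hyper a (S k) x - psX * hyper a (S k) x) by ring.
  extensionality n. unfold psB, psD. destruct n as [|n].
  - rewrite !psCM; cbv beta; rewrite !psXM0, !hyper_Sk.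
    change (INR 0) with 0%R. field. intros e. apply (xkn_nz x k 0). change (INR 0) with 0%R. etransitivity; [|exact e]; ring.
  - rewrite !psCM; cbv beta; rewrite !psXMS, !hyper_Sk, !hyper_Sn, !INRC_S, b_eq.
    field. repeat split; try apply xkn_nz; try apply INRC_S_nz.
    intros e. apply (xkn_nz x k (S n)). rewrite INRC_S. exact e.
Qed.

Lemma negbin_theta (c : C) : (psC 1 - psX) * theta (negbin c) = psC c * (psX * negbin c).
Proof.
  replace ((psC 1 - psX) * theta (negbin c)) with (theta (negbin c) - psX * theta (negbin c)) by ring.
  extensionality n. unfold psB. destruct n as [|n].
  - rewrite !psCM; cbv beta; rewrite !psXM0. unfold theta. simpl. ring.
  - rewrite !psCM; cbv beta; rewrite !psXMS. unfold theta, negbin. rewrite INRC_S, INRC_fact_S. simpl.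
    field. split; [apply INRC_fact_nz|apply INRC_S_nz].
Qed.

Lemma psC_b : psC b = psC 1 - psC a.
Proof. rewrite b_eq. apply psC_minus. Qed.

(** The first-order equations of the two factors show that the Euler operator annihilates the
    left-hand side, because [a + b = 1]. *)
Lemma negbin_mul : (psC 1 - psX) * (negbin a * negbin b) = psC 1.
Proof.
  rewrite (ps_const ((psC 1 - psX) * (negbin a * negbin b))).
  - f_equal. unfold psM at 1. simpl. unfold psB, psM, negbin. simpl. field.
  - rewrite !thetaM, thetaB, thetaC, thetaX.
    transitivity (psC 0 - psX * (negbin a * negbin b) + ((psC 1 - psX) * theta (negbin a) * negbin b
        + negbin a * ((psC 1 - psX) * theta (negbin b)))); [ring|].
    rewrite !negbin_theta, psC_b. ring.
Qed.

End Contiguous.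

(** * The kernel as a sum of products *)

Section Kernel.
Local Open Scope ps_scope.
Variables (a b : C).
Hypothesis Hab : (a + b = 1)%C.
Variables (x y : nat).
Let U (k : nat) := hyper a k x.
Let V (k : nat) := hyper b k y.
Let T k := (psC 1 - psX) * (psXn k * (U k * V k)).
Let J k := psXn (S k) * (psC (b + INR k) * (U (S k) * V k) + psC (a + INR k) * (U k * V (S k))).

Lemma psXnS k : psXn (S k) = psX * psXn k.
Proof. reflexivity. Qed.

(** In the combination [2 theta + x + y] applied to [T k] the interior terms of this lemma and
    of the next one cancel and leave a difference of two consecutive [J]. *)
Lemma theta_T k : theta (T k) = psC (INR k) * ((psC 1 + psX) * (psXn k * (U k * V k))) - J k.
Proof.
  unfold T. rewrite !thetaM, thetaB, thetaC, thetaX, theta_Xn.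
  transitivity (psC 0 * (psXn k * (U k * V k)) - psX * (psXn k * (U k * V k))
    + (psC 1 - psX) * (psC (INR k) * psXn k * (U k * V k))
    + psXn k * (((psC 1 - psX) * theta (U k)) * V k + U k * ((psC 1 - psX) * theta (V k)))); [ring|].
  unfold U at 4, V at 5. rewrite (hyper_theta a b Hab), (hyper_theta b a).
  - unfold J. fold (U k) (V k) (U (S k)) (V (S k)).
    rewrite !psC_plus, (psC_b a b Hab), psXnS. ring.
  - rewrite <- Hab. ring.
Qed.

Lemma xy_T_S k :
  psC (INR x + INR y) * T (S k)
  = J (S k) + J k - psC 2 * (psC (INR (S k)) * ((psC 1 + psX) * (psXn (S k) * (U (S k) * V (S k))))).
Proof.
  unfold T. rewrite psC_plus.
  transitivity (psXn (S k) * ((psC (INR x) * ((psC 1 - psX) * U (S k))) * V (S k)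
     + U (S k) * (psC (INR y) * ((psC 1 - psX) * V (S k))))); [ring|].
  unfold U at 1, V at 2. rewrite (hyper_shift a b Hab), (hyper_shift b a).
  - unfold J. fold (U k) (V k) (U (S k)) (V (S k)) (U (S (S k))) (V (S (S k))).
    rewrite INRC_S, (psXnS (S k)). replace (RtoC 2) with (1 + 1)%C by ring.
    rewrite !psC_plus. ring.
  - rewrite <- Hab. ring.
Qed.

Fixpoint trunc_sum (N : nat) : ps :=
  match N with O => T 0 | S M => trunc_sum M + psC 2 * T (S M) end.

(** The boundary terms [J] cancel in pairs; only the term [T 0] and the last of them survive. *)
Lemma trunc_sum_telescope N :
  psC 2 * theta (trunc_sum N) + psC (INR x + INR y) * trunc_sum N
  = psC (INR x + INR y) * T 0 - psC 2 * J N.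
Proof.
  induction N as [|N IH].
  - simpl. rewrite theta_T. simpl. ring.
  - simpl trunc_sum. rewrite thetaD, thetaM, thetaC.
    transitivity (psC 2 * theta (trunc_sum N) + psC (INR x + INR y) * trunc_sum N
      + psC 2 * (psC 2 * theta (T (S N)) + psC (INR x + INR y) * T (S N))); [ring|].
    rewrite IH, theta_T, xy_T_S. replace (RtoC 2) with (1 + 1)%C by ring.
    rewrite !psC_plus. ring.
Qed.

Local Close Scope ps_scope.

(** The weights of [(u + 1) / (u - 1) = 1 + 2 sum_(k > 0) u^(-k)]. *)
Definition fold_weight (k : nat) : C := match k with O => 1 | _ => 2 end.

(** The infinite sum over [k] makes sense coefficientwise, because its [k]-th term is
    divisible by [X^k]. *)
Definition bilinear_ps : ps := fun n => Csum (fun k => fold_weight k * psM (U k) (V k) (n - k)%nat) (S n).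

Lemma one_minus_X f n :
  psM (psB (psC 1) psX) f n = f n - match n with O => 0 | S m => f m end.
Proof.
  replace (psM (psB (psC 1) psX) f) with (psB f (psM psX f)) by ring.
  unfold psB. destruct n; rewrite ?psXM0, ?psXMS; reflexivity.
Qed.

Lemma trunc_sum_bilinear_ps N n : (n <= N)%nat -> trunc_sum N n = psM (psB (psC 1) psX) bilinear_ps n.
Proof.
  intros H.
  assert (E : forall M, trunc_sum M = psM (psB (psC 1) psX)
     (fun m => Csum (fun k => fold_weight k * psM (psXn k) (psM (U k) (V k)) m) (S M))).
  { induction M as [|M IH].
    - simpl. unfold T. f_equal. extensionality m. simpl. ring.
    - simpl trunc_sum. rewrite IH. unfold T.
      transitivity (psM (psB (psC 1) psX) (psD
        (fun m => Csum (fun k => fold_weight k * psM (psXn k) (psM (U k) (V k)) m) (S M))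
        (psM (psC 2) (psM (psXn (S M)) (psM (U (S M)) (V (S M))))))); [ring|].
      f_equal. extensionality m. unfold psD. rewrite psCM. reflexivity. }
  assert (E2 : forall m, (m <= N)%nat ->
     Csum (fun k => fold_weight k * psM (psXn k) (psM (U k) (V k)) m) (S N) = bilinear_ps m).
  { intros m Hm. unfold bilinear_ps. replace (S N) with (S m + (N - m))%nat by lia.
    generalize (N - m)%nat; intros d. induction d as [|d IHd].
    - rewrite Nat.add_0_r. apply Csum_ext. intros i Hi. rewrite psXnM.
      replace (Nat.leb i m) with true; [reflexivity|]. symmetry. apply Nat.leb_le. lia.
    - rewrite <- plus_n_Sm.
      change (Csum (fun k => fold_weight k * psM (psXn k) (psM (U k) (V k)) m) (S m + d)
        + fold_weight (S m + d)%nat * psM (psXn (S m + d)%nat) (psM (U (S m + d)%nat) (V (S m + d)%nat)) m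
        = Csum (fun k : nat => fold_weight k * psM (U k) (V k) (m - k)%nat) (S m)).
      rewrite IHd, psXnM. replace (Nat.leb (S m + d)%nat m) with false; [ring|].
      symmetry. apply Nat.leb_gt. lia. }
  rewrite E, !one_minus_X, E2 by lia. destruct n; [reflexivity|]. rewrite E2 by lia. reflexivity.
Qed.

(** As a series in [xi], the kernel without its factors [h(x) h(y)]. *)
Definition kernel_ps : ps := fun n => 2 / (INR x + INR y) * psM (psB (psC 1) psX) bilinear_ps n.
Definition leading_ps : ps := psM (psB (psC 1) psX) (psM (U 0) (V 0)).

(** The telescoping identity read at order [n]: its last boundary term is divisible by
    [X^(n+1)]. *)
Lemma kernel_ps_theta n : (0 < x + y)%nat -> (2 * INR n + (INR x + INR y)) * kernel_ps n = 2 * leading_ps n.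
Proof.
  intros H. pose proof (f_equal (fun f : ps => f n) (trunc_sum_telescope n)) as E.
  unfold psD, psB in E. rewrite !psCM in E. unfold theta in E.
  rewrite (trunc_sum_bilinear_ps n n) in E by lia.
  assert (EJ : J n n = 0).
  { unfold J. rewrite psXnM. replace (Nat.leb (S n) n) with false; auto.
    symmetry; apply Nat.leb_gt; lia. }
  rewrite EJ in E. unfold kernel_ps.
  assert (ET : T 0 n = leading_ps n).
  { unfold T, leading_ps. simpl. f_equal. ring. }
  rewrite ET in E. pose proof (INRC_add_nz x y H) as Hn.
  transitivity (2 / (INR x + INR y) *
    (2 * (INR n * psM (psB (psC 1) psX) bilinear_ps n) + (INR x + INR y) * psM (psB (psC 1) psX) bilinear_ps n)).
  - field. exact Hn.
  - rewrite E. field. exact Hn.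
Qed.

End Kernel.

(** * Partial fractions in the variable [x] *)

Definition shifted_negbin (b : C) (x : nat) : ps := fun z => rising b z / INR (fact z) / (INR x + INR z).

(** Residue at [-z] of the hypergeometric series in [x], up to a power of [X]. *)
Definition residue_coef (a b : C) (z : nat) : C :=
  INR z * (rising a z * rising b z) / (INR (fact z) * INR (fact z)).

Section PartialFractions.
Variables (a b : C).
Hypothesis Hab : a + b = 1.
Variable x : nat.
Hypothesis Hx : (0 < x)%nat.

Lemma xn_nz n : INR x + INR n <> 0.
Proof. apply INRC_add_nz. lia. Qed.

(** Both sides satisfy the same first-order recursion, because multiplying the
    series [shifted_negbin] by [theta + x] gives the binomial series of [b]. *)
Lemma shifted_negbin_conv n :
  INR x * psM (shifted_negbin b x) (negbin a) n = rising (a + INR x) n / rising (INR x + 1) n.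
Proof.
  pose (S := psM (shifted_negbin b x) (negbin a)).
  assert (E1 : psD (theta (shifted_negbin b x)) (psM (psC (INR x)) (shifted_negbin b x)) = negbin b).
  { extensionality m. unfold psD. rewrite psCM. unfold theta, shifted_negbin, negbin.
    field. split; [apply INRC_fact_nz|apply xn_nz]. }
  assert (E2 : psM (psB (psC 1) psX) (psD (theta S) (psM (psC (INR x)) S))
     = psD (psC 1) (psM (psC a) (psM psX S))).
  { unfold S. rewrite thetaM.
    transitivity (psD (psM (psM (psB (psC 1) psX) (negbin a)) (psD (theta (shifted_negbin b x)) (psM (psC (INR x)) (shifted_negbin b x))))
      (psM (shifted_negbin b x) (psM (psB (psC 1) psX) (theta (negbin a))))); [ring|].
    rewrite E1, negbin_theta.
    transitivity (psD (psM (psB (psC 1) psX) (psM (negbin a) (negbin b)))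
       (psM (shifted_negbin b x) (psM (psC a) (psM psX (negbin a))))); [ring|].
    rewrite (negbin_mul a b Hab). ring. }
  assert (E3 : INR x * S 0%nat = 1).
  { unfold S, psM, shifted_negbin, negbin. simpl. field. pose proof (xn_nz 0) as Hn. simpl in Hn.
    rewrite Cplus_0_r in Hn. exact Hn. }
  induction n as [|n IH].
  - fold S. rewrite E3. simpl. field.
  - fold S in IH |- *. pose proof (f_equal (fun f : ps => f (Datatypes.S n)) E2) as E.
    cbv beta in E. rewrite one_minus_X in E. cbv beta iota in E. unfold psD in E. rewrite !psCM, psXMS in E.
    unfold theta in E. rewrite INRC_S in E. simpl in E.
    assert (E' : S (Datatypes.S n) = S n * (a + INR x + INR n) / (INR x + 1 + INR n)).
    { pose proof (xkn_nz x 0 n) as Hn. change (INR 0) with 0%R in Hn. rewrite Cplus_0_r in Hn.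
      apply (f_equal (fun w => (w + (INR n + INR x) * S n) / (INR x + 1 + INR n))) in E.
      etransitivity; [|etransitivity; [exact E|]]; field; exact Hn. }
    rewrite E'. simpl rising.
    transitivity ((INR x * S n) * ((a + INR x + INR n) / (INR x + 1 + INR n))); [unfold Cdiv; ring|].
    rewrite IH. field. split; [|apply rising_succ_nz].
    pose proof (xkn_nz x 0 n) as Hn. change (INR 0) with 0%R in Hn. rewrite Cplus_0_r in Hn. exact Hn.
Qed.

(** As a function of [x] the coefficient of order [n] is rational with simple poles at [-1,
    ..., -n] and limit [negbin a n] at infinity; this is its expansion into partial fractions. *)
Lemma hyper_partial_fractions n :
  hyper a 0 x n + Csum (fun z => residue_coef a b z / (INR x + INR z) * hyper a 0 z (n - z)%nat) (S n) = negbin a n.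
Proof.
  (* z/(x+z) = 1 - x/(x+z); the first part is Chu-Vandermonde *)
  assert (E : forall z, (z <= n)%nat ->
    residue_coef a b z / (INR x + INR z) * hyper a 0 z (n - z)%nat
    = negbin a n * (negbin b z * negbin a (n - z)%nat + - INR x * (shifted_negbin b x z * negbin a (n - z)%nat))).
  { intros z Hz. unfold residue_coef, hyper, negbin, shifted_negbin.
    pose proof (rising_add a z (n - z)) as R1. replace (z + (n - z))%nat with n in R1 by lia.
    pose proof (rising_succ_fact z (n - z)) as R2. replace (z + (n - z))%nat with n in R2 by lia.
    rewrite <- R2, R1. simpl (0 + (n - z))%nat.
    field. repeat split; try apply INRC_fact_nz; try apply rising_succ_nz; apply xn_nz. }
  rewrite (Csum_ext _ (fun z => negbin a n * (negbin b z * negbin a (n - z)%nat + - INR x * (shifted_negbin b x z * negbin a (n - z)%nat))))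
    by (intros; apply E; lia).
  rewrite Csum_scal, Csum_plus, Csum_scal.
  change (Csum (fun i => negbin b i * negbin a (n - i)%nat) (S n)) with (psM (negbin b) (negbin a) n).
  change (Csum (fun i => shifted_negbin b x i * negbin a (n - i)%nat) (S n)) with (psM (shifted_negbin b x) (negbin a) n).
  assert (E1 : psM (negbin b) (negbin a) n = 1).
  { pose proof (negbin_mul a b Hab) as Hm. rewrite (psMC (negbin a)) in Hm. clear E.
    induction n as [|m IH].
    - unfold psM, negbin; simpl; field.
    - apply (f_equal (fun f : ps => f (S m))) in Hm. cbv beta in Hm. rewrite one_minus_X, IH in Hm. simpl in Hm.
      transitivity (psM (negbin b) (negbin a) (S m) - 1 + 1); [ring|]. rewrite Hm. ring. }
  rewrite E1. replace (- INR x * psM (shifted_negbin b x) (negbin a) n) with (- (INR x * psM (shifted_negbin b x) (negbin a) n)) by ring.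
  rewrite shifted_negbin_conv. unfold hyper, negbin. simpl (0 + n)%nat.
  field. split; [apply INRC_fact_nz|apply rising_succ_nz].
Qed.

End PartialFractions.

(** * The resolvent equation for the kernel, as formal power series *)

Lemma Csum_swap (g : nat -> nat -> C) n :
  Csum (fun z => Csum (fun w => g z w) (S (n - z))) (S n)
  = Csum (fun w => Csum (fun z => g z w) (S (n - w))) (S n).
Proof.
  rewrite <- (Csum_triangle g), <- (Csum_triangle (fun w z => g z w)).
  apply Csum_ext. intros i Hi. rewrite Csum_rev. apply Csum_ext. intros j Hj.
  f_equal; lia.
Qed.

Lemma Csum_convol (c : nat -> C) (f : nat -> ps) (R : ps) n :
  Csum (fun z => c z * psM (f z) R (n - z)%nat) (S n)
  = psM (fun m => Csum (fun z => c z * f z (m - z)%nat) (S m)) R n.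
Proof.
  unfold psM.
  transitivity (Csum (fun z => Csum (fun l => c z * f z l * R (n - z - l)%nat) (S (n - z))) (S n)).
  - apply Csum_ext. intros i Hi. rewrite <- Csum_scal. apply Csum_ext. intros; ring.
  - rewrite <- (Csum_triangle (fun z l => c z * f z l * R (n - z - l)%nat)).
    apply Csum_ext. intros i Hi. rewrite (Cmult_comm (Csum _ _)), <- Csum_scal.
    apply Csum_ext. intros j Hj. replace (n - j - (i - j))%nat with (n - i)%nat by lia. ring.
Qed.

Lemma kernel_ps_sym a b x y : kernel_ps a b x y = kernel_ps b a y x.
Proof.
  unfold kernel_ps. extensionality n. rewrite (Cplus_comm (INR x)).
  replace (bilinear_ps a b x y) with (bilinear_ps b a y x); [reflexivity|].
  extensionality m. unfold bilinear_ps. apply Csum_ext. intros; rewrite psMC; reflexivity.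
Qed.

Lemma residue_coef_sym a b : residue_coef a b = residue_coef b a.
Proof. extensionality z. unfold residue_coef. rewrite (Cmult_comm (rising a z)). reflexivity. Qed.

Lemma residue_coef_0 a b : residue_coef a b 0 = 0.
Proof. unfold residue_coef. simpl. field. Qed.

Definition at0 (c : C) (n : nat) : C := match n with O => c | _ => 0 end.

(** The defect at order [n] of the resolvent equation satisfied by the kernel. *)
Definition defect (a b : C) (x y : nat) : ps := fun n =>
  kernel_ps a b x y n + Csum (fun z => residue_coef a b z / (INR x + INR z) * kernel_ps a b z y (n - z)%nat) (S n)
  - at0 (2 / (INR x + INR y)) n.

(** What the operator [2 theta + x + y] makes of the defect; [x] has disappeared. *)
Definition scaled_defect (a b : C) (y : nat) : ps := fun n =>
  2 * psM (psB (psC 1) psX) (psM (negbin a) (hyper b 0 y)) n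
  + Csum (fun z => residue_coef a b z * kernel_ps a b z y (n - z)%nat) (S n) - at0 2 n.

Lemma at0_C c n : at0 c n = psC c n.
Proof. destruct n; reflexivity. Qed.

Section Equation.
Variables (a b : C).
Hypothesis Hab : a + b = 1.

Lemma Hba : b + a = 1.
Proof. rewrite <- Hab. ring. Qed.

(** In the term with index [z] write [2 n + x + y = (2 (n - z) + z + y) + (x + z)]: the first
    part acts on the kernel by its first-order equation and leaves the partial fractions of
    [hyper a 0 x], and the second cancels the denominator, hence the dependence on [x]. *)
Lemma defect_theta x y n : (0 < x)%nat -> (0 < y)%nat ->
  (2 * INR n + (INR x + INR y)) * defect a b x y n = scaled_defect a b y n.
Proof.
  intros Hx Hy. unfold defect.
  transitivity ((2 * INR n + (INR x + INR y)) * kernel_ps a b x y n +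
    (2 * INR n + (INR x + INR y)) * Csum (fun z => residue_coef a b z / (INR x + INR z) * kernel_ps a b z y (n - z)%nat) (S n)
    - (2 * INR n + (INR x + INR y)) * at0 (2 / (INR x + INR y)) n); [ring|].
  rewrite kernel_ps_theta by (auto; lia).
  rewrite <- Csum_scal.
  rewrite (Csum_ext _ (fun z => 2 * (residue_coef a b z / (INR x + INR z) * leading_ps a b z y (n - z)%nat)
     + residue_coef a b z * kernel_ps a b z y (n - z)%nat)).
  2:{ intros z Hz. pose proof (kernel_ps_theta a b Hab z y (n - z)) as K.
      assert (Hn : RtoC (INR n) = INR (n - z) + INR z).
      { rewrite <- INRC_add. do 2 f_equal. lia. }
      pose proof (INRC_add_nz x z ltac:(lia)) as Hxz.
      transitivity (residue_coef a b z / (INR x + INR z) * ((2 * INR (n - z) + (INR z + INR y)) * kernel_ps a b z y (n - z)%nat)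
         + residue_coef a b z * kernel_ps a b z y (n - z)%nat).
      - rewrite Hn. field. exact Hxz.
      - rewrite K by lia. field. exact Hxz. }
  rewrite Csum_plus, Csum_scal.
  assert (W : forall z, leading_ps a b z y = psM (hyper a 0 z) (psM (psB (psC 1) psX) (hyper b 0 y))).
  { intros z. unfold leading_ps. ring. }
  assert (E : Csum (fun z => residue_coef a b z / (INR x + INR z) * leading_ps a b z y (n - z)%nat) (S n)
     = psM (psB (negbin a) (hyper a 0 x)) (psM (psB (psC 1) psX) (hyper b 0 y)) n).
  { rewrite (Csum_ext _ (fun z => residue_coef a b z / (INR x + INR z) *
       psM (hyper a 0 z) (psM (psB (psC 1) psX) (hyper b 0 y)) (n - z)%nat)).
    - rewrite (Csum_convol (fun z => residue_coef a b z / (INR x + INR z))).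
      f_equal. f_equal. extensionality m. unfold psB.
      rewrite <- (hyper_partial_fractions a b Hab x Hx m). ring.
    - intros z Hz. rewrite W. reflexivity. }
  rewrite E, W. unfold scaled_defect.
  replace (psM (psB (negbin a) (hyper a 0 x)) (psM (psB (psC 1) psX) (hyper b 0 y)))
    with (psB (psM (psB (psC 1) psX) (psM (negbin a) (hyper b 0 y)))
              (psM (hyper a 0 x) (psM (psB (psC 1) psX) (hyper b 0 y)))) by ring.
  unfold psB at 2.
  assert (A : (2 * INR n + (INR x + INR y)) * at0 (2 / (INR x + INR y)) n = at0 2 n).
  { destruct n; simpl; [|ring]. field. apply INRC_add_nz. lia. }
  rewrite A. ring.
Qed.

(** Partial fractions in [y] cancel everything that does not contain the kernel, and the
    double sum over [w] and [z] reassembles into defects with [a] and [b] exchanged. *)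
Lemma scaled_defect_Lambda y n : (0 < y)%nat ->
  scaled_defect a b y n + Csum (fun z => residue_coef a b z / (INR y + INR z) * scaled_defect a b z (n - z)%nat) (S n)
  = Csum (fun w => residue_coef a b w * defect b a y w (n - w)%nat) (S n).
Proof.
  intros Hy.
  set (L := fun (f : nat -> ps) => Csum (fun z => residue_coef a b z / (INR y + INR z) * f z (n - z)%nat) (S n)).
  (* [A] and [B] are the two parts of the scaled defect without and with the kernel *)
  set (A := fun z => psM (psB (psC 1) psX) (psM (negbin a) (hyper b 0 z))).
  set (B := fun z : nat => (fun m => Csum (fun w => residue_coef a b w * kernel_ps a b w z (m - w)%nat) (S m)) : ps).
  assert (E0 : L (scaled_defect a b) = 2 * L A + L B - 2 * L (fun _ => psC 1)).
  { unfold L. rewrite <- !Csum_scal.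
    transitivity (Csum (fun i => (2 * (residue_coef a b i / (INR y + INR i) * A i (n - i)%nat)
        + residue_coef a b i / (INR y + INR i) * B i (n - i)%nat)
        + - (2 * (residue_coef a b i / (INR y + INR i) * psC 1 (n - i)%nat))) (S n)).
    - apply Csum_ext. intros i Hi. unfold scaled_defect, A, B. rewrite at0_C.
      replace (psC 2 (n - i)%nat) with (2 * psC 1 (n - i)%nat)
        by (destruct (n - i)%nat; simpl; ring). ring.
    - rewrite Csum_plus, Csum_plus. unfold Cminus. f_equal.
      rewrite (Csum_ext _ (fun i => (- (1)) * (2 * (residue_coef a b i / (INR y + INR i) * psC 1 (n - i)%nat)))).
      + rewrite Csum_scal. ring.
      + intros; ring. }
  assert (E1 : A y n + L A = psC 1 n).
  { unfold L. rewrite (Csum_ext _ (fun z => residue_coef a b z / (INR y + INR z) *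
       psM (hyper b 0 z) (psM (psB (psC 1) psX) (negbin a)) (n - z)%nat)).
    - rewrite (Csum_convol (fun z => residue_coef a b z / (INR y + INR z))).
      replace (fun m : nat => Csum (fun z => residue_coef a b z / (INR y + INR z) * hyper b 0 z (m - z)%nat) (S m))
        with (psB (negbin b) (hyper b 0 y)).
      + unfold A.
        transitivity (psD (psM (psB (psC 1) psX) (psM (negbin a) (hyper b 0 y)))
           (psM (psB (negbin b) (hyper b 0 y)) (psM (psB (psC 1) psX) (negbin a))) n); [reflexivity|].
        transitivity (psM (psB (psC 1) psX) (psM (negbin a) (negbin b)) n);
          [|rewrite (negbin_mul a b Hab); reflexivity].
        apply (f_equal (fun f : ps => f n)). ring.
      + extensionality m. unfold psB. rewrite <- (hyper_partial_fractions b a Hba y Hy m), (residue_coef_sym b a). ring.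
    - intros z Hz. unfold A. f_equal. apply (f_equal (fun f : ps => f (n - z)%nat)). ring. }
  assert (E2 : L (fun _ => psC 1) = residue_coef a b n / (INR y + INR n)).
  { unfold L. simpl Csum. rewrite Csum_zero, Nat.sub_diag; [simpl; ring|].
    intros i Hi. destruct (n - i)%nat eqn:e; [lia|]. simpl. ring. }
  assert (E3 : L B = Csum (fun w => residue_coef a b w *
     Csum (fun z => residue_coef b a z / (INR y + INR z) * kernel_ps b a z w (n - w - z)%nat) (S (n - w))) (S n)).
  { unfold L, B.
    transitivity (Csum (fun z => Csum (fun w => residue_coef a b z / (INR y + INR z) * (residue_coef a b w * kernel_ps a b w z (n - z - w)%nat)) (S (n - z))) (S n)).
    - apply Csum_ext. intros i Hi. rewrite Csum_scal. reflexivity.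
    - rewrite Csum_swap. apply Csum_ext. intros w Hw. rewrite <- Csum_scal.
      apply Csum_ext. intros z Hz. rewrite (residue_coef_sym b a), (kernel_ps_sym b a).
      replace (n - w - z)%nat with (n - z - w)%nat by lia. ring. }
  assert (E4 : Csum (fun w => residue_coef a b w * at0 (2 / (INR y + INR w)) (n - w)) (S n) = 2 * (residue_coef a b n / (INR y + INR n))).
  { simpl Csum. rewrite Csum_zero, Nat.sub_diag; [simpl; unfold Cdiv; ring|].
    intros i Hi. destruct (n - i)%nat eqn:e; [lia|]. simpl. ring. }
  change (Csum (fun z => residue_coef a b z / (INR y + INR z) * scaled_defect a b z (n - z)%nat) (S n)) with (L (scaled_defect a b)).
  rewrite E0. unfold scaled_defect at 1. fold (A y). fold (B y n). rewrite at0_C.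
  transitivity (2 * (A y n + L A) + (B y n + L B) - psC 2 n - 2 * L (fun _ => psC 1)); [ring|].
  rewrite E1, E2, E3, <- E4.
  replace (psC 2 n) with (2 * psC 1 n) by (destruct n; simpl; ring).
  unfold B.
  transitivity (Csum (fun w => residue_coef a b w * kernel_ps a b w y (n - w)%nat) (S n) +
    Csum (fun w => residue_coef a b w *
     Csum (fun z => residue_coef b a z / (INR y + INR z) * kernel_ps b a z w (n - w - z)%nat) (S (n - w))) (S n)
    + (- (1)) * Csum (fun w => residue_coef a b w * at0 (2 / (INR y + INR w)) (n - w)) (S n)); [ring|].
  rewrite <- Csum_scal, <- !Csum_plus. apply Csum_ext. intros w Hw.
  unfold defect. rewrite (kernel_ps_sym b a y w). ring.
Qed.

End Equation.

(** Induction on the order of the coefficient: the two previous lemmas express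
    the defect of order [n] through defects of smaller order. *)
Theorem kernel_ps_equation (n : nat) : forall a b : C, a + b = 1 ->
  forall x y : nat, (0 < x)%nat -> (0 < y)%nat -> defect a b x y n = 0.
Proof.
  induction n as [n IH] using lt_wf_ind. intros a b Hab x y Hx Hy.
  (* below order [n] all defects vanish, hence all scaled defects *)
  assert (HV : forall m z, (m < n)%nat -> (0 < z)%nat -> scaled_defect a b z m = 0).
  { intros m z Hm Hz. rewrite <- (defect_theta a b Hab x z m Hx Hz), IH by auto. ring. }
  assert (Hc : (2 * INR n + (INR x + INR y)) <> 0).
  { replace (2 * INR n + (INR x + INR y)) with (INR (n + n + x) + INR y) by (rewrite !INRC_add; ring).
    apply INRC_add_nz. lia. }
  (* at order [n] both sums involve lower orders only, except for [z = 0], where the residue is 0 *)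
  assert (E : scaled_defect a b y n = 0).
  { pose proof (scaled_defect_Lambda a b Hab y n Hy) as H.
    rewrite (Csum_zero (fun z => residue_coef a b z / (INR y + INR z) * scaled_defect a b z (n - z)%nat)) in H.
    - rewrite (Csum_zero (fun w => residue_coef a b w * defect b a y w (n - w)%nat)) in H.
      + rewrite <- H. ring.
      + intros [|i] Hi; [rewrite residue_coef_0; ring|]. rewrite IH; try lia; [ring|].
        rewrite <- Hab. ring.
    - intros [|i] Hi; [rewrite residue_coef_0; unfold Cdiv; ring|]. rewrite HV by lia. ring. }
  rewrite <- (defect_theta a b Hab x y n Hx Hy) in E.
  destruct (Ceq_dec (defect a b x y n) 0) as [e|e]; [exact e|].
  exfalso. exact (Cmult_neq_0 _ _ Hc e E).
Qed.

(** * Series of complex numbers with geometric bounds *)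

Definition Cconv (u : nat -> C) (l : C) : Prop := is_lim_seq (fun n => Cmod (u n - l)) 0%R.

(** Every series below is dominated by an explicit geometric one; convergence, tails and
    interchanges of sums need nothing else. *)
Definition geo (M r : R) (u : nat -> C) : Prop := forall n, (Cmod (u n) <= M * r ^ n)%R.

Lemma Cmod_le_ReIm (z : C) : (Cmod z <= Rabs (Re z) + Rabs (Im z))%R.
Proof.
  replace (Cmod z) with (Cmod (RtoC (Re z) + Ci * RtoC (Im z))).
  - eapply Rle_trans; [apply Cmod_triangle|]. rewrite Cmod_mult, Cmod_Ci, !Cmod_R. lra.
  - f_equal. destruct z as [p q]. unfold Cplus, Cmult, Ci, RtoC. simpl. f_equal; ring.
Qed.

Lemma Im_le_Cmod (z : C) : (Rabs (Im z) <= Cmod z)%R.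
Proof. eapply Rle_trans; [apply Rmax_r|apply Rmax_Cmod]. Qed.

Lemma is_lim_seq_squeeze0 (u v : nat -> R) :
  (forall n, 0 <= u n <= v n)%R -> is_lim_seq v 0%R -> is_lim_seq u 0%R.
Proof.
  intros H Hv. apply is_lim_seq_le_le with (fun _ => 0%R) v; auto. apply is_lim_seq_const.
Qed.

Lemma Cconv_components (u : nat -> C) l :
  is_lim_seq (fun n => Re (u n)) (Re l) -> is_lim_seq (fun n => Im (u n)) (Im l) -> Cconv u l.
Proof.
  intros H1 H2.
  apply is_lim_seq_squeeze0 with (fun n => (Rabs (Re (u n) - Re l) + Rabs (Im (u n) - Im l))%R).
  - intros n. split; [apply Cmod_ge_0|]. apply Cmod_le_ReIm.
  - replace (Finite 0) with (Finite (Rabs (Re l - Re l) + Rabs (Im l - Im l))).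
    + apply is_lim_seq_plus'.
      * apply is_lim_seq_abs with (l := Finite (Re l - Re l)).
        apply is_lim_seq_minus'; auto. apply is_lim_seq_const.
      * apply is_lim_seq_abs with (l := Finite (Im l - Im l)).
        apply is_lim_seq_minus'; auto. apply is_lim_seq_const.
    + f_equal. rewrite !Rminus_diag, !Rabs_R0. ring.
Qed.

Lemma Cconv_Re (u : nat -> C) l : Cconv u l -> is_lim_seq (fun n => Re (u n)) (Re l).
Proof.
  intros H. apply is_lim_seq_ext with (fun n => (Re (u n - l) + Re l)%R).
  - intros n. unfold Re, Im. simpl. ring.
  - replace (Finite (Re l)) with (Finite (0 + Re l)) by (f_equal; ring).
    apply is_lim_seq_plus'; [|apply is_lim_seq_const].
    apply is_lim_seq_abs_0. apply is_lim_seq_squeeze0 with (2 := H).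
    intros n. split; [apply Rabs_pos|apply re_le_Cmod].
Qed.

Lemma Cconv_Im (u : nat -> C) l : Cconv u l -> is_lim_seq (fun n => Im (u n)) (Im l).
Proof.
  intros H. apply is_lim_seq_ext with (fun n => (Im (u n - l) + Im l)%R).
  - intros n. unfold Re, Im. simpl. ring.
  - replace (Finite (Im l)) with (Finite (0 + Im l)) by (f_equal; ring).
    apply is_lim_seq_plus'; [|apply is_lim_seq_const].
    apply is_lim_seq_abs_0. apply is_lim_seq_squeeze0 with (2 := H).
    intros n. split; [apply Rabs_pos|apply Im_le_Cmod].
Qed.

Lemma C_ext (z w : C) : Re z = Re w -> Im z = Im w -> z = w.
Proof. destruct z, w; simpl; intros; subst; reflexivity. Qed.

Lemma Cconv_Clim (u : nat -> C) l : Cconv u l -> Clim_seq u = l.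
Proof.
  intros H. apply C_ext; simpl.
  - rewrite (is_lim_seq_unique _ _ (Cconv_Re u l H)). reflexivity.
  - rewrite (is_lim_seq_unique _ _ (Cconv_Im u l H)). reflexivity.
Qed.

Lemma Re_Csum u n : Re (Csum u (S n)) = sum_n (fun k => Re (u k)) n.
Proof.
  induction n as [|n IH].
  - rewrite sum_O. unfold Re, Im. simpl. ring.
  - rewrite sum_Sn, <- IH. reflexivity.
Qed.

Lemma Im_Csum u n : Im (Csum u (S n)) = sum_n (fun k => Im (u k)) n.
Proof.
  induction n as [|n IH].
  - rewrite sum_O. unfold Re, Im. simpl. ring.
  - rewrite sum_Sn, <- IH. reflexivity.
Qed.

Lemma Cseries_eq (u : nat -> C) l : Cconv (Csum u) l -> Cseries u = l.
Proof.
  intros H. apply C_ext; simpl; apply is_series_unique.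
  - apply (is_lim_seq_ext (fun n => Re (Csum u (S n))) _ (Finite (Re l))).
    + intros; apply Re_Csum.
    + apply (is_lim_seq_incr_1 (fun n => Re (Csum u n))). apply Cconv_Re, H.
  - apply (is_lim_seq_ext (fun n => Im (Csum u (S n))) _ (Finite (Im l))).
    + intros; apply Im_Csum.
    + apply (is_lim_seq_incr_1 (fun n => Im (Csum u n))). apply Cconv_Im, H.
Qed.

Lemma is_lim_seq_geo M r : (0 < r < 1)%R -> is_lim_seq (fun n => M * r ^ n)%R 0%R.
Proof.
  intros H. replace (Finite 0) with (Rbar_mult M 0%R) by (simpl; f_equal; ring).
  apply is_lim_seq_scal_l. apply is_lim_seq_geom. rewrite Rabs_pos_eq; lra.
Qed.

Lemma geo_M_nonneg M r u : geo M r u -> (0 <= M)%R.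
Proof. intros H. specialize (H O). simpl in H. pose proof (Cmod_ge_0 (u O)). lra. Qed.

Section Geo.
Variables (M r : R).
Hypothesis Hr : (0 < r < 1)%R.
Variable u : nat -> C.
Hypothesis Hu : geo M r u.

Lemma geo_partial n d : (Cmod (Csum u (n + d) - Csum u n) <= M * r ^ n / (1 - r) * (1 - r ^ d))%R.
Proof.
  induction d as [|d IH].
  - rewrite Nat.add_0_r. replace (Csum u n - Csum u n) with (RtoC 0) by ring. rewrite Cmod_0. simpl. lra.
  - rewrite <- plus_n_Sm. simpl Csum.
    replace (Csum u (n + d) + u (n + d)%nat - Csum u n) with ((Csum u (n + d) - Csum u n) + u (n + d)%nat) by ring.
    eapply Rle_trans; [apply Cmod_triangle|].
    eapply Rle_trans; [apply Rplus_le_compat; [exact IH|apply Hu]|].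
    right. rewrite pow_add. simpl. field. lra.
Qed.

Lemma geo_ex_series (f : C -> R) : (forall z, Rabs (f z) <= Cmod z)%R -> ex_series (fun n => f (u n)).
Proof.
  intros Hf. apply (@ex_series_le R_AbsRing R_CompleteNormedModule _ (fun n => M * r ^ n)%R).
  - intros n. eapply Rle_trans; [apply Hf|apply Hu].
  - apply (ex_series_scal_l (K := R_AbsRing) (V := R_NormedModule) M (fun n => r ^ n)%R).
    apply ex_series_geom. rewrite Rabs_pos_eq; lra.
Qed.

Lemma geo_conv : Cconv (Csum u) (Cseries u).
Proof.
  apply Cconv_components.
  - apply (is_lim_seq_incr_1 (fun n => Re (Csum u n))).
    apply is_lim_seq_ext with (sum_n (fun k => Re (u k))); [intros; symmetry; apply Re_Csum|].
    apply (Series_correct (fun k => Re (u k))). apply (geo_ex_series Re). apply re_le_Cmod.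
  - apply (is_lim_seq_incr_1 (fun n => Im (Csum u n))).
    apply is_lim_seq_ext with (sum_n (fun k => Im (u k))); [intros; symmetry; apply Im_Csum|].
    apply (Series_correct (fun k => Im (u k))). apply (geo_ex_series Im). apply Im_le_Cmod.
Qed.

Lemma geo_tail n : (Cmod (Cseries u - Csum u n) <= M * r ^ n / (1 - r))%R.
Proof.
  pose proof (geo_M_nonneg _ _ _ Hu) as HM.
  assert (Hlim : is_lim_seq (fun m => Cmod (Csum u (m + n) - Cseries u) + M * r ^ n / (1 - r))%R (M * r ^ n / (1 - r))%R).
  { replace (Finite (M * r ^ n / (1 - r))) with (Finite (0 + M * r ^ n / (1 - r))) by (f_equal; ring).
    apply is_lim_seq_plus'; [|apply is_lim_seq_const].
    apply (is_lim_seq_incr_n (fun m => Cmod (Csum u m - Cseries u)) n). apply geo_conv. }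
  apply (is_lim_seq_le (fun _ => Cmod (Cseries u - Csum u n)) _ (Cmod (Cseries u - Csum u n)) (M * r ^ n / (1 - r))%R) in Hlim;
    [exact Hlim| |apply is_lim_seq_const].
  intros m. replace (Cseries u - Csum u n) with (- (Csum u (m + n) - Cseries u) + (Csum u (m + n) - Csum u n)) by ring.
  eapply Rle_trans; [apply Cmod_triangle|]. rewrite Cmod_opp. apply Rplus_le_compat_l.
  rewrite Nat.add_comm. eapply Rle_trans; [apply geo_partial|].
  rewrite <- (Rmult_1_r (M * r ^ n / (1 - r))) at 2. apply Rmult_le_compat_l.
  - apply Rdiv_le_0_compat; [|lra]. apply Rmult_le_pos; auto. apply pow_le; lra.
  - pose proof (pow_le r m). lra.
Qed.

Lemma geo_Cseries_bound : (Cmod (Cseries u) <= M / (1 - r))%R.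
Proof.
  pose proof (geo_tail 0) as H. simpl in H. unfold Cminus in H.
  rewrite Copp_0, Cplus_0_r, Rmult_1_r in H. exact H.
Qed.

Lemma Cseries_scal c : Cseries (fun n => c * u n) = c * Cseries u.
Proof.
  apply Cseries_eq.
  apply is_lim_seq_squeeze0 with (fun n => (Cmod c * Cmod (Csum u n - Cseries u))%R).
  - intros n. split; [apply Cmod_ge_0|]. rewrite Csum_scal, <- Cmod_mult. right. f_equal. ring.
  - replace (Finite 0) with (Rbar_mult (Cmod c) 0%R) by (simpl; f_equal; ring).
    apply is_lim_seq_scal_l. apply geo_conv.
Qed.

Lemma Cseries_first : Cseries u = u O + Cseries (fun n => u (S n)).
Proof.
  transitivity (u O + (Cseries u - u O)); [ring|]. f_equal. symmetry. apply Cseries_eq.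
  apply is_lim_seq_ext with (fun n => Cmod (Csum u (S n) - Cseries u)).
  - intros n. rewrite Csum_first. f_equal. ring.
  - apply (is_lim_seq_incr_1 (fun n => Cmod (Csum u n - Cseries u))). apply geo_conv.
Qed.

End Geo.

Lemma Cseries_plus M r (u v : nat -> C) : (0 < r < 1)%R -> geo M r u -> geo M r v ->
  Cseries (fun n => u n + v n) = Cseries u + Cseries v.
Proof.
  intros Hr Hu Hv. apply Cseries_eq.
  apply is_lim_seq_squeeze0 with (fun n => (Cmod (Csum u n - Cseries u) + Cmod (Csum v n - Cseries v))%R).
  - intros n. split; [apply Cmod_ge_0|]. rewrite Csum_plus.
    eapply Rle_trans; [|apply Cmod_triangle]. right. f_equal. ring.
  - replace (Finite 0) with (Finite (0 + 0)) by (f_equal; ring).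
    apply is_lim_seq_plus'; eapply geo_conv; eassumption.
Qed.

Lemma Cseries_finite (u : nat -> C) N : (forall n, (N <= n)%nat -> u n = 0) -> Cseries u = Csum u N.
Proof.
  intros H. apply Cseries_eq. apply (is_lim_seq_incr_n _ N).
  apply is_lim_seq_ext with (fun _ => 0%R); [|apply is_lim_seq_const].
  intros n. assert (E : Csum u (n + N) = Csum u N).
  { induction n as [|n IH]; [reflexivity|]. simpl. rewrite IH, H by lia. ring. }
  rewrite E. replace (Csum u N - Csum u N) with (RtoC 0) by ring. symmetry. apply Cmod_0.
Qed.

Lemma Cmod_Csum_le (u : nat -> C) B n : (forall i, (i < n)%nat -> Cmod (u i) <= B)%R ->
  (Cmod (Csum u n) <= INR n * B)%R.
Proof.
  induction n as [|n IH]; intros H.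
  - simpl. rewrite Cmod_0. lra.
  - rewrite S_INR. simpl Csum. eapply Rle_trans; [apply Cmod_triangle|].
    assert (Cmod (Csum u n) <= INR n * B)%R by (apply IH; intros; apply H; lia).
    specialize (H n ltac:(lia)). lra.
Qed.

(** This absorbs polynomial factors at the price of a slightly larger ratio. *)
Lemma linear_le_geometric q : (1 < q)%R -> exists K, (0 < K)%R /\ forall n, (INR n + 1 <= K * q ^ n)%R.
Proof.
  intros Hq. exists (1 + / (q - 1))%R. assert (Hi : (0 < / (q - 1))%R) by (apply Rinv_0_lt_compat; lra).
  split; [lra|]. intros n.
  assert (P : (1 + INR n * (q - 1) <= q ^ n)%R).
  { pose proof (poly n (q - 1) ltac:(lra)) as P. replace (1 + (q - 1))%R with q in P by ring. exact P. }
  pose proof (pos_INR n) as Hn.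
  apply Rle_trans with ((1 + / (q - 1)) * (1 + INR n * (q - 1)))%R.
  - replace ((1 + / (q - 1)) * (1 + INR n * (q - 1)))%R
      with (1 + INR n + (INR n * (q - 1) + / (q - 1)))%R by (field; lra).
    assert (0 <= INR n * (q - 1))%R by (apply Rmult_le_pos; lra). lra.
  - apply Rmult_le_compat_l; lra.
Qed.

Lemma is_lim_seq_linear_geo M r : (0 < r < 1)%R -> is_lim_seq (fun n => (INR n + 1) * (M * r ^ n))%R 0%R.
Proof.
  intros Hr. set (q := ((1 + r) / (2 * r))%R).
  assert (Hq : (1 < q)%R).
  { unfold q. apply Rmult_lt_reg_r with (2 * r)%R; [lra|]. field_simplify; lra. }
  destruct (linear_le_geometric q Hq) as [K [HK HL]].
  apply is_lim_seq_abs_0.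
  apply is_lim_seq_squeeze0 with (fun n => (K * Rabs M) * ((1 + r) / 2) ^ n)%R.
  - intros n. split; [apply Rabs_pos|].
    rewrite !Rabs_mult, (Rabs_pos_eq (INR n + 1)), (Rabs_pos_eq (r ^ n)).
    + replace ((1 + r) / 2)%R with (q * r)%R by (unfold q; field; lra).
      rewrite Rpow_mult_distr. specialize (HL n).
      replace (K * Rabs M * (q ^ n * r ^ n))%R with ((K * q ^ n) * (Rabs M * r ^ n))%R by ring.
      apply Rmult_le_compat_r; auto. apply Rmult_le_pos; [apply Rabs_pos|]. apply pow_le; lra.
    + apply pow_le; lra.
    + pose proof (pos_INR n); lra.
  - apply is_lim_seq_geo. lra.
Qed.

(** A triangle and the full rows differ by one tail per row, and each of these tails is of
    order [r^N]. *)
Lemma Cseries_antidiagonal M r (a : nat -> nat -> C) : (0 < r < 1)%R ->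
  (forall i j, Cmod (a i j) <= M * r ^ (i + j))%R ->
  Cseries (fun i => Cseries (a i)) = Cseries (fun n => Csum (fun i => a i (n - i)%nat) (S n)).
Proof.
  intros Hr Ha. symmetry. apply Cseries_eq.
  assert (HM : (0 <= M)%R).
  { specialize (Ha O O). simpl in Ha. pose proof (Cmod_ge_0 (a O O)). lra. }
  assert (Hrow : forall i, geo (M * r ^ i) r (a i)).
  { intros i j. rewrite Rmult_assoc, <- pow_add. apply Ha. }
  assert (Hout : geo (M / (1 - r)) r (fun i => Cseries (a i))).
  { intros i. eapply Rle_trans; [apply (geo_Cseries_bound _ _ Hr _ (Hrow i))|].
    right. field. lra. }
  apply (is_lim_seq_incr_1 (fun n => Cmod (Csum _ n - _))).
  apply is_lim_seq_squeeze0 with (fun N => ((INR N + 1) * ((M * r / (1 - r)) * r ^ N)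
     + Cmod (Csum (fun i => Cseries (a i)) (S N) - Cseries (fun i => Cseries (a i))))%R).
  - intros N. split; [apply Cmod_ge_0|].
    rewrite Csum_triangle.
    replace (Csum (fun j => Csum (fun l => a j l) (S (N - j))) (S N) - Cseries (fun i => Cseries (a i)))
      with (Csum (fun j => (Csum (a j) (S (N - j)) + (- (1)) * Cseries (a j))) (S N)
        + (Csum (fun i => Cseries (a i)) (S N) - Cseries (fun i => Cseries (a i)))).
    + eapply Rle_trans; [apply Cmod_triangle|]. apply Rplus_le_compat_r.
      rewrite <- S_INR. apply Cmod_Csum_le. intros i Hi.
      replace (Csum (a i) (S (N - i)) + - (1) * Cseries (a i)) with (- (Cseries (a i) - Csum (a i) (S (N - i)))) by ring.
      rewrite Cmod_opp. eapply Rle_trans; [apply (geo_tail _ _ Hr _ (Hrow i))|].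
      right. replace (r ^ N)%R with (r ^ i * r ^ (N - i))%R by (rewrite <- pow_add; f_equal; lia).
      simpl. field. lra.
    + rewrite Csum_plus, Csum_scal.
      change (Csum (fun j : nat => Csum (fun l : nat => a j l) (S (N - j))) (S N)) with (Csum (fun i => Csum (a i) (S (N - i))) (S N)). ring.
  - replace (Finite 0) with (Finite (0 + 0)) by (f_equal; ring).
    apply is_lim_seq_plus'; [apply is_lim_seq_linear_geo; auto|].
    apply (is_lim_seq_incr_1 (fun n => Cmod (Csum (fun i => Cseries (a i)) n - Cseries (fun i => Cseries (a i))))).
    apply (geo_conv _ _ Hr _ Hout).
Qed.

Lemma Cseries_product M N r (u v : nat -> C) : (0 < r < 1)%R -> geo M r u -> geo N r v ->
  Cseries (psM u v) = Cseries u * Cseries v.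
Proof.
  intros Hr Hu Hv. unfold psM.
  rewrite <- (Cseries_antidiagonal (M * N) r (fun i j => u i * v j) Hr).
  - transitivity (Cseries (fun i => Cseries v * u i)).
    + f_equal. extensionality i. rewrite (Cseries_scal _ _ Hr _ Hv). ring.
    + rewrite (Cseries_scal _ _ Hr _ Hu). ring.
  - intros i j. rewrite Cmod_mult, pow_add.
    replace (M * N * (r ^ i * r ^ j))%R with ((M * r ^ i) * (N * r ^ j))%R by ring.
    apply Rmult_le_compat; auto using Cmod_ge_0.
Qed.

Lemma geo_scal M r c u : geo M r u -> geo (Cmod c * M) r (fun n => c * u n).
Proof.
  intros H n. rewrite Cmod_mult, Rmult_assoc. apply Rmult_le_compat_l; [apply Cmod_ge_0|apply H].
Qed.

Lemma geo_weaken M N r u : (0 < r)%R -> (M <= N)%R -> geo M r u -> geo N r u.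
Proof.
  intros Hr HMN H n. eapply Rle_trans; [apply H|]. apply Rmult_le_compat_r; auto. apply pow_le; lra.
Qed.

(** * Growth of the coefficients *)

(** A majorant of [rising a n / n!] for [A = Cmod a], which also serves when [a] and the
    denominator are shifted by the same integer. *)
Fixpoint grow (A : R) (n : nat) : R :=
  match n with O => 1 | S m => grow A m * (1 + A / (INR m + 1)) end%R.

Lemma grow_factor A n : (0 <= A)%R -> (1 <= 1 + A / (INR n + 1))%R.
Proof.
  intros HA. assert (0 <= A / (INR n + 1))%R; [|lra].
  apply Rdiv_le_0_compat; auto. pose proof (pos_INR n). lra.
Qed.

Lemma grow_ge_1 A n : (0 <= A)%R -> (1 <= grow A n)%R.
Proof.
  intros HA. induction n as [|n IH]; simpl; [lra|].
  pose proof (grow_factor A n HA). nra.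
Qed.

Lemma grow_mono A n d : (0 <= A)%R -> (grow A n <= grow A (n + d))%R.
Proof.
  intros HA. induction d as [|d IH].
  - rewrite Nat.add_0_r. lra.
  - rewrite <- plus_n_Sm. simpl. pose proof (grow_factor A (n + d) HA).
    pose proof (grow_ge_1 A (n + d) HA). nra.
Qed.

(** The product has subexponential growth since its factors tend to 1. *)
Lemma grow_le_geometric A q : (0 <= A)%R -> (1 < q)%R ->
  exists K, (1 <= K)%R /\ forall n, (grow A n <= K * q ^ n)%R.
Proof.
  intros HA Hq. destruct (archimed (A / (q - 1))) as [H1 _].
  set (N := Z.to_nat (up (A / (q - 1)))).
  assert (HN : (A / (q - 1) <= INR N)%R).
  { unfold N. rewrite INR_IZR_INZ. destruct (Z_le_gt_dec 0 (up (A / (q - 1)))) as [h|h].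
    - rewrite Z2Nat.id by auto. lra.
    - apply Rle_trans with (IZR (up (A / (q - 1)))); [lra|]. apply IZR_le. lia. }
  exists (grow A N). split; [apply grow_ge_1; auto|].
  induction n as [|n IH].
  - simpl. pose proof (grow_ge_1 A N HA). lra.
  - destruct (le_lt_dec (S n) N) as [h|h].
    + pose proof (grow_mono A (S n) (N - S n) HA) as Hm. replace (S n + (N - S n))%nat with N in Hm by lia.
      pose proof (pow_R1_Rle q (S n) ltac:(lra)). pose proof (grow_ge_1 A N HA).
      eapply Rle_trans; [exact Hm|]. nra.
    + assert (Hf : (1 + A / (INR n + 1) <= q)%R).
      { assert (A / (INR n + 1) <= q - 1)%R; [|lra].
        assert (Hn : (INR N <= INR n)%R) by (apply le_INR; lia).
        pose proof (pos_INR n). apply Rmult_le_reg_r with (INR n + 1)%R; [lra|].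
        unfold Rdiv. rewrite Rmult_assoc, Rinv_l, Rmult_1_r by lra.
        apply (Rmult_le_compat_r (q - 1)) in HN; [|lra].
        unfold Rdiv in HN. rewrite Rmult_assoc, Rinv_l in HN by lra. nra. }
      simpl. pose proof (grow_factor A n HA). pose proof (grow_ge_1 A n HA).
      apply Rle_trans with (grow A N * q ^ n * q)%R; [|right; ring].
      apply Rmult_le_compat; lra.
Qed.

Lemma Cmod_INR n : Cmod (INR n) = INR n.
Proof. rewrite Cmod_R, Rabs_pos_eq; auto. apply pos_INR. Qed.

Lemma rising_div_succ_bound (a : C) x n :
  (Cmod (rising (a + INR x) n / rising (INR x + 1) n) <= grow (Cmod a) n)%R.
Proof.
  induction n as [|n IH].
  - simpl. replace (1 / 1) with (RtoC 1) by field. rewrite Cmod_1. lra.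
  - simpl. assert (Hn : INR x + 1 + INR n <> 0).
    { replace (INR x + 1 + INR n) with (INR (x + n) + 1) by (rewrite INRC_add; ring). apply INRC_S_nz. }
    replace (rising (a + INR x) n * (a + INR x + INR n) / (rising (INR x + 1) n * (INR x + 1 + INR n)))
      with ((rising (a + INR x) n / rising (INR x + 1) n) * ((a + INR x + INR n) / (INR x + 1 + INR n)))
      by (field; split; auto; apply rising_succ_nz).
    rewrite Cmod_mult. apply Rmult_le_compat; try apply Cmod_ge_0; auto.
    rewrite Cmod_div by auto.
    replace (INR x + 1 + INR n) with (RtoC (INR x + INR n + 1)) by (rewrite !RtoC_plus; ring).
    rewrite (Cmod_R (_ + 1)).
    pose proof (pos_INR x). pose proof (pos_INR n). pose proof (Cmod_ge_0 a).
    rewrite Rabs_pos_eq by lra.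
    assert (H2 : (Cmod (a + INR x + INR n) <= Cmod a + (INR x + INR n))%R).
    { replace (a + INR x + INR n) with (a + RtoC (INR x + INR n)) by (rewrite RtoC_plus; ring).
      eapply Rle_trans; [apply Cmod_triangle|]. rewrite Cmod_R, Rabs_pos_eq; lra. }
    apply Rle_trans with (1 + Cmod a / (INR x + INR n + 1))%R.
    + apply Rmult_le_reg_r with (INR x + INR n + 1)%R; [lra|].
      field_simplify; lra.
    + apply Rplus_le_compat_l. unfold Rdiv. apply Rmult_le_compat_l; auto.
      apply Rinv_le_contravar; lra.
Qed.

Lemma rising_div_fact_bound (a : C) n :
  (Cmod (rising a n / INR (fact n)) <= grow (Cmod a) n)%R.
Proof.
  pose proof (rising_div_succ_bound a 0 n) as H. simpl in H.
  rewrite Cplus_0_r, Cplus_0_l, rising_1 in H. exact H.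
Qed.

Lemma rising_succ_ratio (x n k : nat) :
  (Cmod (rising (INR n + 1) k / rising (INR (x + n) + 1) k) <= 1)%R.
Proof.
  induction k as [|k IH].
  - simpl. replace (1 / 1) with (RtoC 1) by field. rewrite Cmod_1. lra.
  - simpl. assert (Hn : INR (x + n) + 1 + INR k <> 0).
    { replace (INR (x + n) + 1 + INR k) with (INR (x + n + k) + 1) by (rewrite !INRC_add; ring). apply INRC_S_nz. }
    replace (rising (INR n + 1) k * (INR n + 1 + INR k) / (rising (INR (x + n) + 1) k * (INR (x + n) + 1 + INR k)))
      with ((rising (INR n + 1) k / rising (INR (x + n) + 1) k) * ((INR n + 1 + INR k) / (INR (x + n) + 1 + INR k)))
      by (field; split; auto; apply rising_succ_nz).
    rewrite Cmod_mult. apply Rle_trans with (1 * 1)%R; [|lra].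
    apply Rmult_le_compat; try apply Cmod_ge_0; auto.
    rewrite Cmod_div by auto.
    replace (INR (x + n) + 1 + INR k) with (RtoC (INR x + INR n + INR k + 1)) by (rewrite plus_INR, !RtoC_plus; ring).
    replace (INR n + 1 + INR k) with (RtoC (INR n + INR k + 1)) by (rewrite !RtoC_plus; ring).
    pose proof (pos_INR x). pose proof (pos_INR n). pose proof (pos_INR k).
    rewrite !Cmod_R, !Rabs_pos_eq by lra.
    apply Rmult_le_reg_r with (INR x + INR n + INR k + 1)%R; [lra|]. field_simplify; lra.
Qed.

Lemma hyper_bound (a : C) k x n :
  (Cmod (hyper a k x n) <= grow (Cmod a) (k + n) * grow (Cmod a) n)%R.
Proof.
  replace (hyper a k x n) with (rising a (k + n) / INR (fact (k + n))
     * ((rising (a + INR x) n / rising (INR x + 1) n)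
        * (rising (INR n + 1) k / rising (INR (x + n) + 1) k))).
  - rewrite !Cmod_mult. apply Rmult_le_compat; try apply Cmod_ge_0.
    + apply Rmult_le_pos; apply Cmod_ge_0.
    + apply rising_div_fact_bound.
    + rewrite <- (Rmult_1_r (grow _ n)). apply Rmult_le_compat; try apply Cmod_ge_0.
      * apply rising_div_succ_bound.
      * apply rising_succ_ratio.
  - unfold hyper. pose proof (rising_add (INR x + 1) n k) as R1.
    rewrite (Nat.add_comm n k) in R1.
    pose proof (rising_succ_fact n k) as R2. rewrite (Nat.add_comm n k) in R2.
    rewrite <- R2, R1.
    replace (INR x + 1 + INR n) with (INR (x + n) + 1) by (rewrite INRC_add; ring).
    field. repeat split; try apply INRC_fact_nz; try apply rising_succ_nz.
Qed.

Lemma psM_bound (f g : ps) F G q n : (0 < q)%R -> geo F q f -> geo G q g ->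
  (Cmod (psM f g n) <= (INR n + 1) * (F * G * q ^ n))%R.
Proof.
  intros Hq Hf Hg. unfold psM. rewrite <- S_INR. apply Cmod_Csum_le. intros i Hi.
  rewrite Cmod_mult. replace (q ^ n)%R with (q ^ i * q ^ (n - i))%R by (rewrite <- pow_add; f_equal; lia).
  replace (F * G * (q ^ i * q ^ (n - i)))%R with ((F * q ^ i) * (G * q ^ (n - i)))%R by ring.
  apply Rmult_le_compat; auto using Cmod_ge_0.
Qed.

(** * Values of the series at [xi] *)

Definition eval_ps (xi : R) (f : ps) : C := Cseries (fun n => f n * RtoC (xi ^ n)).

Lemma psM_pow (xi : R) (f g : ps) :
  (fun n => psM f g n * RtoC (xi ^ n)) = psM (fun n => f n * RtoC (xi ^ n)) (fun n => g n * RtoC (xi ^ n)).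
Proof.
  extensionality n. unfold psM. rewrite Cmult_comm, <- Csum_scal. apply Csum_ext. intros i Hi.
  replace (xi ^ n)%R with (xi ^ i * xi ^ (n - i))%R by (rewrite <- pow_add; f_equal; lia).
  rewrite RtoC_mult. ring.
Qed.

Lemma xi_room (xi : R) : (0 < xi < 1)%R -> exists q, (1 < q)%R /\ (q ^ 3 * xi < 1)%R.
Proof.
  intros H. set (s := sqrt (sqrt xi)).
  assert (H1 : (0 < sqrt xi < 1)%R).
  { split; [apply sqrt_lt_R0; lra|]. rewrite <- sqrt_1. apply sqrt_lt_1; lra. }
  assert (Hs : (0 < s < 1)%R).
  { unfold s. split; [apply sqrt_lt_R0; lra|]. rewrite <- sqrt_1. apply sqrt_lt_1; lra. }
  assert (E : (xi = s ^ 4)%R).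
  { unfold s. replace (sqrt (sqrt xi) ^ 4)%R with ((sqrt (sqrt xi) * sqrt (sqrt xi)) * (sqrt (sqrt xi) * sqrt (sqrt xi)))%R by ring.
    rewrite !sqrt_sqrt; lra. }
  exists (/ s)%R. split.
  - rewrite <- Rinv_1 at 1. apply Rinv_lt_contravar; lra.
  - rewrite E. replace ((/ s) ^ 3 * s ^ 4)%R with s by (field; lra). lra.
Qed.

Section Values.
Variables (a b : C) (xi : R).
Hypothesis Hab : a + b = 1.
Hypothesis Hxi : (0 < xi < 1)%R.

Definition kernel_val (x y : nat) : C := eval_ps xi (kernel_ps a b x y).

(** A coefficient of order [n] of [hyper] is at most of order [q^(2n)] for every [q > 1], and
    a product of two costs one more factor [n + 1], hence [q^n]. With [q^3 xi < 1] the ratio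
    [r = q^3 xi] works for all [k], [x] and [y] at once. *)
Lemma uniform_bounds : exists K r : R, (0 < K)%R /\ (xi < r < 1)%R /\
  (forall k x, geo (K * (r / xi) ^ k) r (fun n => hyper a k x n * RtoC (xi ^ n))) /\
  (forall k x, geo (K * (r / xi) ^ k) r (fun n => hyper b k x n * RtoC (xi ^ n))) /\
  (forall k x y, geo (K * (r / xi) ^ k) r (fun n => psM (hyper a k x) (hyper b k y) n * RtoC (xi ^ n))) /\
  (forall z, Cmod (residue_coef a b z * RtoC (xi ^ z)) <= K * r ^ z)%R.
Proof.
  destruct (xi_room xi Hxi) as [q [Hq Hq3]].
  destruct (grow_le_geometric (Cmod a) q (Cmod_ge_0 a) Hq) as [Ka [HKa Ga]].
  destruct (grow_le_geometric (Cmod b) q (Cmod_ge_0 b) Hq) as [Kb [HKb Gb]].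
  destruct (linear_le_geometric q Hq) as [L [HL Hlin]].
  set (K0 := (Ka * Kb)%R).
  assert (HK0 : (Ka <= K0 /\ Kb <= K0 /\ 1 <= K0)%R) by (unfold K0; nra).
  assert (Hgrow : forall n, (grow (Cmod a) n <= K0 * q ^ n /\ grow (Cmod b) n <= K0 * q ^ n)%R).
  { intros n. assert (0 < q ^ n)%R by (apply pow_lt; lra). split.
    - eapply Rle_trans; [apply Ga|]. apply Rmult_le_compat_r; lra.
    - eapply Rle_trans; [apply Gb|]. apply Rmult_le_compat_r; lra. }
  set (K := ((1 + L) * (K0 * K0 * (K0 * K0)))%R).
  assert (HKK : (0 < K0 * K0 <= K)%R).
  { unfold K. split; [nra|]. assert (1 <= K0 * K0)%R by nra. nra. }
  assert (Hpq : forall n, (0 < q ^ n)%R) by (intros; apply pow_lt; lra).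
  assert (Hpx : forall n, (0 < xi ^ n)%R) by (intros; apply pow_lt; lra).
  assert (HU : forall c, (c = a \/ c = b) -> forall k x, geo (K0 * K0 * q ^ k) (q ^ 2) (hyper c k x)).
  { intros c Hc k x n. eapply Rle_trans; [apply hyper_bound|].
    replace (K0 * K0 * q ^ k * (q ^ 2) ^ n)%R with ((K0 * q ^ (k + n)) * (K0 * q ^ n))%R
      by (rewrite <- pow_mult, pow_add; replace (2 * n)%nat with (n + n)%nat by lia; rewrite pow_add; ring).
    assert (H0 : (0 <= Cmod c)%R) by apply Cmod_ge_0.
    pose proof (grow_ge_1 (Cmod c) (k + n) H0). pose proof (grow_ge_1 (Cmod c) n H0).
    destruct Hc as [->| ->]; apply Rmult_le_compat; try lra; apply Hgrow. }
  assert (Hq23 : (1 < q ^ 2 /\ q ^ 2 <= q ^ 3 /\ q <= q ^ 3)%R).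
  { simpl. repeat split; nra. }
  assert (Hr : (xi < q ^ 3 * xi)%R) by nra.
  assert (HV : forall c, (c = a \/ c = b) -> forall k x,
     geo (K * (q ^ 3 * xi / xi) ^ k) (q ^ 3 * xi) (fun n => hyper c k x n * RtoC (xi ^ n))).
  { intros c Hc k x n. rewrite Cmod_mult, Cmod_R, Rabs_pos_eq by (left; apply Hpx).
    replace (q ^ 3 * xi / xi)%R with (q ^ 3)%R by (field; lra).
    rewrite (Rpow_mult_distr (q ^ 3) xi n), <- Rmult_assoc. apply Rmult_le_compat_r; [left; apply Hpx|].
    eapply Rle_trans; [apply HU; auto|]. apply Rmult_le_compat.
    - apply Rmult_le_pos; [lra|left; apply Hpq].
    - rewrite <- pow_mult. left; apply Hpq.
    - apply Rmult_le_compat; try lra; [left; apply Hpq|]. apply pow_incr; lra.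
    - apply pow_incr; lra. }
  exists K, (q ^ 3 * xi)%R.
  split; [lra|]. split; [lra|]. repeat split.
  - intros k x. apply HV; auto.
  - intros k x. apply HV; auto.
  - intros k x y n. rewrite Cmod_mult, Cmod_R, Rabs_pos_eq by (left; apply Hpx).
    replace (q ^ 3 * xi / xi)%R with (q ^ 3)%R by (field; lra).
    rewrite (Rpow_mult_distr (q ^ 3) xi n), <- Rmult_assoc. apply Rmult_le_compat_r; [left; apply Hpx|].
    eapply Rle_trans; [apply (psM_bound _ _ (K0 * K0 * q ^ k) (K0 * K0 * q ^ k) (q ^ 2)); [lra|apply HU; auto|apply HU; auto]|].
    apply Rle_trans with ((L * q ^ n) * (K0 * K0 * q ^ k * (K0 * K0 * q ^ k) * (q ^ 2) ^ n))%R.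
    + apply Rmult_le_compat_r; auto. rewrite <- pow_mult.
      apply Rmult_le_pos; [|left; apply Hpq]. apply Rmult_le_pos; (apply Rmult_le_pos; [lra|left; apply Hpq]).
    + replace (L * q ^ n * (K0 * K0 * q ^ k * (K0 * K0 * q ^ k) * (q ^ 2) ^ n))%R
        with ((L * (K0 * K0 * (K0 * K0))) * (q ^ 2) ^ k * (q ^ 3) ^ n)%R
        by (rewrite <- !pow_mult; replace (2 * k)%nat with (k + k)%nat by lia;
            replace (3 * n)%nat with (n + 2 * n)%nat by lia; rewrite !pow_add; ring).
      apply Rmult_le_compat_r; [rewrite <- pow_mult; left; apply Hpq|].
      apply Rmult_le_compat.
      * apply Rmult_le_pos; nra.
      * rewrite <- pow_mult. left; apply Hpq.
      * unfold K. apply Rmult_le_compat_r; nra.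
      * apply pow_incr; lra.
  - intros z. rewrite Cmod_mult, Cmod_R, Rabs_pos_eq by (left; apply Hpx).
    rewrite (Rpow_mult_distr (q ^ 3) xi z), <- Rmult_assoc. apply Rmult_le_compat_r; [left; apply Hpx|].
    replace (residue_coef a b z) with (INR z * ((rising a z / INR (fact z)) * (rising b z / INR (fact z))))
      by (unfold residue_coef; field; apply INRC_fact_nz).
    rewrite !Cmod_mult, Cmod_INR.
    apply Rle_trans with ((L * q ^ z) * ((K0 * q ^ z) * (K0 * q ^ z)))%R.
    + apply Rmult_le_compat.
      * apply pos_INR.
      * apply Rmult_le_pos; apply Cmod_ge_0.
      * specialize (Hlin z). lra.
      * apply Rmult_le_compat; try apply Cmod_ge_0; (eapply Rle_trans; [apply rising_div_fact_bound|apply Hgrow]).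
    + replace (L * q ^ z * (K0 * q ^ z * (K0 * q ^ z)))%R with ((L * (K0 * K0)) * (q ^ 3) ^ z)%R
        by (rewrite <- pow_mult; replace (3 * z)%nat with (z + (z + z))%nat by lia; rewrite !pow_add; ring).
      apply Rmult_le_compat_r; [rewrite <- pow_mult; left; apply Hpq|].
      unfold K. assert (1 <= K0 * K0)%R by nra. assert (K0 * K0 <= K0 * K0 * (K0 * K0))%R by nra. nra.
Qed.

Lemma one_minus_X_geo r : (xi < r)%R -> geo 1 r (fun n => psB (psC 1) psX n * RtoC (xi ^ n)).
Proof.
  intros Hr n. destruct n as [|[|n]].
  - simpl. unfold psB. simpl. replace ((1 - 0) * 1) with (RtoC 1) by ring. rewrite Cmod_1. lra.
  - unfold psB. simpl. replace ((0 - 1) * RtoC (xi * 1)) with (RtoC (- xi)) by (rewrite RtoC_opp, Rmult_1_r; ring).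
    rewrite Cmod_R, Rabs_Ropp, Rabs_pos_eq; lra.
  - unfold psB. simpl. replace ((0 - 0) * RtoC (xi * (xi * xi ^ n))) with (RtoC 0) by ring.
    rewrite Cmod_0. apply Rmult_le_pos; [lra|]. apply (pow_le r (S (S n))); lra.
Qed.

Lemma eval_ps_one_minus_X : eval_ps xi (psB (psC 1) psX) = 1 - xi.
Proof.
  unfold eval_ps. rewrite (Cseries_finite _ 2).
  - simpl. unfold psB. simpl. rewrite Rmult_1_r. ring.
  - intros [|[|n]] Hn; try lia. unfold psB. simpl. ring.
Qed.

Lemma kernel_ps_geo : exists K r : R, (0 < K)%R /\ (0 < r < 1)%R /\
  (forall x y, (0 < x + y)%nat -> geo K r (fun n => kernel_ps a b x y n * RtoC (xi ^ n))) /\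
  (forall z, Cmod (residue_coef a b z * RtoC (xi ^ z)) <= K * r ^ z)%R.
Proof.
  destruct uniform_bounds as (K & r & HK & Hr & _ & _ & HP & Hc).
  exists (4 * K)%R, r. split; [lra|]. split; [lra|]. split.
  2:{ intros z. eapply Rle_trans; [apply Hc|]. apply Rmult_le_compat_r; [apply pow_le|]; lra. }
  intros x y Hxy n.
  set (P := fun n => psM (hyper a 0 x) (hyper b 0 y) n * RtoC (xi ^ n)).
  assert (GP : forall m, (Cmod (P m) <= K * r ^ m)%R).
  { intros m. pose proof (HP 0%nat x y m) as H. simpl in H. rewrite Rmult_1_r in H. exact H. }
  assert (GW : (Cmod (leading_ps a b x y n * RtoC (xi ^ n)) <= 2 * K * r ^ n)%R).
  { unfold leading_ps. rewrite one_minus_X. destruct n as [|n].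
    - replace ((psM (hyper a 0 x) (hyper b 0 y) 0%nat - 0) * RtoC (xi ^ 0)) with (P 0%nat) by (unfold P; ring).
      specialize (GP 0%nat). simpl in GP |- *. lra.
    - replace ((psM (hyper a 0 x) (hyper b 0 y) (S n) - psM (hyper a 0 x) (hyper b 0 y) n) * RtoC (xi ^ (S n)))
        with (P (S n) + - (RtoC xi * P n)) by (unfold P; simpl; rewrite RtoC_mult; ring).
      eapply Rle_trans; [apply Cmod_triangle|]. rewrite Cmod_opp, Cmod_mult, Cmod_R, Rabs_pos_eq by lra.
      replace (2 * K * r ^ S n)%R with (K * r ^ S n + r * (K * r ^ n))%R by (simpl; ring).
      apply Rplus_le_compat; [apply GP|]. apply Rmult_le_compat; try lra; [apply Cmod_ge_0|apply GP]. }
  assert (E : kernel_ps a b x y n * RtoC (xi ^ n)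
     = 2 / RtoC (2 * INR n + (INR x + INR y)) * (leading_ps a b x y n * RtoC (xi ^ n))).
  { assert (Hd : RtoC (2 * INR n + (INR x + INR y)) <> 0).
    { apply INRC_pos_nz. pose proof (pos_INR n). apply lt_0_INR in Hxy. rewrite plus_INR in Hxy. lra. }
    pose proof (kernel_ps_theta a b Hab x y n Hxy) as H.
    replace (2 * INR n + (INR x + INR y)) with (RtoC (2 * INR n + (INR x + INR y))) in H
      by (rewrite !RtoC_plus, RtoC_mult; ring).
    transitivity ((RtoC (2 * INR n + (INR x + INR y)) * kernel_ps a b x y n) * RtoC (xi ^ n) / RtoC (2 * INR n + (INR x + INR y))).
    - field. exact Hd.
    - rewrite H. field. exact Hd. }
  rewrite E, Cmod_mult.
  assert (Hxy' : (1 <= INR x + INR y)%R).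
  { rewrite <- plus_INR. apply (le_INR 1). lia. }
  pose proof (pos_INR n) as Hn.
  replace (4 * K * r ^ n)%R with (2 * (2 * K * r ^ n))%R by ring.
  apply Rmult_le_compat; try apply Cmod_ge_0; auto.
  rewrite <- RtoC_div by lra. rewrite Cmod_R, Rabs_pos_eq.
  - apply Rmult_le_reg_r with (2 * INR n + (INR x + INR y))%R; [lra|]. field_simplify; lra.
  - apply Rdiv_le_0_compat; lra.
Qed.

Lemma kernel_val_bound : exists K r : R, (0 < K)%R /\ (0 < r < 1)%R /\
  (forall x y, (0 < x + y)%nat -> Cmod (kernel_val x y) <= K)%R /\
  (forall z, Cmod (residue_coef a b z * RtoC (xi ^ z)) <= K * r ^ z)%R.
Proof.
  destruct kernel_ps_geo as (K & r & HK & Hr & HG & Hc). exists (K / (1 - r))%R, r.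
  assert (HKr : (K <= K / (1 - r))%R).
  { apply Rmult_le_reg_r with (1 - r)%R; [lra|]. field_simplify; nra. }
  split; [lra|]. split; [lra|]. split.
  - intros x y H. apply (geo_Cseries_bound K r Hr _ (HG x y H)).
  - intros z. eapply Rle_trans; [apply Hc|]. apply Rmult_le_compat_r; [apply pow_le|]; lra.
Qed.

(** The resolvent equation [K + L K = L], stripped of the symmetric prefactors. *)
Theorem kernel_val_equation x y : (0 < x)%nat -> (0 < y)%nat ->
  kernel_val x y + Cseries (fun n => residue_coef a b (S n) * RtoC (xi ^ S n) / (INR x + INR (S n)) * kernel_val (S n) y)
  = 2 / (INR x + INR y).
Proof.
  intros Hx Hy. destruct kernel_ps_geo as (K & r & HK & Hr & HG & Hc).
  set (A := fun z m => residue_coef a b z * RtoC (xi ^ z) / (INR x + INR z) * (kernel_ps a b z y m * RtoC (xi ^ m))).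
  assert (Hz : forall z, (Cmod (residue_coef a b z * RtoC (xi ^ z) / (INR x + INR z)) <= K * r ^ z)%R).
  { intros z. unfold Cdiv. rewrite Cmod_mult. rewrite <- (Rmult_1_r (K * r ^ z)).
    apply Rmult_le_compat; try apply Cmod_ge_0; auto.
    rewrite Cmod_inv by (apply INRC_add_nz; lia). rewrite <- INRC_add, Cmod_INR.
    rewrite <- Rinv_1. apply Rinv_le_contravar; [lra|]. apply (le_INR 1). lia. }
  assert (HA : forall z m, (Cmod (A z m) <= K * K * r ^ (z + m))%R).
  { intros z m. unfold A. rewrite Cmod_mult, pow_add.
    replace (K * K * (r ^ z * r ^ m))%R with ((K * r ^ z) * (K * r ^ m))%R by ring.
    apply Rmult_le_compat; try apply Cmod_ge_0; auto. apply (HG z y). lia. }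
  assert (Hrow : forall z, Cseries (A z) = residue_coef a b z * RtoC (xi ^ z) / (INR x + INR z) * kernel_val z y).
  { intros z. apply (Cseries_scal K r Hr _ (HG z y ltac:(lia))). }
  assert (Hout : geo (K * (K / (1 - r))) r (fun z => residue_coef a b z * RtoC (xi ^ z) / (INR x + INR z) * kernel_val z y)).
  { intros z. rewrite Cmod_mult.
    replace (K * (K / (1 - r)) * r ^ z)%R with ((K * r ^ z) * (K / (1 - r)))%R by ring.
    apply Rmult_le_compat; try apply Cmod_ge_0; auto.
    apply (geo_Cseries_bound K r Hr _ (HG z y ltac:(lia))). }
  assert (E1 : Cseries (fun n => residue_coef a b (S n) * RtoC (xi ^ S n) / (INR x + INR (S n)) * kernel_val (S n) y)
     = Cseries (fun n => Csum (fun z => A z (n - z)%nat) (S n))).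
  { rewrite <- (Cseries_antidiagonal (K * K) r A Hr HA).
    transitivity (Cseries (fun z => residue_coef a b z * RtoC (xi ^ z) / (INR x + INR z) * kernel_val z y)).
    - rewrite (Cseries_first _ r Hr _ Hout), residue_coef_0. unfold Cdiv. ring.
    - f_equal. extensionality z. symmetry. apply Hrow. }
  rewrite E1.
  set (e := fun n => at0 (2 / (INR x + INR y)) n + - (1) * (kernel_ps a b x y n * RtoC (xi ^ n))).
  assert (E2 : (fun n => Csum (fun z => A z (n - z)%nat) (S n)) = e).
  { extensionality n. pose proof (kernel_ps_equation n a b Hab x y Hx Hy) as H. unfold defect in H.
    transitivity (Csum (fun z => residue_coef a b z / (INR x + INR z) * kernel_ps a b z y (n - z)%nat) (S n) * RtoC (xi ^ n)).
    - rewrite Cmult_comm, <- Csum_scal. apply Csum_ext. intros i Hi. unfold A.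
      replace (xi ^ n)%R with (xi ^ i * xi ^ (n - i))%R by (rewrite <- pow_add; f_equal; lia).
      rewrite RtoC_mult. unfold Cdiv. ring.
    - unfold e.
      apply (f_equal (fun w => (w - kernel_ps a b x y n + at0 (2 / (INR x + INR y)) n) * RtoC (xi ^ n))) in H.
      assert (H0 : at0 (2 / (INR x + INR y)) n * RtoC (xi ^ n) = at0 (2 / (INR x + INR y)) n)
        by (destruct n; simpl; ring).
      etransitivity; [|etransitivity; [exact H|]].
      + ring.
      + rewrite <- H0 at 2. ring. }
  rewrite E2. unfold e.
  assert (G0 : geo (Cmod (2 / (INR x + INR y)) + K) r (at0 (2 / (INR x + INR y)))).
  { intros [|n]; simpl.
    - lra.
    - rewrite Cmod_0. apply Rmult_le_pos.
      + pose proof (Cmod_ge_0 (2 / (INR x + INR y))). lra.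
      + apply (pow_le r (S n)). lra. }
  assert (G1 : geo (Cmod (2 / (INR x + INR y)) + K) r (fun n => - (1) * (kernel_ps a b x y n * RtoC (xi ^ n)))).
  { apply geo_weaken with K; [lra| |].
    - pose proof (Cmod_ge_0 (2 / (INR x + INR y))). lra.
    - pose proof (geo_scal K r (- (1)) _ (HG x y ltac:(lia))) as G.
      rewrite Cmod_opp, Cmod_1, Rmult_1_l in G. exact G. }
  rewrite (Cseries_plus _ r _ _ Hr G0 G1), (Cseries_scal K r Hr _ (HG x y ltac:(lia))).
  rewrite (Cseries_finite (at0 _) 1).
  - unfold kernel_val, eval_ps. simpl. ring.
  - intros [|n] Hn; [lia|reflexivity].
Qed.

(** The sum over [k] and the expansion in powers of [xi] are exchanged; the geometric bound on
    the terms is kept for later manipulations of the series. *)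
Theorem kernel_val_sum x y : (0 < x + y)%nat ->
  (exists M r : R, (0 < r < 1)%R /\
    geo M r (fun k => fold_weight k * RtoC (xi ^ k) * (eval_ps xi (hyper a k x) * eval_ps xi (hyper b k y)))) /\
  (INR x + INR y) * kernel_val x y
  = 2 * ((1 - xi) * Cseries (fun k => fold_weight k * RtoC (xi ^ k) * (eval_ps xi (hyper a k x) * eval_ps xi (hyper b k y)))).
Proof.
  intros Hxy. destruct uniform_bounds as (K & r & HK & Hr & HU & HV & HP & _).
  assert (Hr' : (0 < r < 1)%R) by lra.
  set (P := fun k => psM (psM (hyper a k x) (hyper b k y)) (psB (psC 1) psX)).
  set (A := fun k m => 2 * (fold_weight k * RtoC (xi ^ k)) * (P k m * RtoC (xi ^ m))).
  assert (HPm : forall k m, (Cmod (P k m * RtoC (xi ^ m)) <= 2 * K * (r / xi) ^ k * r ^ m)%R).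
  { intros k m. unfold P. rewrite psMC, one_minus_X. set (Q := psM (hyper a k x) (hyper b k y)).
    assert (HQ : forall m, (Cmod (Q m * RtoC (xi ^ m)) <= K * (r / xi) ^ k * r ^ m)%R) by (intros; apply HP).
    destruct m as [|m].
    - replace ((Q 0%nat - 0) * RtoC (xi ^ 0)) with (Q 0%nat * RtoC (xi ^ 0)) by ring.
      specialize (HQ 0%nat). pose proof (Cmod_ge_0 (Q 0%nat * RtoC (xi ^ 0))). lra.
    - replace ((Q (S m) - Q m) * RtoC (xi ^ S m)) with (Q (S m) * RtoC (xi ^ S m) + - (RtoC xi * (Q m * RtoC (xi ^ m))))
        by (simpl; rewrite RtoC_mult; ring).
      eapply Rle_trans; [apply Cmod_triangle|]. rewrite Cmod_opp, (Cmod_mult xi), Cmod_R, Rabs_pos_eq by lra.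
      replace (2 * K * (r / xi) ^ k * r ^ S m)%R with (K * (r / xi) ^ k * r ^ S m + r * (K * (r / xi) ^ k * r ^ m))%R
        by (simpl; ring).
      apply Rplus_le_compat; [apply HQ|]. apply Rmult_le_compat; try lra; [apply Cmod_ge_0|apply HQ]. }
  assert (HA : forall k m, (Cmod (A k m) <= 8 * K * r ^ (k + m))%R).
  { intros k m. unfold A. rewrite !(Cmod_mult (2 * _)), !(Cmod_mult 2), (Cmod_mult (fold_weight k)), (Cmod_R 2), (Cmod_R (xi ^ k)), !Rabs_pos_eq by (try apply pow_le; lra).
    assert (Hw : (Cmod (fold_weight k) <= 2)%R) by (destruct k; simpl; rewrite Cmod_R, Rabs_pos_eq; lra).
    apply Rle_trans with ((2 * (2 * xi ^ k)) * (2 * K * (r / xi) ^ k * r ^ m))%R.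
    - apply Rmult_le_compat; auto.
      + apply Rmult_le_pos; [lra|]. apply Rmult_le_pos; [apply Cmod_ge_0|apply pow_le; lra].
      + apply Cmod_ge_0.
      + apply Rmult_le_compat_l; [lra|]. apply Rmult_le_compat_r; auto. apply pow_le; lra.
    - right. replace (2 * (2 * xi ^ k) * (2 * K * (r / xi) ^ k * r ^ m))%R
        with (8 * K * ((xi * (r / xi)) ^ k * r ^ m))%R by (rewrite Rpow_mult_distr; ring).
      replace (xi * (r / xi))%R with r by (field; lra). rewrite pow_add. reflexivity. }
  assert (Hrow : forall k, Cseries (A k) = 2 * (1 - xi) * (fold_weight k * RtoC (xi ^ k) * (eval_ps xi (hyper a k x) * eval_ps xi (hyper b k y)))).
  { intros k. unfold A.
    rewrite (Cseries_scal (2 * K * (r / xi) ^ k) r Hr' (fun m => P k m * RtoC (xi ^ m)) (HPm k)).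
    unfold P. rewrite psM_pow.
    rewrite (Cseries_product _ _ r _ _ Hr' (HP k x y) (one_minus_X_geo r ltac:(lra))).
    rewrite psM_pow, (Cseries_product _ _ r _ _ Hr' (HU k x) (HV k y)).
    fold (eval_ps xi (hyper a k x)). fold (eval_ps xi (hyper b k y)). fold (eval_ps xi (psB (psC 1) psX)).
    rewrite eval_ps_one_minus_X. ring. }
  assert (Hout : geo (8 * K / (1 - r)) r (fun k => Cseries (A k))).
  { intros k. eapply Rle_trans; [apply (geo_Cseries_bound (8 * K * r ^ k) r Hr' (A k))|right; field; lra].
    intros m. rewrite Rmult_assoc, <- pow_add. apply HA. }
  set (w := fun k => fold_weight k * RtoC (xi ^ k) * (eval_ps xi (hyper a k x) * eval_ps xi (hyper b k y))).
  assert (Hw : geo (8 * K / (1 - r) / (2 * (1 - xi))) r w).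
  { intros k. specialize (Hout k). cbv beta in Hout. rewrite Hrow in Hout. fold (w k) in Hout.
    replace (2 * (1 - xi)) with (RtoC (2 * (1 - xi))) in Hout by (rewrite RtoC_mult, RtoC_minus; ring).
    rewrite Cmod_mult, Cmod_R, Rabs_pos_eq in Hout by lra.
    apply Rmult_le_reg_l with (2 * (1 - xi))%R; [lra|]. eapply Rle_trans; [exact Hout|]. right. field. lra. }
  split; [exists (8 * K / (1 - r) / (2 * (1 - xi)))%R, r; split; [exact Hr'|exact Hw]|].
  rewrite Cmult_assoc, <- (Cseries_scal _ r Hr' w Hw).
  destruct kernel_ps_geo as (K2 & r2 & HK2 & Hr2 & HG & _).
  unfold kernel_val, eval_ps at 1. rewrite <- (Cseries_scal K2 r2 Hr2 _ (HG x y Hxy)).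
  transitivity (Cseries (fun n => Csum (fun k => A k (n - k)%nat) (S n))).
  - f_equal. extensionality n. unfold kernel_ps. rewrite psMC.
    rewrite <- (Csum_convol fold_weight (fun k => psM (hyper a k x) (hyper b k y))).
    transitivity (2 * RtoC (xi ^ n) * Csum (fun z => fold_weight z * psM (psM (hyper a z x) (hyper b z y)) (psB (psC 1) psX) (n - z)%nat) (S n)).
    + field. apply INRC_add_nz. exact Hxy.
    + rewrite <- Csum_scal. apply Csum_ext. intros i Hi.
      unfold A, P. replace (xi ^ n)%R with (xi ^ i * xi ^ (n - i))%R by (rewrite <- pow_add; f_equal; lia).
      rewrite RtoC_mult. ring.
  - rewrite <- (Cseries_antidiagonal (8 * K) r A Hr' HA). f_equal. extensionality k. apply Hrow.
Qed.

End Values.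

(** * The operator [1 + L] is injective on square-summable sequences *)

Fixpoint Rsum (u : nat -> R) (n : nat) : R :=
  match n with O => 0 | S m => Rsum u m + u m end%R.

Lemma Rsum_ext (u v : nat -> R) n : (forall i, (i < n)%nat -> u i = v i) -> Rsum u n = Rsum v n.
Proof. induction n as [|n IH]; intros H; simpl; auto. rewrite IH, H; auto. Qed.

Lemma Rsum_scal c u n : Rsum (fun i => c * u i)%R n = (c * Rsum u n)%R.
Proof. induction n as [|n IH]; simpl; [ring|rewrite IH; ring]. Qed.

Lemma Rsum_plus u v n : Rsum (fun i => u i + v i)%R n = (Rsum u n + Rsum v n)%R.
Proof. induction n as [|n IH]; simpl; [ring|rewrite IH; ring]. Qed.

Lemma Rsum_le_const (u : nat -> R) B n : (forall i, (i < n)%nat -> u i <= B)%R -> (Rsum u n <= INR n * B)%R.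
Proof.
  induction n as [|n IH]; intros H; [simpl; lra|]. rewrite S_INR. simpl Rsum.
  assert (Rsum u n <= INR n * B)%R by (apply IH; intros; apply H; lia).
  specialize (H n ltac:(lia)). lra.
Qed.

Lemma Rsum_term_le (u : nat -> R) j n : (forall i, 0 <= u i)%R -> (j < n)%nat -> (u j <= Rsum u n)%R.
Proof.
  intros H. assert (P : forall m, (0 <= Rsum u m)%R).
  { induction m as [|m IH]; simpl; [lra|]. specialize (H m). lra. }
  induction n as [|n IH]; intros Hj; [lia|]. simpl.
  destruct (Nat.eq_dec j n) as [->|e].
  - specialize (P n). lra.
  - specialize (IH ltac:(lia)). specialize (H n). lra.
Qed.

Lemma is_RInt_Rsum (f : nat -> R -> R) (I : nat -> R) a b n :
  (forall i, is_RInt (f i) a b (I i)) -> is_RInt (fun t => Rsum (fun i => f i t) n) a b (Rsum I n).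
Proof.
  intros H. induction n as [|n IH]; simpl.
  - pose proof (is_RInt_const (V := R_NormedModule) a b 0%R) as E.
    unfold scal in E. simpl in E. unfold mult in E. simpl in E. rewrite Rmult_0_r in E. exact E.
  - apply (is_RInt_plus (V := R_NormedModule)); auto.
Qed.

Lemma is_RInt_pow01 n : is_RInt (fun t => t ^ n)%R 0 1 (/ (INR n + 1))%R.
Proof.
  pose proof (pos_INR n) as Hn.
  replace (/ (INR n + 1))%R with (minus (1 ^ (S n) / (INR n + 1)) (0 ^ (S n) / (INR n + 1)))%R.
  - apply (is_RInt_derive (fun t => t ^ (S n) / (INR n + 1))%R (fun t => t ^ n)%R).
    + intros x _. auto_derive; auto. change (Nat.pred (S n)) with n. change (match n with O => 1%R | S _ => (INR n + 1)%R end) with (INR (S n)). rewrite S_INR. field. lra.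
    + intros x _. apply (ex_derive_continuous (V := R_NormedModule)). auto_derive. auto.
  - unfold minus, plus, opp. simpl. rewrite pow1. field. lra.
Qed.

(** The Cauchy matrix is the Gram matrix of the monomials for the measure [t dt] on the unit
    interval. *)
Lemma Cauchy_matrix_nonneg (v : nat -> R) n :
  (0 <= Rsum (fun i => v i * Rsum (fun j => v j / (INR (S i) + INR (S j))) n) n)%R.
Proof.
  set (p := fun t : R => Rsum (fun i => v i * t ^ i)%R n).
  set (F := fun t : R => Rsum (fun i => Rsum (fun j => v i * v j * t ^ (i + j + 1))%R n) n).
  set (I := Rsum (fun i => Rsum (fun j => v i * v j * / (INR (i + j + 1) + 1))%R n) n).
  assert (HI : is_RInt F 0 1 I).
  { apply (is_RInt_Rsum (fun i t => Rsum (fun j => v i * v j * t ^ (i + j + 1))%R n)).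
    intros i. apply (is_RInt_Rsum (fun j t => v i * v j * t ^ (i + j + 1))%R).
    intros j. apply (is_RInt_scal (V := R_NormedModule) (fun t => t ^ (i + j + 1))%R 0 1 (v i * v j)%R).
    apply is_RInt_pow01. }
  assert (E : forall t, F t = (t * (p t * p t))%R).
  { intros t. unfold F, p.
    rewrite <- Rsum_scal, <- Rsum_scal. apply Rsum_ext. intros i _.
    replace (t * (Rsum (fun k => v k * t ^ k) n * (v i * t ^ i)))%R
      with ((t * (v i * t ^ i)) * Rsum (fun k => v k * t ^ k) n)%R by ring.
    rewrite <- Rsum_scal. apply Rsum_ext. intros j _. rewrite !pow_add. simpl. ring. }
  replace (Rsum _ n) with I.
  - rewrite <- (is_RInt_unique F 0 1 I HI). apply RInt_ge_0; [lra|exists I; exact HI|].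
    intros t Ht. rewrite E. apply Rmult_le_pos; [lra|]. nra.
  - unfold I. apply Rsum_ext. intros i _. rewrite <- Rsum_scal. apply Rsum_ext. intros j _.
    replace (INR (i + j + 1) + 1)%R with (INR (S i) + INR (S j))%R.
    + unfold Rdiv. ring.
    + rewrite <- plus_INR, <- S_INR. f_equal. lia.
Qed.

Lemma ell2_bounded u : ell2 u -> exists B, (0 <= B)%R /\ forall n, (Cmod (u (S n)) <= B)%R.
Proof.
  intros [l Hl]. exists (1 + l)%R.
  assert (H : forall n, (Cmod (u (S n)) ^ 2 <= l)%R).
  { intros n. set (w := fun n => (Cmod (u (S n)) ^ 2)%R) in *.
    assert (Hw : forall m, (0 <= w m)%R) by (intros; unfold w; apply pow2_ge_0).
    apply Rle_trans with (sum_n w n).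
    - destruct n as [|n]; [rewrite sum_O; unfold w; lra|]. rewrite sum_Sn. unfold plus. simpl.
      assert (0 <= sum_n w n)%R; [|fold (w (S n)); change (w (S n) <= sum_n w n + w (S n))%R; lra].
      clear -Hw. induction n as [|n IH]; [rewrite sum_O; auto|]. rewrite sum_Sn.
      unfold plus. simpl. specialize (Hw (S n)). lra.
    - apply (is_lim_seq_incr_compare (sum_n w)).
      + exact Hl.
      + intros m. rewrite sum_Sn. unfold plus. simpl. specialize (Hw (S m)). lra. }
  split.
  - pose proof (H O). pose proof (pow2_ge_0 (Cmod (u 1%nat))). lra.
  - intros n. specialize (H n). pose proof (Cmod_ge_0 (u (S n))). nra.
Qed.

Section Operator.
Variables (h : nat -> R) (C0 r : R).
Hypothesis Hr : (0 < r < 1)%R.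
Hypothesis Hh : forall x, (0 <= h x <= C0 * r ^ x)%R.
Variable M : nat -> nat -> C.
Hypothesis HM : forall x y, (0 < x)%nat -> (0 < y)%nat ->
  M x y = RtoC (2 * h x * h y / (INR x + INR y)).

Lemma C0_nonneg : (0 <= C0)%R.
Proof. specialize (Hh O). simpl in Hh. lra. Qed.

Lemma M_bound x y : (0 < x)%nat -> (0 < y)%nat -> (Cmod (M x y) <= C0 * C0 * r ^ (x + y))%R.
Proof.
  intros Hx Hy. rewrite HM, Cmod_R by auto.
  pose proof (Hh x). pose proof (Hh y).
  assert (H2 : (2 <= INR x + INR y)%R).
  { rewrite <- plus_INR. apply (le_INR 2). lia. }
  rewrite Rabs_pos_eq.
  - apply Rle_trans with (h x * h y)%R.
    + apply Rmult_le_reg_r with (INR x + INR y)%R; [lra|]. field_simplify; [|lra].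
      assert (0 <= h x * h y)%R by (apply Rmult_le_pos; lra). nra.
    + rewrite pow_add. replace (C0 * C0 * (r ^ x * r ^ y))%R with ((C0 * r ^ x) * (C0 * r ^ y))%R by ring.
      apply Rmult_le_compat; lra.
  - apply Rdiv_le_0_compat; [|lra]. apply Rmult_le_pos; [|lra]. apply Rmult_le_pos; lra.
Qed.

Lemma op_geo u B x : (0 < x)%nat -> (0 <= B)%R -> (forall n, Cmod (u (S n)) <= B)%R ->
  geo (C0 * C0 * r * B * r ^ x) r (fun n => M x (S n) * u (S n)).
Proof.
  intros Hx HB Hu n. rewrite Cmod_mult.
  replace (C0 * C0 * r * B * r ^ x * r ^ n)%R with ((C0 * C0 * r ^ (x + S n)) * B)%R
    by (rewrite pow_add; simpl; ring).
  apply Rmult_le_compat; try apply Cmod_ge_0; auto. apply M_bound; lia.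
Qed.

(** Testing [d + L d = 0] against [d] gives a sum of squares plus a nonnegative Cauchy form,
    up to a truncation error that tends to 0. The functional [f] stands for the real or the
    imaginary part. *)
Lemma injective_component (f : C -> R) (d : nat -> C) (B : R) :
  (forall z : C, Rabs (f z) <= Cmod z)%R -> (forall z w : C, f (z + w)%C = f z + f w)%R ->
  (forall (c : R) (z : C), f (RtoC c * z)%C = c * f z)%R ->
  (0 <= B)%R -> (forall n, Cmod (d (S n)) <= B)%R ->
  (forall x, (0 < x)%nat -> d x + op_of_matrix M d x = 0) ->
  forall j, f (d (S j)) = 0%R.
Proof.
  intros Hf Hadd Hlin HB Hd He.
  set (e := fun i => f (d (S i))).
  assert (f0 : f (RtoC 0) = 0%R).
  { pose proof (Hadd (RtoC 0) (RtoC 0)) as H. rewrite Cplus_0_r in H. lra. }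
  set (m := fun i n => (2 * h (S i) * h (S n) / (INR (S i) + INR (S n)))%R).
  set (K := (C0 * C0 * r * B / (1 - r))%R).
  assert (HC0 := C0_nonneg).
  assert (HK : (0 <= K)%R).
  { unfold K. apply Rdiv_le_0_compat; [|lra]. repeat apply Rmult_le_pos; lra. }
  (* truncation of the equation at [N]: the error is a geometric tail *)
  assert (Htail : forall i N, (Rabs (e i + Rsum (fun n => m i n * e n)%R N) <= K * r ^ N)%R).
  { intros i N. pose proof (op_geo d B (S i) ltac:(lia) HB Hd) as G.
    pose proof (geo_tail _ _ Hr _ G N) as T.
    assert (E1 : f (Csum (fun n => M (S i) (S n) * d (S n)) N) = Rsum (fun n => m i n * e n)%R N).
    { clear T. induction N as [|N IH]; [exact f0|]. simpl. rewrite Hadd, IH, HM by lia.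
      rewrite Hlin. reflexivity. }
    assert (E2 : (e i + Rsum (fun n => m i n * e n)%R N
       = - f (Cseries (fun n => M (S i) (S n) * d (S n)) - Csum (fun n => M (S i) (S n) * d (S n)) N)%C)%R).
    { rewrite <- E1. specialize (He (S i) ltac:(lia)). unfold op_of_matrix in He.
      pose proof (Hadd (Cseries (fun n => M (S i) (S n) * d (S n)) - Csum (fun n => M (S i) (S n) * d (S n)) N)
        (Csum (fun n => M (S i) (S n) * d (S n)) N)) as H1.
      replace (Cseries (fun n => M (S i) (S n) * d (S n)) - Csum (fun n => M (S i) (S n) * d (S n)) N
         + Csum (fun n => M (S i) (S n) * d (S n)) N) with (Cseries (fun n => M (S i) (S n) * d (S n))) in H1 by ring.
      pose proof (Hadd (d (S i)) (Cseries (fun n => M (S i) (S n) * d (S n)))) as H2.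
      rewrite He, f0 in H2. unfold e. lra. }
    rewrite E2, Rabs_Ropp. eapply Rle_trans; [apply Hf|]. eapply Rle_trans; [exact T|].
    unfold K. replace (C0 * C0 * r * B / (1 - r) * r ^ N)%R with ((C0 * C0 * r * B) * 1 * r ^ N / (1 - r))%R by (field; lra).
    unfold Rdiv. apply Rmult_le_compat_r; [left; apply Rinv_0_lt_compat; lra|].
    apply Rmult_le_compat_r; [apply pow_le; lra|]. apply Rmult_le_compat_l; [repeat apply Rmult_le_pos; lra|].
    rewrite <- (pow1 (S i)). apply pow_incr. lra. }
  (* the truncated Cauchy form is nonnegative and can be dropped *)
  assert (Hsq : forall N, (Rsum (fun i => e i * e i)%R N <= (INR N + 1) * (B * K * r ^ N))%R).
  { intros N. pose proof (Cauchy_matrix_nonneg (fun i => h (S i) * e i)%R N) as P.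
    assert (E : (Rsum (fun i => e i * e i) N = Rsum (fun i => e i * (e i + Rsum (fun n => m i n * e n) N)) N
      + - 2 * Rsum (fun i => h (S i) * e i * Rsum (fun j => h (S j) * e j / (INR (S i) + INR (S j))) N) N)%R).
    { rewrite <- Rsum_scal, <- Rsum_plus. apply Rsum_ext. intros i _.
      replace (Rsum (fun n => m i n * e n)%R N) with (2 * h (S i) * Rsum (fun j => h (S j) * e j / (INR (S i) + INR (S j))) N)%R.
      - ring.
      - rewrite <- Rsum_scal. apply Rsum_ext. intros j _. unfold m, Rdiv. ring. }
    rewrite E.
    assert (T : (Rsum (fun i => e i * (e i + Rsum (fun n => m i n * e n) N)) N <= INR N * (B * (K * r ^ N)))%R).
    { apply Rsum_le_const. intros i _. eapply Rle_trans; [apply Rle_abs|]. rewrite Rabs_mult.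
      apply Rmult_le_compat; try apply Rabs_pos; [|apply Htail].
      eapply Rle_trans; [apply Hf|apply Hd]. }
    assert (0 <= B * (K * r ^ N))%R.
    { apply Rmult_le_pos; auto. apply Rmult_le_pos; auto. apply pow_le; lra. }
    lra. }
  intros j.
  assert (Hlim : is_lim_seq (fun N => (INR N + 1) * (B * K * r ^ N))%R 0%R) by (apply is_lim_seq_linear_geo; auto).
  apply (is_lim_seq_incr_n _ (S j)) in Hlim.
  apply (is_lim_seq_le (fun _ => (e j * e j)%R) _ (e j * e j)%R 0%R) in Hlim; [|intros n|apply is_lim_seq_const].
  - simpl in Hlim. unfold e in Hlim. nra.
  - eapply Rle_trans; [|apply Hsq]. apply (Rsum_term_le (fun i => e i * e i)%R).
    + intros i. nra.
    + lia.
Qed.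

Lemma op_injective (d : nat -> C) : ell2 d ->
  (forall x, (0 < x)%nat -> d x + op_of_matrix M d x = 0) -> forall x, (0 < x)%nat -> d x = 0.
Proof.
  intros Hd He [|x] Hx; [lia|]. destruct (ell2_bounded d Hd) as [B [HB Hb]].
  apply C_ext; simpl.
  - apply (injective_component Re d B); auto.
    + apply re_le_Cmod.
    + intros; apply re_scal_l.
  - apply (injective_component Im d B); auto.
    + apply Im_le_Cmod.
    + intros; apply im_scal_l.
Qed.

(** * Identification of the matrix of [L (1 + L)^(-1)] *)

Variable kp : nat -> nat -> C.
Variable Kb : R.
Hypothesis Hkb : forall x y, (0 < x)%nat -> (0 < y)%nat -> (Cmod (kp x y) <= Kb)%R.
Hypothesis Heq : forall x y, (0 < x)%nat -> (0 < y)%nat ->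
  kp x y + Cseries (fun n => RtoC (2 * (h (S n) * h (S n))) / (INR x + INR (S n)) * kp (S n) y) = 2 / (INR x + INR y).

(** The candidate [delta_y - K delta_y] for [(1 + L)^(-1) delta_y]. *)
Definition resolvent_col (y x : nat) : C := delta y x - RtoC (h x * h y) * kp x y.

Lemma resolvent_col_ell2 y : (0 < y)%nat -> ell2 (resolvent_col y).
Proof.
  intros Hy. unfold ell2.
  set (B := (C0 * r * h y * Kb)%R).
  assert (HKb : (0 <= Kb)%R).
  { pose proof (Hkb 1 1 ltac:(lia) ltac:(lia)). pose proof (Cmod_ge_0 (kp 1 1)). lra. }
  assert (HB : (0 <= B)%R).
  { unfold B. pose proof C0_nonneg. pose proof (Hh y). repeat apply Rmult_le_pos; lra. }
  apply (ex_series_incr_n (V := R_NormedModule) _ y).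
  apply (@ex_series_le R_AbsRing R_CompleteNormedModule _ (fun n => B * B * r ^ n)%R).
  - intros n. assert (E : resolvent_col y (S (y + n)) = - (RtoC (h (S (y + n)) * h y) * kp (S (y + n)) y)).
    { unfold resolvent_col, delta. destruct (Nat.eq_dec (S (y + n)) y) as [e|e]; [lia|]. ring. }
    rewrite E. change (norm (Cmod (- (RtoC (h (S (y + n)) * h y) * kp (S (y + n)) y)) ^ 2)%R)
      with (Rabs (Cmod (- (RtoC (h (S (y + n)) * h y) * kp (S (y + n)) y)) ^ 2)).
    rewrite Rabs_pos_eq by apply pow2_ge_0. rewrite Cmod_opp, Cmod_mult, Cmod_R, Rabs_pos_eq
      by (pose proof (Hh y); pose proof (Hh (S (y + n))); apply Rmult_le_pos; lra).
    assert (Hle : (h (S (y + n)) * h y * Cmod (kp (S (y + n)) y) <= B * r ^ n)%R).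
    { replace (B * r ^ n)%R with ((C0 * r ^ (S n)) * h y * Kb)%R by (unfold B; simpl; ring).
      pose proof (Hh y). pose proof (Hh (S (y + n))).
      apply Rmult_le_compat; [apply Rmult_le_pos; lra|apply Cmod_ge_0| |apply Hkb; lia].
      apply Rmult_le_compat_r; [lra|]. eapply Rle_trans; [apply H0|].
      apply Rmult_le_compat_l; [apply C0_nonneg|].
      replace (S (y + n)) with (y + S n)%nat by lia. rewrite pow_add.
      rewrite <- (Rmult_1_l (r ^ S n)) at 2. apply Rmult_le_compat_r; [apply pow_le; lra|].
      rewrite <- (pow1 y). apply pow_incr. lra. }
    assert (0 <= h (S (y + n)) * h y * Cmod (kp (S (y + n)) y))%R.
    { pose proof (Hh y). pose proof (Hh (S (y + n))). apply Rmult_le_pos; [apply Rmult_le_pos; lra|apply Cmod_ge_0]. }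
    assert (Hrn : (0 <= r ^ n <= 1)%R).
    { split; [apply pow_le; lra|]. rewrite <- (pow1 n). apply pow_incr. lra. }
    apply Rle_trans with ((B * r ^ n) ^ 2)%R; [apply pow_incr; lra|].
    simpl. assert (0 <= B * B)%R by nra. assert (0 <= B * B * r ^ n)%R by (apply Rmult_le_pos; lra). nra.
  - apply (ex_series_scal_l (K := R_AbsRing) (V := R_NormedModule) (B * B)%R (fun n => r ^ n)%R).
    apply ex_series_geom. rewrite Rabs_pos_eq; lra.
Qed.

Lemma resolvent_col_solves y x : (0 < y)%nat -> (0 < x)%nat ->
  op_id_plus (op_of_matrix M) (resolvent_col y) x = delta y x.
Proof.
  intros Hy Hx. unfold op_id_plus, op_of_matrix.
  set (k := fun n => RtoC (2 * (h (S n) * h (S n))) / (INR x + INR (S n)) * kp (S n) y).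
  assert (HKb : (0 <= Kb)%R).
  { pose proof (Hkb 1 1 ltac:(lia) ltac:(lia)). pose proof (Cmod_ge_0 (kp 1 1)). lra. }
  assert (HC0 := C0_nonneg).
  assert (Gk : geo (2 * (C0 * C0) * Kb) r k).
  { intros n. unfold k. rewrite Cmod_mult. pose proof (Hh (S n)) as Hn.
    assert (Hrn : (0 < r ^ n <= 1)%R).
    { split; [apply pow_lt; lra|]. rewrite <- (pow1 n). apply pow_incr. lra. }
    assert (Hrn' : (r ^ S n <= r ^ n /\ 0 <= r ^ S n <= 1)%R) by (simpl; nra).
    replace (2 * (C0 * C0) * Kb * r ^ n)%R with ((2 * (C0 * C0) * r ^ n) * Kb)%R by ring.
    apply Rmult_le_compat; try apply Cmod_ge_0; [|apply Hkb; lia].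
    assert (Hd : (1 <= INR x + INR (S n))%R) by (rewrite <- plus_INR; apply (le_INR 1); lia).
    rewrite <- RtoC_plus, <- RtoC_div, Cmod_R by lra.
    assert (Hh2 : (0 <= h (S n) * h (S n) <= C0 * C0 * r ^ n)%R).
    { split; [nra|]. apply Rle_trans with ((C0 * r ^ S n) * (C0 * r ^ S n))%R.
      - apply Rmult_le_compat; lra.
      - replace (C0 * r ^ S n * (C0 * r ^ S n))%R with (C0 * C0 * (r ^ S n * r ^ S n))%R by ring.
        apply Rmult_le_compat_l; nra. }
    rewrite Rabs_pos_eq by (apply Rdiv_le_0_compat; lra).
    apply Rle_trans with (2 * (h (S n) * h (S n)))%R; [|lra].
    apply Rmult_le_reg_r with (INR x + INR (S n))%R; [lra|]. field_simplify; [|lra]. nra. }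
  assert (Gd : geo (C0 * C0 * r * 1 * r ^ x) r (fun n => M x (S n) * delta y (S n))).
  { apply op_geo; auto; [lra|]. intros n. unfold delta. destruct (Nat.eq_dec (S n) y); rewrite Cmod_R, Rabs_pos_eq; lra. }
  assert (Es : Cseries (fun n => M x (S n) * delta y (S n)) = M x y).
  { rewrite (Cseries_finite _ y).
    - destruct y as [|y']; [lia|]. simpl Csum. rewrite Csum_zero.
      + unfold delta. destruct (Nat.eq_dec (S y') (S y')); [ring|lia].
      + intros i Hi. unfold delta. destruct (Nat.eq_dec (S i) (S y')); [lia|ring].
    - intros n Hn. unfold delta. destruct (Nat.eq_dec (S n) y); [lia|ring]. }
  set (B := (C0 * C0 * r * 1 * r ^ x + Cmod (RtoC (- (h x * h y))) * (2 * (C0 * C0) * Kb))%R).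
  assert (Hpos : (0 <= C0 * C0 * r * 1 * r ^ x)%R).
  { repeat apply Rmult_le_pos; try lra. apply pow_le; lra. }
  assert (Hpos2 : (0 <= Cmod (RtoC (- (h x * h y))) * (2 * (C0 * C0) * Kb))%R).
  { apply Rmult_le_pos; [apply Cmod_ge_0|]. repeat apply Rmult_le_pos; lra. }
  replace (fun n => M x (S n) * resolvent_col y (S n)) with
    (fun n => M x (S n) * delta y (S n) + RtoC (- (h x * h y)) * k n).
  - rewrite (Cseries_plus B r).
    + rewrite Es, (Cseries_scal _ _ Hr _ Gk), HM by auto.
      specialize (Heq x y Hx Hy). fold k in Heq.
      replace (Cseries k) with (2 / (INR x + INR y) - kp x y) by (rewrite <- Heq; ring).
      unfold resolvent_col.
      assert (Hd : (INR x + INR y <> 0)%R) by (pose proof (lt_0_INR x Hx); pose proof (lt_0_INR y Hy); lra).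
      rewrite RtoC_opp, RtoC_div, !RtoC_mult, RtoC_plus by auto. field.
      apply INRC_add_nz. lia.
    + exact Hr.
    + apply geo_weaken with (3 := Gd); [lra|]. unfold B. lra.
    + apply geo_weaken with (3 := geo_scal _ _ _ _ Gk); [lra|]. unfold B. lra.
  - extensionality n. unfold resolvent_col, k. rewrite HM by lia.
    assert (Hd : (INR x + INR (S n) <> 0)%R) by (pose proof (lt_0_INR x Hx); pose proof (lt_0_INR (S n) ltac:(lia)); lra).
    rewrite RtoC_opp, RtoC_div, !RtoC_mult, RtoC_plus by auto. field.
    apply INRC_add_nz. lia.
Qed.

(** By injectivity the preimage selected by [op_inv] is [resolvent_col], and [L u = delta_y -
    u] for it. *)
Theorem resolvent_matrix x y : (0 < x)%nat -> (0 < y)%nat ->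
  matrix_of_op (fun u => op_of_matrix M (op_inv (op_id_plus (op_of_matrix M)) u)) x y
  = RtoC (h x * h y) * kp x y.
Proof.
  intros Hx Hy. unfold matrix_of_op, op_inv.
  set (P := fun u : nat -> C => ell2 u /\ forall x, (0 < x)%nat -> op_id_plus (op_of_matrix M) u x = delta y x).
  assert (HP : P (epsilon (inhabits (fun _ : nat => RtoC 0)) P)).
  { apply epsilon_spec. exists (resolvent_col y). split; [apply resolvent_col_ell2; auto|].
    intros; apply resolvent_col_solves; auto. }
  set (u := epsilon (inhabits (fun _ : nat => RtoC 0)) P) in *.
  destruct HP as [Hu1 Hu2].
  assert (Hd2 : ell2 (fun n => u n - resolvent_col y n)).
  { pose proof (resolvent_col_ell2 y Hy) as Hs. unfold ell2 in *.
    apply (@ex_series_le R_AbsRing R_CompleteNormedModule _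
      (fun n => plus (scal 2 (Cmod (u (S n)) ^ 2)) (scal 2 (Cmod (resolvent_col y (S n)) ^ 2)))%R).
    - intros n. change (norm (Cmod (u (S n) - resolvent_col y (S n)) ^ 2)%R) with (Rabs (Cmod (u (S n) - resolvent_col y (S n)) ^ 2)).
      rewrite Rabs_pos_eq by apply pow2_ge_0. unfold plus, scal. simpl. unfold mult. simpl.
      pose proof (Cmod_triangle (u (S n)) (- resolvent_col y (S n))) as T. rewrite Cmod_opp in T.
      fold (u (S n) - resolvent_col y (S n)) in T.
      pose proof (Cmod_ge_0 (u (S n) - resolvent_col y (S n))) as H0. unfold Cminus in *. cbv beta in *.
      revert T H0. generalize (Cmod (u (S n) + - resolvent_col y (S n))) (Cmod (u (S n))) (Cmod (resolvent_col y (S n))).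
      intros p s t T H0. assert (p * p <= (s + t) * (s + t))%R by (apply Rmult_le_compat; lra).
      pose proof (pow2_ge_0 (s - t)). simpl in *. nra.
    - apply (ex_series_plus (V := R_NormedModule)); apply (ex_series_scal (V := R_NormedModule)); auto. }
  assert (Heqd : forall z, (0 < z)%nat -> u z - resolvent_col y z = 0).
  { apply (op_injective _ Hd2). intros z Hz.
    destruct (ell2_bounded u Hu1) as [B1 [HB1 Hb1]].
    destruct (ell2_bounded _ (resolvent_col_ell2 y Hy)) as [B2 [HB2 Hb2]].
    pose proof (op_geo u B1 z Hz HB1 Hb1) as G1. pose proof (op_geo _ B2 z Hz HB2 Hb2) as G2.
    specialize (Hu2 z Hz). pose proof (resolvent_col_solves y z Hy Hz) as Hs.
    unfold op_id_plus, op_of_matrix in *.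
    replace (fun n => M z (S n) * (u (S n) - resolvent_col y (S n)))
      with (fun n => M z (S n) * u (S n) + - (1) * (M z (S n) * resolvent_col y (S n))) by (extensionality n; ring).
    set (A1 := (C0 * C0 * r * B1 * r ^ z)%R) in *. set (A2 := (C0 * C0 * r * B2 * r ^ z)%R) in *.
    pose proof (geo_M_nonneg _ _ _ G1). pose proof (geo_M_nonneg _ _ _ G2).
    rewrite (Cseries_plus (A1 + A2) r); auto.
    - rewrite (Cseries_scal _ _ Hr _ G2).
      transitivity ((u z + Cseries (fun n => M z (S n) * u (S n)))
        - (resolvent_col y z + Cseries (fun n => M z (S n) * resolvent_col y (S n)))); [ring|].
      rewrite Hu2, Hs. ring.
    - apply geo_weaken with A1; auto; lra.
    - apply geo_weaken with A2; [lra|lra|]. pose proof (geo_scal _ _ (- (1)) _ G2) as G.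
      rewrite Cmod_opp, Cmod_1, Rmult_1_l in G. exact G. }
  specialize (Hu2 x Hx). unfold op_id_plus in Hu2. fold P. fold u.
  specialize (Heqd x Hx).
  transitivity (delta y x - u x); [rewrite <- Hu2; ring|].
  transitivity (delta y x - resolvent_col y x); [|unfold resolvent_col; ring].
  transitivity (delta y x - resolvent_col y x - (u x - resolvent_col y x)); [ring|]. rewrite Heqd. ring.
Qed.

End Operator.

Open Scope R_scope.

(** * Euler's product for the cosine, in one real form for real and imaginary argument *)

(** For [mu = nu^2] this is the product of the rising factorials of [1/2 - nu] and [1/2 + nu];
    it is real both for real and for imaginary [nu]. *)
Fixpoint half_prod (mu : R) (n : nat) : R :=
  match n with O => 1 | S m => half_prod mu m * ((INR m + 1 / 2) ^ 2 - mu) end.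

Lemma half_prod_pos mu n : mu < 1 / 4 -> 0 < half_prod mu n.
Proof.
  intros H. induction n as [|n IH]; simpl; [lra|]. pose proof (pos_INR n).
  apply Rmult_lt_0_compat; auto. nra.
Qed.

Lemma le_2sin t : 0 <= t <= PI / 2 -> t <= 2 * sin t.
Proof.
  intros Ht. destruct (Req_dec t 0) as [->|Hn]; [rewrite sin_0; lra|].
  set (u := t / 2). assert (Hu : 0 < u <= PI / 4) by (unfold u; lra).
  assert (Hpi := PI_RGT_0).
  assert (Hc : forall v, 0 <= v <= PI / 4 -> / sqrt 2 <= cos v).
  { intros v Hv. replace (/ sqrt 2) with (cos (PI / 4)) by (rewrite cos_PI4; unfold Rdiv; ring).
    apply cos_decr_1; lra. }
  assert (Hs : u * / sqrt 2 <= sin u).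
  { destruct (MVT_gen sin 0 u cos) as [x [Hx E]].
    - intros x _. apply is_derive_Reals, derivable_pt_lim_sin.
    - intros x _. apply continuity_sin.
    - rewrite Rmin_left, Rmax_right in Hx by lra. rewrite sin_0 in E.
      specialize (Hc x ltac:(lra)). nra. }
  assert (H2 : 0 < / sqrt 2) by (apply Rinv_0_lt_compat, sqrt_lt_R0; lra).
  assert (H3 : / sqrt 2 * / sqrt 2 = / 2).
  { rewrite <- Rinv_mult, sqrt_sqrt by lra. reflexivity. }
  replace t with (2 * u) by (unfold u; field). rewrite sin_2a.
  specialize (Hc u ltac:(lra)).
  assert (u * / sqrt 2 * / sqrt 2 <= sin u * cos u).
  { apply Rmult_le_compat; try lra. apply Rmult_le_pos; lra. }
  rewrite Rmult_assoc, H3 in H. lra.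
Qed.

(** Here [c] is meant to be the cosine of [2 nu t], trigonometric or hyperbolic according to
    [nu]; only its differential equation [c'' = - lam c] matters. *)
Definition cos_moment (c : R -> R) (n : nat) : R := RInt (fun t => cos t ^ n * c t) 0 (PI / 2).

Section CosineIntegral.
Variables (c s : R -> R) (lam : R).
Hypothesis Hc : forall t, is_derive c t (s t).
Hypothesis Hs : forall t, is_derive s t (- lam * c t).
Hypothesis Hs0 : s 0 = 0.

Lemma c_cont t : continuous c t.
Proof. apply (ex_derive_continuous (V := R_NormedModule)). exists (s t). apply Hc. Qed.

Lemma cosn_c_cont n t : continuous (fun t => cos t ^ n * c t) t.
Proof.
  apply (continuous_mult (K := R_AbsRing)); [|apply c_cont].
  apply (ex_derive_continuous (V := R_NormedModule)). auto_derive. auto.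
Qed.

Lemma cos_moment_ex n : ex_RInt (fun t => cos t ^ n * c t) 0 (PI / 2).
Proof. apply (ex_RInt_continuous (V := R_CompleteNormedModule)). intros; apply cosn_c_cont. Qed.

(** Integration of [(f c' - f' c)' = (n^2 - lam) cos^n c - n (n-1) cos^(n-2) c] with [f = cos^n]. *)
Lemma cos_moment_rec n : ((INR n + 2) ^ 2 - lam) * cos_moment c (S (S n)) = (INR n + 2) * (INR n + 1) * cos_moment c n.
Proof.
  assert (I : is_RInt (fun t => ((INR n + 2) ^ 2 - lam) * (cos t ^ (S (S n)) * c t)
      - (INR n + 2) * (INR n + 1) * (cos t ^ n * c t)) 0 (PI / 2)
    (minus (cos (PI / 2) ^ (S (S n)) * s (PI / 2) + (INR n + 2) * cos (PI / 2) ^ (S n) * sin (PI / 2) * c (PI / 2))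
           (cos 0 ^ (S (S n)) * s 0 + (INR n + 2) * cos 0 ^ (S n) * sin 0 * c 0))).
  { apply (is_RInt_derive (fun t => cos t ^ (S (S n)) * s t + (INR n + 2) * cos t ^ (S n) * sin t * c t)).
    - intros x _. pose proof (Hc x) as Hcx. pose proof (Hs x) as Hsx.
      auto_derive.
      + repeat split; eexists; eassumption.
      + rewrite (is_derive_unique (fun t : R => c t) x _ Hcx), (is_derive_unique (fun t : R => s t) x _ Hsx).
        change (Nat.pred (S (S n))) with (S n). change (Nat.pred (S n)) with n.
        change (match n with O => 1 | S _ => INR n + 1 end) with (INR (S n)). rewrite !S_INR.
        assert (E : sin x * sin x = 1 - cos x * cos x).
        { pose proof (sin2_cos2 x) as H. unfold Rsqr in H. lra. }
        simpl pow.
        transitivity (((INR n + 1 + 1) * (- sin x) * (cos x * cos x ^ n) * s x + cos x * (cos x * cos x ^ n) * (- lam * c x))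
          + ((INR n + 2) * (- (INR n + 1) * cos x ^ n * (sin x * sin x) + cos x * cos x ^ n * cos x) * c x
             + (INR n + 2) * (cos x * cos x ^ n) * sin x * s x)); [ring|rewrite E; ring].
    - intros x _. apply (continuous_minus (V := R_NormedModule));
        apply (continuous_scal_r (V := R_NormedModule)); apply cosn_c_cont. }
  match type of I with is_RInt _ _ _ ?v => assert (Z : v = 0);
    [rewrite cos_PI2, sin_0, Hs0; unfold minus, plus, opp; simpl; ring|rewrite Z in I] end.
  apply (is_RInt_unique (V := R_CompleteNormedModule)) in I.
  rewrite (RInt_minus (V := R_CompleteNormedModule)) in I.
  - rewrite !(RInt_scal (V := R_CompleteNormedModule)) in I by apply cos_moment_ex.
    unfold minus, plus, opp, scal in I. simpl in I. unfold mult in I. simpl in I. unfold cos_moment. simpl. lra.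
  - apply (ex_RInt_scal (V := R_NormedModule)), cos_moment_ex.
  - apply (ex_RInt_scal (V := R_NormedModule)), cos_moment_ex.
Qed.

Lemma cos_moment_1 : (1 - lam) * cos_moment c 1 = c (PI / 2).
Proof.
  assert (I : is_RInt (fun t => (1 - lam) * (cos t ^ 1 * c t)) 0 (PI / 2)
    (minus (cos (PI / 2) * s (PI / 2) + sin (PI / 2) * c (PI / 2)) (cos 0 * s 0 + sin 0 * c 0))).
  { apply (is_RInt_derive (fun t => cos t * s t + sin t * c t)).
    - intros x _. pose proof (Hc x) as Hcx. pose proof (Hs x) as Hsx.
      auto_derive.
      + repeat split; eexists; eassumption.
      + rewrite (is_derive_unique (fun t : R => c t) x _ Hcx), (is_derive_unique (fun t : R => s t) x _ Hsx). ring.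
    - intros x _. apply (continuous_scal_r (V := R_NormedModule)); apply cosn_c_cont. }
  match type of I with is_RInt _ _ _ ?v => assert (Z : v = c (PI / 2));
    [rewrite cos_PI2, sin_0, Hs0, sin_PI2; unfold minus, plus, opp; simpl; ring|rewrite Z in I] end.
  apply (is_RInt_unique (V := R_CompleteNormedModule)) in I.
  rewrite (RInt_scal (V := R_CompleteNormedModule)) in I by apply cos_moment_ex. exact I.
Qed.

End CosineIntegral.

Definition wallis (n : nat) : R := cos_moment (fun _ => 1) n.

Lemma const1_derive t : is_derive (fun _ : R => 1) t 0.
Proof. apply (is_derive_const (V := R_NormedModule)). Qed.

Lemma const0_derive t : is_derive (fun _ : R => 0) t (- 0 * 1).
Proof. replace (- 0 * 1) with 0 by ring. apply (is_derive_const (V := R_NormedModule)). Qed.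

Lemma wallis_rec n : (INR n + 2) * wallis (S (S n)) = (INR n + 1) * wallis n.
Proof.
  pose proof (cos_moment_rec _ _ _ const1_derive const0_derive eq_refl n) as H.
  fold (wallis n) in H. fold (wallis (S (S n))) in H.
  pose proof (pos_INR n). apply Rmult_eq_reg_l with (INR n + 2); [|lra]. nra.
Qed.

Lemma wallis_1 : wallis 1 = 1.
Proof.
  pose proof (cos_moment_1 _ _ _ const1_derive const0_derive eq_refl) as H. fold (wallis 1) in H. lra.
Qed.

Lemma wallis_0 : wallis 0 = PI / 2.
Proof.
  unfold wallis, cos_moment. rewrite (RInt_ext _ (fun _ => 1)) by (intros; simpl; ring).
  rewrite RInt_const. unfold scal. simpl. unfold mult. simpl. lra.
Qed.

Lemma wallis_pos n : 0 < wallis n.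
Proof.
  assert (H : forall m, 0 < wallis m /\ 0 < wallis (S m)).
  { induction m as [|m [IH1 IH2]].
    - rewrite wallis_0, wallis_1. pose proof PI_RGT_0. lra.
    - split; auto. pose proof (wallis_rec m) as E. pose proof (pos_INR m).
      destruct (Rlt_le_dec 0 (wallis (S (S m)))) as [h|h]; auto. nra. }
  exact (proj1 (H n)).
Qed.

(** The recursion makes this product of neighbours constant in [n]. *)
Lemma wallis_prod n : (INR n + 1) * (wallis (S n) * wallis n) = PI / 2.
Proof.
  induction n as [|n IH].
  - rewrite wallis_1, wallis_0. simpl. lra.
  - pose proof (wallis_rec n) as E. rewrite S_INR. rewrite <- IH.
    transitivity (((INR n + 2) * wallis (S (S n))) * wallis (S n)); [ring|]. rewrite E. ring.
Qed.

Lemma wallis_decr n : wallis (S n) <= wallis n.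
Proof.
  unfold wallis, cos_moment. pose proof PI_RGT_0. apply RInt_le; [lra| | |].
  - apply (cos_moment_ex _ _ const1_derive).
  - apply (cos_moment_ex _ _ const1_derive).
  - intros x Hx. rewrite !Rmult_1_r. pose proof (cos_ge_0 x ltac:(lra) ltac:(lra)). pose proof (COS_bound x).
    simpl. assert (0 <= cos x ^ n) by (apply pow_le; auto). nra.
Qed.

Section CosineProduct.
Variables (c s : R -> R) (mu B : R).
Hypothesis Hc : forall t, is_derive c t (s t).
Hypothesis Hs : forall t, is_derive s t (- (4 * mu) * c t).
Hypothesis Hs0 : s 0 = 0.
Hypothesis Hc0 : c 0 = 1.
Hypothesis HB : forall t, 0 <= t <= PI / 2 -> Rabs (c t) <= B.
Hypothesis Hmu : mu < 1 / 4.

Lemma c_quadratic t : 0 <= t <= PI / 2 -> Rabs (1 - c t) <= Rabs (4 * mu) * B * (t * t).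
Proof.
  intros Ht.
  destruct (MVT_gen c 0 t s) as [x [Hx E]].
  - intros; apply Hc.
  - intros u _. apply continuity_pt_filterlim. apply (c_cont _ _ Hc).
  - rewrite Rmin_left, Rmax_right in Hx by lra.
    destruct (MVT_gen s 0 x (fun t => - (4 * mu) * c t)) as [y [Hy E2]].
    + intros; apply Hs.
    + intros u _. apply continuity_pt_filterlim.
      apply (ex_derive_continuous (V := R_NormedModule)). eexists. apply Hs.
    + rewrite Rmin_left, Rmax_right in Hy by lra.
      replace (1 - c t) with (4 * mu * c y * (x * t)) by
        (rewrite Hc0 in E; rewrite Hs0 in E2; replace (c t) with (1 + s x * t) by lra;
         replace (s x) with (- (4 * mu) * c y * x) by lra; ring).
      rewrite Rabs_mult, Rabs_mult. specialize (HB y ltac:(lra)).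
      rewrite (Rabs_pos_eq (x * t)) by nra.
      apply Rmult_le_compat.
      * apply Rmult_le_pos; apply Rabs_pos.
      * nra.
      * apply Rmult_le_compat_l; [apply Rabs_pos|auto].
      * nra.
Qed.

Let K := 4 * (Rabs (4 * mu) * B).

Lemma K_nonneg : 0 <= K.
Proof.
  unfold K. pose proof (Rabs_pos (4 * mu)). pose proof PI_RGT_0.
  pose proof (HB 0 ltac:(lra)). pose proof (Rabs_pos (c 0)). nra.
Qed.

(** The weight [cos^n] concentrates at 0, where [c = 1]: the quadratic error is at most a
    multiple of [sin^2], which the recursion integrates exactly. *)
Lemma cos_moment_close n : Rabs (wallis n - cos_moment c n) <= K * (wallis n / (INR n + 2)).
Proof.
  pose proof PI_RGT_0 as Hpi.
  assert (E0 : ex_RInt (fun t => cos t ^ n * 1) 0 (PI / 2)) by apply (cos_moment_ex _ _ const1_derive).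
  assert (E1 : ex_RInt (fun t => cos t ^ n * c t) 0 (PI / 2)) by apply (cos_moment_ex _ _ Hc).
  assert (E2 : ex_RInt (fun t => cos t ^ (S (S n)) * 1) 0 (PI / 2)) by apply (cos_moment_ex _ _ const1_derive).
  unfold wallis at 1, cos_moment.
  rewrite <- (RInt_minus (V := R_CompleteNormedModule)) by auto.
  assert (E3 : ex_RInt (fun t => K * (cos t ^ n * 1 - cos t ^ S (S n) * 1)) 0 (PI / 2)).
  { apply (ex_RInt_scal (V := R_NormedModule)). apply (ex_RInt_minus (V := R_NormedModule)); auto. }
  replace (K * (wallis n / (INR n + 2))) with (RInt (fun t => K * (cos t ^ n * 1 - cos t ^ S (S n) * 1)) 0 (PI / 2)).
  -
    eapply Rle_trans; [apply abs_RInt_le; [lra|]|].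
    + apply (ex_RInt_minus (V := R_NormedModule)); auto.
    + apply RInt_le; [lra| |exact E3|].
      * apply (ex_RInt_continuous (V := R_CompleteNormedModule)). intros z _.
        apply (continuous_comp (fun t => minus (cos t ^ n * 1) (cos t ^ n * c t)) Rabs).
        -- apply (continuous_minus (V := R_NormedModule)); [apply (cosn_c_cont _ _ const1_derive)|apply (cosn_c_cont _ _ Hc)].
        -- apply continuous_Rabs.
      * intros x Hx. unfold minus, plus, opp. simpl.
        pose proof (cos_ge_0 x ltac:(lra) ltac:(lra)) as Hcos.
        assert (Hp : 0 <= cos x ^ n) by (apply pow_le; auto).
        replace (cos x ^ n * 1 + - (cos x ^ n * c x)) with (cos x ^ n * (1 - c x)) by ring.
        rewrite Rabs_mult, (Rabs_pos_eq (cos x ^ n)) by auto.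
        pose proof (c_quadratic x ltac:(lra)) as Hq. pose proof (le_2sin x ltac:(lra)) as Hsin.
        assert (E : sin x * sin x = 1 - cos x * cos x).
        { pose proof (sin2_cos2 x) as H. unfold Rsqr in H. lra. }
        replace (K * (cos x ^ n * 1 - cos x * (cos x * cos x ^ n) * 1))
          with (cos x ^ n * (K * (sin x * sin x))) by (rewrite E; ring).
        apply Rmult_le_compat_l; auto. eapply Rle_trans; [exact Hq|].
        unfold K. replace (4 * (Rabs (4 * mu) * B) * (sin x * sin x)) with (Rabs (4 * mu) * B * ((2 * sin x) * (2 * sin x))) by ring.
        apply Rmult_le_compat_l.
        -- pose proof K_nonneg as HK. unfold K in HK. lra.
        -- apply Rmult_le_compat; lra.
  - rewrite (RInt_scal (V := R_CompleteNormedModule)), (RInt_minus (V := R_CompleteNormedModule)) by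
      (auto; apply (ex_RInt_minus (V := R_NormedModule)); auto).
    fold (cos_moment (fun _ => 1) n). fold (cos_moment (fun _ => 1) (S (S n))). fold (wallis n). fold (wallis (S (S n))).
    unfold scal, minus, plus, opp. simpl. unfold mult. simpl. f_equal.
    pose proof (wallis_rec n) as E. pose proof (pos_INR n).
    replace (wallis (S (S n))) with ((INR n + 1) * wallis n / (INR n + 2)) by (rewrite <- E; field; lra). field. lra.
Qed.

Lemma cos_moment_product m :
  cos_moment c (2 * m + 1) * wallis (2 * m + 1) * (4 * half_prod mu (S m)) = c (PI / 2) * INR (fact m) ^ 2.
Proof.
  induction m as [|m IH].
  - simpl Nat.mul. simpl Nat.add. rewrite wallis_1. pose proof (cos_moment_1 _ _ _ Hc Hs Hs0) as E.
    simpl. rewrite <- E. field.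
  - replace (2 * S m + 1)%nat with (S (S (2 * m + 1))) by lia.
    pose proof (cos_moment_rec _ _ _ Hc Hs Hs0 (2 * m + 1)) as E1. pose proof (wallis_rec (2 * m + 1)) as E2.
    rewrite !plus_INR, !mult_INR in E1, E2. change (INR 2) with 2 in *. change (INR 1) with 1 in *.
    rewrite fact_simpl, mult_INR, !S_INR.
    change (half_prod mu (S (S m))) with (half_prod mu (S m) * ((INR (S m) + 1 / 2) ^ 2 - mu)). rewrite S_INR.
    pose proof (pos_INR m) as Hm.
    apply Rmult_eq_reg_l with (2 * INR m + 1 + 2); [|lra].
    transitivity ((((2 * INR m + 1 + 2) ^ 2 - 4 * mu) * cos_moment c (S (S (2 * m + 1))))
      * ((2 * INR m + 1 + 2) * wallis (S (S (2 * m + 1)))) * half_prod mu (S m)); [field|].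
    rewrite E1, E2.
    transitivity ((2 * INR m + 1 + 2) * (INR m + 1) ^ 2 * (cos_moment c (2 * m + 1) * wallis (2 * m + 1) * (4 * half_prod mu (S m)))); [field|].
    rewrite IH. ring.
Qed.

Lemma is_lim_inv_INR (k : R) : 0 < k -> is_lim_seq (fun m => / (INR m + k)) 0.
Proof.
  intros Hk. replace (Finite 0) with (Rbar_inv p_infty) by reflexivity.
  apply is_lim_seq_inv; [|discriminate].
  apply is_lim_seq_le_p_loc with INR; [|apply is_lim_seq_INR].
  exists 0%nat. intros n _. lra.
Qed.

(** The square lies between the products with the two neighbours, which are known. *)
Lemma wallis_limit : is_lim_seq (fun m => 4 * INR m * wallis (2 * m + 1) ^ 2) PI.
Proof.
  assert (Hb : forall m, PI * (INR m / (INR m + 1)) <= 4 * INR m * wallis (2 * m + 1) ^ 2 <= PI).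
  { intros m. pose proof (wallis_prod (2 * m)) as P1. pose proof (wallis_prod (2 * m + 1)) as P2.
    replace (S (2 * m)) with (2 * m + 1)%nat in P1 by lia.
    pose proof (wallis_decr (2 * m)) as D1. replace (S (2 * m)) with (2 * m + 1)%nat in D1 by lia.
    pose proof (wallis_decr (2 * m + 1)) as D2.
    pose proof (wallis_pos (2 * m)). pose proof (wallis_pos (2 * m + 1)). pose proof (wallis_pos (S (2 * m + 1))).
    rewrite plus_INR, mult_INR in P2. rewrite mult_INR in P1. change (INR 2) with 2 in *. change (INR 1) with 1 in *.
    pose proof (pos_INR m). set (q := wallis (2 * m + 1)) in *.
    assert (Q1 : (2 * INR m + 1) * q ^ 2 <= PI / 2).
    { rewrite <- P1. apply Rmult_le_compat_l; [lra|]. replace (q ^ 2) with (q * q) by ring. apply Rmult_le_compat_l; lra. }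
    assert (Q2 : PI / 2 <= (2 * INR m + 1 + 1) * q ^ 2).
    { rewrite <- P2. apply Rmult_le_compat_l; [lra|]. replace (q ^ 2) with (q * q) by ring. apply Rmult_le_compat_r; lra. }
    assert (0 <= q ^ 2) by apply pow2_ge_0.
    split.
    - apply Rmult_le_reg_r with (INR m + 1); [lra|]. field_simplify; [|lra]. nra.
    - nra. }
  apply (is_lim_seq_le_le (fun m => PI * (INR m / (INR m + 1))) _ (fun _ => PI) PI); [| |apply is_lim_seq_const].
  - intros m. specialize (Hb m). exact Hb.
  - apply is_lim_seq_ext with (fun m => PI * (1 - / (INR m + 1))).
    + intros m. pose proof (pos_INR m). field. lra.
    + replace (Finite PI) with (Rbar_mult PI (1 - 0)) by (simpl; f_equal; ring).
      apply is_lim_seq_scal_l. apply is_lim_seq_minus'; [apply is_lim_seq_const|].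
      apply is_lim_inv_INR. lra.
Qed.

Lemma cos_moment_ratio_limit : is_lim_seq (fun m => cos_moment c (2 * m + 1) / wallis (2 * m + 1)) 1.
Proof.
  assert (Hb : forall m, Rabs (cos_moment c (2 * m + 1) / wallis (2 * m + 1) - 1) <= K * / (INR m + 1)).
  { intros m. pose proof (cos_moment_close (2 * m + 1)) as H. pose proof (wallis_pos (2 * m + 1)) as HJ.
    replace (cos_moment c (2 * m + 1) / wallis (2 * m + 1) - 1) with (- ((wallis (2 * m + 1) - cos_moment c (2 * m + 1)) / wallis (2 * m + 1))) by (field; lra).
    rewrite Rabs_Ropp. unfold Rdiv at 1. rewrite Rabs_mult, (Rabs_pos_eq (/ _)) by (left; apply Rinv_0_lt_compat; auto).
    rewrite plus_INR, mult_INR in H. change (INR 2) with 2 in *. change (INR 1) with 1 in *.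
    pose proof (pos_INR m).
    apply Rle_trans with (K * (wallis (2 * m + 1) / (2 * INR m + 1 + 2)) * / wallis (2 * m + 1)).
    - apply Rmult_le_compat_r; auto. left; apply Rinv_0_lt_compat; auto.
    - replace (K * (wallis (2 * m + 1) / (2 * INR m + 1 + 2)) * / wallis (2 * m + 1)) with (K * / (2 * INR m + 1 + 2)) by (field; lra).
      apply Rmult_le_compat_l; [apply K_nonneg|]. apply Rinv_le_contravar; lra. }
  apply is_lim_seq_ext with (fun m => (cos_moment c (2 * m + 1) / wallis (2 * m + 1) - 1) + 1); [intros; ring|].
  replace (Finite 1) with (Finite (0 + 1)) by (f_equal; ring).
  apply is_lim_seq_plus'; [|apply is_lim_seq_const].
  apply is_lim_seq_abs_0. apply is_lim_seq_squeeze0 with (fun m => K * / (INR m + 1)).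
  - intros m. split; [apply Rabs_pos|apply Hb].
  - replace (Finite 0) with (Rbar_mult K 0) by (simpl; f_equal; ring).
    apply is_lim_seq_scal_l, is_lim_inv_INR. lra.
Qed.

(** Euler's product for the cosine, obtained by comparing the recursions for the moments of
    [c] and of 1. *)
Theorem cosine_product_limit :
  is_lim_seq (fun m => c (PI / 2) * (INR m * INR (fact m) ^ 2 / half_prod mu (S m))) PI.
Proof.
  apply is_lim_seq_ext with (fun m => (4 * INR m * wallis (2 * m + 1) ^ 2) * (cos_moment c (2 * m + 1) / wallis (2 * m + 1))).
  - intros m. pose proof (cos_moment_product m) as E. pose proof (wallis_pos (2 * m + 1)). pose proof (half_prod_pos mu (S m) Hmu).
    transitivity (INR m * (c (PI / 2) * INR (fact m) ^ 2) / half_prod mu (S m)); [|field; lra].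
    rewrite <- E. field. lra.
  - replace (Finite PI) with (Finite (PI * 1)) by (f_equal; ring).
    apply is_lim_seq_mult'; [apply wallis_limit|apply cos_moment_ratio_limit].
Qed.

(** All terms of the sequence have the sign of [c (PI / 2)], and their limit is positive. *)
Theorem cosine_end_pos : 0 < c (PI / 2).
Proof.
  pose proof cosine_product_limit as H. pose proof PI_RGT_0 as Hpi.
  destruct (Rlt_le_dec 0 (c (PI / 2))) as [h|h]; auto. exfalso.
  apply (is_lim_seq_le _ (fun _ => 0) PI 0) in H; [simpl in H; lra| |apply is_lim_seq_const].
  intros m. assert (0 <= INR m * INR (fact m) ^ 2 / half_prod mu (S m)).
  { apply Rdiv_le_0_compat; [|apply half_prod_pos; auto]. apply Rmult_le_pos; [apply pos_INR|apply pow2_ge_0]. }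
  nra.
Qed.

End CosineProduct.

Open Scope C_scope.

(** * Limits and derivatives of complex-valued functions *)

Definition Flim {T : Type} (F : (T -> Prop) -> Prop) (f : T -> C) (l : C) : Prop :=
  forall eps : R, (0 < eps)%R -> F (fun y => Cmod (f y - l) < eps)%R.

Section FlimRules.
Context {T : Type} (F : (T -> Prop) -> Prop) {FF : Filter F}.

Lemma Flim_const c : Flim F (fun _ => c) c.
Proof.
  intros eps He. apply filter_forall. intros y. replace (c - c) with (RtoC 0) by ring.
  rewrite Cmod_0. exact He.
Qed.

Lemma Flim_ext f g l : (forall y, f y = g y) -> Flim F f l -> Flim F g l.
Proof. intros E H eps He. apply filter_imp with (2 := H eps He). intros y. rewrite E. auto. Qed.

Lemma Flim_ext_loc f g l : F (fun y => f y = g y) -> Flim F f l -> Flim F g l.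
Proof.
  intros E H eps He. apply filter_imp with (2 := filter_and _ _ E (H eps He)).
  intros y [e h]. rewrite <- e. auto.
Qed.

Lemma Flim_plus f g l m : Flim F f l -> Flim F g m -> Flim F (fun y => f y + g y) (l + m).
Proof.
  intros Hf Hg eps He. assert (He2 : (0 < eps / 2)%R) by lra.
  apply filter_imp with (2 := filter_and _ _ (Hf _ He2) (Hg _ He2)).
  intros y [h1 h2]. replace (f y + g y - (l + m)) with ((f y - l) + (g y - m)) by ring.
  eapply Rle_lt_trans; [apply Cmod_triangle|]. lra.
Qed.

Lemma Flim_bounded f l : Flim F f l -> F (fun y => Cmod (f y) <= Cmod l + 1)%R.
Proof.
  intros H. apply filter_imp with (2 := H 1%R Rlt_0_1). intros y h.
  replace (f y) with (l + (f y - l)) by ring. eapply Rle_trans; [apply Cmod_triangle|]. lra.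
Qed.

Lemma Flim_mult f g l m : Flim F f l -> Flim F g m -> Flim F (fun y => f y * g y) (l * m).
Proof.
  intros Hf Hg eps He.
  pose proof (Cmod_ge_0 l) as Hl. pose proof (Cmod_ge_0 m) as Hm.
  set (a := (eps / (2 * (Cmod m + 1)))%R). set (b := (eps / (2 * (Cmod l + 1)))%R).
  assert (Ha : (0 < a)%R) by (apply Rdiv_lt_0_compat; lra).
  assert (Hb : (0 < b)%R) by (apply Rdiv_lt_0_compat; lra).
  apply filter_imp with (2 := filter_and _ _ (Flim_bounded f l Hf) (filter_and _ _ (Hf a Ha) (Hg b Hb))).
  intros y (h0 & h1 & h2). replace (f y * g y - l * m) with ((f y) * (g y - m) + (f y - l) * m) by ring.
  eapply Rle_lt_trans; [apply Cmod_triangle|]. rewrite !Cmod_mult.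
  assert (E1 : (Cmod (f y) * Cmod (g y - m) <= (Cmod l + 1) * Cmod (g y - m))%R)
    by (apply Rmult_le_compat_r; auto using Cmod_ge_0).
  assert (E2 : ((Cmod l + 1) * Cmod (g y - m) < (Cmod l + 1) * b)%R) by (apply Rmult_lt_compat_l; lra).
  assert (E3 : (Cmod (f y - l) * Cmod m <= a * (Cmod m + 1))%R).
  { apply Rmult_le_compat; try apply Cmod_ge_0; lra. }
  assert (E4 : ((Cmod l + 1) * b = eps / 2)%R) by (unfold b; field; lra).
  assert (E5 : (a * (Cmod m + 1) = eps / 2)%R) by (unfold a; field; lra).
  lra.
Qed.

Lemma Flim_opp f l : Flim F f l -> Flim F (fun y => - f y) (- l).
Proof.
  intros H eps He. apply filter_imp with (2 := H eps He). intros y h.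
  replace (- f y - - l) with (- (f y - l)) by ring. rewrite Cmod_opp. exact h.
Qed.

Lemma Flim_minus f g l m : Flim F f l -> Flim F g m -> Flim F (fun y => f y - g y) (l - m).
Proof. intros Hf Hg. apply Flim_plus; auto. apply Flim_opp; auto. Qed.

Lemma Flim_nz (f : T -> C) (l : C) : l <> 0 -> Flim F f l -> F (fun y => Cmod l / 2 < Cmod (f y))%R.
Proof.
  intros Hl H. apply Cmod_gt_0 in Hl. assert (Hl2 : (0 < Cmod l / 2)%R) by lra.
  apply filter_imp with (2 := H _ Hl2).
  intros y h. pose proof (Cmod_triangle (f y) (- (f y - l))) as Ht. rewrite Cmod_opp in Ht.
  replace (f y + - (f y - l)) with l in Ht by ring. lra.
Qed.

Lemma Flim_inv (f : T -> C) (l : C) : l <> 0 -> Flim F f l -> Flim F (fun y => / f y) (/ l).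
Proof.
  intros Hl H eps He. pose proof Hl as Hl'. apply Cmod_gt_0 in Hl'.
  assert (Hb : (0 < eps * (Cmod l * Cmod l / 2))%R) by (apply Rmult_lt_0_compat; nra).
  apply filter_imp with (2 := filter_and _ _ (Flim_nz f l Hl H) (H _ Hb)). intros y [h1 h2].
  assert (Hf : f y <> 0) by (apply Cmod_gt_0; lra).
  replace (/ f y - / l) with (- (f y - l) / (f y * l)) by (field; auto).
  rewrite Cmod_div, Cmod_opp, Cmod_mult by (apply Cmult_neq_0; auto).
  apply Rmult_lt_reg_r with (Cmod (f y) * Cmod l)%R; [apply Rmult_lt_0_compat; lra|].
  unfold Rdiv. rewrite Rmult_assoc, Rinv_l by (apply Rmult_integral_contrapositive_currified; lra).
  rewrite Rmult_1_r. eapply Rlt_trans; [exact h2|]. apply Rmult_lt_compat_l; auto.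
  nra.
Qed.

Lemma Flim_unique (f : T -> C) (l m : C) : ProperFilter F -> Flim F f l -> Flim F f m -> l = m.
Proof.
  intros PF H1 H2. destruct (Ceq_dec l m) as [e|e]; auto. exfalso.
  assert (Hd : (0 < Cmod (l - m))%R) by (apply Cmod_gt_0, Cminus_eq_contra; auto).
  assert (Hd2 : (0 < Cmod (l - m) / 2)%R) by lra.
  destruct (filter_ex _ (filter_and _ _ (H1 _ Hd2) (H2 _ Hd2))) as [y [h1 h2]].
  pose proof (Cmod_triangle (- (f y - l)) (f y - m)) as Ht. rewrite Cmod_opp in Ht.
  replace (- (f y - l) + (f y - m)) with (l - m) in Ht by ring. lra.
Qed.

End FlimRules.

Lemma locally_C_Cmod (z : C) (P : C -> Prop) :
  locally z P <-> exists d : R, (0 < d)%R /\ forall w, (Cmod (w - z) < d)%R -> P w.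
Proof.
  split.
  - intros [d H]. exists d. split; [apply cond_pos|]. intros w Hw. apply H.
    pose proof (re_le_Cmod (w - z)). pose proof (Im_le_Cmod (w - z)).
    split; unfold ball; simpl; unfold AbsRing_ball, abs, minus, plus, opp; simpl;
      unfold Re, Im in *; simpl in *; lra.
  - intros [d [Hd H]]. exists (mkposreal (d / 2) ltac:(lra)). intros w [H1 H2]. apply H.
    unfold ball in H1, H2; simpl in H1, H2; unfold AbsRing_ball, abs, minus, plus, opp in H1, H2; simpl in H1, H2.
    eapply Rle_lt_trans; [apply Cmod_le_ReIm|]. unfold Re, Im. simpl. lra.
Qed.

Lemma Flim_id (z : C) : Flim (locally z) (fun w => w) z.
Proof. intros eps He. apply locally_C_Cmod. exists eps. auto. Qed.

Lemma Flim_RtoC (t : R) : Flim (locally t) RtoC t.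
Proof.
  intros eps He. exists (mkposreal eps He). intros y Hy. rewrite <- RtoC_minus, Cmod_R. exact Hy.
Qed.

Lemma Flim_comp {T : Type} (F : (T -> Prop) -> Prop) {FF : Filter F} (f : T -> C) (g : C -> C) l m :
  Flim F f l -> Flim (locally l) g m -> Flim F (fun y => g (f y)) m.
Proof.
  intros Hf Hg eps He. specialize (Hg eps He). apply locally_C_Cmod in Hg. destruct Hg as [d [Hd H]].
  apply filter_imp with (2 := Hf d Hd). intros y h. apply H, h.
Qed.

Lemma Flim_locally {T : Type} (F : (T -> Prop) -> Prop) {FF : Filter F} (f : T -> C) l (P : C -> Prop) :
  Flim F f l -> locally l P -> F (fun y => P (f y)).
Proof.
  intros Hf HP. apply locally_C_Cmod in HP. destruct HP as [d [Hd H]].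
  apply filter_imp with (2 := Hf d Hd). intros y h. apply H, h.
Qed.

(** The derivative of [f] along the injection [i]: with [i = RtoC] this is the
    derivative of a curve, with [i] the identity the complex derivative. *)
Definition Gder {T : UniformSpace} (i f : T -> C) (x : T) (d : C) : Prop :=
  forall eps : R, (0 < eps)%R ->
  locally x (fun y => Cmod (f y - f x - d * (i y - i x)) <= eps * Cmod (i y - i x))%R.

Definition Rder (f : R -> C) (t : R) (d : C) : Prop := Gder RtoC f t d.
Definition Cder (f : C -> C) (z d : C) : Prop := Gder (fun w => w) f z d.

Section GderRules.
Context {T : UniformSpace} (i : T -> C) (x : T).
Hypothesis Hi : Flim (locally x) i (i x).

Lemma Gder_const c : Gder i (fun _ => c) x 0.
Proof.
  intros eps He. apply filter_forall. intros y. replace (c - c - 0 * (i y - i x)) with (RtoC 0) by ring.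
  rewrite Cmod_0. apply Rmult_le_pos; [lra|apply Cmod_ge_0].
Qed.

Lemma Gder_id : Gder i i x 1.
Proof.
  intros eps He. apply filter_forall. intros y. replace (i y - i x - 1 * (i y - i x)) with (RtoC 0) by ring.
  rewrite Cmod_0. apply Rmult_le_pos; [lra|apply Cmod_ge_0].
Qed.

Lemma Gder_lip f d : Gder i f x d ->
  locally x (fun y => Cmod (f y - f x) <= (Cmod d + 1) * Cmod (i y - i x))%R.
Proof.
  intros H. apply filter_imp with (2 := H 1%R Rlt_0_1). intros y h.
  replace (f y - f x) with ((f y - f x - d * (i y - i x)) + d * (i y - i x)) by ring.
  eapply Rle_trans; [apply Cmod_triangle|]. rewrite Cmod_mult. lra.
Qed.

Lemma Gder_cont f d : Gder i f x d -> Flim (locally x) f (f x).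
Proof.
  intros H eps He. pose proof (Cmod_ge_0 d).
  assert (Hb : (0 < eps / (Cmod d + 1))%R) by (apply Rdiv_lt_0_compat; lra).
  apply filter_imp with (2 := filter_and _ _ (Gder_lip f d H) (Hi _ Hb)). intros y [h1 h2].
  eapply Rle_lt_trans; [exact h1|]. apply Rmult_lt_reg_r with (/ (Cmod d + 1))%R; [apply Rinv_0_lt_compat; lra|].
  field_simplify; [|lra|lra]. unfold Rdiv in h2. unfold Rdiv. exact h2.
Qed.

Lemma Gder_ext_loc f g d : locally x (fun y => f y = g y) -> f x = g x -> Gder i f x d -> Gder i g x d.
Proof.
  intros E Ex H eps He. apply filter_imp with (2 := filter_and _ _ E (H eps He)).
  intros y [e h]. rewrite <- e, <- Ex. exact h.
Qed.

Lemma Gder_ext f g d : (forall y, f y = g y) -> Gder i f x d -> Gder i g x d.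
Proof. intros E. apply Gder_ext_loc; auto. apply filter_forall. auto. Qed.

Lemma Gder_plus (f g : T -> C) (d e : C) : Gder i f x d -> Gder i g x e -> Gder i (fun y => f y + g y) x (d + e).
Proof.
  intros Hf Hg eps He.
  assert (He2 : (0 < eps / 2)%R) by lra.
  apply filter_imp with (2 := filter_and _ _ (Hf _ He2) (Hg _ He2)).
  intros y [h1 h2].
  replace (f y + g y - (f x + g x) - (d + e) * (i y - i x))
    with ((f y - f x - d * (i y - i x)) + (g y - g x - e * (i y - i x))) by ring.
  eapply Rle_trans; [apply Cmod_triangle|]. lra.
Qed.

Lemma Gder_opp f d : Gder i f x d -> Gder i (fun y => - f y) x (- d).
Proof.
  intros H eps He. apply filter_imp with (2 := H eps He). intros y h.
  replace (- f y - - f x - - d * (i y - i x)) with (- (f y - f x - d * (i y - i x))) by ring.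
  rewrite Cmod_opp. exact h.
Qed.

Lemma Gder_minus f g d e : Gder i f x d -> Gder i g x e -> Gder i (fun y => f y - g y) x (d - e).
Proof. intros Hf Hg. apply Gder_plus; auto. apply Gder_opp; auto. Qed.

Lemma Gder_mult (f g : T -> C) (d e : C) : Gder i f x d -> Gder i g x e ->
  Gder i (fun y => f y * g y) x (d * g x + f x * e).
Proof.
  intros Hf Hg eps He.
  pose proof (Cmod_ge_0 (f x)) as H1. pose proof (Cmod_ge_0 (g x)) as H2. pose proof (Cmod_ge_0 d) as H3.
  set (a := (eps / (3 * (Cmod (g x) + 1)))%R). set (b := (eps / (3 * (Cmod (f x) + 1)))%R).
  set (c := (eps / (3 * (Cmod d + 1)))%R).
  assert (Ha : (0 < a)%R) by (apply Rdiv_lt_0_compat; lra).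
  assert (Hb : (0 < b)%R) by (apply Rdiv_lt_0_compat; lra).
  assert (Hc : (0 < c)%R) by (apply Rdiv_lt_0_compat; lra).
  apply filter_imp with (2 := filter_and _ _ (filter_and _ _ (Hf a Ha) (Hg b Hb))
     (filter_and _ _ (Gder_lip f d Hf) (Gder_cont g e Hg c Hc))).
  intros y [[h1 h2] [h3 h4]]. set (D := Cmod (i y - i x)) in *.
  assert (HD : (0 <= D)%R) by apply Cmod_ge_0.
  replace (f y * g y - f x * g x - (d * g x + f x * e) * (i y - i x))
    with ((f y - f x - d * (i y - i x)) * g x + f x * (g y - g x - e * (i y - i x)) + (f y - f x) * (g y - g x)) by ring.
  eapply Rle_trans; [apply Cmod_triangle|].
  eapply Rle_trans; [apply Rplus_le_compat_r, Cmod_triangle|]. rewrite !Cmod_mult.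
  assert (E1 : (Cmod (f y - f x - d * (i y - i x)) * Cmod (g x) <= eps / 3 * D)%R).
  { apply Rle_trans with ((a * D) * (Cmod (g x) + 1))%R.
    - apply Rmult_le_compat; auto using Cmod_ge_0. lra.
    - right. unfold a. field. lra. }
  assert (E2 : (Cmod (f x) * Cmod (g y - g x - e * (i y - i x)) <= eps / 3 * D)%R).
  { apply Rle_trans with ((Cmod (f x) + 1) * (b * D))%R.
    - apply Rmult_le_compat; auto using Cmod_ge_0. lra.
    - right. unfold b. field. lra. }
  assert (E3 : (Cmod (f y - f x) * Cmod (g y - g x) <= eps / 3 * D)%R).
  { apply Rle_trans with (((Cmod d + 1) * D) * c)%R.
    - apply Rmult_le_compat; auto using Cmod_ge_0. lra.
    - right. unfold c. field. lra. }
  lra.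
Qed.

Lemma Gder_comp (f : T -> C) (g : C -> C) d e :
  Gder i f x d -> Cder g (f x) e -> Gder i (fun y => g (f y)) x (e * d).
Proof.
  intros Hf Hg eps He. pose proof (Cmod_ge_0 d) as H1. pose proof (Cmod_ge_0 e) as H2.
  set (a := (eps / (2 * (Cmod d + 1)))%R). set (b := (eps / (2 * (Cmod e + 1)))%R).
  assert (Ha : (0 < a)%R) by (apply Rdiv_lt_0_compat; lra).
  assert (Hb : (0 < b)%R) by (apply Rdiv_lt_0_compat; lra).
  pose proof (Flim_locally _ _ _ _ (Gder_cont f d Hf) (Hg a Ha)) as L.
  apply filter_imp with (2 := filter_and _ _ L (filter_and _ _ (Hf b Hb) (Gder_lip f d Hf))).
  intros y [h1 [h2 h3]]. set (D := Cmod (i y - i x)) in *.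
  assert (HD : (0 <= D)%R) by apply Cmod_ge_0.
  replace (g (f y) - g (f x) - e * d * (i y - i x))
    with ((g (f y) - g (f x) - e * (f y - f x)) + e * (f y - f x - d * (i y - i x))) by ring.
  eapply Rle_trans; [apply Cmod_triangle|]. rewrite Cmod_mult.
  assert (E1 : (Cmod (g (f y) - g (f x) - e * (f y - f x)) <= eps / 2 * D)%R).
  { eapply Rle_trans; [exact h1|]. apply Rle_trans with (a * ((Cmod d + 1) * D))%R.
    - apply Rmult_le_compat_l; lra.
    - right. unfold a. field. lra. }
  assert (E2 : (Cmod e * Cmod (f y - f x - d * (i y - i x)) <= eps / 2 * D)%R).
  { apply Rle_trans with ((Cmod e + 1) * (b * D))%R.
    - apply Rmult_le_compat; auto using Cmod_ge_0. lra.
    - right. unfold b. field. lra. }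
  lra.
Qed.

End GderRules.

Lemma Cder_inv (z : C) : z <> 0 -> Cder Cinv z (- / (z * z)).
Proof.
  intros Hz eps He. pose proof Hz as Hz'. apply Cmod_gt_0 in Hz'.
  assert (Hb : (0 < eps * (Cmod z * Cmod z * Cmod z / 2))%R).
  { apply Rmult_lt_0_compat; auto. assert (0 < Cmod z * Cmod z)%R by nra. nra. }
  apply filter_imp with (2 := filter_and _ _ (Flim_nz _ _ z Hz (Flim_id z)) (Flim_id z _ Hb)).
  intros w [h1 h2]. assert (Hw : (w : C) <> RtoC 0) by (apply Cmod_gt_0; lra).
  replace (/ w - / z - - / (z * z) * (w - z)) with ((w - z) * ((w - z) / (w * (z * z)))) by (field; auto).
  rewrite Cmod_mult, Rmult_comm. apply Rmult_le_compat_r; [apply Cmod_ge_0|].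
  rewrite Cmod_div, !Cmod_mult by (repeat apply Cmult_neq_0; auto).
  assert (Hp : (0 < Cmod w * (Cmod z * Cmod z))%R) by (apply Rmult_lt_0_compat; nra).
  apply Rmult_le_reg_r with (Cmod w * (Cmod z * Cmod z))%R; auto.
  unfold Rdiv. rewrite Rmult_assoc, Rinv_l, Rmult_1_r by lra.
  left. eapply Rlt_le_trans; [exact h2|]. apply Rmult_le_compat_l; [lra|].
  assert (Cmod z / 2 * (Cmod z * Cmod z) <= Cmod w * (Cmod z * Cmod z))%R by (apply Rmult_le_compat_r; nra). lra.
Qed.

Lemma Cder_cont f z d : Cder f z d -> Flim (locally z) f (f z).
Proof. apply Gder_cont. apply Flim_id. Qed.

Lemma Rder_cont f t d : Rder f t d -> Flim (locally t) f (f t).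
Proof. apply Gder_cont. apply Flim_RtoC. Qed.

Lemma Cder_comp (f g : C -> C) z d e : Cder f z d -> Cder g (f z) e -> Cder (fun w => g (f w)) z (e * d).
Proof. apply Gder_comp, Flim_id. Qed.

Lemma Rder_comp (f : R -> C) (g : C -> C) t d e : Rder f t d -> Cder g (f t) e -> Rder (fun u => g (f u)) t (e * d).
Proof. apply Gder_comp, Flim_RtoC. Qed.

(** * Link with the derivative and continuity of normed modules *)

Lemma Rder_is_derive f t d :
  Rder f t d <-> is_derive (K := R_AbsRing) (V := C_R_NormedModule) f t d.
Proof.
  assert (E : forall y : R, minus (minus (f y) (f t) : C_R_NormedModule) (scal (minus y t) d)
     = f y - f t - d * (RtoC y - RtoC t)).
  { intros y. rewrite scal_R_Cmult. unfold minus at 3. unfold plus, opp. simpl. rewrite RtoC_plus, RtoC_opp.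
    change (minus (minus (f y) (f t) : C_R_NormedModule) ((RtoC y + - RtoC t) * d)) with (f y - f t - (RtoC y + - RtoC t) * d).
    ring. }
  assert (N : forall z : C_R_NormedModule, norm z = Cmod z) by (intros z; rewrite Cmod_norm; reflexivity).
  assert (A : forall y : R, Cmod (RtoC y - RtoC t) = norm (minus y t)).
  { intros y. rewrite <- RtoC_minus, Cmod_R. reflexivity. }
  split.
  - intros H. split; [apply is_linear_scal_l|]. intros x Hx.
    apply (@is_filter_lim_locally_unique R_AbsRing (AbsRing_NormedModule R_AbsRing) t x) in Hx. subst x. intros eps.
    apply filter_imp with (2 := H eps (cond_pos eps)). intros y h.
    refine (Rle_trans _ _ _ (Req_le _ _ (eq_trans (N _) (f_equal Cmod (E y)))) _).
    refine (Rle_trans _ _ _ h (Req_le _ _ _)). f_equal. apply A.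
  - intros [_ H] eps He.
    specialize (H t (fun P HP => HP) (mkposreal eps He)).
    apply filter_imp with (2 := H). intros y h.
    refine (Rle_trans _ _ _ (Req_le _ _ (eq_sym (eq_trans (N _) (f_equal Cmod (E y))))) _).
    refine (Rle_trans _ _ _ h (Req_le _ _ _)). simpl pos. f_equal. symmetry. apply A.
Qed.

Lemma Flim_continuous {U : UniformSpace} (f : U -> C) x :
  Flim (locally x) f (f x) <-> continuous (U := C_UniformSpace) f x.
Proof.
  split.
  - intros H P HP. apply (Flim_locally _ _ _ _ H HP).
  - intros H eps He. apply (H (fun w => Cmod (w - f x) < eps)%R). apply locally_C_Cmod. exists eps. auto.
Qed.

Lemma Gder_component (p : C -> R) (f : R -> C) t d :
  (forall z : C, Rabs (p z) <= Cmod z)%R -> (forall z w : C, p (z - w)%C = p z - p w)%R ->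
  (forall (c : R) (z : C), p (z * RtoC c)%C = p z * c)%R ->
  Rder f t d -> is_derive (fun u => p (f u)) t (p d).
Proof.
  intros Hp Hm Hs H. split; [apply is_linear_scal_l|]. intros x Hx.
  apply (@is_filter_lim_locally_unique R_AbsRing (AbsRing_NormedModule R_AbsRing) t x) in Hx. subst x. intros eps.
  apply filter_imp with (2 := H eps (cond_pos eps)). intros y h.
  unfold norm, minus, plus, opp, scal. simpl. unfold abs. simpl. unfold mult. simpl.
  replace (p (f y) + - p (f t) + - ((y + - t) * p d))%R with (p (f y - f t - d * (RtoC y - RtoC t))).
  - eapply Rle_trans; [apply Hp|]. eapply Rle_trans; [exact h|].
    rewrite <- RtoC_minus, Cmod_R. unfold Rminus. lra.
  - rewrite !Hm, <- RtoC_minus, Hs. ring.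
Qed.

Lemma Rder_Re f t d : Rder f t d -> is_derive (fun u => Re (f u)) t (Re d).
Proof.
  apply Gder_component; [apply re_le_Cmod|reflexivity|]. intros; apply re_scal_r.
Qed.

Lemma Rder_Im f t d : Rder f t d -> is_derive (fun u => Im (f u)) t (Im d).
Proof.
  apply Gder_component; [apply Im_le_Cmod|reflexivity|]. intros; apply im_scal_r.
Qed.

Lemma Rder_pair (p q : R -> R) t a b : is_derive p t a -> is_derive q t b ->
  Rder (fun u => (p u, q u)) t (a, b).
Proof.
  intros [_ H1] [_ H2] eps He.
  assert (He2 : (0 < eps / 2)%R) by lra.
  specialize (H1 t (fun P HP => HP) (mkposreal _ He2)). specialize (H2 t (fun P HP => HP) (mkposreal _ He2)).
  apply filter_imp with (2 := filter_and _ _ H1 H2). intros y [h1 h2].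
  unfold norm, minus, plus, opp, scal in h1, h2. simpl in h1, h2.
  unfold abs in h1, h2. simpl in h1, h2. unfold mult in h1, h2. simpl in h1, h2.
  eapply Rle_trans; [apply Cmod_le_ReIm|]. rewrite <- RtoC_minus, Cmod_R.
  unfold Re, Im. simpl.
  replace (p y + - p t + - (a * (y - t) - b * 0))%R with (p y + - p t + - ((y + - t) * a))%R by ring.
  replace (q y + - q t + - (a * 0 + b * (y - t)))%R with (q y + - q t + - ((y + - t) * b))%R by ring.
  unfold Rminus. lra.
Qed.

Lemma Rder_RtoC (p : R -> R) t a : is_derive p t a -> Rder (fun u => RtoC (p u)) t (RtoC a).
Proof. intros H. apply (Rder_pair p (fun _ => 0%R) t a 0%R H). apply (is_derive_const (V := R_NormedModule)). Qed.

(** Real and imaginary parts are estimated separately, whence the factor 2. *)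
Lemma mean_value_inequality (f df : R -> C) a b K : (a <= b)%R ->
  (forall t, a <= t <= b -> Rder f t (df t))%R -> (forall t, a <= t <= b -> Cmod (df t) <= K)%R ->
  (Cmod (f b - f a) <= 2 * K * (b - a))%R.
Proof.
  intros Hab Hd HK.
  assert (comp : forall p : C -> R, (forall z, Rabs (p z) <= Cmod z)%R ->
     (forall t d, Rder f t d -> is_derive (fun u => p (f u)) t (p d)) ->
     (Rabs (p (f b) - p (f a)) <= K * (b - a))%R).
  { intros p Hp Hder. destruct (MVT_gen (fun u => p (f u)) a b (fun u => p (df u))) as [x [Hx E]].
    - intros x Hx. rewrite Rmin_left, Rmax_right in Hx by lra. apply Hder, Hd. lra.
    - intros x Hx. rewrite Rmin_left, Rmax_right in Hx by lra.
      apply continuity_pt_filterlim. apply (ex_derive_continuous (V := R_NormedModule)).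
      eexists. apply Hder, Hd. lra.
    - rewrite Rmin_left, Rmax_right in Hx by lra. rewrite E, Rabs_mult, (Rabs_pos_eq (b - a)) by lra.
      apply Rmult_le_compat_r; [lra|]. eapply Rle_trans; [apply Hp|]. apply HK. lra. }
  pose proof (comp Re re_le_Cmod (Rder_Re f)). pose proof (comp Im Im_le_Cmod (Rder_Im f)).
  eapply Rle_trans; [apply Cmod_le_ReIm|]. unfold Re, Im in *. simpl in *. unfold Rminus in *. lra.
Qed.

Lemma Rder_zero_const (f : R -> C) a b : (a <= b)%R ->
  (forall t, a <= t <= b -> Rder f t 0)%R -> f b = f a.
Proof.
  intros Hab Hd. apply Ceq_minus, Cmod_eq_0. apply Rle_antisym; [|apply Cmod_ge_0].
  eapply Rle_trans; [apply (mean_value_inequality f (fun _ => 0) a b 0%R Hab Hd)|].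
  - intros. rewrite Cmod_0. lra.
  - lra.
Qed.

(** * The complex exponential *)

Lemma Cexp_add z w : Cexp (z + w) = Cexp z * Cexp w.
Proof.
  unfold Cexp. destruct z as [p q], w as [p' q']. simpl. rewrite exp_plus, cos_plus, sin_plus.
  unfold Cmult. simpl. f_equal; ring.
Qed.

Lemma Cexp_RtoC (r : R) : Cexp (RtoC r) = RtoC (exp r).
Proof. unfold Cexp. simpl. rewrite cos_0, sin_0. unfold RtoC. f_equal; ring. Qed.

Lemma Cexp_0 : Cexp 0 = 1.
Proof. rewrite Cexp_RtoC, exp_0. reflexivity. Qed.

Lemma Cexp_opp_r z : Cexp z * Cexp (- z) = 1.
Proof. rewrite <- Cexp_add. replace (z + - z) with (RtoC 0) by ring. apply Cexp_0. Qed.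

Lemma Cexp_nz z : Cexp z <> 0.
Proof.
  intros e. pose proof (Cexp_opp_r z) as H. rewrite e, Cmult_0_l in H. apply C1_nz. auto.
Qed.

Lemma Cexp_opp z : Cexp (- z) = / Cexp z.
Proof.
  pose proof (Cexp_nz z). transitivity ((Cexp z * Cexp (- z)) / Cexp z); [field; auto|].
  rewrite Cexp_opp_r. field; auto.
Qed.

Lemma Cmod_Cexp z : Cmod (Cexp z) = exp (Re z).
Proof.
  unfold Cmod, Cexp. simpl.
  replace (exp (Re z) * cos (Im z) * (exp (Re z) * cos (Im z) * 1) + exp (Re z) * sin (Im z) * (exp (Re z) * sin (Im z) * 1))%R
    with (exp (Re z) * exp (Re z) * (Rsqr (sin (Im z)) + Rsqr (cos (Im z))))%R by (unfold Rsqr; ring).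
  rewrite sin2_cos2, Rmult_1_r. apply sqrt_square. left. apply exp_pos.
Qed.

Lemma Rder_Cexp_line (w : C) t : Rder (fun u => Cexp (RtoC u * w)) t (w * Cexp (RtoC t * w)).
Proof.
  destruct w as [p q].
  replace (fun u : R => Cexp (RtoC u * (p, q))) with
    (fun u : R => (exp (u * p) * cos (u * q), exp (u * p) * sin (u * q))%R).
  - replace ((p, q) * Cexp (RtoC t * (p, q))) with
      ((p * exp (t * p) * cos (t * q) - exp (t * p) * (q * sin (t * q)))%R,
       (p * exp (t * p) * sin (t * q) + exp (t * p) * (q * cos (t * q)))%R).
    + apply (Rder_pair (fun u => exp (u * p) * cos (u * q))%R (fun u => exp (u * p) * sin (u * q))%R);
        auto_derive; auto; ring.
    + unfold Cexp, Cmult. simpl. rewrite !Rmult_0_l, Rminus_0_r, Rplus_0_r. f_equal; ring.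
  - extensionality u. unfold Cexp, Cmult. simpl. rewrite !Rmult_0_l, Rminus_0_r, Rplus_0_r. reflexivity.
Qed.

(** Two mean value inequalities, each with a factor 2, and the bound 3 of the exponential on
    the unit disc. *)
Lemma Cexp_quadratic (w : C) : (Cmod w <= 1)%R -> (Cmod (Cexp w - 1 - w) <= 12 * (Cmod w * Cmod w))%R.
Proof.
  intros Hw. pose proof (Cmod_ge_0 w) as H0.
  assert (B1 : forall t, (0 <= t <= 1)%R -> (Cmod (Cexp (RtoC t * w)) <= 3)%R).
  { intros t Ht. rewrite Cmod_Cexp, re_scal_l. eapply Rle_trans; [|apply exp_le_3].
    assert (H : (t * Re w <= 1)%R).
    { pose proof (re_le_Cmod w). pose proof (Rle_abs (Re w)). nra. }
    destruct H as [H| ->]; [left; apply exp_increasing; auto|lra]. }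
  assert (B2 : forall t, (0 <= t <= 1)%R -> (Cmod (Cexp (RtoC t * w) - 1) <= 6 * Cmod w)%R).
  { intros t Ht.
    pose proof (mean_value_inequality (fun u => Cexp (RtoC u * w)) (fun u => w * Cexp (RtoC u * w)) 0 t (Cmod w * 3)%R (proj1 Ht)) as M.
    cbv beta in M. rewrite Cmult_0_l, Cexp_0 in M. eapply Rle_trans; [apply M|].
    - intros u _. apply Rder_Cexp_line.
    - intros u Hu. rewrite Cmod_mult. apply Rmult_le_compat_l; auto. apply B1. lra.
    - nra. }
  pose proof (mean_value_inequality (fun u => Cexp (RtoC u * w) - (1 + RtoC u * w))
    (fun u => w * Cexp (RtoC u * w) - (0 + (1 * w + RtoC u * 0))) 0 1 (Cmod w * (6 * Cmod w))%R Rle_0_1) as M.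
  cbv beta in M. rewrite Cmult_0_l, Cexp_0, Cmult_1_l in M.
  replace (Cexp w - 1 - w) with (Cexp w - (1 + w) - (1 - (1 + 0))) by ring.
  eapply Rle_trans; [apply M|].
  - intros t _. apply Gder_minus; [apply Rder_Cexp_line|]. apply Gder_plus; [apply Gder_const|].
    replace (w + RtoC t * 0) with (1 * w + RtoC t * 0) by ring.
    apply (Gder_mult RtoC t (Flim_RtoC t) RtoC (fun _ => w)); [apply Gder_id|apply Gder_const].
  - intros t Ht. replace (w * Cexp (RtoC t * w) - (0 + (w + RtoC t * 0))) with (w * (Cexp (RtoC t * w) - 1)) by ring.
    rewrite Cmod_mult. apply Rmult_le_compat_l; auto.
  - lra.
Qed.

Lemma Cder_Cexp z : Cder Cexp z (Cexp z).
Proof.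
  intros eps He. pose proof (Cexp_nz z) as Hz. apply Cmod_gt_0 in Hz.
  assert (Hb : (0 < Rmin 1 (eps / (12 * Cmod (Cexp z))))%R).
  { apply Rmin_glb_lt; [lra|]. apply Rdiv_lt_0_compat; lra. }
  apply filter_imp with (2 := Flim_id z _ Hb). intros w h.
  pose proof (Rmin_l 1 (eps / (12 * Cmod (Cexp z)))). pose proof (Rmin_r 1 (eps / (12 * Cmod (Cexp z)))) as h2.
  replace (Cexp w - Cexp z - Cexp z * (w - z)) with (Cexp z * (Cexp (w - z) - 1 - (w - z))).
  - rewrite Cmod_mult. apply Rle_trans with (Cmod (Cexp z) * (12 * (Cmod (w - z) * Cmod (w - z))))%R.
    + apply Rmult_le_compat_l; [lra|]. apply Cexp_quadratic. lra.
    + replace (Cmod (Cexp z) * (12 * (Cmod (w - z) * Cmod (w - z))))%R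
        with ((12 * Cmod (Cexp z) * Cmod (w - z)) * Cmod (w - z))%R by ring.
      apply Rmult_le_compat_r; [apply Cmod_ge_0|].
      apply Rle_trans with (12 * Cmod (Cexp z) * (eps / (12 * Cmod (Cexp z))))%R.
      * apply Rmult_le_compat_l; lra.
      * right. field. lra.
  - assert (Ew : forall u v : C, Cexp u = Cexp v * Cexp (u - v)) by (intros u v; rewrite <- Cexp_add; f_equal; ring).
    rewrite (Ew w z). ring.
Qed.

(** * The Gamma function *)

Lemma Cconv_Flim (u : nat -> C) l : Cconv u l <-> Flim eventually u l.
Proof.
  split.
  - intros H eps He. apply is_lim_seq_spec in H. destruct (H (mkposreal eps He)) as [N HN].
    exists N. intros n Hn. specialize (HN n Hn). simpl in HN.
    rewrite Rminus_0_r, Rabs_pos_eq in HN by apply Cmod_ge_0. exact HN.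
  - intros H. apply is_lim_seq_spec. intros eps. destruct (H eps (cond_pos eps)) as [N HN].
    exists N. intros n Hn. rewrite Rminus_0_r, Rabs_pos_eq by apply Cmod_ge_0. apply HN, Hn.
Qed.

Definition gamma_approx (z : C) (n : nat) : C := INR (fact n) * Cexp (z * ln (INR n)) / rising z (S n).

(** Convergence is recorded together with the value, because [Gamma] is defined at every
    point, convergent or not. *)
Definition isGamma (z l : C) : Prop := Cconv (gamma_approx z) l.

Lemma isGamma_Gamma z l : isGamma z l -> Gamma z = l.
Proof. intros H. apply Cconv_Clim. exact H. Qed.

Lemma ln_le_minus_1 y : (0 < y)%R -> (ln y <= y - 1)%R.
Proof.
  intros Hy. rewrite <- (ln_exp (y - 1)). pose proof (exp_ineq1_le (y - 1)) as H.
  destruct H as [H|H].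
  - left. apply ln_increasing; lra.
  - right. f_equal. lra.
Qed.

Lemma ln_step_bounds n : (1 <= n)%nat ->
  (/ (INR n + 1) <= ln (INR (S n)) - ln (INR n) <= / INR n)%R.
Proof.
  intros Hn. apply (lt_INR 0) in Hn. simpl (INR 0) in Hn. rewrite S_INR. split.
  - assert (H : (ln (INR n / (INR n + 1)) <= INR n / (INR n + 1) - 1)%R).
    { apply ln_le_minus_1. apply Rdiv_lt_0_compat; lra. }
    rewrite ln_div in H by lra.
    replace (INR n / (INR n + 1) - 1)%R with (- / (INR n + 1))%R in H by (field; lra). lra.
  - assert (H : (ln ((INR n + 1) / INR n) <= (INR n + 1) / INR n - 1)%R).
    { apply ln_le_minus_1. apply Rdiv_lt_0_compat; lra. }
    rewrite ln_div in H by lra.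
    replace ((INR n + 1) / INR n - 1)%R with (/ INR n)%R in H by (field; lra). lra.
Qed.

(** Consecutive ratios are [1 + O(1/n^2)], and the bound by differences of [1/n] makes the
    increments summable by telescoping. *)
Lemma ratio_converges (u : nat -> C) (N : nat) (K : R) : (1 <= N)%nat -> (0 <= K)%R ->
  (forall n, (N <= n)%nat -> Cmod (u (S n) - u n) <= K * (/ INR n - / INR (S n)) * Cmod (u n))%R ->
  exists l, Cconv u l.
Proof.
  intros HN HK H.
  set (B := (Cmod (u N) * exp (K * / INR N))%R).
  assert (Hpos : forall n, (N <= n)%nat -> (0 < INR n)%R) by (intros; apply lt_0_INR; lia).
  assert (Hd : forall n, (N <= n)%nat -> (0 <= / INR n - / INR (S n))%R).
  { intros n Hn. pose proof (Hpos n Hn). rewrite S_INR.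
    assert (/ (INR n + 1) <= / INR n)%R by (apply Rinv_le_contravar; lra). lra. }
  assert (HB : forall d, (Cmod (u (N + d)%nat) <= Cmod (u N) * exp (K * (/ INR N - / INR (N + d))))%R).
  { induction d as [|d IH].
    - rewrite Nat.add_0_r, Rminus_diag, Rmult_0_r, exp_0. lra.
    - rewrite <- plus_n_Sm. specialize (H (N + d)%nat ltac:(lia)). specialize (Hd (N + d)%nat ltac:(lia)).
      set (e := (K * (/ INR (N + d) - / INR (S (N + d))))%R) in *.
      assert (He : (0 <= e)%R) by (unfold e; apply Rmult_le_pos; auto).
      replace (u (S (N + d))) with (u (N + d)%nat + (u (S (N + d)) - u (N + d)%nat)) by ring.
      eapply Rle_trans; [apply Cmod_triangle|].
      apply Rle_trans with (Cmod (u (N + d)%nat) * exp e)%R.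
      + pose proof (exp_ineq1_le e). pose proof (Cmod_ge_0 (u (N + d)%nat)). nra.
      + apply Rle_trans with (Cmod (u N) * exp (K * (/ INR N - / INR (N + d))) * exp e)%R.
        * apply Rmult_le_compat_r; [left; apply exp_pos|exact IH].
        * rewrite Rmult_assoc, <- exp_plus. right. f_equal. f_equal. unfold e. ring. }
  assert (HB2 : forall n, (N <= n)%nat -> (Cmod (u n) <= B)%R).
  { intros n Hn. replace n with (N + (n - N))%nat by lia. eapply Rle_trans; [apply HB|].
    apply Rmult_le_compat_l; [apply Cmod_ge_0|].
    replace (N + (n - N))%nat with n by lia.
    assert (Hle : (K * (/ INR N - / INR n) <= K * / INR N)%R).
    { apply Rmult_le_compat_l; auto. assert (0 < / INR n)%R by (apply Rinv_0_lt_compat; auto). lra. }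
    destruct Hle as [Hle|Hle]; [left; apply exp_increasing; auto|right; f_equal; auto]. }
  assert (HB0 : (0 <= B)%R) by (eapply Rle_trans; [apply Cmod_ge_0|apply (HB2 N); lia]).
  assert (HC : forall n d, (N <= n)%nat -> (Cmod (u (n + d)%nat - u n) <= K * B * (/ INR n - / INR (n + d)))%R).
  { intros n d Hn. induction d as [|d IH].
    - rewrite Nat.add_0_r, Rminus_diag, Rmult_0_r. replace (u n - u n) with (RtoC 0) by ring. rewrite Cmod_0. lra.
    - rewrite <- plus_n_Sm. replace (u (S (n + d)) - u n) with ((u (S (n + d)) - u (n + d)%nat) + (u (n + d)%nat - u n)) by ring.
      eapply Rle_trans; [apply Cmod_triangle|].
      specialize (H (n + d)%nat ltac:(lia)). specialize (Hd (n + d)%nat ltac:(lia)). specialize (HB2 (n + d)%nat ltac:(lia)).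
      assert (K * (/ INR (n + d) - / INR (S (n + d))) * Cmod (u (n + d)%nat)
        <= K * (/ INR (n + d) - / INR (S (n + d))) * B)%R.
      { apply Rmult_le_compat_l; auto. apply Rmult_le_pos; auto. }
      lra. }
  assert (HC2 : forall n m, (N <= n)%nat -> (n <= m)%nat -> (Cmod (u m - u n) <= K * B * / INR n)%R).
  { intros n m Hn Hm. replace m with (n + (m - n))%nat by lia. eapply Rle_trans; [apply HC; auto|].
    apply Rmult_le_compat_l; [apply Rmult_le_pos; auto|].
    assert (0 < / INR (n + (m - n)))%R by (apply Rinv_0_lt_compat, Hpos; lia). lra. }
  assert (Hcauchy : forall p : C -> R, (forall z, Rabs (p z) <= Cmod z)%R -> (forall z w : C, p (z - w)%C = p z - p w)%R ->
     ex_finite_lim_seq (fun n => p (u n))).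
  { intros p Hp Hm. apply ex_lim_seq_cauchy_corr. intros eps.
    assert (Hlim : is_lim_seq (fun n => (2 * (K * B) * / (INR n + 1))%R) 0%R).
    { replace (Finite 0) with (Rbar_mult (2 * (K * B))%R 0%R) by (simpl; f_equal; ring).
      apply is_lim_seq_scal_l, is_lim_inv_INR. lra. }
    apply is_lim_seq_spec in Hlim. destruct (Hlim eps) as [M HM].
    exists (S (N + M)). intros n m Hn Hm'. set (k := S (N + M)) in *.
    assert (T : forall j, (k <= j)%nat -> (Rabs (p (u j) - p (u k)) <= K * B * / INR k)%R).
    { intros j Hj. rewrite <- Hm. eapply Rle_trans; [apply Hp|]. apply HC2; lia. }
    pose proof (T n Hn) as T1. pose proof (T m Hm') as T2.
    replace (p (u n) - p (u m))%R with ((p (u n) - p (u k)) - (p (u m) - p (u k)))%R by ring.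
    eapply Rle_lt_trans; [apply Rabs_triang|]. rewrite Rabs_Ropp.
    specialize (HM (N + M)%nat ltac:(lia)). rewrite Rminus_0_r in HM.
    unfold k in T1, T2. rewrite S_INR in T1, T2. eapply Rle_lt_trans; [|eapply Rle_lt_trans; [apply Rle_abs|exact HM]].
    fold k in T1, T2. lra. }
  destruct (Hcauchy Re re_le_Cmod ltac:(reflexivity)) as [l1 H1].
  destruct (Hcauchy Im Im_le_Cmod ltac:(reflexivity)) as [l2 H2].
  exists (l1, l2). apply Cconv_components; assumption.
Qed.

Lemma rising_nz (z : C) n : (forall i, z + INR i <> 0) -> rising z n <> 0.
Proof.
  intros H. induction n as [|n IH]; simpl; [apply C1_nz|]. apply Cmult_neq_0; auto.
Qed.

Lemma Re_pos_nz (z : C) i : (0 < Re z)%R -> z + INR i <> 0.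
Proof.
  intros H e. apply (f_equal Re) in e. unfold Re in *. simpl in e. pose proof (pos_INR i). lra.
Qed.

(** The ratio of consecutive approximants is [(n+1) exp (z d) / (z+n+1)] with [d = ln (n+1) -
    ln n], which is [1 + O(1/n^2)]. *)
Lemma gamma_approx_converges (z : C) : (0 < Re z)%R -> exists l, isGamma z l.
Proof.
  intros Hz. pose proof (Cmod_ge_0 z) as Hz0.
  destruct (INR_unbounded (Cmod z)) as [N0 HN0].
  (* [24 |z|^2 / n] bounds [(n+1) * 12 (|z|/n)^2], and [|z| / n] bounds [z ((n+1) d - 1)] *)
  apply (ratio_converges (gamma_approx z) (S N0) (24 * (Cmod z * Cmod z) + Cmod z)%R); [lia|nra|].
  intros n Hn. assert (Hn1 : (1 <= n)%nat) by lia.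
  assert (Hnp : (0 < INR n)%R) by (apply lt_0_INR; lia).
  assert (Hn2 : (1 <= INR n)%R) by (apply (le_INR 1); lia).
  assert (Hzn : (Cmod z <= INR n)%R).
  { left. eapply Rlt_le_trans; [exact HN0|]. apply le_INR. lia. }
  pose proof (ln_step_bounds n Hn1) as Hd. set (d := (ln (INR (S n)) - ln (INR n))%R) in *.
  assert (Hd0 : (0 < d)%R).
  { assert (0 < / (INR n + 1))%R by (apply Rinv_0_lt_compat; lra). lra. }
  assert (Hden : z + INR n + 1 <> 0).
  { pose proof (Re_pos_nz z (S n) Hz) as H. rewrite INRC_S in H. intros e. apply H. rewrite <- e. ring. }
  assert (Hris : rising z (S n) <> 0) by (apply rising_nz; intros; apply Re_pos_nz; auto).
  assert (E : gamma_approx z (S n) - gamma_approx z n = gamma_approx z n * (((INR n + 1) * (Cexp (z * d) - 1 - z * d)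
      + z * ((INR n + 1) * d - 1)) / (z + INR n + 1))).
  { unfold gamma_approx.
    replace (z * ln (INR (S n))) with (z * ln (INR n) + z * d) by (unfold d; rewrite RtoC_minus; ring).
    rewrite Cexp_add, INRC_fact_S.
    change (rising z (S (S n))) with (rising z (S n) * (z + INR (S n))). rewrite INRC_S.
    set (Rz := rising z (S n)) in *. field. repeat split; auto; intros e; apply Hden; rewrite <- e; ring. }
  rewrite E, Cmod_mult, Rmult_comm. apply Rmult_le_compat_r; [apply Cmod_ge_0|].
  rewrite Cmod_div by auto.
  assert (Hdm : (INR n + 1 <= Cmod (z + INR n + 1))%R).
  { eapply Rle_trans; [|apply re_le_Cmod]. unfold Re in *. simpl. rewrite Rabs_pos_eq by lra. lra. }
  assert (Hzd : (Cmod (z * d) <= Cmod z * / INR n)%R).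
  { rewrite Cmod_mult, Cmod_R, Rabs_pos_eq by lra. apply Rmult_le_compat_l; lra. }
  assert (Hzn1 : (Cmod z * / INR n <= 1)%R).
  { apply Rmult_le_reg_r with (INR n); auto. rewrite Rmult_assoc, Rinv_l by lra. lra. }
  assert (Hq : (Cmod (Cexp (z * d) - 1 - z * d) <= 12 * ((Cmod z * / INR n) * (Cmod z * / INR n)))%R).
  { eapply Rle_trans; [apply Cexp_quadratic; lra|]. apply Rmult_le_compat_l; [lra|].
    apply Rmult_le_compat; auto; apply Cmod_ge_0. }
  assert (Hn1c : Cmod (INR n + 1) = (INR n + 1)%R).
  { rewrite <- RtoC_plus, Cmod_R, Rabs_pos_eq; lra. }
  assert (Hnum : (Cmod ((INR n + 1) * (Cexp (z * d) - 1 - z * d) + z * ((INR n + 1) * d - 1))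
     <= (24 * (Cmod z * Cmod z) + Cmod z) * / INR n)%R).
  { eapply Rle_trans; [apply Cmod_triangle|]. rewrite !Cmod_mult, Hn1c.
    assert (P1 : ((INR n + 1) * Cmod (Cexp (z * d) - 1 - z * d) <= 24 * (Cmod z * Cmod z) * / INR n)%R).
    { apply Rle_trans with ((2 * INR n) * (12 * (Cmod z * / INR n * (Cmod z * / INR n))))%R.
      - apply Rmult_le_compat; try apply Cmod_ge_0; try lra.
      - right. field. lra. }
    assert (P2 : (Cmod ((INR n + 1) * d - 1) <= / INR n)%R).
    { replace ((INR n + 1) * d - 1) with (RtoC ((INR n + 1) * d - 1)) by (rewrite RtoC_minus, RtoC_mult, RtoC_plus; reflexivity).
      rewrite Cmod_R. apply Rabs_le.
      assert (1 <= (INR n + 1) * d)%R.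
      { apply Rle_trans with ((INR n + 1) * / (INR n + 1))%R; [rewrite Rinv_r; lra|]. apply Rmult_le_compat_l; lra. }
      assert ((INR n + 1) * d <= 1 + / INR n)%R.
      { apply Rle_trans with ((INR n + 1) * / INR n)%R; [apply Rmult_le_compat_l; lra|]. right. field. lra. }
      assert (0 < / INR n)%R by (apply Rinv_0_lt_compat; lra). lra. }
    assert (Cmod z * Cmod ((INR n + 1) * d - 1) <= Cmod z * / INR n)%R by (apply Rmult_le_compat_l; auto).
    lra. }
  rewrite S_INR. replace (/ INR n - / (INR n + 1))%R with (/ INR n * / (INR n + 1))%R by (field; lra).
  unfold Rdiv. rewrite <- Rmult_assoc. apply Rmult_le_compat; auto using Cmod_ge_0.
  - left. apply Rinv_0_lt_compat. lra.
  - apply Rinv_le_contravar; lra.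
Qed.

Lemma inv_INR_C_lim : Flim eventually (fun n => RtoC (/ (INR n + 1))) 0.
Proof.
  apply Cconv_Flim. apply is_lim_seq_ext with (fun n => / (INR n + 1))%R.
  - intros n. pose proof (pos_INR n). replace (RtoC (/ (INR n + 1)) - 0) with (RtoC (/ (INR n + 1))) by ring.
    rewrite Cmod_R, Rabs_pos_eq; [reflexivity|]. left. apply Rinv_0_lt_compat. lra.
  - apply is_lim_inv_INR. lra.
Qed.

Lemma rising_shift (z : C) n : z * rising (z + 1) n = rising z (S n).
Proof.
  pose proof (rising_add z 1 n) as H. simpl Nat.add in H. rewrite H.
  simpl. change (INR 1) with 1%R. ring.
Qed.

(** Functional equation, in the direction that lowers the argument. *)
Lemma isGamma_down (z l : C) : (forall i, z + INR i <> 0) -> isGamma (z + 1) l -> isGamma z (l / z).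
Proof.
  intros Hz H. apply Cconv_Flim. apply Cconv_Flim in H.
  assert (Hz0 : z <> 0) by (intros e; apply (Hz O); simpl; rewrite e; ring).
  apply (Flim_ext_loc _ (fun n => gamma_approx (z + 1) n * ((1 + z * RtoC (/ (INR n + 1))) * (/ (1 - RtoC (/ (INR n + 1))) * / z)))).
  - exists 1%nat. intros n Hn.
    assert (Hnp : (0 < INR n)%R) by (apply lt_0_INR; lia).
    assert (Hn0 : RtoC (INR n) <> 0) by (apply INRC_pos_nz; auto).
    assert (Hris : rising z (S n) <> 0) by (apply rising_nz; auto).
    assert (E : rising (z + 1) (S n) = rising z (S n) * (z + (INR n + 1)) / z).
    { pose proof (rising_shift z (S n)) as Hs. change (rising z (S (S n))) with (rising z (S n) * (z + INR (S n))) in Hs.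
      rewrite INRC_S in Hs. rewrite <- Hs. field. auto. }
    unfold gamma_approx. rewrite E.
    replace ((z + 1) * ln (INR n)) with (z * ln (INR n) + RtoC (ln (INR n))) by ring.
    rewrite Cexp_add, Cexp_RtoC, exp_ln by auto.
    rewrite RtoC_inv by lra. rewrite RtoC_plus.
    pose proof (INRC_S_nz n) as Hs1.
    pose proof (Hz (S n)) as Hzn. rewrite INRC_S in Hzn.
    set (Rz := rising z (S n)) in *. field. repeat split; auto.
    + intros e. apply Hn0. rewrite <- e. ring.
  - replace (l / z) with (l * ((1 + z * 0) * (/ (1 - 0) * / z))) by (field; auto).
    apply Flim_mult; [apply eventually_filter|exact H|].
    apply Flim_mult; [apply eventually_filter| |].
    + apply Flim_plus; [apply eventually_filter|apply Flim_const, eventually_filter|].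
      apply Flim_mult; [apply eventually_filter|apply Flim_const, eventually_filter|apply inv_INR_C_lim].
    + apply Flim_mult; [apply eventually_filter| |apply Flim_const, eventually_filter].
      apply Flim_inv; [apply eventually_filter| |].
      * replace (1 - 0) with (RtoC 1) by ring. apply C1_nz.
      * apply Flim_minus; [apply eventually_filter|apply Flim_const, eventually_filter|apply inv_INR_C_lim].
Qed.

Lemma isGamma_down_n (z l : C) n : (forall i, z + INR i <> 0) -> isGamma (z + INR n) l -> isGamma z (l / rising z n).
Proof.
  revert l. induction n as [|n IH]; intros l Hz H.
  - simpl in *. rewrite Cplus_0_r in H. replace (l / 1) with l by field. exact H.
  - assert (Hr : rising z n <> 0) by (apply rising_nz; auto).
    replace (l / rising z (S n)) with (l / (z + INR n) / rising z n) by (simpl; field; auto).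
    apply IH; auto. apply isGamma_down.
    + intros i. rewrite <- Cplus_assoc, <- INRC_add. apply Hz.
    + rewrite <- Cplus_assoc, <- INRC_S. exact H.
Qed.

(** * Evaluation of the weight [psi], of the matrix [L] and of the gauge factor [g] *)

Lemma Csqrt_RtoC p : (0 < p)%R -> Csqrt (RtoC p) = RtoC (sqrt p).
Proof.
  intros Hp. unfold Csqrt, Cpowc, Clog, Carg.
  rewrite Cmod_R, (Rabs_pos_eq p) by lra. simpl Im. simpl Re.
  destruct (Rle_dec 0 0) as [_|h]; [|lra].
  replace (p / p)%R with 1%R by (field; lra). rewrite acos_1.
  replace (1 / 2 * (ln p, 0%R)) with (RtoC (/ 2 * ln p)).
  - rewrite Cexp_RtoC. f_equal. rewrite <- Rpower_sqrt by auto. reflexivity.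
  - change (ln p, 0%R) with (RtoC (ln p)). rewrite RtoC_mult, RtoC_inv by lra. field.
Qed.

Lemma Cos_real r : Ccos (RtoC PI * RtoC r) = RtoC (cos (PI * r)).
Proof.
  unfold Ccos.
  replace (Cexp (Ci * (RtoC PI * RtoC r))) with ((cos (PI * r), sin (PI * r)) : C).
  - replace (Cexp (- (Ci * (RtoC PI * RtoC r)))) with ((cos (PI * r), - sin (PI * r))%R : C).
    + apply C_ext; simpl; field.
    + unfold Cexp, Ci. simpl.
      replace (- (0 * (PI * r - 0 * 0) - 1 * (PI * 0 + 0 * r)))%R with 0%R by ring.
      replace (- (0 * (PI * 0 + 0 * r) + 1 * (PI * r - 0 * 0)))%R with (- (PI * r))%R by ring.
      rewrite exp_0, cos_neg, sin_neg, !Rmult_1_l. reflexivity.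
  - unfold Cexp, Ci. simpl.
    replace (0 * (PI * r - 0 * 0) - 1 * (PI * 0 + 0 * r))%R with 0%R by ring.
    replace (0 * (PI * 0 + 0 * r) + 1 * (PI * r - 0 * 0))%R with (PI * r)%R by ring.
    rewrite exp_0, !Rmult_1_l. reflexivity.
Qed.

Lemma Cos_imag t : Ccos (RtoC PI * (0%R, t)) = RtoC ((exp (PI * t) + exp (- (PI * t))) / 2).
Proof.
  unfold Ccos.
  replace (Ci * (RtoC PI * (0%R, t))) with (RtoC (- (PI * t))).
  - rewrite <- RtoC_opp, !Cexp_RtoC, Ropp_involutive, RtoC_div, RtoC_plus by lra.
    rewrite Cplus_comm. reflexivity.
  - apply C_ext; simpl; ring.
Qed.

Definition admissible_nu (nu : C) : Prop :=
  (exists r : R, (0 <= r < 1 / 2)%R /\ nu = RtoC r) \/ Re nu = 0%R.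

(** The two ranges of [nu] enter the rest of the proof only through these consequences. *)
Lemma nu_data (nu : C) : admissible_nu nu ->
  exists mu cv : R, RtoC mu = nu * nu /\ (mu < 1 / 4)%R /\ Ccos (RtoC PI * nu) = RtoC cv /\ (0 < cv)%R /\
   is_lim_seq (fun m => cv * (INR m * INR (fact m) ^ 2 / half_prod mu (S m)))%R PI /\ (- (1 / 2) < Re nu < 1 / 2)%R.
Proof.
  intros [[r [Hr ->]]|Hn].
  - assert (Hmu : (r * r < 1 / 4)%R) by nra.
    assert (D1 : forall t, is_derive (fun t : R => cos (2 * r * t)) t (- (2 * r) * sin (2 * r * t))%R).
    { intros t. auto_derive; auto. ring. }
    assert (D2 : forall t, is_derive (fun t : R => - (2 * r) * sin (2 * r * t))%R t (- (4 * (r * r)) * cos (2 * r * t))%R).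
    { intros t. auto_derive; auto. ring. }
    assert (Z : (- (2 * r) * sin (2 * r * 0) = 0)%R) by (rewrite Rmult_0_r, sin_0; ring).
    assert (O : (cos (2 * r * 0) = 1)%R) by (rewrite Rmult_0_r, cos_0; ring).
    assert (B : forall t, (0 <= t <= PI / 2 -> Rabs (cos (2 * r * t)) <= 1)%R).
    { intros t _. apply Rabs_le, COS_bound. }
    assert (E : (cos (2 * r * (PI / 2)) = cos (PI * r))%R) by (f_equal; field).
    exists (r * r)%R, (cos (PI * r)). repeat split.
    + apply RtoC_mult.
    + exact Hmu.
    + apply Cos_real.
    + rewrite <- E. apply (cosine_end_pos _ _ _ _ D1 D2 Z O B Hmu).
    + rewrite <- E. apply (cosine_product_limit _ _ _ _ D1 D2 Z O B Hmu).
    + simpl. lra.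
    + simpl. lra.
  - destruct nu as [p t]. simpl in Hn. subst p.
    assert (Hmu : (- (t * t) < 1 / 4)%R) by nra.
    set (c := fun u : R => ((exp (2 * t * u) + exp (- (2 * t * u))) / 2)%R).
    set (s := fun u : R => (t * (exp (2 * t * u) - exp (- (2 * t * u))))%R).
    assert (D1 : forall u, is_derive c u (s u)).
    { intros u. unfold c, s. auto_derive; auto. field. }
    assert (D2 : forall u, is_derive s u (- (4 * (- (t * t))) * c u)%R).
    { intros u. unfold c, s. auto_derive; auto. field. }
    assert (Z : s 0%R = 0%R) by (unfold s; rewrite Rmult_0_r, Ropp_0; ring).
    assert (O : c 0%R = 1%R) by (unfold c; rewrite Rmult_0_r, Ropp_0, exp_0; field).
    assert (B : forall u, (0 <= u <= PI / 2 -> Rabs (c u) <= exp (PI * Rabs t))%R).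
    { intros u Hu.
      assert (A : forall v, (v <= PI * Rabs t -> exp v <= exp (PI * Rabs t))%R).
      { intros v [Hv|Hv]; [left; apply exp_increasing; auto|right; f_equal; auto]. }
      assert (P : (Rabs (2 * t * u) <= PI * Rabs t)%R).
      { rewrite !Rabs_mult, (Rabs_pos_eq 2), (Rabs_pos_eq u) by lra. pose proof (Rabs_pos t). nra. }
      unfold c. pose proof (exp_pos (2 * t * u)). pose proof (exp_pos (- (2 * t * u))).
      rewrite Rabs_pos_eq by lra.
      assert (exp (2 * t * u) <= exp (PI * Rabs t))%R.
      { apply A. eapply Rle_trans; [apply Rle_abs|exact P]. }
      assert (exp (- (2 * t * u)) <= exp (PI * Rabs t))%R.
      { apply A. eapply Rle_trans; [apply Rle_abs|]. rewrite Rabs_Ropp. exact P. }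
      lra. }
    assert (E : c (PI / 2)%R = ((exp (PI * t) + exp (- (PI * t))) / 2)%R).
    { unfold c. replace (2 * t * (PI / 2))%R with (PI * t)%R by field. reflexivity. }
    exists (- (t * t))%R, ((exp (PI * t) + exp (- (PI * t))) / 2)%R. repeat split.
    + apply C_ext; simpl; ring.
    + exact Hmu.
    + apply Cos_imag.
    + rewrite <- E. apply (cosine_end_pos _ _ _ _ D1 D2 Z O B Hmu).
    + rewrite <- E. apply (cosine_product_limit _ _ _ _ D1 D2 Z O B Hmu).
    + simpl. lra.
    + simpl. lra.
Qed.

Section Weight.
Variables (nu : C) (mu cv xi : R).
Hypothesis Hmu : RtoC mu = nu * nu.
Hypothesis Hmu4 : (mu < 1 / 4)%R.
Hypothesis Hcos : Ccos (RtoC PI * nu) = RtoC cv.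
Hypothesis Hcv : (0 < cv)%R.
Hypothesis Hlim : is_lim_seq (fun m => cv * (INR m * INR (fact m) ^ 2 / half_prod mu (S m)))%R PI.
Hypothesis Hre : (- (1 / 2) < Re nu < 1 / 2)%R.
Hypothesis Hxi : (0 < xi < 1)%R.

Let a : C := 1 / 2 - nu.
Let b : C := 1 / 2 + nu.

Lemma half_Re : Re (1 / 2) = (1 / 2)%R.
Proof. replace (1 / 2) with (RtoC (1 / 2)); [reflexivity|]. rewrite RtoC_div by lra. reflexivity. Qed.

Lemma a_Re : Re a = (1 / 2 - Re nu)%R.
Proof. unfold a. pose proof half_Re as H. unfold Re in *. simpl fst. simpl in H. lra. Qed.

Lemma b_Re : Re b = (1 / 2 + Re nu)%R.
Proof. unfold b. pose proof half_Re as H. unfold Re in *. simpl fst. simpl in H. lra. Qed.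

Lemma ab_sum : a + b = 1.
Proof. unfold a, b. field. Qed.

Lemma half_prod_rising n : RtoC (half_prod mu n) = rising a n * rising b n.
Proof.
  induction n as [|n IH]; simpl; [ring|].
  replace ((INR n + 1 / 2) * ((INR n + 1 / 2) * 1) - mu)%R with ((INR n + 1 / 2) * (INR n + 1 / 2) - mu)%R by ring.
  rewrite RtoC_mult, IH, RtoC_minus, RtoC_mult, RtoC_plus, RtoC_div, Hmu by lra. unfold a, b. field.
Qed.

Lemma shift_nz (z : C) (n : nat) : (0 < Re z < 1)%R -> forall i, z - INR n + INR i <> 0.
Proof.
  intros H i e. apply (f_equal Re) in e. unfold Re in *. simpl in e.
  rewrite !INR_IZR_INZ in e.
  assert (E : (IZR (Z.of_nat n - Z.of_nat i) = fst z)%R) by (rewrite minus_IZR; lra).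
  rewrite <- E in H. destruct H as [H1 H2]. apply lt_IZR in H1. apply lt_IZR in H2. lia.
Qed.

(** The reflection formula: the product of the two approximants is [n (n!)^2] divided by
    Euler's product for the cosine, since [n^a n^b = n]. *)
Lemma gamma_pair : exists Ga Gb : C, isGamma a Ga /\ isGamma b Gb /\ Ga * Gb = RtoC (PI / cv).
Proof.
  destruct (gamma_approx_converges a) as [Ga HGa]; [rewrite a_Re; lra|].
  destruct (gamma_approx_converges b) as [Gb HGb]; [rewrite b_Re; lra|].
  exists Ga, Gb. split; [exact HGa|]. split; [exact HGb|].
  apply Cconv_Flim in HGa. apply Cconv_Flim in HGb.
  apply (Flim_unique eventually (fun n => gamma_approx a n * gamma_approx b n)).
  - apply eventually_filter.
  - apply Flim_mult; auto. apply eventually_filter.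
  - apply (Flim_ext_loc _ (fun n => RtoC (INR n * INR (fact n) ^ 2 / half_prod mu (S n)))).
    + exists 1%nat. intros n Hn. assert (Hnp : (0 < INR n)%R) by (apply lt_0_INR; lia).
      pose proof (half_prod_pos mu (S n) Hmu4) as HP.
      unfold gamma_approx. rewrite RtoC_div, half_prod_rising by lra. rewrite RtoC_mult, RtoC_pow.
      assert (E : Cexp (a * ln (INR n)) * Cexp (b * ln (INR n)) = INR n).
      { rewrite <- Cexp_add. replace (a * ln (INR n) + b * ln (INR n)) with ((a + b) * ln (INR n)) by ring.
        rewrite ab_sum, Cmult_1_l, Cexp_RtoC, exp_ln; auto. }
      rewrite <- E.
      assert (Ha : rising a (S n) <> 0) by (apply rising_nz; intros; apply Re_pos_nz; rewrite a_Re; lra).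
      assert (Hb : rising b (S n) <> 0) by (apply rising_nz; intros; apply Re_pos_nz; rewrite b_Re; lra).
      set (ra := rising a (S n)) in *. set (rb := rising b (S n)) in *. field. auto.
    + apply Cconv_Flim. apply Cconv_components; cbn [Re Im fst snd RtoC].
      * replace (Finite (PI / cv)) with (Finite (/ cv * PI)) by (f_equal; field; lra).
        apply is_lim_seq_ext with (fun m => / cv * (cv * (INR m * INR (fact m) ^ 2 / half_prod mu (S m))))%R.
        -- intros n. pose proof (half_prod_pos mu (S n) Hmu4) as HP. field. split; lra.
        -- apply (is_lim_seq_scal_l _ (/ cv) PI). exact Hlim.
      * apply is_lim_seq_const.
Qed.

Lemma isGamma_unique (z l m : C) : isGamma z l -> isGamma z m -> l = m.
Proof. intros H1 H2. rewrite <- (isGamma_Gamma z l H1). apply isGamma_Gamma. exact H2. Qed.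

(** The functional equation upwards follows from the downward one and the uniqueness of
    limits, once both limits are known to exist. *)
Lemma isGamma_up (z l : C) n : (0 < Re z)%R -> isGamma z l -> Gamma (z + INR n) = rising z n * l.
Proof.
  intros Hz H. destruct (gamma_approx_converges (z + INR n)) as [m Hm].
  { unfold Re in *. simpl. pose proof (pos_INR n). lra. }
  rewrite (isGamma_Gamma _ _ Hm).
  assert (Hn : forall i, z + INR i <> 0) by (intros; apply Re_pos_nz; auto).
  pose proof (isGamma_down_n z m n Hn Hm) as H2.
  rewrite (isGamma_unique _ _ _ H H2). field. apply rising_nz. auto.
Qed.

Lemma rising_reflect (z : C) n : rising (1 - z - INR n) n = (- (1)) ^ n * rising z n.
Proof.
  induction n as [|n IH]; [simpl; ring|].
  rewrite <- rising_shift. replace (1 - z - INR (S n) + 1) with (1 - z - INR n) by (rewrite INRC_S; ring).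
  rewrite IH, INRC_S. simpl. ring.
Qed.

Lemma psi_eval x : psi nu xi x = RtoC (xi ^ x * half_prod mu x / (2 * INR (fact x) ^ 2)).
Proof.
  destruct gamma_pair as (Ga & Gb & HGa & HGb & HG). unfold psi. fold a. fold b.
  rewrite (isGamma_up a Ga) by (auto; rewrite a_Re; lra).
  rewrite (isGamma_up b Gb) by (auto; rewrite b_Re; lra).
  replace (rising a x * Ga * (rising b x * Gb)) with (rising a x * rising b x * (Ga * Gb)) by ring.
  rewrite HG, <- half_prod_rising. rewrite Hcos.
  pose proof PI_RGT_0. pose proof (lt_0_INR _ (lt_O_fact x)) as Hf.
  rewrite <- RtoC_mult, <- RtoC_div, <- RtoC_mult, <- RtoC_mult, <- RtoC_div.
  - f_equal. field. lra.
  - apply pow_nonzero. lra.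
  - lra.
Qed.

(** The square root [h(x)] of [x psi(x)]. *)
Definition root_weight (x : nat) : R := sqrt (INR x * (xi ^ x * half_prod mu x / (2 * INR (fact x) ^ 2))).

Lemma weight_pos x : (0 < xi ^ x * half_prod mu x / (2 * INR (fact x) ^ 2))%R.
Proof.
  pose proof (lt_0_INR _ (lt_O_fact x)) as Hf. apply Rdiv_lt_0_compat.
  - apply Rmult_lt_0_compat; [apply pow_lt; lra|apply half_prod_pos; auto].
  - assert (0 < INR (fact x) ^ 2)%R by (apply pow_lt; auto). lra.
Qed.

Lemma root_weight_sq x : (root_weight x * root_weight x = INR x * (xi ^ x * half_prod mu x / (2 * INR (fact x) ^ 2)))%R.
Proof.
  unfold root_weight. apply sqrt_sqrt. apply Rmult_le_pos; [apply pos_INR|left; apply weight_pos].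
Qed.

Lemma residue_coef_root_weight x : residue_coef a b x * RtoC (xi ^ x) = RtoC (2 * (root_weight x * root_weight x)).
Proof.
  rewrite root_weight_sq. unfold residue_coef. rewrite <- half_prod_rising.
  pose proof (lt_0_INR _ (lt_O_fact x)) as Hf.
  replace (2 * (INR x * (xi ^ x * half_prod mu x / (2 * INR (fact x) ^ 2))))%R
    with (INR x * half_prod mu x / (INR (fact x) * INR (fact x)) * xi ^ x)%R by (field; lra).
  rewrite RtoC_mult, RtoC_div, !RtoC_mult by nra. reflexivity.
Qed.

Lemma Lmat_eval x y : (0 < x)%nat -> (0 < y)%nat ->
  Lmat nu xi x y = RtoC (2 * root_weight x * root_weight y / (INR x + INR y)).
Proof.
  intros Hx Hy. apply lt_INR in Hx. apply lt_INR in Hy. simpl in Hx, Hy.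
  unfold Lmat. rewrite !psi_eval, <- !RtoC_mult.
  set (p := (xi ^ x * half_prod mu x / (2 * INR (fact x) ^ 2))%R).
  set (q := (xi ^ y * half_prod mu y / (2 * INR (fact y) ^ 2))%R).
  assert (Hp : (0 < p)%R) by apply weight_pos. assert (Hq : (0 < q)%R) by apply weight_pos.
  rewrite Csqrt_RtoC by (apply Rmult_lt_0_compat; [apply Rmult_lt_0_compat; [apply Rmult_lt_0_compat; assumption|assumption]|assumption]).
  replace (INR x * INR y * p * q)%R with ((INR x * p) * (INR y * q))%R by ring.
  rewrite sqrt_mult by (apply Rmult_le_pos; lra).
  change (sqrt (INR x * p)) with (root_weight x). change (sqrt (INR y * q)) with (root_weight y).
  rewrite <- RtoC_mult, <- RtoC_plus, <- RtoC_div by lra. f_equal. field. lra.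
Qed.

(** Lowering the argument by [x] divides Gamma by a rising factorial, and the reflection of
    the latter produces the sign; under the square root only the positive product [half_prod]
    remains. *)
Lemma gfun_eval Ga Gb x : isGamma a Ga -> isGamma b Gb -> Ga * Gb = RtoC (PI / cv) ->
  gfun nu (- Z.of_nat x) = RtoC (sqrt (PI / cv / half_prod mu x)) * ((- (1)) ^ x * rising a x) / Gb.
Proof.
  intros HGa HGb HG. pose proof PI_RGT_0 as Hpi. pose proof (half_prod_pos mu x Hmu4) as HP.
  assert (Hprod : (0 < PI / cv)%R) by (apply Rdiv_lt_0_compat; lra).
  assert (HGb0 : Gb <> 0).
  { intros e. rewrite e, Cmult_0_r in HG. symmetry in HG. apply (INRC_pos_nz _ Hprod). exact HG. }
  assert (Ez : RtoC (IZR (- Z.of_nat x)) = - INR x) by (rewrite opp_IZR, RtoC_opp, <- INR_IZR_INZ; reflexivity).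
  unfold gfun. rewrite Ez. fold a. fold b.
  assert (Hra : rising a x <> 0) by (apply rising_nz; intros; apply Re_pos_nz; rewrite a_Re; lra).
  assert (Hrb : rising b x <> 0) by (apply rising_nz; intros; apply Re_pos_nz; rewrite b_Re; lra).
  assert (Hm1 : (- (1)) ^ x <> 0).
  { apply Cpow_nz. intros e. apply (f_equal Re) in e. simpl in e. lra. }
  assert (Eb : Gamma (b + - INR x) = Gb / ((- (1)) ^ x * rising a x)).
  { rewrite <- rising_reflect. replace (1 - a - INR x) with (b - INR x) by (rewrite <- ab_sum; ring).
    apply isGamma_Gamma. apply isGamma_down_n.
    - intros i. apply shift_nz. rewrite b_Re. lra.
    - replace (b - INR x + INR x) with b by ring. exact HGb. }
  assert (Ea : Gamma (a + - INR x) = Ga / ((- (1)) ^ x * rising b x)).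
  { rewrite <- rising_reflect. replace (1 - b - INR x) with (a - INR x) by (rewrite <- ab_sum; ring).
    apply isGamma_Gamma. apply isGamma_down_n.
    - intros i. apply shift_nz. rewrite a_Re. lra.
    - replace (a - INR x + INR x) with a by ring. exact HGa. }
  rewrite Ea, Eb.
  assert (Hsq : (- (1)) ^ x * (- (1)) ^ x = 1).
  { clear. induction x as [|x IH]; simpl; [ring|]. transitivity ((- (1)) ^ x * (- (1)) ^ x); [ring|exact IH]. }
  replace (Gb / ((- (1)) ^ x * rising a x) * (Ga / ((- (1)) ^ x * rising b x))) with (RtoC (PI / cv / half_prod mu x)).
  - rewrite Csqrt_RtoC by (apply Rdiv_lt_0_compat; auto). field. auto.
  - rewrite RtoC_div, <- HG, half_prod_rising by lra.
    transitivity (Ga * Gb / (((- (1)) ^ x * (- (1)) ^ x) * (rising a x * rising b x))); [rewrite Hsq; field; auto|].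
    field. auto.
Qed.

(** The square roots of Gamma values combine with [h(x) h(y)] into the product of the
    prefactors of the Laurent coefficients of the two factors of the integrand. *)
Lemma gauge_weight x y : (0 < x)%nat -> (0 < y)%nat ->
  gfun nu (- Z.of_nat y) / gfun nu (- Z.of_nat x) * RtoC (root_weight x * root_weight y)
  = RtoC (sqrt (INR x * INR y)) * RtoC (sqrt xi) ^ (x + y) / 2
    * ((- (1)) ^ (x + y) * rising b x * rising a y) / (INR (fact x) * INR (fact y)).
Proof.
  intros Hx Hy. destruct gamma_pair as (Ga & Gb & HGa & HGb & HG).
  rewrite (gfun_eval Ga Gb x), (gfun_eval Ga Gb y) by auto.
  pose proof PI_RGT_0 as Hpi. pose proof (half_prod_pos mu x Hmu4) as HPx. pose proof (half_prod_pos mu y Hmu4) as HPy.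
  assert (Hprod : (0 < PI / cv)%R) by (apply Rdiv_lt_0_compat; lra).
  assert (HGb0 : Gb <> 0).
  { intros e. rewrite e, Cmult_0_r in HG. symmetry in HG. apply (INRC_pos_nz _ Hprod). exact HG. }
  assert (Hra : rising a x <> 0) by (apply rising_nz; intros; apply Re_pos_nz; rewrite a_Re; lra).
  assert (Hm1 : (- (1)) ^ x <> 0).
  { apply Cpow_nz. intros e. apply (f_equal Re) in e. simpl in e. lra. }
  assert (Hsq : (- (1)) ^ x * (- (1)) ^ x = 1).
  { clear. induction x as [|x IH]; simpl; [ring|]. transitivity ((- (1)) ^ x * (- (1)) ^ x); [ring|exact IH]. }
  pose proof (lt_0_INR _ (lt_O_fact x)) as Hfx. pose proof (lt_0_INR _ (lt_O_fact y)) as Hfy.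
  assert (Hxp := lt_0_INR x Hx). assert (Hyp := lt_0_INR y Hy).
  set (s := sqrt xi). assert (Hs : (0 < s)%R) by (apply sqrt_lt_R0; lra).
  assert (Hxis : (xi = s * s)%R) by (symmetry; apply sqrt_sqrt; lra).
  assert (Hw : forall z, (root_weight z = sqrt (INR z) * (s ^ z * sqrt (half_prod mu z) / (sqrt 2 * INR (fact z))))%R).
  { intros z. pose proof (lt_0_INR _ (lt_O_fact z)) as Hfz. pose proof (half_prod_pos mu z Hmu4) as HPz.
    assert (Hsz : (0 < s ^ z)%R) by (apply pow_lt; auto).
    assert (H2 : (0 < sqrt 2)%R) by (apply sqrt_lt_R0; lra).
    unfold root_weight. rewrite sqrt_mult; [|apply pos_INR|left; apply weight_pos]. f_equal.
    apply sqrt_lem_1.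
    - left. apply weight_pos.
    - apply Rdiv_le_0_compat; [|apply Rmult_lt_0_compat; lra]. apply Rmult_le_pos; [lra|apply sqrt_pos].
    - transitivity ((s ^ z * s ^ z) * (sqrt (half_prod mu z) * sqrt (half_prod mu z)) / ((sqrt 2 * sqrt 2) * (INR (fact z) * INR (fact z))))%R.
      + field. split; lra.
      + rewrite !sqrt_sqrt by lra. rewrite <- Rpow_mult_distr, <- Hxis. field. lra. }
  assert (Hratio : (sqrt (PI / cv / half_prod mu y) / sqrt (PI / cv / half_prod mu x) * (root_weight x * root_weight y)
     = sqrt (INR x * INR y) * s ^ (x + y) / 2 * half_prod mu x / (INR (fact x) * INR (fact y)))%R).
  { rewrite !Hw, sqrt_mult by lra. rewrite !(sqrt_div_alt (PI / cv)) by auto.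
    assert (H2 : (sqrt 2 * sqrt 2 = 2)%R) by (apply sqrt_sqrt; lra).
    assert (H2p : (0 < sqrt 2)%R) by (apply sqrt_lt_R0; lra).
    assert (Hpx : (0 < sqrt (half_prod mu x))%R) by (apply sqrt_lt_R0; auto).
    assert (Hpy : (0 < sqrt (half_prod mu y))%R) by (apply sqrt_lt_R0; auto).
    assert (Hpc : (0 < sqrt (PI / cv))%R) by (apply sqrt_lt_R0; auto).
    rewrite pow_add. rewrite <- (sqrt_sqrt (half_prod mu x)) at 3 by lra. rewrite <- H2 at 3. field. repeat split; lra. }
  transitivity (RtoC (sqrt (PI / cv / half_prod mu y) / sqrt (PI / cv / half_prod mu x) * (root_weight x * root_weight y))
    * ((- (1)) ^ y * rising a y / ((- (1)) ^ x * rising a x))).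
  - assert (Hq : (0 < sqrt (PI / cv / half_prod mu x))%R) by (apply sqrt_lt_R0, Rdiv_lt_0_compat; auto).
    rewrite (RtoC_mult (_ / _)), RtoC_div by lra.
    field. repeat split; auto. apply INRC_pos_nz; auto.
  - rewrite Hratio. unfold Rdiv. rewrite !RtoC_mult, RtoC_inv, RtoC_inv, RtoC_mult, RtoC_pow, half_prod_rising by nra.
    assert (Epow : (- (1)) ^ (x + y) = (- (1)) ^ x * (- (1)) ^ y).
    { clear. induction x as [|x IH]; simpl; [ring|]. rewrite IH. ring. }
    rewrite Epow.
    transitivity (RtoC (sqrt (INR x * INR y)) * RtoC s ^ (x + y) / 2 * (rising b x * rising a y
      * ((- (1)) ^ x * (- (1)) ^ x) * / ((- (1)) ^ x) * (- (1)) ^ y) / (INR (fact x) * INR (fact y))).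
    + rewrite Hsq. field. repeat split; auto; apply INRC_fact_nz.
    + field. repeat split; auto; apply INRC_fact_nz.
Qed.

End Weight.

(** * The principal logarithm *)

Lemma Re_over_Cmod_bound (z : C) : z <> 0 -> (-1 <= Re z / Cmod z <= 1)%R.
Proof.
  intros Hz. apply Cmod_gt_0 in Hz. pose proof (re_le_Cmod z) as H. apply Rabs_le_between in H.
  split; apply Rmult_le_reg_r with (Cmod z); auto; unfold Rdiv; rewrite Rmult_assoc, Rinv_l by lra; lra.
Qed.

Lemma Cexp_Clog (z : C) : z <> 0 -> Cexp (Clog z) = z.
Proof.
  intros Hz. pose proof (Re_over_Cmod_bound z Hz) as Hb. pose proof Hz as Hz'. apply Cmod_gt_0 in Hz'.
  assert (Hcos : cos (Carg z) = (Re z / Cmod z)%R).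
  { unfold Carg. destruct (Rle_dec 0 (Im z)); [|rewrite cos_neg]; apply cos_acos; auto. }
  assert (Hsq : sqrt (1 - Rsqr (Re z / Cmod z)) = (Rabs (Im z) / Cmod z)%R).
  { apply sqrt_lem_1.
    - assert (Rsqr (Re z / Cmod z) <= 1)%R; [|lra]. rewrite <- Rsqr_1. apply Rsqr_le_abs_1.
      rewrite Rabs_R1. apply Rabs_le. lra.
    - apply Rdiv_le_0_compat; auto. apply Rabs_pos.
    - pose proof (Cmod2_alt z) as E. assert (E' : (Cmod z ^ 2 = Re z ^ 2 + Im z ^ 2)%R).
      { exact E. }
      transitivity ((Rabs (Im z) * Rabs (Im z)) / (Cmod z ^ 2))%R; [field; lra|].
      rewrite <- Rabs_mult, (Rabs_pos_eq (Im z * Im z)) by nra.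
      unfold Rsqr. transitivity ((Cmod z ^ 2 - Re z ^ 2) / Cmod z ^ 2)%R; [rewrite E'; f_equal; ring|field; lra]. }
  assert (Hsin : sin (Carg z) = (Im z / Cmod z)%R).
  { unfold Carg. destruct (Rle_dec 0 (Im z)) as [h|h].
    - rewrite sin_acos, Hsq, Rabs_pos_eq; auto.
    - rewrite sin_neg, sin_acos, Hsq, Rabs_left by (auto; lra). field. lra. }
  unfold Cexp, Clog. simpl. rewrite exp_ln, Hcos, Hsin by auto.
  apply C_ext; simpl; field; lra.
Qed.

Definition slit (z : C) : Prop := Im z <> 0%R \/ (0 < Re z)%R.

Lemma slit_nz (z : C) : slit z -> z <> 0.
Proof. intros [H|H] e; rewrite e in H; simpl in H; lra. Qed.

Lemma Cmod_rev_triangle (z w : C) : (Rabs (Cmod z - Cmod w) <= Cmod (z - w))%R.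
Proof.
  apply Rabs_le. pose proof (Cmod_triangle (z - w) w) as H1. pose proof (Cmod_triangle (- (z - w)) z) as H2.
  rewrite Cmod_opp in H2. replace (z - w + w) with z in H1 by ring. replace (- (z - w) + z) with w in H2 by ring. lra.
Qed.

Lemma continuous_Cmod (z : C) : continuous (T := C_UniformSpace) Cmod z.
Proof.
  intros P [d HP]. apply locally_C_Cmod. exists d. split; [apply cond_pos|]. intros w Hw. apply HP.
  eapply Rle_lt_trans; [apply Cmod_rev_triangle|exact Hw].
Qed.

Lemma continuous_Re (z : C) : continuous (T := C_UniformSpace) Re z.
Proof.
  intros P [d HP]. apply locally_C_Cmod. exists d. split; [apply cond_pos|]. intros w Hw. apply HP.
  eapply Rle_lt_trans; [|exact Hw]. apply (re_le_Cmod (w - z)).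
Qed.

Lemma continuous_Im (z : C) : continuous (T := C_UniformSpace) Im z.
Proof.
  intros P [d HP]. apply locally_C_Cmod. exists d. split; [apply cond_pos|]. intros w Hw. apply HP.
  eapply Rle_lt_trans; [|exact Hw]. apply (Im_le_Cmod (w - z)).
Qed.

Lemma continuous_cosarg (z : C) : z <> 0 -> continuous (T := C_UniformSpace) (fun w => Re w / Cmod w)%R z.
Proof.
  intros Hz. apply Cmod_gt_0 in Hz.
  apply (continuous_mult (K := R_AbsRing) (fun w : C_UniformSpace => Re w) (fun w : C_UniformSpace => / Cmod w)%R); [apply continuous_Re|].
  apply (continuous_comp (V := R_UniformSpace) (fun w : C_UniformSpace => Cmod w) Rinv); [apply continuous_Cmod|].
  apply continuous_Rinv. lra.
Qed.

(** The angle is controlled by its cosine near 0; this gives continuity on the positive axis. *)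
Lemma acos_small u : (-1 <= u <= 1)%R -> (acos u * acos u <= 8 * (1 - u))%R.
Proof.
  intros Hu. set (th := acos u). pose proof (acos_bound u) as Hb. fold th in Hb.
  assert (E : cos th = u) by (apply cos_acos; auto).
  pose proof (le_2sin (th / 2) ltac:(lra)) as H2.
  assert (E2 : (1 - u = 2 * (sin (th / 2) * sin (th / 2)))%R).
  { rewrite <- E. replace th with (2 * (th / 2))%R at 1 by field. rewrite cos_2a_sin. ring. }
  rewrite E2. nra.
Qed.

(** Off the real axis [Carg] is [acos] of a continuous function up to a locally constant sign;
    on the positive axis both determinations vanish. *)
Lemma continuous_Carg (z : C) : slit z -> continuous (T := C_UniformSpace) Carg z.
Proof.
  intros Hz. pose proof (slit_nz z Hz) as Hz0.
  destruct (Req_dec (Im z) 0) as [Hi|Hi].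
  - destruct Hz as [Hz|Hz]; [contradiction|].
    assert (Ez : (Re z / Cmod z = 1)%R).
    { assert (E : Cmod z = Re z).
      { replace z with (RtoC (Re z)) at 1 by (apply C_ext; simpl; auto). rewrite Cmod_R, Rabs_pos_eq; lra. }
      rewrite E. field. lra. }
    assert (Az : Carg z = 0%R).
    { unfold Carg. rewrite Ez, acos_1. destruct (Rle_dec 0 (Im z)); lra. }
    intros P [d HP]. rewrite Az in HP.
    assert (Hd : (0 < d * d / 8)%R) by (pose proof (cond_pos d); nra).
    pose proof (continuous_cosarg z Hz0 (fun v => Rabs (v - 1) < d * d / 8)%R) as Hc.
    assert (Hl : locally (Re z / Cmod z)%R (fun v => Rabs (v - 1) < d * d / 8)%R).
    { rewrite Ez. exists (mkposreal _ Hd). intros v Hv. exact Hv. }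
    specialize (Hc Hl). unfold filtermap in Hc.
    assert (Hnz : locally (z : C_UniformSpace) (fun w : C => w <> RtoC 0)).
    { apply filter_imp with (2 := Flim_nz _ _ z Hz0 (Flim_id z)). intros w Hw. apply Cmod_gt_0 in Hz0. apply Cmod_gt_0. lra. }
    apply filter_imp with (2 := filter_and _ _ Hnz Hc). intros w [Hw1 Hw2]. apply HP.
    pose proof (acos_small _ (Re_over_Cmod_bound w Hw1)) as Ha.
    assert (Hab : (Rabs (Carg w) * Rabs (Carg w) < d * d)%R).
    { assert (E : (Rabs (Carg w) * Rabs (Carg w) = acos (Re w / Cmod w) * acos (Re w / Cmod w))%R).
      { rewrite <- Rabs_mult. unfold Carg. destruct (Rle_dec 0 (Im w)); rewrite Rabs_pos_eq by nra; ring. }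
      rewrite E. apply Rabs_lt_between in Hw2. lra. }
    change (Rabs (Carg w + - 0) < d)%R. rewrite Ropp_0, Rplus_0_r.
    pose proof (Rabs_pos (Carg w)). pose proof (cond_pos d). nra.
  - assert (Hlt : (-1 < Re z / Cmod z < 1)%R).
    { pose proof (Cmod2_alt z) as E. assert (E' : (Cmod z ^ 2 = Re z ^ 2 + Im z ^ 2)%R) by exact E.
      apply Cmod_gt_0 in Hz0.
      assert (0 < Im z ^ 2)%R by (simpl; rewrite Rmult_1_r; destruct (Rlt_le_dec 0 (Im z)); [nra|assert (Im z < 0)%R by lra; nra]).
      assert (Rabs (Re z) < Cmod z)%R.
      { destruct (Rlt_le_dec (Rabs (Re z)) (Cmod z)) as [h|h]; auto. exfalso.
        assert (Cmod z * Cmod z <= Rabs (Re z) * Rabs (Re z))%R by (apply Rmult_le_compat; lra).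
        rewrite <- Rabs_mult, (Rabs_pos_eq (Re z * Re z)) in H0 by nra. simpl in E'. nra. }
      apply Rabs_lt_between in H0. split; apply Rmult_lt_reg_r with (Cmod z); auto;
        unfold Rdiv; rewrite Rmult_assoc, Rinv_l by lra; lra. }
    assert (Hac : continuous (T := C_UniformSpace) (fun w : C => acos (Re w / Cmod w)) z).
    { apply (continuous_comp (V := R_UniformSpace) (fun w : C_UniformSpace => (Re w / Cmod w)%R) acos);
        [apply continuous_cosarg; auto|].
      apply continuity_pt_filterlim. apply derivable_continuous_pt.
      apply derivable_pt_acos. auto. }
    destruct (Rlt_le_dec 0 (Im z)) as [hp|hn].
    + apply (continuous_ext_loc (T := C_UniformSpace) _ (fun w : C => acos (Re w / Cmod w))); auto.
      assert (L : locally (Im z) (fun v => 0 < v)%R) by (apply open_gt; auto).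
      apply filter_imp with (2 := (continuous_Im z _ L : locally z (fun w : C => 0 < Im w)%R)). intros w Hw. unfold Carg.
      destruct (Rle_dec 0 (Im w)); auto. lra.
    + apply (continuous_ext_loc (T := C_UniformSpace) _ (fun w : C => (- acos (Re w / Cmod w))%R)).
      * assert (L : locally (Im z) (fun v => v < 0)%R) by (apply open_lt; lra).
        apply filter_imp with (2 := (continuous_Im z _ L : locally z (fun w : C => Im w < 0)%R)). intros w Hw. unfold Carg.
        destruct (Rle_dec 0 (Im w)); auto. lra.
      * apply (continuous_opp (V := R_NormedModule)). exact Hac.
Qed.

Lemma Flim_Clog (z : C) : slit z -> Flim (locally z) Clog (Clog z).
Proof.
  intros Hz. pose proof (slit_nz z Hz) as Hz0.
  assert (H1 : continuous (T := C_UniformSpace) (fun w : C => ln (Cmod w)) z).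
  { apply (continuous_comp (V := R_UniformSpace) (fun w : C_UniformSpace => Cmod w) ln); [apply continuous_Cmod|].
    apply Cmod_gt_0 in Hz0. apply continuity_pt_filterlim. apply derivable_continuous_pt.
    exists (/ Cmod z)%R. apply derivable_pt_lim_ln. auto. }
  pose proof (continuous_Carg z Hz) as H2.
  intros eps He. assert (He2 : (0 < eps / 2)%R) by lra.
  assert (L1 : locally (ln (Cmod z)) (fun v => Rabs (v - ln (Cmod z)) < eps / 2)%R) by (exists (mkposreal _ He2); auto).
  assert (L2 : locally (Carg z) (fun v => Rabs (v - Carg z) < eps / 2)%R) by (exists (mkposreal _ He2); auto).
  apply filter_imp with (2 := filter_and (F := locally (z : C_UniformSpace)) (fun w : C => Rabs (ln (Cmod w) - ln (Cmod z)) < eps / 2)%R (fun w : C => Rabs (Carg w - Carg z) < eps / 2)%R (H1 _ L1) (H2 _ L2)). intros w [h1 h2].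
  eapply Rle_lt_trans; [apply Cmod_le_ReIm|]. unfold Re, Im, Clog. simpl. unfold Rminus in *. lra.
Qed.

(** The logarithm is a continuous inverse of a function with nonzero derivative. *)
Lemma Cder_Clog (z : C) : slit z -> Cder Clog z (/ z).
Proof.
  intros Hz eps He. pose proof (slit_nz z Hz) as Hz0. pose proof Hz0 as Hm. apply Cmod_gt_0 in Hm.
  set (e := Rmin (Cmod z / 2) (eps * (Cmod z * Cmod z) / 2)).
  assert (He1 : (0 < e)%R).
  { apply Rmin_glb_lt; [lra|]. assert (0 < Cmod z * Cmod z)%R by nra. nra. }
  pose proof (Flim_locally _ _ _ _ (Flim_Clog z Hz) (Cder_Cexp (Clog z) e He1)) as L.
  assert (Hnz : locally (z : C_UniformSpace) (fun w : C => w <> RtoC 0)).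
  { apply filter_imp with (2 := Flim_nz _ _ z Hz0 (Flim_id z)). intros w Hw. apply Cmod_gt_0. lra. }
  apply filter_imp with (2 := filter_and _ _ Hnz L). intros w [Hw h].
  rewrite !Cexp_Clog in h by auto.
  set (D := Clog w - Clog z) in *.
  pose proof (Rmin_l (Cmod z / 2) (eps * (Cmod z * Cmod z) / 2)) as m1.
  pose proof (Rmin_r (Cmod z / 2) (eps * (Cmod z * Cmod z) / 2)) as m2. fold e in m1, m2.
  pose proof (Cmod_ge_0 D) as HD.
  assert (B : (Cmod z * Cmod D <= 2 * Cmod (w - z))%R).
  { pose proof (Cmod_triangle (- (w - z - z * D)) (w - z)) as T. rewrite Cmod_opp in T.
    replace (- (w - z - z * D) + (w - z)) with (z * D) in T by ring. rewrite Cmod_mult in T.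
    assert (e * Cmod D <= Cmod z / 2 * Cmod D)%R by (apply Rmult_le_compat_r; auto). lra. }
  replace (D - / z * (w - z)) with (- (w - z - z * D) / z) by (field; auto).
  rewrite Cmod_div, Cmod_opp by auto. apply Rmult_le_reg_r with (Cmod z); auto.
  unfold Rdiv. rewrite Rmult_assoc, Rinv_l, Rmult_1_r by lra.
  eapply Rle_trans; [exact h|].
  apply Rle_trans with ((eps * (Cmod z * Cmod z) / 2) * Cmod D)%R; [apply Rmult_le_compat_r; auto|].
  replace (eps * (Cmod z * Cmod z) / 2 * Cmod D)%R with (eps * Cmod z / 2 * (Cmod z * Cmod D))%R by field.
  replace (eps * Cmod (w - z) * Cmod z)%R with (eps * Cmod z / 2 * (2 * Cmod (w - z)))%R by field.
  apply Rmult_le_compat_l; [|exact B]. assert (0 < eps * Cmod z)%R by nra. lra.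
Qed.

Lemma Cpowc_nz (z a : C) : Cpowc z a <> 0.
Proof. apply Cexp_nz. Qed.

Lemma Cpowc_opp (z a : C) : Cpowc z (- a) = / Cpowc z a.
Proof. unfold Cpowc. rewrite <- Cexp_opp. f_equal. ring. Qed.

Lemma Cpowc_1 (a : C) : Cpowc 1 a = 1.
Proof.
  unfold Cpowc, Clog, Carg. rewrite Cmod_1, ln_1. simpl. destruct (Rle_dec 0 0) as [_|h]; [|lra].
  replace (1 / 1)%R with 1%R by field. rewrite acos_1.
  change (0%R, 0%R) with (RtoC 0). rewrite Cmult_0_r. apply Cexp_0.
Qed.

Lemma Cder_Cpowc (z a : C) : slit z -> Cder (fun w => Cpowc w a) z (a / z * Cpowc z a).
Proof.
  intros Hz. unfold Cpowc.
  replace (a / z * Cexp (a * Clog z)) with (Cexp (a * Clog z) * (0 * Clog z + a * / z)) by (unfold Cdiv; ring).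
  apply (Cder_comp (fun w => a * Clog w) Cexp); [|apply Cder_Cexp].
  apply (Gder_mult (fun w => w) z (Flim_id z) (fun _ => a) Clog); [apply Gder_const|apply Cder_Clog; auto].
Qed.

(** * Functions with a continuous complex derivative *)

(** Continuity of the derivative is required because integrals are differentiated under the
    integral sign. *)
Definition holo1 (F : C -> C) (z : C) : Prop :=
  exists dF : C -> C, locally z (fun w => Cder F w (dF w)) /\ Flim (locally z) dF (dF z).

Lemma locally_point (z : C) (P : C -> Prop) : locally z P -> P z.
Proof. apply locally_singleton. Qed.

Lemma holo1_cont F z : holo1 F z -> Flim (locally z) F (F z).
Proof. intros (d & H & _). apply locally_point in H. apply (Cder_cont F z _ H). Qed.

Lemma holo1_const c z : holo1 (fun _ => c) z.
Proof.
  exists (fun _ => 0). split; [apply filter_forall; intros; apply Gder_const|].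
  apply Flim_const. apply locally_filter.
Qed.

Lemma holo1_id z : holo1 (fun w => w) z.
Proof.
  exists (fun _ => 1). split; [apply filter_forall; intros; apply Gder_id|].
  apply Flim_const. apply locally_filter.
Qed.

Lemma holo1_plus F G z : holo1 F z -> holo1 G z -> holo1 (fun w => F w + G w) z.
Proof.
  intros (f & H1 & H2) (g & H3 & H4). exists (fun w => f w + g w). split.
  - apply filter_imp with (2 := filter_and _ _ H1 H3). intros w [h1 h2]. apply Gder_plus; auto.
  - apply Flim_plus; auto. apply locally_filter.
Qed.

Lemma holo1_mult F G z : holo1 F z -> holo1 G z -> holo1 (fun w => F w * G w) z.
Proof.
  intros HF HG. pose proof (holo1_cont F z HF) as CF. pose proof (holo1_cont G z HG) as CG.
  destruct HF as (f & H1 & H2). destruct HG as (g & H3 & H4).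
  exists (fun w => f w * G w + F w * g w). split.
  - apply filter_imp with (2 := filter_and _ _ H1 H3). intros w [h1 h2].
    apply Gder_mult; auto. apply Flim_id.
  - apply Flim_plus; [apply locally_filter| |]; apply Flim_mult; auto; apply locally_filter.
Qed.

Lemma holo1_comp F G z : holo1 F z -> holo1 G (F z) -> holo1 (fun w => G (F w)) z.
Proof.
  intros HF HG. pose proof (holo1_cont F z HF) as CF.
  destruct HF as (f & H1 & H2). destruct HG as (g & H3 & H4).
  exists (fun w => g (F w) * f w). split.
  - pose proof (Flim_locally _ _ _ _ CF H3) as L.
    apply filter_imp with (2 := filter_and _ _ H1 L). intros w [h1 h2]. apply Cder_comp; auto.
  - apply Flim_mult; auto; try apply locally_filter.
    apply (Flim_comp _ F g (F z)); auto.
Qed.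

Lemma locally_nz (z : C) : z <> 0 -> locally z (fun w : C => w <> 0).
Proof.
  intros Hz. apply filter_imp with (2 := Flim_nz _ _ z Hz (Flim_id z)). intros w Hw.
  apply Cmod_gt_0 in Hz. apply Cmod_gt_0. lra.
Qed.

Lemma holo1_Cinv (z : C) : z <> 0 -> holo1 Cinv z.
Proof.
  intros Hz. exists (fun w => - / (w * w)). split.
  - apply filter_imp with (2 := locally_nz z Hz). intros w Hw. apply Cder_inv. exact Hw.
  - apply Flim_opp; [apply locally_filter|]. apply Flim_inv; [apply locally_filter|apply Cmult_neq_0; auto|].
    apply Flim_mult; try apply Flim_id. apply locally_filter.
Qed.

Lemma holo1_inv (F : C -> C) (z : C) : F z <> 0 -> holo1 F z -> holo1 (fun w => / F w) z.
Proof. intros Hz H. apply (holo1_comp F Cinv); auto. apply holo1_Cinv; auto. Qed.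

Lemma holo1_opp F z : holo1 F z -> holo1 (fun w => - F w) z.
Proof.
  intros (f & H1 & H2). exists (fun w => - f w). split.
  - apply filter_imp with (2 := H1). intros w h. apply Gder_opp; auto.
  - apply Flim_opp; auto. apply locally_filter.
Qed.

Lemma holo1_minus F G z : holo1 F z -> holo1 G z -> holo1 (fun w => F w - G w) z.
Proof. intros HF HG. apply holo1_plus; auto. apply holo1_opp; auto. Qed.

Lemma holo1_pow F z n : holo1 F z -> holo1 (fun w => F w ^ n) z.
Proof.
  intros H. induction n as [|n IH]; simpl.
  - apply holo1_const.
  - apply holo1_mult; auto.
Qed.

Lemma holo1_ext_loc (F G : C -> C) z : locally z (fun w => F w = G w) -> holo1 F z -> holo1 G z.
Proof.
  intros E (f & H1 & H2). exists f. split; auto.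
  apply locally_locally in E.
  apply filter_imp with (2 := filter_and _ _ E H1). intros w [h1 h2].
  apply Gder_ext_loc with F; auto. apply (locally_point w). exact h1.
Qed.

Lemma locally_slit (z : C) : slit z -> locally z slit.
Proof.
  intros [H|H].
  - assert (L : locally (Im z) (fun v => v <> 0%R)) by (apply open_neq; auto).
    apply filter_imp with (2 := (continuous_Im z _ L : locally z (fun w : C => Im w <> 0%R))). intros w Hw. left. exact Hw.
  - assert (L : locally (Re z) (fun v => 0 < v)%R) by (apply open_gt; auto).
    apply filter_imp with (2 := (continuous_Re z _ L : locally z (fun w : C => 0 < Re w)%R)). intros w Hw. right. exact Hw.
Qed.

Lemma Flim_Cpowc (z a : C) : slit z -> Flim (locally z) (fun w => Cpowc w a) (Cpowc z a).
Proof. intros Hz. apply (Cder_cont (fun w => Cpowc w a) z _ (Cder_Cpowc z a Hz)). Qed.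

Lemma holo1_Cpowc (z a : C) : slit z -> holo1 (fun w => Cpowc w a) z.
Proof.
  intros Hz. exists (fun w => a / w * Cpowc w a). split.
  - apply filter_imp with (2 := locally_slit z Hz). intros w Hw. apply Cder_Cpowc; auto.
  - apply Flim_mult; [apply locally_filter| |apply Flim_Cpowc; auto].
    apply Flim_mult; [apply locally_filter|apply Flim_const, locally_filter|].
    apply Flim_inv; [apply locally_filter|apply slit_nz; auto|apply Flim_id].
Qed.

Lemma Cder_unique F (z d e : C) : Cder F z d -> Cder F z e -> d = e.
Proof.
  intros H1 H2. destruct (Ceq_dec d e) as [E|E]; auto. exfalso.
  assert (Hd : (0 < Cmod (d - e))%R) by (apply Cmod_gt_0, Cminus_eq_contra; auto).
  assert (He : (0 < Cmod (d - e) / 4)%R) by lra.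
  pose proof (filter_and _ _ (H1 _ He) (H2 _ He)) as L. apply locally_C_Cmod in L. destruct L as [r [Hr L]].
  specialize (L (z + RtoC (r / 2))).
  replace (z + RtoC (r / 2) - z) with (RtoC (r / 2)) in L by ring.
  rewrite Cmod_R, Rabs_pos_eq in L by lra. destruct (L ltac:(lra)) as [h1 h2].
  set (v := F (z + RtoC (r / 2)) - F z) in *.
  pose proof (Cmod_triangle (- (v - d * RtoC (r / 2))) (v - e * RtoC (r / 2))) as T. rewrite Cmod_opp in T.
  replace (- (v - d * RtoC (r / 2)) + (v - e * RtoC (r / 2))) with ((d - e) * RtoC (r / 2)) in T by ring.
  rewrite Cmod_mult, Cmod_R, Rabs_pos_eq in T by lra. nra.
Qed.

Definition Cderiv (F : C -> C) (z : C) : C := epsilon (inhabits (RtoC 0)) (Cder F z).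

Lemma Cderiv_eq F z d : Cder F z d -> Cderiv F z = d.
Proof.
  intros H. apply (Cder_unique F z); auto. unfold Cderiv. apply epsilon_spec. exists d. exact H.
Qed.

Lemma holo1_Cderiv F z : holo1 F z ->
  locally z (fun w => Cder F w (Cderiv F w)) /\ Flim (locally z) (Cderiv F) (Cderiv F z).
Proof.
  intros (f & H1 & H2).
  assert (E : locally z (fun w => Cderiv F w = f w)).
  { apply filter_imp with (2 := H1). intros w h. apply Cderiv_eq; auto. }
  split.
  - apply filter_imp with (2 := H1). intros w h. rewrite (Cderiv_eq F w _ h). exact h.
  - rewrite (locally_point _ _ E). apply (Flim_ext_loc _ f); auto.
    apply filter_imp with (2 := E). auto.
Qed.

(** * Power series and the binomial series *)

Definition pow_series (c : nat -> C) (w : C) : C := Cseries (fun n => c n * w ^ n).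
Definition deriv_coef (c : nat -> C) : nat -> C := fun n => (INR n + 1) * c (S n).

Lemma geo_pow_series M rho c w R : geo M rho c -> (0 < rho)%R -> (Cmod w <= R)%R -> geo M (rho * R) (fun n => c n * w ^ n).
Proof.
  intros Hc Hrho Hw n. rewrite Cmod_mult, Cmod_pow, Rpow_mult_distr, <- Rmult_assoc.
  pose proof (Cmod_ge_0 w). apply Rmult_le_compat; auto using Cmod_ge_0.
  - apply pow_le; auto.
  - apply pow_incr; lra.
Qed.

(** Second-order remainder of [w^n], by the recursion [A_(n+1) = w A_n + n z^(n-1) (w-z)^2]. *)
Lemma pow_remainder (w z : C) (R : R) n : (0 < R)%R -> (Cmod w <= R)%R -> (Cmod z <= R)%R ->
  (Cmod (w ^ n - z ^ n - INR n * z ^ (pred n) * (w - z)) <= INR n * INR n * (R ^ n / (R * R)) * (Cmod (w - z) * Cmod (w - z)))%R.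
Proof.
  intros HR Hw Hz. set (d := Cmod (w - z)). assert (Hd : (0 <= d)%R) by apply Cmod_ge_0.
  induction n as [|n IH].
  - simpl. replace (1 - 1 - 0 * 1 * (w - z)) with (RtoC 0) by ring. rewrite Cmod_0. lra.
  - replace (w ^ S n - z ^ S n - INR (S n) * z ^ Nat.pred (S n) * (w - z))
      with (w * (w ^ n - z ^ n - INR n * z ^ (Nat.pred n) * (w - z)) + INR n * z ^ (Nat.pred n) * ((w - z) * (w - z))).
    2:{ destruct n as [|n]; [simpl; ring|]. rewrite !INRC_S. simpl. ring. }
    eapply Rle_trans; [apply Cmod_triangle|]. rewrite !Cmod_mult. fold d. rewrite Cmod_INR, Cmod_pow.
    pose proof (pos_INR n) as Hn.
    assert (E1 : (Cmod w * Cmod (w ^ n - z ^ n - INR n * z ^ Nat.pred n * (w - z))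
       <= R * (INR n * INR n * (R ^ n / (R * R)) * (d * d)))%R).
    { apply Rmult_le_compat; auto using Cmod_ge_0. }
    assert (E2 : (INR n * Cmod z ^ Nat.pred n * (d * d) <= INR n * (R ^ S n / (R * R)) * (d * d))%R).
    { apply Rmult_le_compat_r; [nra|]. destruct n as [|n]; [simpl; lra|].
      apply Rmult_le_compat_l; auto. simpl Nat.pred.
      replace (R ^ S (S n) / (R * R))%R with (R ^ n)%R by (simpl; field; lra).
      apply pow_incr. pose proof (Cmod_ge_0 z). lra. }
    rewrite S_INR.
    assert (0 <= R ^ S n / (R * R))%R by (apply Rdiv_le_0_compat; [apply pow_le; lra|nra]).
    replace (R * (INR n * INR n * (R ^ n / (R * R)) * (d * d)))%R
      with (INR n * INR n * (R ^ S n / (R * R)) * (d * d))%R in E1 by (simpl; field; lra).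
    assert (0 <= R ^ S n / (R * R) * (d * d))%R by (apply Rmult_le_pos; nra).
    nra.
Qed.

Lemma geo_deriv_coef M rho q c : geo M rho c -> (0 < rho)%R -> (1 < q)%R ->
  exists N, geo N (rho * q) (deriv_coef c).
Proof.
  intros Hc Hrho Hq. destruct (linear_le_geometric q Hq) as [K [HK HL]].
  exists (K * M * rho)%R. intros n. unfold deriv_coef. rewrite Cmod_mult.
  rewrite <- RtoC_plus, Cmod_R, Rabs_pos_eq by (pose proof (pos_INR n); lra).
  apply Rle_trans with ((K * q ^ n) * (M * rho ^ (S n)))%R.
  - apply Rmult_le_compat; auto using Cmod_ge_0. pose proof (pos_INR n); lra.
  - right. rewrite Rpow_mult_distr. simpl. ring.
Qed.

(** Two factors [q] absorb the polynomial growth caused by two derivatives. *)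
Lemma geometric_room (x : R) : (0 <= x < 1)%R -> exists q, (1 < q)%R /\ (x * q < 1)%R /\ (x * (q * q) < 1)%R.
Proof.
  intros Hx. exists (1 + (1 - x) / 4)%R. split; [lra|].
  set (e := ((1 - x) / 4)%R). assert (0 < e <= 1 / 4)%R by (unfold e; lra).
  assert (E : x = (1 - 4 * e)%R) by (unfold e; field). split; rewrite E; nra.
Qed.

(** The second-order remainders of the monomials sum up to a multiple of [Cmod (w - z)^2]. *)
Lemma Cder_pow_series M rho c (z : C) : geo M rho c -> (0 < rho)%R -> (rho * Cmod z < 1)%R ->
  Cder (pow_series c) z (pow_series (deriv_coef c) z).
Proof.
  intros Hc Hrho Hz. pose proof (Cmod_ge_0 z) as Hz0.
  assert (Hinv : (0 < / rho)%R) by (apply Rinv_0_lt_compat; auto).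
  assert (Hzr : (Cmod z < / rho)%R).
  { apply Rmult_lt_reg_l with rho; auto. rewrite Rinv_r by lra. auto. }
  set (R0 := ((Cmod z + / rho) / 2)%R). assert (HR : (Cmod z < R0 < / rho)%R) by (unfold R0; lra).
  assert (HRr : (0 < rho * R0 < 1)%R).
  { split; [apply Rmult_lt_0_compat; lra|]. rewrite <- (Rinv_r rho) by lra. apply Rmult_lt_compat_l; lra. }
  destruct (geometric_room (rho * R0) ltac:(lra)) as [q [Hq [Hq1 Hq2]]].
  destruct (linear_le_geometric q Hq) as [K [HK HL]].
  pose proof (geo_M_nonneg _ _ _ Hc) as HM.
  set (B := (K * K * M / (R0 * R0) / (1 - rho * R0 * (q * q)))%R).
  assert (HR2 : (0 < R0 * R0)%R) by (apply Rmult_lt_0_compat; lra).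
  assert (HB : (0 <= B)%R).
  { unfold B. apply Rdiv_le_0_compat; [|lra]. apply Rdiv_le_0_compat; auto. apply Rmult_le_pos; nra. }
  assert (Hbound : forall w, (Cmod w <= R0)%R ->
    (Cmod (pow_series c w - pow_series c z - pow_series (deriv_coef c) z * (w - z)) <= B * (Cmod (w - z) * Cmod (w - z)))%R).
  { intros w Hw. set (d := Cmod (w - z)).
    assert (Gw : geo M (rho * R0) (fun n => c n * w ^ n)) by (apply geo_pow_series; auto).
    assert (Gz : geo M (rho * R0) (fun n => c n * z ^ n)) by (apply geo_pow_series; auto; lra).
    set (t := fun n => c n * (INR n * z ^ (Nat.pred n))).
    destruct (geo_deriv_coef M rho q c Hc Hrho Hq) as [N HN].
    assert (Gd : geo N (rho * R0 * q) (fun n => deriv_coef c n * z ^ n)).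
    { replace (rho * R0 * q)%R with (rho * q * R0)%R by ring. apply geo_pow_series; auto; [|lra].
      apply Rmult_lt_0_compat; lra. }
    assert (Hrq : (0 < rho * R0 * q < 1)%R) by (split; [apply Rmult_lt_0_compat; lra|auto]).
    assert (gamma_approx : geo (N / (rho * R0 * q)) (rho * R0 * q) t).
    { intros [|n].
      - unfold t. simpl. replace (c 0%nat * (0 * 1)) with (RtoC 0) by ring. rewrite Cmod_0, Rmult_1_r.
        apply Rdiv_le_0_compat; [|lra]. apply (geo_M_nonneg _ _ _ Gd).
      - replace (t (S n)) with (deriv_coef c n * z ^ n).
        + eapply Rle_trans; [apply Gd|]. right. simpl. field. repeat split; lra.
        + unfold t, deriv_coef. rewrite INRC_S. simpl. ring. }
    assert (Et : Cseries t = pow_series (deriv_coef c) z).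
    { rewrite (Cseries_first _ _ Hrq t gamma_approx). unfold t at 1. simpl. unfold pow_series.
      replace (fun n => t (S n)) with (fun n => deriv_coef c n * z ^ n); [ring|].
      extensionality n. unfold t, deriv_coef. rewrite INRC_S. simpl. ring. }
    set (rr := (rho * R0 * (q * q))%R) in *.
    assert (Hrr : (0 < rr < 1)%R) by (split; auto; unfold rr; apply Rmult_lt_0_compat; nra).
    set (u := fun n => c n * (w ^ n - z ^ n - INR n * z ^ (Nat.pred n) * (w - z))).
    assert (Gu : geo (K * K * M / (R0 * R0) * (d * d)) rr u).
    { intros n. unfold u. rewrite Cmod_mult.
      pose proof (pow_remainder w z R0 n ltac:(lra) Hw ltac:(lra)) as P. fold d in P.
      apply Rle_trans with ((M * rho ^ n) * (INR n * INR n * (R0 ^ n / (R0 * R0)) * (d * d)))%R.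
      - apply Rmult_le_compat; auto using Cmod_ge_0.
      - apply Rle_trans with ((M * rho ^ n) * ((K * q ^ n) * (K * q ^ n) * (R0 ^ n / (R0 * R0)) * (d * d)))%R.
        + apply Rmult_le_compat_l; [apply Rmult_le_pos; auto; apply pow_le; lra|].
          apply Rmult_le_compat_r; [apply Rmult_le_pos; apply Cmod_ge_0|].
          apply Rmult_le_compat_r; [apply Rdiv_le_0_compat; auto; apply pow_le; lra|].
          pose proof (pos_INR n). specialize (HL n). apply Rmult_le_compat; lra.
        + right. unfold rr. rewrite !Rpow_mult_distr. field. lra. }
    assert (E : pow_series c w - pow_series c z - pow_series (deriv_coef c) z * (w - z) = Cseries u).
    { symmetry. apply Cseries_eq. apply Cconv_Flim.
      apply (Flim_ext _ (fun n => Csum (fun n => c n * w ^ n) n - Csum (fun n => c n * z ^ n) n - Csum t n * (w - z))).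
      - intros n. rewrite (Cmult_comm (Csum t n)), <- Csum_scal.
        replace (Csum u n) with (Csum (fun i => c i * w ^ i + (- (1) * (c i * z ^ i) + - (1) * ((w - z) * t i))) n).
        + rewrite Csum_plus, Csum_plus, !Csum_scal. ring.
        + apply Csum_ext. intros i _. unfold u, t. ring.
      - rewrite <- Et. apply Flim_minus; [apply eventually_filter| |].
        + apply Flim_minus; [apply eventually_filter| |]; apply Cconv_Flim; [apply (geo_conv _ _ HRr _ Gw)|apply (geo_conv _ _ HRr _ Gz)].
        + apply Flim_mult; [apply eventually_filter| |apply Flim_const, eventually_filter].
          apply Cconv_Flim. apply (geo_conv _ _ Hrq _ gamma_approx). }
    rewrite E. eapply Rle_trans; [apply (geo_Cseries_bound _ _ Hrr _ Gu)|].
    right. unfold B. fold rr. field. split; lra. }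
  intros eps He.
  assert (Hp : (0 < Rmin (R0 - Cmod z) (eps / (B + 1)))%R).
  { apply Rmin_glb_lt; [lra|]. apply Rdiv_lt_0_compat; lra. }
  apply filter_imp with (2 := Flim_id z _ Hp). intros w Hw.
  pose proof (Rmin_l (R0 - Cmod z) (eps / (B + 1))). pose proof (Rmin_r (R0 - Cmod z) (eps / (B + 1))).
  eapply Rle_trans; [apply Hbound|].
  - pose proof (Cmod_rev_triangle w z) as T. apply Rabs_le_between in T. lra.
  - rewrite <- Rmult_assoc. apply Rmult_le_compat_r; [apply Cmod_ge_0|].
    apply Rle_trans with (B * (eps / (B + 1)))%R; [apply Rmult_le_compat_l; lra|].
    apply Rmult_le_reg_r with (B + 1)%R; [lra|]. field_simplify; nra.
Qed.

Lemma holo1_pow_series M rho c (z : C) : geo M rho c -> (0 < rho)%R -> (rho * Cmod z < 1)%R -> holo1 (pow_series c) z.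
Proof.
  intros Hc Hrho Hz. pose proof (Cmod_ge_0 z) as Hz0. exists (pow_series (deriv_coef c)). split.
  - assert (L : locally (Cmod z) (fun v => rho * v < 1)%R).
    { apply (open_comp (fun v => rho * v)%R (fun v => v < 1)%R); [|apply open_lt|exact Hz].
      intros v _. apply (continuous_scal_r (V := R_NormedModule) rho (fun v : R => v)), continuous_id. }
    apply filter_imp with (2 := (continuous_Cmod z _ L : locally z (fun w : C => rho * Cmod w < 1)%R)).
    intros w Hw. apply (Cder_pow_series M rho); auto.
  - destruct (geometric_room (rho * Cmod z)) as [q [Hq [Hq1 Hq2]]].
    { split; auto. apply Rmult_le_pos; lra. }
    destruct (geo_deriv_coef M rho q c Hc Hrho Hq) as [N HN].
    apply (Cder_cont _ z (pow_series (deriv_coef (deriv_coef c)) z)). apply (Cder_pow_series N (rho * q)); auto.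
    + apply Rmult_lt_0_compat; lra.
    + replace (rho * q * Cmod z)%R with (rho * Cmod z * q)%R by ring. auto.
Qed.

(** Coefficients of [(1-u)^al]. *)
Definition binom_coef (al : C) (n : nat) : C := rising (- al) n / INR (fact n).

Lemma binom_coef_geo al q : (1 < q)%R -> exists K, geo K q (binom_coef al).
Proof.
  intros Hq. destruct (grow_le_geometric (Cmod (- al)) q (Cmod_ge_0 _) Hq) as [K [_ HK]].
  exists K. intros n. eapply Rle_trans; [apply rising_div_fact_bound|apply HK].
Qed.

Lemma slit_one_minus (u : C) : (Cmod u < 1)%R -> slit (1 - u).
Proof.
  intros H. right. pose proof (re_le_Cmod u) as Hr. apply Rabs_le_between in Hr.
  unfold Re in *. simpl. lra.
Qed.

(** The binomial series solves [(1-u) S' = -al S], so [S (1-u)^(-al)] is constant. *)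
Theorem binomial_series (al u : C) : (Cmod u < 1)%R -> Cpowc (1 - u) al = pow_series (binom_coef al) u.
Proof.
  intros Hu. pose proof (Cmod_ge_0 u) as Hu0.
  destruct (geometric_room (Cmod u) ltac:(lra)) as [q [Hq [Hq1 Hq2]]].
  destruct (binom_coef_geo al q Hq) as [K HK].
  set (S := pow_series (binom_coef al)). set (S1 := pow_series (deriv_coef (binom_coef al))).
  assert (Hode : forall w, (Cmod w <= Cmod u)%R -> (1 - w) * S1 w = - al * S w).
  { intros w Hw. destruct (geo_deriv_coef K q q _ HK ltac:(lra) Hq) as [N HN].
    set (r := (q * q * Cmod u)%R). assert (Hr : (r < 1)%R) by (unfold r; lra).
    (* a common ratio strictly between 0 and 1, also when u = 0 *)
    set (r1 := ((r + 1) / 2)%R). assert (Hr1 : (0 < r1 < 1 /\ r <= r1)%R).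
    { assert (0 <= r)%R by (unfold r; apply Rmult_le_pos; nra). unfold r1; lra. }
    assert (up : forall B v, geo B r v -> geo B r1 v).
    { intros B v Hv n. eapply Rle_trans; [apply Hv|]. apply Rmult_le_compat_l; [apply (geo_M_nonneg _ _ _ Hv)|].
      apply pow_incr. assert (0 <= r)%R by (unfold r; apply Rmult_le_pos; nra). lra. }
    assert (G1 : geo N r1 (fun n => deriv_coef (binom_coef al) n * w ^ n)).
    { apply up. apply geo_pow_series; auto; nra. }
    assert (G0 : geo K r1 (fun n => binom_coef al n * w ^ n)).
    { intros n. eapply Rle_trans; [apply (geo_pow_series K q _ _ (Cmod u) HK ltac:(lra) Hw)|].
      apply Rmult_le_compat_l; [apply (geo_M_nonneg _ _ _ HK)|]. apply pow_incr.
      assert (q * Cmod u <= r)%R by (unfold r; apply Rmult_le_compat_r; nra). split; [apply Rmult_le_pos; lra|]. lra. }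
    set (t := fun n => INR n * binom_coef al n * w ^ n).
    assert (Et : forall n, t (Datatypes.S n) = w * (deriv_coef (binom_coef al) n * w ^ n)).
    { intros n. unfold t, deriv_coef. rewrite INRC_S. simpl. ring. }
    assert (gamma_approx : geo (N * / r1 * Cmod u + 0) r1 t).
    { rewrite Rplus_0_r. pose proof (geo_M_nonneg _ _ _ G1) as HN0.
      assert (0 < / r1)%R by (apply Rinv_0_lt_compat; lra). intros [|n].
      - unfold t. simpl. replace (0 * binom_coef al 0 * 1) with (RtoC 0) by ring. rewrite Cmod_0, Rmult_1_r.
        apply Rmult_le_pos; auto. apply Rmult_le_pos; lra.
      - rewrite Et, Cmod_mult.
        apply Rle_trans with (Cmod u * (N * r1 ^ n))%R.
        + apply Rmult_le_compat; auto using Cmod_ge_0.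
        + right. simpl. field. lra. }
    assert (Ew : w * S1 w = Cseries t).
    { rewrite (Cseries_first _ _ (proj1 Hr1) t gamma_approx). unfold t at 1. simpl.
      replace (fun n => t (Datatypes.S n)) with (fun n => w * (deriv_coef (binom_coef al) n * w ^ n)) by (extensionality n; symmetry; apply Et).
      rewrite (Cseries_scal _ _ (proj1 Hr1) _ G1). unfold S1, pow_series. ring. }
    transitivity (S1 w + - (1) * (w * S1 w)); [ring|]. rewrite Ew.
    rewrite <- (Cseries_scal _ _ (proj1 Hr1) _ gamma_approx). unfold S1, S, pow_series.
    rewrite <- (Cseries_scal _ _ (proj1 Hr1) _ G0 (- al)).
    set (MM := (N + (Cmod (- (1)) * (N * / r1 * Cmod u + 0)))%R).
    pose proof (geo_M_nonneg _ _ _ G1). pose proof (geo_scal _ _ (- (1)) _ gamma_approx) as Gt'.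
    pose proof (geo_M_nonneg _ _ _ Gt').
    rewrite <- (Cseries_plus MM r1).
    - f_equal. extensionality n. unfold t, deriv_coef, binom_coef. rewrite INRC_fact_S. simpl.
      field. split; [apply INRC_fact_nz|apply INRC_S_nz].
    - apply Hr1.
    - apply geo_weaken with (3 := G1); unfold MM; lra.
    - apply geo_weaken with (3 := Gt'); unfold MM; lra. }
  set (D := fun t : R => S (RtoC t * u) * Cpowc (1 - RtoC t * u) (- al)).
  assert (HD : forall t, (0 <= t <= 1)%R -> Rder D t 0).
  { intros t Ht. set (w := RtoC t * u).
    assert (Hw : (Cmod w <= Cmod u)%R).
    { unfold w. rewrite Cmod_mult, Cmod_R, Rabs_pos_eq by lra. nra. }
    assert (Hsl : slit (1 - w)) by (apply slit_one_minus; lra).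
    assert (Hl : Rder (fun t => RtoC t * u) t (1 * u + RtoC t * 0)).
    { apply (Gder_mult RtoC t (Flim_RtoC t) RtoC (fun _ => u)); [apply Gder_id|apply Gder_const]. }
    replace (RtoC 0) with ((S1 w * (1 * u + RtoC t * 0)) * Cpowc (1 - w) (- al)
       + S w * ((- al / (1 - w) * Cpowc (1 - w) (- al)) * (0 - (1 * u + RtoC t * 0)))).
    - apply (Gder_mult RtoC t (Flim_RtoC t) (fun t => S (RtoC t * u)) (fun t => Cpowc (1 - RtoC t * u) (- al))).
      + apply (Rder_comp (fun t => RtoC t * u) S); auto. apply (Cder_pow_series K q); auto; [lra|].
        apply Rle_lt_trans with (q * Cmod u)%R; [apply Rmult_le_compat_l; [lra|exact Hw]|lra].
      + apply (Rder_comp (fun t => 1 - RtoC t * u) (fun v => Cpowc v (- al))).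
        * apply Gder_minus; [apply Gder_const|exact Hl].
        * apply Cder_Cpowc. exact Hsl.
    - pose proof (slit_nz _ Hsl) as Hnz.
      replace (S1 w) with (- al * S w / (1 - w)) by (rewrite <- Hode by auto; field; auto).
      field. auto. }
  pose proof (Rder_zero_const D 0 1 Rle_0_1 HD) as E. unfold D in E.
  rewrite Cmult_1_l, Cmult_0_l in E. replace (1 - 0) with (RtoC 1) in E by ring. rewrite Cpowc_1 in E.
  assert (E0 : S 0 = 1).
  { unfold S, pow_series. rewrite (Cseries_finite _ 1).
    - simpl. unfold binom_coef. simpl. field.
    - intros [|n] Hn; [lia|]. simpl. ring. }
  rewrite E0, Cpowc_opp in E. pose proof (Cpowc_nz (1 - u) al) as Hnz.
  transitivity (1 * 1 * Cpowc (1 - u) al); [ring|]. rewrite <- E. field. exact Hnz.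
Qed.

(** * Piecewise smooth paths *)

(** Inductive, so that statements about paths are proved piece by piece. The parametrization
    [h] of a piece is smooth beyond its end points, as for closed intervals; [g] itself may
    have corners there. *)
Inductive pw_smooth (g : R -> C) : R -> R -> Prop :=
| pw_smooth_piece (a b : R) (h dh : R -> C) : (a < b)%R ->
    (forall t, (a <= t <= b)%R -> locally t (fun u => Rder h u (dh u)) /\ Flim (locally t) dh (dh t)) ->
    (forall t, (a <= t <= b)%R -> g t = h t) -> pw_smooth g a b
| pw_smooth_cat (a b c : R) : pw_smooth g a b -> pw_smooth g b c -> pw_smooth g a c.

Lemma pw_smooth_lt g a b : pw_smooth g a b -> (a < b)%R.
Proof. induction 1; auto. eapply Rlt_trans; eauto. Qed.

Lemma piecewise_C1_pw_smooth g : piecewise_C1 g -> pw_smooth g 0 1.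
Proof.
  intros (n & s & H0 & H1 & Hp). rewrite <- H0, <- H1.
  assert (piece : forall i, (i < n)%nat -> pw_smooth g (s i) (s (S i))).
  { intros i Hi. destruct (Hp i Hi) as [Hlt (h & dh & D & Cn & E)].
    apply pw_smooth_piece with h dh; auto. intros t Ht. split.
    - apply filter_forall. intros u. apply Rder_is_derive, D.
    - apply (Flim_continuous dh t), Cn. }
  assert (Hn : n <> 0%nat) by (intros e; subst n; lra).
  assert (G : forall m, (S m <= n)%nat -> pw_smooth g (s 0%nat) (s (S m))).
  { induction m as [|m IH]; intros Hm; [apply piece; lia|].
    apply pw_smooth_cat with (s (S m)); [apply IH; lia|apply piece; lia]. }
  destruct n as [|n]; [contradiction|]. apply G. lia.
Qed.

Notation is_CInt := (is_RInt (V := C_R_NormedModule)).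

Definition path_int (g : R -> C) (f : C -> C) (a b : R) : C :=
  RInt (V := C_R_CompleteNormedModule) (fun t => f (g t) * velocity g t) a b.

Definition ex_path_int (g : R -> C) (f : C -> C) (a b : R) : Prop :=
  ex_RInt (V := C_R_NormedModule) (fun t => f (g t) * velocity g t) a b.

Definition cont_on (g : R -> C) (f : C -> C) (a b : R) : Prop :=
  forall t, (a <= t <= b)%R -> Flim (locally (g t)) f (f (g t)).

Lemma cont_on_sub g f a b a' b' : (a <= a')%R -> (b' <= b)%R -> cont_on g f a b -> cont_on g f a' b'.
Proof. intros H1 H2 H t Ht. apply H. lra. Qed.

Lemma is_CInt_components (F : R -> C) a b (l : C) :
  is_RInt (fun t => Re (F t)) a b (Re l) -> is_RInt (fun t => Im (F t)) a b (Im l) -> is_CInt F a b l.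
Proof.
  intros H1 H2. destruct l as [l1 l2].
  apply (is_RInt_fct_extend_pair (U := R_NormedModule) (V := R_NormedModule)); assumption.
Qed.

Lemma is_CInt_Re (F : R -> C) a b (l : C) : is_CInt F a b l -> is_RInt (fun t => Re (F t)) a b (Re l).
Proof. apply (is_RInt_fct_extend_fst (U := R_NormedModule) (V := R_NormedModule)). Qed.

Lemma is_CInt_Im (F : R -> C) a b (l : C) : is_CInt F a b l -> is_RInt (fun t => Im (F t)) a b (Im l).
Proof. apply (is_RInt_fct_extend_snd (U := R_NormedModule) (V := R_NormedModule)). Qed.

Lemma is_CInt_Cscal (c : C) (F : R -> C) a b (l : C) : is_CInt F a b l -> is_CInt (fun t => c * F t) a b (c * l).
Proof.
  intros H. pose proof (is_CInt_Re _ _ _ _ H) as H1. pose proof (is_CInt_Im _ _ _ _ H) as H2.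
  apply is_CInt_components.
  - apply (is_RInt_minus (V := R_NormedModule)); apply (is_RInt_scal (V := R_NormedModule)); assumption.
  - apply (is_RInt_plus (V := R_NormedModule)); apply (is_RInt_scal (V := R_NormedModule)); assumption.
Qed.

Lemma is_CInt_unique (F : R -> C) a b (l : C) : is_CInt F a b l -> RInt (V := C_R_CompleteNormedModule) F a b = l.
Proof. apply (is_RInt_unique (V := C_R_CompleteNormedModule)). Qed.

Lemma ex_path_int_correct g f a b : ex_path_int g f a b -> is_CInt (fun t => f (g t) * velocity g t) a b (path_int g f a b).
Proof. intros H. apply (RInt_correct (V := C_R_CompleteNormedModule)). exact H. Qed.

Lemma piece_velocity g h (dh : R -> C) (a b t : R) : (a < t < b)%R ->
  (forall u, (a <= u <= b)%R -> g u = h u) -> Rder h t (dh t) -> velocity g t = dh t.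
Proof.
  intros Ht E D.
  assert (L : locally t (fun u => g u = h u)).
  { assert (Hd : (0 < Rmin (t - a) (b - t))%R) by (apply Rmin_glb_lt; lra).
    exists (mkposreal _ Hd). intros u Hu. apply E.
    unfold ball in Hu; simpl in Hu; unfold AbsRing_ball, abs, minus, plus, opp in Hu; simpl in Hu.
    pose proof (Rmin_l (t - a) (b - t)). pose proof (Rmin_r (t - a) (b - t)).
    apply Rabs_lt_between in Hu. lra. }
  unfold velocity. apply C_ext; simpl.
  - rewrite (Derive_ext_loc _ (fun s => Re (h s))).
    + apply is_derive_unique. apply Rder_Re. exact D.
    + apply filter_imp with (2 := L). intros u e. rewrite e. reflexivity.
  - rewrite (Derive_ext_loc _ (fun s => Im (h s))).
    + apply is_derive_unique. apply Rder_Im. exact D.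
    + apply filter_imp with (2 := L). intros u e. rewrite e. reflexivity.
Qed.

Section Piece.
Variables (g h dh : R -> C) (a b : R).
Hypothesis Hab : (a < b)%R.
Hypothesis Hh : forall t, (a <= t <= b)%R -> locally t (fun u => Rder h u (dh u)) /\ Flim (locally t) dh (dh t).
Hypothesis Hg : forall t, (a <= t <= b)%R -> g t = h t.

Lemma piece_Rder t : (a <= t <= b)%R -> Rder h t (dh t).
Proof. intros Ht. destruct (Hh t Ht) as [H _]. apply (locally_singleton _ _ H). Qed.

Lemma piece_Flim_h t : (a <= t <= b)%R -> Flim (locally t) h (h t).
Proof. intros Ht. apply (Rder_cont h t _ (piece_Rder t Ht)). Qed.

Lemma piece_transfer (f : C -> C) l : is_CInt (fun t => f (h t) * dh t) a b l ->
  is_CInt (fun t => f (g t) * velocity g t) a b l.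
Proof.
  apply is_RInt_ext. intros t Ht. rewrite Rmin_left, Rmax_right in Ht by lra.
  rewrite Hg by lra. rewrite (piece_velocity g h dh a b t Ht Hg); auto. apply piece_Rder. lra.
Qed.

Lemma piece_cont (f : C -> C) : cont_on g f a b ->
  forall t, (a <= t <= b)%R -> Flim (locally t) (fun t => f (h t) * dh t) (f (h t) * dh t).
Proof.
  intros Hf t Ht. apply Flim_mult; [apply locally_filter| |apply Hh; auto].
  apply (Flim_comp _ h f (h t)); [apply piece_Flim_h; auto|].
  rewrite <- Hg by auto. apply Hf. auto.
Qed.

Lemma piece_ex (f : C -> C) : cont_on g f a b -> ex_RInt (V := C_R_NormedModule) (fun t => f (h t) * dh t) a b.
Proof.
  intros Hf. apply (ex_RInt_continuous (V := C_R_CompleteNormedModule)). intros t Ht.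
  rewrite Rmin_left, Rmax_right in Ht by lra.
  apply (Flim_continuous (fun t => f (h t) * dh t) t). apply piece_cont; auto.
Qed.

End Piece.

Lemma path_ex g a b : pw_smooth g a b -> forall f, cont_on g f a b -> ex_path_int g f a b.
Proof.
  induction 1 as [a b h dh Hab Hh Hg|a b c H1 IH1 H2 IH2]; intros f Hf.
  - destruct (piece_ex g h dh a b Hab Hh Hg f Hf) as [l Hl]. exists l. apply (piece_transfer g h dh); auto.
  - apply pw_smooth_lt in H1. apply pw_smooth_lt in H2. apply (ex_RInt_Chasles (V := C_R_NormedModule) _ a b c).
    + apply IH1. apply (cont_on_sub g f a c); auto; lra.
    + apply IH2. apply (cont_on_sub g f a c); auto; lra.
Qed.

Lemma path_Chasles g f a b c : pw_smooth g a b -> pw_smooth g b c -> cont_on g f a c ->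
  path_int g f a c = path_int g f a b + path_int g f b c.
Proof.
  intros H1 H2 Hf. pose proof (pw_smooth_lt _ _ _ H1). pose proof (pw_smooth_lt _ _ _ H2). unfold path_int.
  rewrite <- (RInt_Chasles (V := C_R_CompleteNormedModule) _ a b c).
  - reflexivity.
  - apply (path_ex g a b H1). apply (cont_on_sub g f a c); auto; lra.
  - apply (path_ex g b c H2). apply (cont_on_sub g f a c); auto; lra.
Qed.

Lemma path_int_plus g f k a b : ex_path_int g f a b -> ex_path_int g k a b ->
  path_int g (fun w => f w + k w) a b = path_int g f a b + path_int g k a b.
Proof.
  intros H1 H2. unfold path_int. rewrite <- (RInt_plus (V := C_R_CompleteNormedModule)) by assumption.
  apply (RInt_ext (V := C_R_CompleteNormedModule)). intros t _.
  assert (E : forall p q v : C, (p + q) * v = p * v + q * v) by (intros; ring). apply E.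
Qed.

Lemma path_int_scal g f c a b : ex_path_int g f a b -> path_int g (fun w => c * f w) a b = c * path_int g f a b.
Proof.
  intros H. apply is_CInt_unique. apply (is_RInt_ext (V := C_R_NormedModule) (fun t => c * (f (g t) * velocity g t))).
  - intros t _. assert (E : forall p q v : C, p * (q * v) = p * q * v) by (intros; ring). apply E.
  - apply is_CInt_Cscal, ex_path_int_correct, H.
Qed.

Lemma path_int_ext g f k a b : (a <= b)%R -> (forall t, (a <= t <= b)%R -> f (g t) = k (g t)) -> path_int g f a b = path_int g k a b.
Proof.
  intros Hab H. apply (RInt_ext (V := C_R_CompleteNormedModule)). intros t Ht.
  rewrite Rmin_left, Rmax_right in Ht by lra. rewrite H by lra. reflexivity.
Qed.

(** The constant depends on the weight [f] alone, so that one estimate serves all tails of a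
    series of functions [phi]. *)
Lemma path_bound g a b : pw_smooth g a b -> forall f, cont_on g f a b ->
  exists K, (0 <= K)%R /\ forall phi B, cont_on g phi a b -> (forall t, a <= t <= b -> Cmod (phi (g t)) <= B)%R ->
    (Cmod (path_int g (fun w => (f w * phi w)%C) a b) <= K * B)%R.
Proof.
  induction 1 as [a b h dh Hab Hh Hg|a b c H1 IH1 H2 IH2]; intros f Hf.
  - assert (Hex : ex_RInt (fun t => Cmod (f (h t) * dh t)) a b).
    { apply (ex_RInt_continuous (V := R_CompleteNormedModule)). intros t Ht.
      rewrite Rmin_left, Rmax_right in Ht by lra.
      apply (continuous_comp (V := C_UniformSpace) (fun t => f (h t) * dh t) Cmod); [|apply continuous_Cmod].
      apply (Flim_continuous (fun t => f (h t) * dh t) t). apply (piece_cont g h dh a b); auto. }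
    exists (RInt (fun t => Cmod (f (h t) * dh t)) a b). split.
    { apply RInt_ge_0; auto; [lra|]. intros; apply Cmod_ge_0. }
    intros phi B Hphi HB.
    assert (Hfp : cont_on g (fun w => f w * phi w) a b).
    { intros t Ht. apply Flim_mult; [apply locally_filter|apply Hf; auto|apply Hphi; auto]. }
    destruct (piece_ex g h dh a b Hab Hh Hg _ Hfp) as [l Hl].
    pose proof (piece_transfer g h dh a b Hab Hh Hg (fun w => f w * phi w) l Hl) as Hl2. apply is_CInt_unique in Hl2.
    unfold path_int. rewrite Hl2.
    assert (E : Cmod l = norm (l : C_R_NormedModule)) by (rewrite Cmod_norm; reflexivity). rewrite E.
    apply (norm_RInt_le (V := C_R_NormedModule) (fun t => f (h t) * phi (h t) * dh t) (fun t => B * Cmod (f (h t) * dh t))%R a b l); [lra| |exact Hl|].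
    + intros t Ht.
      assert (E2 : norm (f (h t) * phi (h t) * dh t : C_R_NormedModule) = Cmod (f (h t) * phi (h t) * dh t)) by (rewrite Cmod_norm; reflexivity).
      rewrite E2, !Cmod_mult. specialize (HB t Ht). rewrite Hg in HB by auto.
      replace (Cmod (f (h t)) * Cmod (phi (h t)) * Cmod (dh t))%R with (Cmod (phi (h t)) * (Cmod (f (h t)) * Cmod (dh t)))%R by ring.
      apply Rmult_le_compat_r; auto. apply Rmult_le_pos; apply Cmod_ge_0.
    + rewrite Rmult_comm. apply (is_RInt_scal (V := R_NormedModule) (fun t => Cmod (f (h t) * dh t)) a b B).
      apply (RInt_correct (V := R_CompleteNormedModule)). exact Hex.
  - pose proof (pw_smooth_lt _ _ _ H1). pose proof (pw_smooth_lt _ _ _ H2).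
    destruct (IH1 f) as [K1 [HK1 B1]]; [apply (cont_on_sub g f a c); auto; lra|].
    destruct (IH2 f) as [K2 [HK2 B2]]; [apply (cont_on_sub g f a c); auto; lra|].
    exists (K1 + K2)%R. split; [lra|]. intros phi B Hphi HB.
    rewrite (path_Chasles g _ a b c); auto.
    + eapply Rle_trans; [apply Cmod_triangle|]. rewrite Rmult_plus_distr_r. apply Rplus_le_compat.
      * apply B1; [apply (cont_on_sub g phi a c); auto; lra|]. intros; apply HB; lra.
      * apply B2; [apply (cont_on_sub g phi a c); auto; lra|]. intros; apply HB; lra.
    + intros t Ht. apply Flim_mult; [apply locally_filter|apply Hf; auto|apply Hphi; auto].
Qed.

Lemma is_CInt_FTC (P dP : R -> C) a b : (a <= b)%R ->
  (forall t, (a <= t <= b)%R -> Rder P t (dP t)) -> (forall t, (a <= t <= b)%R -> Flim (locally t) dP (dP t)) ->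
  is_CInt dP a b (P b - P a).
Proof.
  intros Hab D Cn. apply (is_RInt_derive (V := C_R_CompleteNormedModule) P dP a b).
  - intros t Ht. rewrite Rmin_left, Rmax_right in Ht by lra. apply Rder_is_derive. auto.
  - intros t Ht. rewrite Rmin_left, Rmax_right in Ht by lra. apply (Flim_continuous dP t). auto.
Qed.

Lemma path_FTC g a b : pw_smooth g a b -> forall P f, cont_on g f a b ->
  (forall t, (a <= t <= b)%R -> Cder P (g t) (f (g t))) -> path_int g f a b = P (g b) - P (g a).
Proof.
  induction 1 as [a b h dh Hab Hh Hg|a b c H1 IH1 H2 IH2]; intros P f Hf HP.
  - apply is_CInt_unique. apply (piece_transfer g h dh); auto. rewrite !Hg by lra.
    apply (is_CInt_FTC (fun t => P (h t)) (fun t => f (h t) * dh t)); [lra| |].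
    + intros t Ht. apply Rder_comp; [apply (piece_Rder h dh a b); auto|]. rewrite <- Hg by auto. apply HP. auto.
    + apply (piece_cont g h dh a b); auto.
  - pose proof (pw_smooth_lt _ _ _ H1). pose proof (pw_smooth_lt _ _ _ H2).
    rewrite (path_Chasles g _ a b c); auto.
    rewrite (IH1 P f), (IH2 P f); [ring| | | |].
    + apply (cont_on_sub g f a c); auto; lra.
    + intros; apply HP; lra.
    + apply (cont_on_sub g f a c); auto; lra.
    + intros; apply HP; lra.
Qed.

(** * Radial deformation of a path onto a circle *)

Lemma Flim_Re {T : Type} (F : (T -> Prop) -> Prop) {FF : Filter F} (f : T -> C) (l : C) :
  Flim F f l -> Flim F (fun y => RtoC (Re (f y))) (RtoC (Re l)).
Proof.
  intros H eps He. apply filter_imp with (2 := H eps He). intros y h.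
  rewrite <- RtoC_minus, Cmod_R. eapply Rle_lt_trans; [|exact h]. apply (re_le_Cmod (f y - l)).
Qed.

Lemma locally_fst (x y : R) (P : R -> Prop) : locally x P -> locally ((x, y) : R * R) (fun p => P (fst p)).
Proof. intros [d H]. exists d. intros [u v] [H1 _]. apply H, H1. Qed.

Lemma locally_snd (x y : R) (P : R -> Prop) : locally y P -> locally ((x, y) : R * R) (fun p => P (snd p)).
Proof. intros [d H]. exists d. intros [u v] [_ H2]. apply H, H2. Qed.

Lemma Flim_fst (x y : R) (f : R -> C) l : Flim (locally x) f l -> Flim (locally ((x, y) : R * R)) (fun p => f (fst p)) l.
Proof. intros H eps He. apply (locally_fst x y _ (H eps He)). Qed.

Lemma Flim_snd (x y : R) (f : R -> C) l : Flim (locally y) f l -> Flim (locally ((x, y) : R * R)) (fun p => f (snd p)) l.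
Proof. intros H eps He. apply (locally_snd x y _ (H eps He)). Qed.

Definition log_ratio (r : R) (z : C) : R := (ln (Cmod z) - ln r)%R.

(** The point at parameter [v] on the ray from [r z/|z|] ([v = 0]) to [z] ([v = 1]). *)
Definition ray_point (r : R) (z : C) (v : R) : C := z * Cexp (RtoC ((v - 1) * log_ratio r z)).

Lemma ray_point_1 r z : ray_point r z 1 = z.
Proof. unfold ray_point. rewrite Rminus_diag, Rmult_0_l, Cexp_0. ring. Qed.

Lemma ray_point_0_Cmod (r : R) (z : C) : (0 < r)%R -> z <> 0 -> Cmod (ray_point r z 0) = r.
Proof.
  intros Hr Hz. apply Cmod_gt_0 in Hz. unfold ray_point, log_ratio. rewrite Cmod_mult, Cmod_Cexp. simpl.
  replace ((0 - 1) * (ln (Cmod z) - ln r))%R with (ln (/ Cmod z) + ln r)%R by (rewrite ln_Rinv by auto; ring).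
  rewrite exp_plus, !exp_ln; auto; [field; lra|]. apply Rinv_0_lt_compat; auto.
Qed.

Section Curve.
(* a smooth curve avoiding the origin, near one parameter value *)
Variables (r : R) (h dh : R -> C) (t0 : R).
Hypothesis Hh : locally t0 (fun u => Rder h u (dh u)).
Hypothesis Hdh : Flim (locally t0) dh (dh t0).
Hypothesis Hnz : h t0 <> 0.

Definition dlog_ratio (u : R) : R := Re (dh u * / h u).

Lemma h_Flim : Flim (locally t0) h (h t0).
Proof. apply (Rder_cont h t0 _ (locally_singleton _ _ Hh)). Qed.

Lemma h_loc_nz : locally t0 (fun u => h u <> 0).
Proof.
  apply filter_imp with (2 := Flim_nz _ _ (h t0) Hnz h_Flim). intros u Hu.
  apply Cmod_gt_0. pose proof Hnz as H. apply Cmod_gt_0 in H. lra.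
Qed.

Lemma log_ratio_Rder u : Rder h u (dh u) -> h u <> 0 -> Rder (fun t => RtoC (log_ratio r (h t))) u (RtoC (dlog_ratio u)).
Proof.
  intros D Hu. apply Rder_RtoC.
  pose proof (Rder_Re h u _ D) as D1. pose proof (Rder_Im h u _ D) as D2.
  assert (Hpos : (0 < Re (h u) ^ 2 + Im (h u) ^ 2)%R).
  { pose proof (Cmod2_alt (h u)) as E. assert (E' : (Cmod (h u) ^ 2 = Re (h u) ^ 2 + Im (h u) ^ 2)%R) by exact E.
    rewrite <- E'. apply pow_lt. apply Cmod_gt_0. exact Hu. }
  apply (is_derive_ext (fun t => / 2 * ln (Re (h t) ^ 2 + Im (h t) ^ 2) - ln r)%R).
  - intros t. unfold log_ratio, Cmod. fold (Re (h t)). fold (Im (h t)).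
    destruct (Rlt_le_dec 0 (Re (h t) ^ 2 + Im (h t) ^ 2)) as [hp|hn].
    + rewrite <- (sqrt_sqrt (Re (h t) ^ 2 + Im (h t) ^ 2)) at 1 by lra.
      rewrite ln_mult by (apply sqrt_lt_R0; auto). unfold Re, Im. simpl. match goal with |- ?x = ?y => change (x = y :> R) end. lra.
    + assert (E0 : (Re (h t) ^ 2 + Im (h t) ^ 2 = 0)%R).
      { pose proof (pow2_ge_0 (Re (h t))). pose proof (pow2_ge_0 (Im (h t))). lra. }
      assert (L0 : ln 0 = 0%R).
      { unfold ln. destruct (Rlt_dec 0 0) as [H|H]; [exfalso; apply (Rlt_irrefl 0 H)|reflexivity]. }
      rewrite E0, sqrt_0, L0. change ((/ 2 * 0 - ln r = 0 - ln r)%R). ring.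
  - assert (G : forall (p q : R -> R) (p' q' : R), is_derive p u p' -> is_derive q u q' -> (0 < p u ^ 2 + q u ^ 2)%R ->
      is_derive (fun t => / 2 * ln (p t ^ 2 + q t ^ 2) - ln r)%R u ((p u * p' + q u * q') / (p u ^ 2 + q u ^ 2))%R).
    { intros p q p' q' Dp divdiff Hp. auto_derive.
      - repeat split; [eexists; exact Dp|eexists; exact divdiff|]. simpl in Hp. exact Hp.
      - rewrite (is_derive_unique (fun t : R => p t) u _ Dp), (is_derive_unique (fun t : R => q t) u _ divdiff).
        simpl in *. field. lra. }
    replace (dlog_ratio u) with ((Re (h u) * Re (dh u) + Im (h u) * Im (dh u)) / (Re (h u) ^ 2 + Im (h u) ^ 2))%R.
    + apply (G (fun t => Re (h t)) (fun t => Im (h t))); auto.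
    + unfold dlog_ratio. unfold Re, Im in *. simpl in *. field. lra.
Qed.

Definition ray (u v : R) : C := ray_point r (h u) v.
Definition dray (u v : R) : C := (dh u + h u * RtoC ((v - 1) * dlog_ratio u)) * Cexp (RtoC ((v - 1) * log_ratio r (h u))).

Lemma ray_der_u u v : Rder h u (dh u) -> h u <> 0 -> Rder (fun t => ray t v) u (dray u v).
Proof.
  intros D Hu. unfold ray, ray_point, dray.
  replace ((dh u + h u * RtoC ((v - 1) * dlog_ratio u)) * Cexp (RtoC ((v - 1) * log_ratio r (h u)))) with
    (dh u * Cexp (RtoC ((v - 1) * log_ratio r (h u))) + h u * (Cexp (RtoC ((v - 1) * log_ratio r (h u)))
      * (0 * RtoC (log_ratio r (h u)) + RtoC (v - 1) * RtoC (dlog_ratio u)))) by (rewrite !RtoC_mult; ring).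
  apply (Gder_mult RtoC u (Flim_RtoC u) h (fun t => Cexp (RtoC ((v - 1) * log_ratio r (h t))))); [exact D|].
  apply (Rder_comp (fun t => RtoC ((v - 1) * log_ratio r (h t))) Cexp); [|apply Cder_Cexp].
  apply (Gder_ext RtoC u (fun t => RtoC (v - 1) * RtoC (log_ratio r (h t)))).
  - intros t. rewrite RtoC_mult. reflexivity.
  - apply (Gder_mult RtoC u (Flim_RtoC u) (fun _ => RtoC (v - 1)) (fun t => RtoC (log_ratio r (h t)))); [apply Gder_const|].
    apply log_ratio_Rder; auto.
Qed.

Lemma exp_line_der (s v : R) : Rder (fun v => Cexp (RtoC ((v - 1) * s))) v (Cexp (RtoC ((v - 1) * s)) * RtoC s).
Proof.
  replace (Cexp (RtoC ((v - 1) * s)) * RtoC s) with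
    (Cexp (RtoC ((v - 1) * s)) * ((1 - 0) * RtoC s + (RtoC v - 1) * 0)) by ring.
  apply (Rder_comp (fun v => RtoC ((v - 1) * s)) Cexp); [|apply Cder_Cexp].
  apply (Gder_ext RtoC v (fun v => (RtoC v - 1) * RtoC s)).
  - intros t. rewrite RtoC_mult, RtoC_minus. reflexivity.
  - apply (Gder_mult RtoC v (Flim_RtoC v) (fun v => RtoC v - 1) (fun _ => RtoC s)); [|apply Gder_const].
    apply Gder_minus; [apply Gder_id|apply Gder_const].
Qed.

Lemma ray_der_v u v : Rder (fun v => ray u v) v (ray u v * RtoC (log_ratio r (h u))).
Proof.
  unfold ray, ray_point.
  replace (h u * Cexp (RtoC ((v - 1) * log_ratio r (h u))) * RtoC (log_ratio r (h u))) with
    (0 * Cexp (RtoC ((v - 1) * log_ratio r (h u))) + h u * (Cexp (RtoC ((v - 1) * log_ratio r (h u))) * RtoC (log_ratio r (h u)))) by ring.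
  apply (Gder_mult RtoC v (Flim_RtoC v) (fun _ => h u) (fun v => Cexp (RtoC ((v - 1) * log_ratio r (h u))))); [apply Gder_const|].
  apply exp_line_der.
Qed.

(** Equality of the mixed second derivatives of [ray]. *)
Lemma dray_der_v u v : Rder (fun v => dray u v) v (dray u v * RtoC (log_ratio r (h u)) + ray u v * RtoC (dlog_ratio u)).
Proof.
  unfold dray, ray, ray_point. set (E := fun v => Cexp (RtoC ((v - 1) * log_ratio r (h u)))).
  replace ((dh u + h u * RtoC ((v - 1) * dlog_ratio u)) * Cexp (RtoC ((v - 1) * log_ratio r (h u))) * RtoC (log_ratio r (h u))
     + h u * Cexp (RtoC ((v - 1) * log_ratio r (h u))) * RtoC (dlog_ratio u)) with
    ((0 + (0 * RtoC ((v - 1) * dlog_ratio u) + h u * ((1 - 0) * RtoC (dlog_ratio u) + (RtoC v - 1) * 0))) * E v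
      + (dh u + h u * RtoC ((v - 1) * dlog_ratio u)) * (E v * RtoC (log_ratio r (h u)))) by (unfold E; ring).
  apply (Gder_mult RtoC v (Flim_RtoC v) (fun v => dh u + h u * RtoC ((v - 1) * dlog_ratio u)) E); [|apply exp_line_der].
  apply Gder_plus; [apply Gder_const|].
  apply (Gder_mult RtoC v (Flim_RtoC v) (fun _ => h u) (fun v => RtoC ((v - 1) * dlog_ratio u))); [apply Gder_const|].
  apply (Gder_ext RtoC v (fun v => (RtoC v - 1) * RtoC (dlog_ratio u))).
  - intros t. rewrite RtoC_mult, RtoC_minus. reflexivity.
  - apply (Gder_mult RtoC v (Flim_RtoC v) (fun v => RtoC v - 1) (fun _ => RtoC (dlog_ratio u))); [|apply Gder_const].
    apply Gder_minus; [apply Gder_id|apply Gder_const].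
Qed.

Lemma log_ratio_Flim : Flim (locally t0) (fun u => RtoC (log_ratio r (h u))) (RtoC (log_ratio r (h t0))).
Proof. apply (Rder_cont (fun u => RtoC (log_ratio r (h u))) t0 _ (log_ratio_Rder t0 (locally_singleton _ _ Hh) Hnz)). Qed.

Lemma dlog_ratio_Flim : Flim (locally t0) (fun u => RtoC (dlog_ratio u)) (RtoC (dlog_ratio t0)).
Proof.
  unfold dlog_ratio. apply (Flim_Re _ (fun u => dh u * / h u)). apply Flim_mult; [apply locally_filter|exact Hdh|].
  apply Flim_inv; [apply locally_filter|exact Hnz|apply h_Flim].
Qed.

Let F2 (v0 : R) := locally ((t0, v0) : R * R).

Lemma exp_Flim v0 : Flim (F2 v0) (fun p => Cexp (RtoC ((snd p - 1) * log_ratio r (h (fst p))))) (Cexp (RtoC ((v0 - 1) * log_ratio r (h t0)))).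
Proof.
  apply (Flim_comp _ (fun p : R * R => RtoC ((snd p - 1) * log_ratio r (h (fst p)))) Cexp (RtoC ((v0 - 1) * log_ratio r (h t0)))).
  - rewrite RtoC_mult, RtoC_minus.
    apply (Flim_ext _ (fun p : R * R => (RtoC (snd p) - 1) * RtoC (log_ratio r (h (fst p))))).
    + intros p. rewrite RtoC_mult, RtoC_minus. reflexivity.
    + apply Flim_mult; [apply locally_filter| |apply (Flim_fst t0 v0 (fun u => RtoC (log_ratio r (h u)))), log_ratio_Flim].
      apply Flim_minus; [apply locally_filter| |apply Flim_const, locally_filter].
      apply (Flim_snd t0 v0 RtoC), Flim_RtoC.
  - apply (Cder_cont _ _ _ (Cder_Cexp _)).
Qed.

Lemma ray_Flim v0 : Flim (F2 v0) (fun p => ray (fst p) (snd p)) (ray t0 v0).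
Proof.
  unfold ray, ray_point. apply Flim_mult; [apply locally_filter| |apply exp_Flim].
  apply (Flim_fst t0 v0 h), h_Flim.
Qed.

Lemma dray_Flim v0 : Flim (F2 v0) (fun p => dray (fst p) (snd p)) (dray t0 v0).
Proof.
  unfold dray. apply Flim_mult; [apply locally_filter| |apply exp_Flim].
  apply Flim_plus; [apply locally_filter|apply (Flim_fst t0 v0 dh), Hdh|].
  apply Flim_mult; [apply locally_filter|apply (Flim_fst t0 v0 h), h_Flim|].
  rewrite RtoC_mult, RtoC_minus.
  apply (Flim_ext _ (fun p : R * R => (RtoC (snd p) - 1) * RtoC (dlog_ratio (fst p)))).
  - intros p. rewrite RtoC_mult, RtoC_minus. reflexivity.
  - apply Flim_mult; [apply locally_filter| |apply (Flim_fst t0 v0 (fun u => RtoC (dlog_ratio u))), dlog_ratio_Flim].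
    apply Flim_minus; [apply locally_filter| |apply Flim_const, locally_filter].
    apply (Flim_snd t0 v0 RtoC), Flim_RtoC.
Qed.

(* a function with continuous complex derivative on the rays over a neighbourhood *)
Variable F : C -> C.
Hypothesis HF : locally t0 (fun u => forall v, (0 <= v <= 1)%R -> holo1 F (ray u v)).

Definition phi (u v : R) : C := F (ray u v) * (ray u v * RtoC (log_ratio r (h u))).
Definition Dphi (u v : R) : C :=
  (Cderiv F (ray u v) * dray u v) * (ray u v * RtoC (log_ratio r (h u)))
  + F (ray u v) * (dray u v * RtoC (log_ratio r (h u)) + ray u v * RtoC (dlog_ratio u)).

Lemma phi_der u v : Rder h u (dh u) -> h u <> 0 -> Cder F (ray u v) (Cderiv F (ray u v)) ->
  Rder (fun t => phi t v) u (Dphi u v).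
Proof.
  intros D Hu HFv. unfold phi, Dphi.
  apply (Gder_mult RtoC u (Flim_RtoC u) (fun t => F (ray t v)) (fun t => ray t v * RtoC (log_ratio r (h t)))).
  - apply (Rder_comp (fun t => ray t v) F); auto. apply ray_der_u; auto.
  - apply (Gder_mult RtoC u (Flim_RtoC u) (fun t => ray t v) (fun t => RtoC (log_ratio r (h t)))); [apply ray_der_u; auto|apply log_ratio_Rder; auto].
Qed.

(** [d/du (F(K) K_v) = d/dv (F(K) K_u)], so the [u]-derivative integrates exactly over [v]. *)
Lemma phi_exact v : holo1 F (ray t0 v) -> Rder (fun v => F (ray t0 v) * dray t0 v) v (Dphi t0 v).
Proof.
  intros HFv. apply holo1_Cderiv in HFv. destruct HFv as [HFv _]. apply locally_singleton in HFv.
  unfold Dphi.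
  replace (Cderiv F (ray t0 v) * dray t0 v * (ray t0 v * RtoC (log_ratio r (h t0))) +
     F (ray t0 v) * (dray t0 v * RtoC (log_ratio r (h t0)) + ray t0 v * RtoC (dlog_ratio t0)))
   with ((Cderiv F (ray t0 v) * (ray t0 v * RtoC (log_ratio r (h t0)))) * dray t0 v +
     F (ray t0 v) * (dray t0 v * RtoC (log_ratio r (h t0)) + ray t0 v * RtoC (dlog_ratio t0))) by ring.
  apply (Gder_mult RtoC v (Flim_RtoC v) (fun v => F (ray t0 v)) (fun v => dray t0 v)).
  - apply (Rder_comp (fun v => ray t0 v) F); auto. apply ray_der_v.
  - apply dray_der_v.
Qed.

Lemma Dphi_Flim v0 : (0 <= v0 <= 1)%R -> Flim (F2 v0) (fun p => Dphi (fst p) (snd p)) (Dphi t0 v0).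
Proof.
  intros Hv. assert (HFv : holo1 F (ray t0 v0)) by (apply (locally_singleton _ _ HF); auto).
  pose proof (holo1_cont _ _ HFv) as C0. apply holo1_Cderiv in HFv. destruct HFv as [_ C1].
  assert (L : Flim (F2 v0) (fun p => RtoC (log_ratio r (h (fst p)))) (RtoC (log_ratio r (h t0))))
    by (apply (Flim_fst t0 v0 (fun u => RtoC (log_ratio r (h u)))), log_ratio_Flim).
  assert (CF : Flim (F2 v0) (fun p => F (ray (fst p) (snd p))) (F (ray t0 v0))).
  { apply (Flim_comp _ (fun p : R * R => ray (fst p) (snd p)) F (ray t0 v0)); auto. apply ray_Flim. }
  assert (CD : Flim (F2 v0) (fun p => Cderiv F (ray (fst p) (snd p))) (Cderiv F (ray t0 v0))).
  { apply (Flim_comp _ (fun p : R * R => ray (fst p) (snd p)) (Cderiv F) (ray t0 v0)); auto. apply ray_Flim. }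
  pose proof (ray_Flim v0) as CK. pose proof (dray_Flim v0) as CdK.
  assert (FF : Filter (F2 v0)) by apply locally_filter.
  unfold Dphi. apply Flim_plus; auto; apply Flim_mult; auto.
  - apply Flim_mult; auto.
  - apply Flim_mult; auto.
  - apply Flim_plus; auto; apply Flim_mult; auto.
    apply (Flim_fst t0 v0 (fun u => RtoC (dlog_ratio u))), dlog_ratio_Flim.
Qed.

(** Differentiation under the integral sign, followed by [phi_exact]. The functional [p]
    stands for the real or the imaginary part. *)
Lemma component_derivative (p : C -> R) :
  (forall z : C, Rabs (p z) <= Cmod z)%R -> (forall z w : C, p (z - w)%C = p z - p w)%R ->
  (forall f t d, Rder f t d -> is_derive (fun u => p (f u)) t (p d)) ->
  is_derive (fun u => RInt (fun v => p (phi u v)) 0 1) t0 (p (F (h t0) * dh t0 - F (ray t0 0) * dray t0 0)).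
Proof.
  intros Hp Hm Hder.
  assert (Hcont : forall (T : UniformSpace) (f : T -> C) (x : T), Flim (locally x) f (f x) -> continuous (fun y => p (f y)) x).
  { intros T f x H P [d HP]. apply filter_imp with (2 := H d (cond_pos d)). intros y hy. apply HP.
    change (Rabs (p (f y) - p (f x)) < d)%R. rewrite <- Hm. eapply Rle_lt_trans; [apply Hp|exact hy]. }
  assert (Hloc : locally t0 (fun u => forall v, (0 <= v <= 1)%R -> Rder (fun t => phi t v) u (Dphi u v))).
  { apply filter_imp with (2 := filter_and _ _ (filter_and _ _ Hh h_loc_nz) HF). intros u [[h1 h2] h3] v Hv.
    apply phi_der; auto. specialize (h3 v Hv). apply holo1_Cderiv in h3. destruct h3 as [h3 _].
    apply (locally_singleton _ _ h3). }
  assert (E : p (F (h t0) * dh t0 - F (ray t0 0) * dray t0 0) = RInt (fun v => Derive (fun u => p (phi u v)) t0) 0 1).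
  { symmetry. apply is_RInt_unique.
    apply (is_RInt_ext (fun v => p (Dphi t0 v))).
    - intros v Hv. rewrite Rmin_left, Rmax_right in Hv by lra. symmetry. apply is_derive_unique.
      apply (Hder (fun t => phi t v)). apply (locally_singleton _ _ Hloc). lra.
    - rewrite Hm.
      assert (E1 : F (h t0) * dh t0 = F (ray t0 1) * dray t0 1).
      { unfold dray, ray. rewrite ray_point_1, Rminus_diag, !Rmult_0_l, Cexp_0. ring. }
      rewrite E1. apply (is_RInt_derive (fun v => p (F (ray t0 v) * dray t0 v)) (fun v => p (Dphi t0 v))).
      + intros v Hv. rewrite Rmin_left, Rmax_right in Hv by lra.
        apply (Hder (fun v => F (ray t0 v) * dray t0 v)). apply phi_exact. apply (locally_singleton _ _ HF). lra.
      + intros v Hv. rewrite Rmin_left, Rmax_right in Hv by lra. apply Hcont.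
        intros eps He. pose proof (Dphi_Flim v Hv eps He) as [d HL]. exists d. intros w Hw.
        apply (HL (t0, w)). split; [apply ball_center|exact Hw]. }
  rewrite E.
  apply (is_derive_RInt_param (fun u v => p (phi u v)) 0 1 t0).
  - apply filter_imp with (2 := Hloc). intros u H v Hv. rewrite Rmin_left, Rmax_right in Hv by lra.
    eexists. apply (Hder (fun t => phi t v)). apply H. exact Hv.
  - intros v Hv. rewrite Rmin_left, Rmax_right in Hv by lra.
    apply (continuity_2d_pt_ext_loc (fun u v => p (Dphi u v))).
    + apply locally_2d_locally.
      assert (HFv : holo1 F (ray t0 v)) by (apply (locally_singleton _ _ HF); auto).
      apply holo1_Cderiv in HFv. destruct HFv as [HFv _].
      pose proof (Flim_locally _ _ _ _ (ray_Flim v) HFv) as L.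
      apply filter_imp with (2 := filter_and _ _ (filter_and _ _ (locally_fst t0 v _ Hh) (locally_fst t0 v _ h_loc_nz)) L).
      intros [u w] [[h1 h2] h3]. simpl in *. symmetry. apply is_derive_unique.
      apply (Hder (fun t => phi t w)). apply phi_der; auto.
    + apply continuity_2d_pt_filterlim. apply (Hcont _ (fun q : R * R => Dphi (fst q) (snd q)) (t0, v)).
      apply (Dphi_Flim v Hv).
  - apply filter_imp with (2 := HF). intros u H. apply (ex_RInt_continuous (V := R_CompleteNormedModule)).
    intros v Hv. rewrite Rmin_left, Rmax_right in Hv by lra. apply Hcont. unfold phi.
    pose proof (Rder_cont (fun v => ray u v) v _ (ray_der_v u v)) as CK.
    apply Flim_mult; [apply locally_filter| |].
    + apply (Flim_comp _ (fun v => ray u v) F (ray u v)); auto. apply holo1_cont. apply H. exact Hv.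
    + apply Flim_mult; [apply locally_filter|exact CK|apply Flim_const, locally_filter].
Qed.

End Curve.

(** The primitive of the difference of the two integrands, as a function of the end point. *)
Definition ray_potential (r : R) (F : C -> C) (z : C) : C :=
  (RInt (fun v => Re (F (ray_point r z v) * (ray_point r z v * RtoC (log_ratio r z)))) 0 1,
   RInt (fun v => Im (F (ray_point r z v) * (ray_point r z v * RtoC (log_ratio r z)))) 0 1).

Section Homotopy.
Variables (r : R) (Om : C -> Prop) (F : C -> C).
Hypothesis Om_open : forall z : C, Om z -> locally z Om.
Hypothesis Om_nz : forall z : C, Om z -> z <> 0.
Hypothesis Om_ray_point : forall z v, Om z -> (0 <= v <= 1)%R -> Om (ray_point r z v).
Hypothesis HF : forall z, Om z -> holo1 F z.

Definition on_circle (g : R -> C) (t : R) : C := ray_point r (g t) 0.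

Lemma circle_pw_smooth g a b : pw_smooth g a b -> (forall t, (a <= t <= b)%R -> Om (g t)) -> pw_smooth (on_circle g) a b.
Proof.
  induction 1 as [a b h dh Hab Hh Hg|a b c H1 IH1 H2 IH2]; intros HOm.
  - apply pw_smooth_piece with (fun t => ray r h t 0) (fun t => dray r h dh t 0); auto.
    + intros t Ht. destruct (Hh t Ht) as [D Cn].
      assert (Hn : h t <> 0) by (rewrite <- Hg by auto; apply Om_nz; auto).
      split.
      * apply filter_imp with (2 := filter_and _ _ D (h_loc_nz h dh t D Hn)). intros u [h1 h2]. apply ray_der_u; auto.
      * intros eps He. destruct (dray_Flim r h dh t D Cn Hn 0 eps He) as [d Hd]. exists d. intros u Hu.
        apply (Hd (u, 0%R)). split; [exact Hu|apply ball_center].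
    + intros t Ht. unfold on_circle, ray. rewrite Hg by auto. reflexivity.
  - pose proof (pw_smooth_lt _ _ _ H1). pose proof (pw_smooth_lt _ _ _ H2). apply pw_smooth_cat with b.
    + apply IH1. intros; apply HOm; lra.
    + apply IH2. intros; apply HOm; lra.
Qed.

(** Along a path the difference of the two integrands is the derivative of [ray_potential];
    for a closed path the right-hand side vanishes. *)
Theorem homotopy_to_circle g a b : pw_smooth g a b -> (forall t, (a <= t <= b)%R -> Om (g t)) ->
  path_int g F a b - path_int (on_circle g) F a b = ray_potential r F (g b) - ray_potential r F (g a).
Proof.
  intros Hpw. assert (Hlt := pw_smooth_lt _ _ _ Hpw). revert Hlt.
  induction Hpw as [a b h dh Hab Hh Hg|a b c H1 IH1 H2 IH2]; intros Hlt HOm.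
  - assert (HOmh : forall t, (a <= t <= b)%R -> Om (h t)) by (intros; rewrite <- Hg by auto; auto).
    assert (Hder : forall t, (a <= t <= b)%R ->
      Rder (fun u => ray_potential r F (h u)) t (F (h t) * dh t - F (ray r h t 0) * dray r h dh t 0)).
    { intros t Ht. destruct (Hh t Ht) as [D Cn]. pose proof (HOmh t Ht) as Ho. pose proof (Om_nz _ Ho) as Hn.
      assert (HFl : locally t (fun u => forall v, (0 <= v <= 1)%R -> holo1 F (ray r h u v))).
      { pose proof (Flim_locally _ _ _ _ (h_Flim h dh t D) (Om_open _ Ho)) as L.
        apply filter_imp with (2 := L). intros u Hu v Hv. apply HF. apply Om_ray_point; auto. }
      replace (F (h t) * dh t - F (ray r h t 0) * dray r h dh t 0) with
        ((Re (F (h t) * dh t - F (ray r h t 0) * dray r h dh t 0), Im (F (h t) * dh t - F (ray r h t 0) * dray r h dh t 0)) : C)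
        by (apply C_ext; reflexivity).
      apply (Rder_pair (fun u => RInt (fun v => Re (phi r h F u v)) 0 1) (fun u => RInt (fun v => Im (phi r h F u v)) 0 1)).
      - apply component_derivative; auto; [apply re_le_Cmod|apply Rder_Re].
      - apply component_derivative; auto; [apply Im_le_Cmod|apply Rder_Im]. }
    assert (Hc1 : cont_on g F a b) by (intros t Ht; apply holo1_cont, HF; auto).
    pose proof (fun t Ht => piece_cont g h dh a b Hh Hg F Hc1 t Ht) as C1.
    assert (Hpwe : pw_smooth (on_circle g) a b) by (apply circle_pw_smooth; auto; apply pw_smooth_piece with h dh; auto).
    assert (Hh2 : forall t, (a <= t <= b)%R -> locally t (fun u => Rder (fun t => ray r h t 0) u (dray r h dh u 0))
       /\ Flim (locally t) (fun t => dray r h dh t 0) (dray r h dh t 0)).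
    { intros t Ht. destruct (Hh t Ht) as [D Cn]. pose proof (Om_nz _ (HOmh t Ht)) as Hn. split.
      - apply filter_imp with (2 := filter_and _ _ D (h_loc_nz h dh t D Hn)). intros u [h1 h2]. apply ray_der_u; auto.
      - intros eps He. destruct (dray_Flim r h dh t D Cn Hn 0 eps He) as [d Hd]. exists d. intros u Hu.
        apply (Hd (u, 0%R)). split; [exact Hu|apply ball_center]. }
    assert (Hg2 : forall t, (a <= t <= b)%R -> on_circle g t = ray r h t 0)
      by (intros t Ht; unfold on_circle, ray; rewrite Hg by auto; reflexivity).
    assert (Hc2 : cont_on (on_circle g) F a b).
    { intros t Ht. apply holo1_cont, HF. unfold on_circle. apply Om_ray_point; auto. lra. }
    pose proof (fun t Ht => piece_cont (on_circle g) (fun t => ray r h t 0) (fun t => dray r h dh t 0) a b Hh2 Hg2 F Hc2 t Ht) as C2.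
    assert (I : is_CInt (fun t => F (h t) * dh t - F (ray r h t 0) * dray r h dh t 0) a b (ray_potential r F (g b) - ray_potential r F (g a))).
    { rewrite !Hg by lra. apply (is_CInt_FTC (fun u => ray_potential r F (h u))); [lra|exact Hder|].
      intros t Ht. apply Flim_minus; [apply locally_filter|apply C1; auto|apply C2; auto]. }
    destruct (piece_ex g h dh a b Hab Hh Hg F Hc1) as [l1 I1].
    destruct (piece_ex (on_circle g) _ _ a b Hab Hh2 Hg2 F Hc2) as [l2 I2].
    pose proof (is_RInt_minus (V := C_R_NormedModule) _ _ _ _ _ _ I1 I2) as I3.
    apply is_CInt_unique in I.
    pose proof (is_RInt_unique (V := C_R_CompleteNormedModule) _ _ _ _ I3) as I4.
    assert (E : ray_potential r F (g b) - ray_potential r F (g a) = l1 - l2) by (rewrite <- I; exact I4).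
    rewrite E. unfold path_int.
    rewrite (is_CInt_unique _ _ _ _ (piece_transfer g h dh a b Hab Hh Hg F l1 I1)).
    rewrite (is_CInt_unique _ _ _ _ (piece_transfer (on_circle g) _ _ a b Hab Hh2 Hg2 F l2 I2)).
    reflexivity.
  - pose proof (pw_smooth_lt _ _ _ H1). pose proof (pw_smooth_lt _ _ _ H2).
    assert (O1 : forall t, (a <= t <= b)%R -> Om (g t)) by (intros; apply HOm; lra).
    assert (O2 : forall t, (b <= t <= c)%R -> Om (g t)) by (intros; apply HOm; lra).
    rewrite (path_Chasles g F a b c), (path_Chasles (on_circle g) F a b c).
    + transitivity ((path_int g F a b - path_int (on_circle g) F a b) + (path_int g F b c - path_int (on_circle g) F b c)); [ring|].
      rewrite IH1, IH2 by auto. ring.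
    + apply circle_pw_smooth; auto.
    + apply circle_pw_smooth; auto.
    + intros t Ht. apply holo1_cont, HF. unfold on_circle. apply Om_ray_point; auto. lra.
    + auto.
    + auto.
    + intros t Ht. apply holo1_cont, HF. auto.
Qed.

End Homotopy.

(** * The plane without the two cuts *)

(** The complement of the cuts [[0, s]] and [[1/s, +oo)]. *)
Definition cut_plane (s : R) (z : C) : Prop := Im z <> 0%R \/ (Re z < 0)%R \/ (s < Re z < / s)%R.

Lemma Cpow_one (w : C) : w = w ^ 1.
Proof. simpl. ring. Qed.

Section Domain.
Variable s : R.
Hypothesis Hs : (0 < s < 1)%R.

Lemma inv_s : (1 < / s)%R.
Proof. rewrite <- Rinv_1 at 1. apply Rinv_lt_contravar; lra. Qed.

Lemma cut_plane_nz (z : C) : cut_plane s z -> z <> 0.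
Proof. intros [H|[H|H]] e; rewrite e in H; simpl in H; lra. Qed.

Lemma cut_plane_open (z : C) : cut_plane s z -> locally z (cut_plane s).
Proof.
  intros [H|[H|H]].
  - assert (L : locally (Im z) (fun v => v <> 0%R)) by (apply open_neq; auto).
    apply filter_imp with (2 := (continuous_Im z _ L : locally z (fun w : C => Im w <> 0%R))). intros w Hw. left. exact Hw.
  - assert (L : locally (Re z) (fun v => v < 0)%R) by (apply open_lt; auto).
    apply filter_imp with (2 := (continuous_Re z _ L : locally z (fun w : C => Re w < 0)%R)). intros w Hw. right; left. exact Hw.
  - assert (L : locally (Re z) (fun v => s < v < / s)%R).
    { apply (open_and (fun v => s < v)%R (fun v => v < / s)%R); [apply open_gt|apply open_lt|auto]. }
    apply filter_imp with (2 := (continuous_Re z _ L : locally z (fun w : C => s < Re w < / s)%R)). intros w Hw. right; right. exact Hw.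
Qed.

Lemma cut_plane_inv (z : C) : cut_plane s z -> cut_plane s (/ z).
Proof.
  intros H. pose proof (cut_plane_nz z H) as Hn. pose proof inv_s.
  assert (Hp : (0 < Re z ^ 2 + Im z ^ 2)%R).
  { pose proof (Cmod2_alt z) as E. assert (E' : (Cmod z ^ 2 = Re z ^ 2 + Im z ^ 2)%R) by exact E.
    rewrite <- E'. apply pow_lt. apply Cmod_gt_0. exact Hn. }
  assert (ER : Re (/ z) = (Re z / (Re z ^ 2 + Im z ^ 2))%R) by reflexivity.
  assert (EI : Im (/ z) = (- Im z / (Re z ^ 2 + Im z ^ 2))%R) by reflexivity.
  assert (Hq : (0 < / (Re z ^ 2 + Im z ^ 2))%R) by (apply Rinv_0_lt_compat; auto).
  destruct (Req_dec (Im z) 0) as [Hi|Hi].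
  - right. destruct H as [H|[H|H]]; [contradiction| |].
    + left. rewrite ER. unfold Rdiv. nra.
    + right. rewrite ER, Hi. replace (Re z / (Re z ^ 2 + 0 ^ 2))%R with (/ Re z)%R by (field; lra).
      split.
      * rewrite <- (Rinv_inv s). apply Rinv_lt_contravar; [apply Rmult_lt_0_compat; lra|lra].
      * apply Rinv_lt_contravar; [apply Rmult_lt_0_compat; lra|lra].
  - left. rewrite EI. unfold Rdiv. apply Rmult_integral_contrapositive_currified; lra.
Qed.

Lemma cut_plane_ray_point r (z : C) v : (s < r < / s)%R -> cut_plane s z -> (0 <= v <= 1)%R -> cut_plane s (ray_point r z v).
Proof.
  intros Hr H Hv. pose proof (cut_plane_nz z H) as Hn. pose proof inv_s.
  unfold ray_point. rewrite Cexp_RtoC. set (k := exp ((v - 1) * log_ratio r z)).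
  assert (Hk : (0 < k)%R) by apply exp_pos.
  assert (ER : Re (z * RtoC k) = (Re z * k)%R) by apply re_scal_r.
  assert (EI : Im (z * RtoC k) = (Im z * k)%R) by apply im_scal_r.
  destruct (Req_dec (Im z) 0) as [Hi|Hi].
  - right. destruct H as [H|[H|H]]; [contradiction| |].
    + left. rewrite ER. nra.
    + right. rewrite ER.
      assert (Em : Cmod z = Re z).
      { replace z with (RtoC (Re z)) at 1 by (apply C_ext; simpl; auto). rewrite Cmod_R, Rabs_pos_eq; lra. }
      assert (Ek : (Re z * k = exp (v * ln (Re z) + (1 - v) * ln r))%R).
      { rewrite <- (exp_ln (Re z)) at 1 by lra. unfold k, log_ratio. rewrite Em, <- exp_plus. f_equal. ring. }
      rewrite Ek.
      assert (L1 : (ln s < ln (Re z))%R) by (apply ln_increasing; lra).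
      assert (L2 : (ln s < ln r)%R) by (apply ln_increasing; lra).
      assert (L3 : (ln (Re z) < ln (/ s))%R) by (apply ln_increasing; lra).
      assert (L4 : (ln r < ln (/ s))%R) by (apply ln_increasing; lra).
      split.
      * rewrite <- (exp_ln s) at 1 by lra. apply exp_increasing.
        destruct (Req_dec v 0) as [->|Hv0]; [lra|]. nra.
      * rewrite <- (exp_ln (/ s)) by lra. apply exp_increasing.
        destruct (Req_dec v 0) as [->|Hv0]; [lra|]. nra.
  - left. rewrite EI. apply Rmult_integral_contrapositive_currified; lra.
Qed.

(** * Closed loops around the inner cut *)

Definition two_pi_i : C := 2 * PI * Ci.

Lemma two_pi_i_nz : two_pi_i <> 0.
Proof.
  unfold two_pi_i. pose proof PI_RGT_0. repeat apply Cmult_neq_0; try apply Ci_nz; apply INRC_pos_nz; lra.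
Qed.

Definition loop (g : R -> C) : Prop :=
  pw_smooth g 0 1 /\ g 0%R = g 1%R /\ (forall t, (0 <= t <= 1)%R -> cut_plane s (g t)) /\
  path_int g (fun w => / w) 0 1 = two_pi_i.

Section Loop.
Variable g : R -> C.
Hypothesis Hg : loop g.

Lemma loop_cont F : (forall z, cut_plane s z -> holo1 F z) -> cont_on g F 0 1.
Proof. intros HF t Ht. apply holo1_cont, HF. apply Hg. auto. Qed.

Section Circle.
Variable r : R.
Hypothesis Hr : (s < r < / s)%R.

Lemma circle_Cmod t : (0 <= t <= 1)%R -> Cmod (on_circle r g t) = r.
Proof. intros Ht. unfold on_circle. apply ray_point_0_Cmod; [lra|]. apply cut_plane_nz. apply Hg. auto. Qed.

Lemma circle_cut_plane t : (0 <= t <= 1)%R -> cut_plane s (on_circle r g t).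
Proof. intros Ht. unfold on_circle. apply cut_plane_ray_point; auto; [|lra]. apply Hg. auto. Qed.

(** The two end points of the loop coincide, so the difference of potentials vanishes. *)
Lemma loop_circle F : (forall z, cut_plane s z -> holo1 F z) -> path_int g F 0 1 = path_int (on_circle r g) F 0 1.
Proof.
  intros HF. destruct Hg as (H1 & H2 & H3 & _).
  pose proof (homotopy_to_circle r (cut_plane s) F cut_plane_open cut_plane_nz (fun z v => cut_plane_ray_point r z v Hr) HF g 0 1 H1 H3) as E.
  rewrite H2 in E. replace (ray_potential r F (g 1%R) - ray_potential r F (g 1%R)) with (RtoC 0) in E by ring.
  apply Ceq_minus. exact E.
Qed.

Lemma circle_loop : loop (on_circle r g).
Proof.
  pose proof Hg as (H1 & H2 & H3 & H4). repeat split.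
  - apply (circle_pw_smooth r (cut_plane s) cut_plane_nz); auto.
  - unfold on_circle. rewrite H2. reflexivity.
  - apply circle_cut_plane.
  - rewrite <- H4. symmetry. apply loop_circle. intros z Hz. apply holo1_Cinv. apply cut_plane_nz. exact Hz.
Qed.

End Circle.

Lemma loop_pow n : path_int g (fun w => w ^ n) 0 1 = 0.
Proof.
  pose proof Hg as (H1 & H2 & H3 & _).
  rewrite (path_FTC g 0 1 H1 (fun w => / (INR n + 1) * w ^ S n)).
  - rewrite H2. ring.
  - apply loop_cont. intros z _. apply holo1_pow, holo1_id.
  - intros t _. set (z := g t).
    assert (D : forall m, Cder (fun w => w ^ S m) z ((INR m + 1) * z ^ m)).
    { induction m as [|m IH].
      - apply (Gder_ext (fun w => w) z (fun w => w)); [apply Cpow_one|].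
        replace ((INR 0 + 1) * z ^ 0) with (RtoC 1) by (simpl; ring). apply Gder_id.
      - replace ((INR (S m) + 1) * z ^ S m) with (1 * z ^ S m + z * ((INR m + 1) * z ^ m)) by (rewrite INRC_S; simpl; ring).
        apply (Gder_mult (fun w => w) z (Flim_id z) (fun w => w) (fun w => w ^ S m)); [apply Gder_id|exact IH]. }
    replace (z ^ n) with (0 * z ^ S n + / (INR n + 1) * ((INR n + 1) * z ^ n)) by (field; apply INRC_S_nz).
    apply (Gder_mult (fun w => w) z (Flim_id z) (fun _ => / (INR n + 1)) (fun w => w ^ S n)); [apply Gder_const|apply D].
Qed.

Lemma loop_inv_pow n : path_int g (fun w => / w ^ S (S n)) 0 1 = 0.
Proof.
  pose proof Hg as (H1 & H2 & H3 & _).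
  rewrite (path_FTC g 0 1 H1 (fun w => - / (INR n + 1) * (/ w) ^ S n)).
  - rewrite H2. ring.
  - apply loop_cont. intros z Hz. apply holo1_inv; [apply Cpow_nz, cut_plane_nz; auto|]. apply holo1_pow, holo1_id.
  - intros t Ht. set (z := g t). assert (Hz : z <> 0) by (apply cut_plane_nz, H3; auto).
    assert (D : forall m, Cder (fun w => (/ w) ^ S m) z (- (INR m + 1) * / z ^ S (S m))).
    { induction m as [|m IH].
      - apply (Gder_ext (fun w => w) z Cinv); [intros y; apply (Cpow_one (/ y))|].
        replace (- (INR 0 + 1) * / z ^ 2) with (- / (z * z)) by (simpl; field; auto). apply Cder_inv. auto.
      - replace (- (INR (S m) + 1) * / z ^ S (S (S m))) with (- / (z * z) * (/ z) ^ S m + / z * (- (INR m + 1) * / z ^ S (S m))).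
        + apply (Gder_mult (fun w => w) z (Flim_id z) Cinv (fun w => (/ w) ^ S m)); [apply Cder_inv; auto|exact IH].
        + rewrite Cpow_inv, INRC_S by auto. simpl. field. split; auto. apply Cpow_nz. auto. }
    replace (/ z ^ S (S n)) with (0 * (/ z) ^ S n + - / (INR n + 1) * (- (INR n + 1) * / z ^ S (S n)))
      by (field; split; [apply Cpow_nz; auto|apply INRC_S_nz]).
    apply (Gder_mult (fun w => w) z (Flim_id z) (fun _ => - / (INR n + 1)) (fun w => (/ w) ^ S n)); [apply Gder_const|apply D].
Qed.

(** The tails of the series are uniformly small on the path, and [path_bound] integrates them
    against the weight. *)
Lemma loop_series (f : C -> C) (u : nat -> C -> C) (phi : C -> C) (M rho : R) :
  (0 < rho < 1)%R -> cont_on g f 0 1 -> cont_on g phi 0 1 -> (forall n, cont_on g (u n) 0 1) ->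
  (forall t, (0 <= t <= 1)%R -> geo M rho (fun n => u n (g t)) /\ phi (g t) = Cseries (fun n => u n (g t))) ->
  path_int g (fun w => f w * phi w) 0 1 = Cseries (fun n => path_int g (fun w => f w * u n w) 0 1).
Proof.
  intros Hrho Hf Hphi Hu Hser. pose proof Hg as (H1 & _ & _ & _).
  destruct (path_bound g 0 1 H1 f Hf) as [K [HK HB]].
  assert (Hmul : forall k, cont_on g k 0 1 -> cont_on g (fun w => f w * k w) 0 1).
  { intros k Hk t Ht. apply Flim_mult; [apply locally_filter|apply Hf; auto|apply Hk; auto]. }
  assert (Hsum : forall n, cont_on g (fun w => Csum (fun i => u i w) n) 0 1 /\
    path_int g (fun w => f w * Csum (fun i => u i w) n) 0 1 = Csum (fun i => path_int g (fun w => f w * u i w) 0 1) n).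
  { induction n as [|n [IH1 IH2]].
    - split.
      + intros t Ht. simpl. apply Flim_const, locally_filter.
      + simpl. transitivity (path_int g (fun w => 0 * f w) 0 1).
        * apply path_int_ext; [lra|]. intros; ring.
        * rewrite path_int_scal; [ring|]. apply (path_ex g 0 1 H1). exact Hf.
    - split.
      + intros t Ht. simpl. apply Flim_plus; [apply locally_filter|apply IH1; auto|apply Hu; auto].
      + simpl. rewrite <- IH2, <- path_int_plus.
        * apply path_int_ext; [lra|]. intros; ring.
        * apply (path_ex g 0 1 H1). apply Hmul, IH1.
        * apply (path_ex g 0 1 H1). apply Hmul, Hu. }
  symmetry. apply Cseries_eq.
  apply is_lim_seq_squeeze0 with (fun n => (K * (M / (1 - rho)) * rho ^ n)%R).
  - intros n. split; [apply Cmod_ge_0|].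
    destruct (Hsum n) as [C1 E1]. rewrite <- E1.
    replace (path_int g (fun w => f w * Csum (fun i => u i w) n) 0 1 - path_int g (fun w => f w * phi w) 0 1)
      with (path_int g (fun w => f w * (Csum (fun i => u i w) n + - (1) * phi w)) 0 1).
    + replace (K * (M / (1 - rho)) * rho ^ n)%R with (K * (M * rho ^ n / (1 - rho)))%R by (field; lra).
      apply HB.
      * intros t Ht. apply Flim_plus; [apply locally_filter|apply C1; auto|].
        apply Flim_mult; [apply locally_filter|apply Flim_const, locally_filter|apply Hphi; auto].
      * intros t Ht. destruct (Hser t Ht) as [G E]. rewrite E.
        replace (Csum (fun i => u i (g t)) n + - (1) * Cseries (fun i => u i (g t)))
          with (- (Cseries (fun i => u i (g t)) - Csum (fun i => u i (g t)) n)) by ring.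
        rewrite Cmod_opp. apply (geo_tail M rho Hrho _ G).
    + transitivity (path_int g (fun w => f w * Csum (fun i => u i w) n + - (1) * (f w * phi w)) 0 1).
      * apply path_int_ext; [lra|]. intros; ring.
      * rewrite path_int_plus.
        -- rewrite path_int_scal; [ring|]. apply (path_ex g 0 1 H1). apply Hmul, Hphi.
        -- apply (path_ex g 0 1 H1). apply Hmul, C1.
        -- apply (path_ex g 0 1 H1). intros t Ht. apply Flim_mult; [apply locally_filter|apply Flim_const, locally_filter|].
           apply Hmul; auto.
  - apply is_lim_seq_geo. auto.
Qed.

End Loop.

(** * Divided differences *)

(** Two derivatives at [p] are what makes the divided difference at [p] differentiable there. *)
Definition holo2 (F : C -> C) (z : C) : Prop :=
  exists dF : C -> C, locally z (fun w => Cder F w (dF w)) /\ holo1 dF z.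

Lemma holo2_holo1 F z : holo2 F z -> holo1 F z.
Proof. intros (f & H1 & H2). exists f. split; auto. apply holo1_cont. exact H2. Qed.

Lemma holo2_mult F G z : holo2 F z -> holo2 G z -> holo2 (fun w => F w * G w) z.
Proof.
  intros HF HG. pose proof (holo2_holo1 F z HF) as CF. pose proof (holo2_holo1 G z HG) as CG.
  destruct HF as (f & H1 & H2). destruct HG as (g & H3 & H4).
  exists (fun w => f w * G w + F w * g w). split.
  - apply filter_imp with (2 := filter_and _ _ H1 H3). intros w [h1 h2]. apply Gder_mult; auto. apply Flim_id.
  - apply holo1_plus; apply holo1_mult; auto.
Qed.

Lemma holo2_comp F G z : holo2 F z -> holo2 G (F z) -> holo2 (fun w => G (F w)) z.
Proof.
  intros HF HG. pose proof (holo2_holo1 F z HF) as CF. pose proof (holo1_cont F z CF) as C0.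
  destruct HF as (f & H1 & H2). destruct HG as (g & H3 & H4).
  exists (fun w => g (F w) * f w). split.
  - pose proof (Flim_locally _ _ _ _ C0 H3) as L.
    apply filter_imp with (2 := filter_and _ _ H1 L). intros w [h1 h2]. apply Cder_comp; auto.
  - apply holo1_mult; auto. apply (holo1_comp F g); auto.
Qed.

Lemma holo2_Cinv (z : C) : z <> 0 -> holo2 Cinv z.
Proof.
  intros Hz. exists (fun w => - / (w * w)). split.
  - apply filter_imp with (2 := locally_nz z Hz). intros w Hw. apply Cder_inv. exact Hw.
  - apply holo1_opp. apply holo1_inv; [apply Cmult_neq_0; auto|]. apply holo1_mult; apply holo1_id.
Qed.

Lemma holo2_affine (a b : C) z : holo2 (fun w => a + b * w) z.
Proof.
  exists (fun _ => b). split; [|apply holo1_const].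
  apply filter_forall. intros w eps He. apply filter_forall. intros y.
  assert (E : forall p q : C, a + b * p - (a + b * q) - b * (p - q) = 0) by (intros; ring).
  rewrite E, Cmod_0. apply Rmult_le_pos; [lra|apply Cmod_ge_0].
Qed.

Lemma holo2_Cpowc (a z : C) : slit z -> holo2 (fun w => Cpowc w a) z.
Proof.
  intros Hz. exists (fun w => a / w * Cpowc w a). split.
  - apply filter_imp with (2 := locally_slit z Hz). intros w Hw. apply Cder_Cpowc; auto.
  - apply holo1_mult; [|apply holo1_Cpowc; auto].
    apply holo1_mult; [apply holo1_const|]. apply holo1_Cinv. apply slit_nz; auto.
Qed.

Lemma holo2_ext F G z : (forall w, F w = G w) -> holo2 F z -> holo2 G z.
Proof. intros E H. replace G with F; auto. extensionality w. apply E. Qed.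

(** The removable singularity at [p] is filled by the derivative. *)
Definition divdiff (h : C -> C) (p w : C) : C := if Ceq_dec w p then Cderiv h p else (h w - h p) / (w - p).

Lemma divdiff_off h p w : w <> p -> divdiff h p w = (h w - h p) / (w - p).
Proof. intros H. unfold divdiff. destruct (Ceq_dec w p); [contradiction|reflexivity]. Qed.

Lemma segment_bound (k dk : C -> C) (p w : C) (B : R) :
  (forall v : R, (0 <= v <= 1)%R -> Cder k (p + RtoC v * (w - p)) (dk (p + RtoC v * (w - p)))) ->
  (forall v : R, (0 <= v <= 1)%R -> (Cmod (dk (p + RtoC v * (w - p))%C) <= B)%R) ->
  (Cmod (k w - k p) <= 2 * B * Cmod (w - p))%R.
Proof.
  intros HD HB.
  pose proof (mean_value_inequality (fun v => k (p + RtoC v * (w - p)))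
    (fun v => dk (p + RtoC v * (w - p)) * (0 + (1 * (w - p) + RtoC v * 0))) 0 1 (B * Cmod (w - p))%R Rle_0_1) as M.
  cbv beta in M. replace (p + 1 * (w - p)) with w in M by ring. replace (p + 0 * (w - p)) with p in M by ring.
  eapply Rle_trans; [apply M|].
  - intros v Hv. apply (Rder_comp (fun v => p + RtoC v * (w - p)) k).
    + apply Gder_plus; [apply Gder_const|].
      apply (Gder_mult RtoC v (Flim_RtoC v) RtoC (fun _ => w - p)); [apply Gder_id|apply Gder_const].
    + apply HD. exact Hv.
  - intros v Hv. replace (0 + (1 * (w - p) + RtoC v * 0)) with (w - p) by ring.
    rewrite Cmod_mult. apply Rmult_le_compat_r; [apply Cmod_ge_0|auto].
  - lra.
Qed.

Lemma Cder_sq (p w : C) : Cder (fun u => (u - p) * (u - p)) w (2 * (w - p)).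
Proof.
  replace (2 * (w - p)) with ((1 - 0) * (w - p) + (w - p) * (1 - 0)) by ring.
  apply (Gder_mult (fun w => w) w (Flim_id w) (fun u => u - p) (fun u => u - p));
    apply Gder_minus; try apply Gder_id; apply Gder_const.
Qed.

(** At the point [p] itself, by a Taylor expansion of order two with remainder in Peano form. *)
Lemma holo1_divdiff (h : C -> C) (p w : C) : holo2 h p -> holo1 h w -> holo1 (divdiff h p) w.
Proof.
  intros Hh Hw. destruct (Ceq_dec w p) as [->|Hne].
  - destruct Hh as (dh & H1 & (d2f & H2 & H3)).
    apply locally_singleton in H2. set (d2 := d2f p) in *. clear H3.
    pose proof (locally_singleton _ _ H1) as D1.
    assert (Ed : Cderiv h p = dh p) by (apply Cderiv_eq; exact D1).
    (* Taylor expansion of order two with a remainder controlled by the definition of the second derivative *)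
    assert (Peano : forall eps, (0 < eps)%R -> exists d, (0 < d)%R /\ forall u, (Cmod (u - p) < d)%R ->
      Cder h u (dh u) /\ (Cmod (dh u - dh p - d2 * (u - p)) <= eps * Cmod (u - p))%R /\
      (Cmod (h u - h p - dh p * (u - p) - d2 / 2 * ((u - p) * (u - p))) <= 2 * eps * (Cmod (u - p) * Cmod (u - p)))%R).
    { intros eps He. pose proof (filter_and _ _ H1 (H2 eps He)) as L. apply locally_C_Cmod in L.
      destruct L as [d [Hd L]]. exists d. split; auto. intros u Hu.
      destruct (L u Hu) as [L1 L2]. split; [exact L1|]. split; [exact L2|].
      set (k := fun u => h u - (dh p * u + d2 / 2 * ((u - p) * (u - p)))).
      set (dk := fun u => dh u - (dh p + d2 * (u - p))).
      assert (Hseg : forall v, (0 <= v <= 1)%R -> (Cmod (p + RtoC v * (u - p) - p) <= Cmod (u - p))%R).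
      { intros v Hv. replace (p + RtoC v * (u - p) - p) with (RtoC v * (u - p)) by ring.
        rewrite Cmod_mult, Cmod_R, Rabs_pos_eq by lra. pose proof (Cmod_ge_0 (u - p)). nra. }
      pose proof (segment_bound k dk p u (eps * Cmod (u - p))%R) as SB.
      replace (h u - h p - dh p * (u - p) - d2 / 2 * ((u - p) * (u - p))) with (k u - k p) by (unfold k; ring).
      replace (2 * eps * (Cmod (u - p) * Cmod (u - p)))%R with (2 * (eps * Cmod (u - p)) * Cmod (u - p))%R by ring.
      apply SB.
      - intros v Hv. specialize (Hseg v Hv). destruct (L (p + RtoC v * (u - p)) ltac:(lra)) as [L3 _].
        unfold k, dk. apply Gder_minus; [exact L3|]. set (x := p + RtoC v * (u - p)).
        replace (dh p + d2 * (x - p)) with ((0 * x + dh p * 1) + (0 * ((x - p) * (x - p)) + d2 / 2 * (2 * (x - p)))) by field.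
        apply Gder_plus.
        + apply (Gder_mult (fun w => w) x (Flim_id x) (fun _ => dh p) (fun w => w)); [apply Gder_const|apply Gder_id].
        + apply (Gder_mult (fun w => w) x (Flim_id x) (fun _ => d2 / 2) (fun u => (u - p) * (u - p))); [apply Gder_const|apply Cder_sq].
      - intros v Hv. specialize (Hseg v Hv). destruct (L (p + RtoC v * (u - p)) ltac:(lra)) as [_ L4].
        unfold dk. set (x := p + RtoC v * (u - p)) in *.
        replace (dh x - (dh p + d2 * (x - p))) with (dh x - dh p - d2 * (x - p)) by ring.
        eapply Rle_trans; [exact L4|]. apply Rmult_le_compat_l; lra. }
    exists (fun u => if Ceq_dec u p then d2 / 2 else (dh u * (u - p) - (h u - h p)) / ((u - p) * (u - p))).
    split.
    + destruct (Peano 1%R Rlt_0_1) as [d [Hd Hp]]. apply locally_C_Cmod. exists d. split; auto. intros u Hu.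
      destruct (Ceq_dec u p) as [->|Hup].
      * intros eps He. destruct (Peano (eps / 2)%R ltac:(lra)) as [d1 [Hd1 Hp1]].
        apply locally_C_Cmod. exists d1. split; auto. intros y Hy. destruct (Hp1 y Hy) as (_ & _ & R1).
        unfold divdiff at 2. destruct (Ceq_dec p p) as [_|e]; [|contradiction]. rewrite Ed.
        destruct (Ceq_dec y p) as [->|Hyp].
        -- unfold divdiff. destruct (Ceq_dec p p) as [_|e]; [|contradiction]. rewrite Ed.
           replace (dh p - dh p - d2 / 2 * (p - p)) with (RtoC 0) by ring. rewrite Cmod_0.
           apply Rmult_le_pos; [lra|apply Cmod_ge_0].
        -- rewrite divdiff_off by auto. pose proof (Cminus_eq_contra _ _ Hyp) as Hn.
           replace ((h y - h p) / (y - p) - dh p - d2 / 2 * (y - p)) with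
             ((h y - h p - dh p * (y - p) - d2 / 2 * ((y - p) * (y - p))) / (y - p)) by (field; auto).
           rewrite Cmod_div by auto. pose proof Hn as Hn'. apply Cmod_gt_0 in Hn'.
           apply Rmult_le_reg_r with (Cmod (y - p)); auto. unfold Rdiv. rewrite Rmult_assoc, Rinv_l by lra.
           rewrite Rmult_1_r. eapply Rle_trans; [exact R1|]. right. field.
      * pose proof (Cminus_eq_contra _ _ Hup) as Hn. destruct (Hp u Hu) as (D & _ & _).
        assert (Lne : locally u (fun y : C => y <> p)).
        { pose proof Hn as Hn'. apply Cmod_gt_0 in Hn'. apply locally_C_Cmod. exists (Cmod (u - p)). split; auto.
          intros y Hy e. subst y. replace (p - u) with (- (u - p)) in Hy by ring. rewrite Cmod_opp in Hy. lra. }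
        apply (Gder_ext_loc (fun w => w) u (fun y => (h y - h p) * / (y - p))).
        -- apply filter_imp with (2 := Lne). intros y Hy. rewrite divdiff_off by auto. reflexivity.
        -- rewrite divdiff_off by auto. reflexivity.
        -- replace ((dh u * (u - p) - (h u - h p)) / ((u - p) * (u - p))) with
             ((dh u - 0) * / (u - p) + (h u - h p) * (- / ((u - p) * (u - p)) * (1 - 0))) by (field; auto).
           apply (Gder_mult (fun w => w) u (Flim_id u) (fun y => h y - h p) (fun y => / (y - p))).
           ++ apply Gder_minus; [exact D|apply Gder_const].
           ++ apply (Cder_comp (fun y => y - p) Cinv); [|apply Cder_inv; auto].
              apply Gder_minus; [apply Gder_id|apply Gder_const].
    + destruct (Ceq_dec p p) as [_|e]; [|contradiction].
      intros eps He. destruct (Peano (eps / 4)%R ltac:(lra)) as [d1 [Hd1 Hp1]].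
      apply locally_C_Cmod. exists d1. split; auto. intros y Hy. destruct (Hp1 y Hy) as (_ & R0 & R1).
      destruct (Ceq_dec y p) as [->|Hyp].
      * replace (d2 / 2 - d2 / 2) with (RtoC 0) by ring. rewrite Cmod_0. exact He.
      * pose proof (Cminus_eq_contra _ _ Hyp) as Hn. pose proof Hn as Hn'. apply Cmod_gt_0 in Hn'.
        replace ((dh y * (y - p) - (h y - h p)) / ((y - p) * (y - p)) - d2 / 2) with
          (((dh y - dh p - d2 * (y - p)) * (y - p) + - (h y - h p - dh p * (y - p) - d2 / 2 * ((y - p) * (y - p)))) / ((y - p) * (y - p)))
          by (field; auto).
        rewrite Cmod_div, Cmod_mult by (apply Cmult_neq_0; auto).
        assert (Hpp : (0 < Cmod (y - p) * Cmod (y - p))%R) by (apply Rmult_lt_0_compat; auto).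
        apply Rmult_lt_reg_r with (Cmod (y - p) * Cmod (y - p))%R; auto.
        unfold Rdiv. rewrite Rmult_assoc, Rinv_l, Rmult_1_r by lra.
        eapply Rle_lt_trans; [apply Cmod_triangle|]. rewrite Cmod_opp, Cmod_mult.
        assert (Cmod (dh y - dh p - d2 * (y - p)) * Cmod (y - p) <= eps / 4 * Cmod (y - p) * Cmod (y - p))%R
          by (apply Rmult_le_compat_r; auto; lra).
        nra.
  - pose proof (Cminus_eq_contra _ _ Hne) as Hn.
    apply (holo1_ext_loc (fun y => (h y - h p) * / (y - p))).
    + pose proof Hn as Hn'. apply Cmod_gt_0 in Hn'. apply locally_C_Cmod. exists (Cmod (w - p)). split; auto.
      intros y Hy. rewrite divdiff_off; [reflexivity|]. intros e. subst y.
      replace (p - w) with (- (w - p)) in Hy by ring. rewrite Cmod_opp in Hy. lra.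
    + apply holo1_mult; [apply holo1_minus; auto; apply holo1_const|].
      apply holo1_inv; auto. apply holo1_minus; [apply holo1_id|apply holo1_const].
Qed.

End Domain.

(** * Laurent coefficients along a loop *)

(** The coefficients of [w^j] and, below, of [w^(-1-j)] in the Laurent expansion of [F]. *)
Definition coef_pos (g : R -> C) (F : C -> C) (j : nat) : C := / two_pi_i * path_int g (fun w => F w * / w ^ S j) 0 1.
Definition coef_neg (g : R -> C) (F : C -> C) (j : nat) : C := / two_pi_i * path_int g (fun w => F w * w ^ j) 0 1.

Lemma geometric_series (q : C) : (Cmod q < 1)%R -> Cseries (fun n => q ^ n) = / (1 - q).
Proof.
  intros Hq. assert (Hn : 1 - q <> 0).
  { intros e. assert (E : q = 1) by (replace q with (1 - (1 - q)) by ring; rewrite e; ring).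
    rewrite E, Cmod_1 in Hq. lra. }
  assert (Hn' := Hn). apply Cmod_gt_0 in Hn'. pose proof (Cmod_ge_0 q).
  assert (S : forall n, Csum (fun n => q ^ n) n = (1 - q ^ n) * / (1 - q)).
  { induction n as [|n IH]; simpl; [ring|]. rewrite IH. field. exact Hn. }
  assert (P : forall n, Cmod (q ^ n) = (Cmod q ^ n)%R).
  { induction n as [|n IH]; [apply Cmod_1|]. simpl. rewrite Cmod_mult, IH. reflexivity. }
  apply Cseries_eq. set (r := ((1 + Cmod q) / 2)%R).
  apply is_lim_seq_squeeze0 with (fun n => (/ Cmod (1 - q) * r ^ n)%R).
  - intros n. split; [apply Cmod_ge_0|]. rewrite S.
    replace ((1 - q ^ n) * / (1 - q) - / (1 - q)) with (- (/ (1 - q) * q ^ n)) by ring.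
    rewrite Cmod_opp, Cmod_mult, Cmod_inv, P by auto.
    apply Rmult_le_compat_l; [left; apply Rinv_0_lt_compat; auto|]. apply pow_incr. unfold r. lra.
  - apply is_lim_seq_geo. unfold r. lra.
Qed.

(** Geometric series in [p/w], with bounds that depend on the circle only. *)
Lemma cauchy_kernel (w p : C) (r : R) : p <> 0 -> (Cmod p < r)%R -> Cmod w = r ->
  geo (/ r) (Cmod p * / r) (fun j => p ^ j * / w ^ S j) /\ / (w - p) = Cseries (fun j => p ^ j * / w ^ S j).
Proof.
  intros Hp Hlt Hw. pose proof Hp as Hp'. apply Cmod_gt_0 in Hp'. subst r.
  assert (Hwn : w <> 0) by (apply Cmod_gt_0; lra).
  assert (Hq : (Cmod (p / w) < 1)%R).
  { rewrite Cmod_div by auto. apply Rmult_lt_reg_r with (Cmod w); [lra|].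
    unfold Rdiv. rewrite Rmult_assoc, Rinv_l by lra. lra. }
  assert (Hd : w - p <> 0).
  { intros e. assert (E : w = p) by (replace w with (w - p + p) by ring; rewrite e; ring). rewrite E in Hlt. lra. }
  assert (Hr : (0 < Cmod (p / w) < 1)%R).
  { split; auto. rewrite Cmod_div by auto. apply Rdiv_lt_0_compat; lra. }
  assert (E : forall j, p ^ j * / w ^ S j = / w * (p / w) ^ j).
  { intros j. induction j as [|j IH]; [simpl; field; auto|].
    replace (p ^ S j * / w ^ S (S j)) with (p / w * (p ^ j * / w ^ S j)).
    - rewrite IH. simpl. ring.
    - simpl. field. split; auto. apply Cpow_nz. auto. }
  assert (P : forall n, Cmod ((p / w) ^ n) = (Cmod (p / w) ^ n)%R).
  { induction n as [|n IH]; [apply Cmod_1|]. simpl. rewrite Cmod_mult, IH. reflexivity. }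
  assert (G : geo 1 (Cmod (p / w)) (fun j => (p / w) ^ j)) by (intros n; rewrite P; lra).
  split.
  - intros j. rewrite E, Cmod_mult, Cmod_inv, P, Cmod_div by auto. right. reflexivity.
  - replace (fun j => p ^ j * / w ^ S j) with (fun j => / w * (p / w) ^ j) by (extensionality j; rewrite E; reflexivity).
    rewrite (Cseries_scal 1 (Cmod (p / w)) Hr _ G), geometric_series by auto.
    field. auto.
Qed.

Section Coefficients.
Variables (s : R) (g : R -> C) (F : C -> C).
Hypothesis Hs : (0 < s < 1)%R.
Hypothesis Hg : loop s g.
Hypothesis HF : forall z : C, cut_plane s z -> holo1 F z.

Lemma weighted_pos_holo1 j (z : C) : cut_plane s z -> holo1 (fun w => F w * / w ^ S j) z.
Proof.
  intros Hz. apply holo1_mult; auto. apply holo1_inv; [apply Cpow_nz, (cut_plane_nz s Hs); auto|apply holo1_pow, holo1_id].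
Qed.

Lemma weighted_neg_holo1 j (z : C) : cut_plane s z -> holo1 (fun w => F w * w ^ j) z.
Proof. intros Hz. apply holo1_mult; auto. apply holo1_pow, holo1_id. Qed.

Lemma Cmod_pow (w : C) n : Cmod (w ^ n) = (Cmod w ^ n)%R.
Proof. induction n as [|n IH]; [apply Cmod_1|]. simpl. rewrite Cmod_mult, IH. reflexivity. Qed.

(** Cauchy's estimate on the circle of radius [r]; the next lemma is its counterpart for the
    other half of the coefficients. *)
Lemma coef_pos_geo r : (s < r < / s)%R -> exists M, geo M (/ r) (coef_pos g F).
Proof.
  intros Hr. assert (Hr0 : (0 < r)%R) by lra.
  pose proof (circle_loop s Hs g Hg r Hr) as He.
  destruct (path_bound (on_circle r g) 0 1 (proj1 He) F (loop_cont s _ He F HF)) as [K [HK HB]].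
  exists (Cmod (/ two_pi_i) * (K * / r))%R. intros j. unfold coef_pos. rewrite Cmod_mult.
  rewrite Rmult_assoc. apply Rmult_le_compat_l; [apply Cmod_ge_0|].
  rewrite (loop_circle s Hs g Hg r Hr) by (intros; apply weighted_pos_holo1; auto).
  replace (K * / r * (/ r) ^ j)%R with (K * (/ r) ^ S j)%R by (simpl; ring).
  apply (HB (fun w => / w ^ S j)).
  - apply (loop_cont s _ He). intros z Hz. apply holo1_inv; [apply Cpow_nz, (cut_plane_nz s Hs); auto|apply holo1_pow, holo1_id].
  - intros t Ht. pose proof (circle_Cmod s Hs g Hg r Hr t Ht) as E.
    assert (Hn : on_circle r g t <> 0) by (apply Cmod_gt_0; lra).
    rewrite Cmod_inv by (apply Cpow_nz; auto). rewrite Cmod_pow, E, pow_inv. lra.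
Qed.

Lemma coef_neg_geo r : (s < r < / s)%R -> exists M, geo M r (coef_neg g F).
Proof.
  intros Hr. assert (Hr0 : (0 < r)%R) by lra.
  pose proof (circle_loop s Hs g Hg r Hr) as He.
  destruct (path_bound (on_circle r g) 0 1 (proj1 He) F (loop_cont s _ He F HF)) as [K [HK HB]].
  exists (Cmod (/ two_pi_i) * K)%R. intros j. unfold coef_neg. rewrite Cmod_mult.
  rewrite Rmult_assoc. apply Rmult_le_compat_l; [apply Cmod_ge_0|].
  rewrite (loop_circle s Hs g Hg r Hr) by (intros; apply weighted_neg_holo1; auto).
  apply (HB (fun w => w ^ j)).
  - apply (loop_cont s _ He). intros z Hz. apply holo1_pow, holo1_id.
  - intros t Ht. pose proof (circle_Cmod s Hs g Hg r Hr t Ht) as E.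
    rewrite Cmod_pow, E. lra.
Qed.

Lemma two_pi_i_coef_pos r j : (s < r < / s)%R ->
  path_int (on_circle r g) (fun w => F w * / w ^ S j) 0 1 = two_pi_i * coef_pos g F j.
Proof.
  intros Hr. rewrite <- (loop_circle s Hs g Hg r Hr) by (intros; apply weighted_pos_holo1; auto).
  unfold coef_pos. field. apply two_pi_i_nz.
Qed.

Lemma two_pi_i_coef_neg r j : (s < r < / s)%R ->
  path_int (on_circle r g) (fun w => F w * w ^ j) 0 1 = two_pi_i * coef_neg g F j.
Proof.
  intros Hr. rewrite <- (loop_circle s Hs g Hg r Hr) by (intros; apply weighted_neg_holo1; auto).
  unfold coef_neg. field. apply two_pi_i_nz.
Qed.

End Coefficients.

Lemma loop_inv_powers s (Hs : (0 < s < 1)%R) g : loop s g ->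
  forall j, path_int g (fun w => 1 * / w ^ S j) 0 1 = match j with O => two_pi_i | S _ => 0 end.
Proof.
  intros Hg j. transitivity (path_int g (fun w => / w ^ S j) 0 1).
  - apply path_int_ext; [lra|]. intros; ring.
  - destruct j as [|j]; [|apply (loop_inv_pow s Hs); auto].
    transitivity (path_int g (fun w => / w) 0 1); [|apply Hg].
    apply path_int_ext; [lra|]. intros. rewrite <- (Cpow_one (g t)). reflexivity.
Qed.

(** * The regular part of a Laurent expansion *)

Section RegularPart.
Variables (s : R) (g : R -> C) (h : C -> C).
Hypothesis Hs : (0 < s < 1)%R.
Hypothesis Hg : loop s g.
Hypothesis Hh : forall z : C, cut_plane s z -> holo2 h z.

Let Hc : forall z : C, cut_plane s z -> holo1 h z.
Proof. intros z Hz. apply holo2_holo1, Hh, Hz. Qed.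

(** Cauchy's integral for the regular part of [h], with the value [h p] taken out so that it
    makes sense for [p] on either side of the contour and on it. *)
Definition regular_part (p : C) : C := h p + / two_pi_i * path_int g (divdiff h p) 0 1.

Section OnCircle.
Variables (r : R) (p : C).
Hypothesis Hr : (s < r < / s)%R.
Hypothesis Hp : cut_plane s p.
Hypothesis Hne : Cmod p <> r.

Lemma circle_avoids t : (0 <= t <= 1)%R -> on_circle r g t - p <> 0.
Proof.
  intros Ht e. apply Hne. rewrite <- (circle_Cmod s Hs g Hg r Hr t Ht).
  f_equal. symmetry. apply Ceq_minus. exact e.
Qed.

Lemma circle_kernel_cont : cont_on (on_circle r g) (fun w => / (w - p)) 0 1.
Proof.
  intros t Ht. apply (holo1_cont (fun w => / (w - p))), (holo1_inv (fun w => w - p)); [apply circle_avoids; auto|].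
  apply holo1_minus; [apply holo1_id|apply holo1_const].
Qed.

Lemma divided_difference_split :
  path_int g (divdiff h p) 0 1 = path_int (on_circle r g) (fun w => h w * / (w - p)) 0 1
                        - h p * path_int (on_circle r g) (fun w => 1 * / (w - p)) 0 1.
Proof.
  pose proof (circle_loop s Hs g Hg r Hr) as He.
  rewrite (loop_circle s Hs g Hg r Hr (divdiff h p)) by (intros z Hz; apply holo1_divdiff; auto).
  transitivity (path_int (on_circle r g) (fun w => h w * / (w - p) + - h p * (1 * / (w - p))) 0 1).
  - apply path_int_ext; [lra|]. intros t Ht. pose proof (circle_avoids t Ht) as Hn.
    rewrite divdiff_off; [field; auto|]. intros e. apply Hn. rewrite e. ring.
  - assert (E1 : ex_path_int (on_circle r g) (fun w => 1 * / (w - p)) 0 1).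
    { apply path_ex; [apply He|]. intros t Ht. apply Flim_mult; [apply locally_filter|apply Flim_const, locally_filter|].
      apply circle_kernel_cont; auto. }
    rewrite path_int_plus.
    + rewrite path_int_scal by exact E1. ring.
    + apply path_ex; [apply He|]. intros t Ht. apply Flim_mult; [apply locally_filter| |apply circle_kernel_cont; auto].
      apply (loop_cont s _ He); auto.
    + apply path_ex; [apply He|]. intros t Ht. apply Flim_mult; [apply locally_filter|apply Flim_const, locally_filter|].
      apply Flim_mult; [apply locally_filter|apply Flim_const, locally_filter|]. apply circle_kernel_cont; auto.
Qed.

End OnCircle.

Lemma one_cont e : cont_on e (fun _ => 1) 0 1.
Proof. intros t Ht. apply Flim_const, locally_filter. Qed.

(** On a circle around [p] the kernel [1/(w - p)] expands in powers of [p/w]. *)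
Lemma regular_part_inside (r : R) (p : C) : (s < r < / s)%R -> cut_plane s p -> (Cmod p < r)%R ->
  regular_part p = pow_series (coef_pos g h) p.
Proof.
  intros Hr Hp Hpr. pose proof (circle_loop s Hs g Hg r Hr) as He.
  pose proof (cut_plane_nz s Hs p Hp) as Hpn. pose proof Hpn as Hp0. apply Cmod_gt_0 in Hp0.
  assert (Hr0 : (0 < r)%R) by lra.
  assert (Hrho : (0 < Cmod p * / r < 1)%R).
  { split; [apply Rmult_lt_0_compat; auto; apply Rinv_0_lt_compat; auto|].
    apply Rmult_lt_reg_r with r; auto. rewrite Rmult_assoc, Rinv_l by lra. lra. }
  assert (term : forall n, cont_on (on_circle r g) (fun w => p ^ n * / w ^ S n) 0 1).
  { intros n. apply (loop_cont s _ He). intros z Hz. apply holo1_mult; [apply holo1_const|].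
    apply holo1_inv; [apply Cpow_nz, (cut_plane_nz s Hs); auto|apply holo1_pow, holo1_id]. }
  assert (ser : forall k : C -> C, cont_on (on_circle r g) k 0 1 ->
    path_int (on_circle r g) (fun w => k w * / (w - p)) 0 1
    = Cseries (fun j => p ^ j * path_int (on_circle r g) (fun w => k w * / w ^ S j) 0 1)).
  { intros k Hk. rewrite (loop_series s _ He k (fun j w => p ^ j * / w ^ S j) (fun w => / (w - p)) (/ r) (Cmod p * / r)); auto.
    - f_equal. extensionality j. rewrite <- path_int_scal.
      + apply path_int_ext; [lra|]. intros; ring.
      + apply path_ex; [apply He|]. intros t Ht. apply Flim_mult; [apply locally_filter|apply Hk; auto|].
        apply (loop_cont s _ He (fun w => / w ^ S j)); auto. intros z Hz.
        apply holo1_inv; [apply Cpow_nz, (cut_plane_nz s Hs); auto|apply holo1_pow, holo1_id].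
    - apply circle_kernel_cont; auto. lra.
    - intros t Ht. apply cauchy_kernel; auto. apply (circle_Cmod s Hs); auto. }
  unfold regular_part. rewrite (divided_difference_split r p); auto; [|lra].
  rewrite (ser h), (ser (fun _ => 1)).
  2: apply one_cont. 2: apply (loop_cont s _ He); auto.
  replace (Cseries (fun j => p ^ j * path_int (on_circle r g) (fun w => 1 * / w ^ S j) 0 1)) with two_pi_i.
  2:{ rewrite (Cseries_finite _ 1).
      - transitivity (0 + p ^ 0 * path_int (on_circle r g) (fun w => 1 * / w ^ 1) 0 1); [|reflexivity].
        rewrite (loop_inv_powers s Hs _ He 0). simpl. ring.
      - intros [|n] Hn; [lia|]. rewrite (loop_inv_powers s Hs _ He (S n)). ring. }
  replace (Cseries (fun j => p ^ j * path_int (on_circle r g) (fun w => h w * / w ^ S j) 0 1)) with (two_pi_i * pow_series (coef_pos g h) p).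
  - field. apply two_pi_i_nz.
  - destruct (coef_pos_geo s g h Hs Hg Hc r Hr) as [M HM].
    unfold pow_series. rewrite <- (Cseries_scal M (/ r * Cmod p)).
    + f_equal. extensionality j. rewrite (two_pi_i_coef_pos s); auto. ring.
    + rewrite Rmult_comm. exact Hrho.
    + apply geo_pow_series; auto; [apply Rinv_0_lt_compat; auto|lra].
Qed.

(** On a circle leaving [p] outside the kernel expands in powers of [w/p], and the integral of
    [1/(w - p)] vanishes. *)
Lemma regular_part_outside (r : R) (p : C) : (s < r < / s)%R -> cut_plane s p -> (r < Cmod p)%R ->
  regular_part p = h p - / p * pow_series (coef_neg g h) (/ p).
Proof.
  intros Hr Hp Hpr. pose proof (circle_loop s Hs g Hg r Hr) as He.
  pose proof (cut_plane_nz s Hs p Hp) as Hpn. pose proof Hpn as Hp0. apply Cmod_gt_0 in Hp0.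
  assert (Hr0 : (0 < r)%R) by lra.
  assert (Hrho : (0 < r * / Cmod p < 1)%R).
  { split; [apply Rmult_lt_0_compat; auto; apply Rinv_0_lt_compat; auto|].
    apply Rmult_lt_reg_r with (Cmod p); auto. rewrite Rmult_assoc, Rinv_l by lra. lra. }
  assert (ser : forall k : C -> C, cont_on (on_circle r g) k 0 1 ->
    path_int (on_circle r g) (fun w => k w * / (w - p)) 0 1
    = Cseries (fun j => - / p ^ S j * path_int (on_circle r g) (fun w => k w * w ^ j) 0 1)).
  { intros k Hk. rewrite (loop_series s _ He k (fun j w => - / p ^ S j * w ^ j) (fun w => / (w - p)) (/ Cmod p) (r * / Cmod p)); auto.
    - f_equal. extensionality j. rewrite <- path_int_scal.
      + apply path_int_ext; [lra|]. intros; ring.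
      + apply path_ex; [apply He|]. intros t Ht. apply Flim_mult; [apply locally_filter|apply Hk; auto|].
        apply (loop_cont s _ He (fun w => w ^ j)); auto. intros z Hz. apply holo1_pow, holo1_id.
    - apply circle_kernel_cont; auto. lra.
    - intros n. apply (loop_cont s _ He). intros z Hz. apply holo1_mult; [apply holo1_const|apply holo1_pow, holo1_id].
    - intros t Ht. pose proof (circle_Cmod s Hs g Hg r Hr t Ht) as Ew. set (w := on_circle r g t) in *.
      assert (Hwn : w <> 0) by (apply Cmod_gt_0; lra).
      destruct (cauchy_kernel p w (Cmod p) Hwn ltac:(lra) eq_refl) as [G E].
      rewrite Ew in G.
      assert (HG : geo (/ Cmod p) (r * / Cmod p) (fun j => - / p ^ S j * w ^ j)).
      { intros j. specialize (G j). replace (- / p ^ S j * w ^ j) with (- (w ^ j * / p ^ S j)) by ring. rewrite Cmod_opp. exact G. }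
      split; [exact HG|].
      replace (fun n => - / p ^ S n * w ^ n) with (fun n => - (1) * (w ^ n * / p ^ S n)) by (extensionality n; ring).
      rewrite (Cseries_scal (/ Cmod p) (r * / Cmod p) Hrho _ G), <- E.
      assert (Hwp : w - p <> 0) by (apply circle_avoids; auto; lra).
      assert (Hpw : p - w <> 0) by (intros e; apply Hwp; replace (w - p) with (- (p - w)) by ring; rewrite e; ring).
      field. auto. }
  unfold regular_part. rewrite (divided_difference_split r p); auto; [|lra].
  rewrite (ser h), (ser (fun _ => 1)).
  2: apply one_cont. 2: apply (loop_cont s _ He); auto.
  replace (Cseries (fun j => - / p ^ S j * path_int (on_circle r g) (fun w => 1 * w ^ j) 0 1)) with (RtoC 0).
  2:{ rewrite (Cseries_finite _ 0); [reflexivity|]. intros n _.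
      replace (path_int (on_circle r g) (fun w => 1 * w ^ n) 0 1) with (RtoC 0); [ring|].
      rewrite <- (loop_pow s _ He n). apply path_int_ext; [lra|]. intros; ring. }
  replace (Cseries (fun j => - / p ^ S j * path_int (on_circle r g) (fun w => h w * w ^ j) 0 1))
    with ((- / p * two_pi_i) * pow_series (coef_neg g h) (/ p)).
  - field. split; [auto|apply two_pi_i_nz].
  - destruct (coef_neg_geo s g h Hs Hg Hc r Hr) as [M HM].
    unfold pow_series. rewrite <- (Cseries_scal M (r * / Cmod p)).
    + f_equal. extensionality j. rewrite (two_pi_i_coef_neg s), Cpow_inv by auto. simpl. field. split; auto. apply Cpow_nz; auto.
    + exact Hrho.
    + apply geo_pow_series; auto. rewrite Cmod_inv by auto. lra.
Qed.

(** Each point lies in the domain of one of the two expansions, hence the regular part is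
    holomorphic on the whole cut plane. *)
Lemma regular_part_holo1 (p : C) : cut_plane s p -> holo1 regular_part p.
Proof.
  intros Hp. pose proof (inv_s s Hs) as Hi.
  pose proof (cut_plane_nz s Hs p Hp) as Hpn. pose proof Hpn as Hp0. apply Cmod_gt_0 in Hp0.
  assert (Lm : forall P : R -> Prop, locally (Cmod p) P -> locally p (fun w : C => P (Cmod w))).
  { intros P HP. exact (continuous_Cmod p P HP). }
  destruct (Rlt_le_dec (Cmod p) (/ s)) as [Hin|Hout].
  - assert (Hr : exists r, (s < r < / s)%R /\ (Cmod p < r)%R).
    { exists ((Rmax s (Cmod p) + / s) / 2)%R. pose proof (Rmax_l s (Cmod p)). pose proof (Rmax_r s (Cmod p)).
      assert (Rmax s (Cmod p) < / s)%R by (apply Rmax_lub_lt; lra). lra. }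
    destruct Hr as [r [Hr Hpr]]. assert (Hr0 : (0 < r)%R) by lra.
    destruct (coef_pos_geo s g h Hs Hg Hc r Hr) as [M HM].
    apply (holo1_ext_loc (pow_series (coef_pos g h))).
    + assert (L : locally (Cmod p) (fun v => v < r)%R) by (apply open_lt; auto).
      apply filter_imp with (2 := filter_and _ _ (cut_plane_open s p Hp) (Lm _ L)).
      intros w [h1 h2]. symmetry. apply (regular_part_inside r); auto.
    + apply (holo1_pow_series M (/ r)); auto; [apply Rinv_0_lt_compat; auto|].
      apply Rmult_lt_reg_l with r; auto. rewrite <- Rmult_assoc, Rinv_r by lra. lra.
  - assert (Hr : exists r, (s < r < / s)%R /\ (r < Cmod p)%R).
    { exists ((s + / s) / 2)%R. lra. }
    destruct Hr as [r [Hr Hpr]]. assert (Hr0 : (0 < r)%R) by lra.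
    destruct (coef_neg_geo s g h Hs Hg Hc r Hr) as [M HM].
    apply (holo1_ext_loc (fun w => h w - / w * pow_series (coef_neg g h) (/ w))).
    + assert (L : locally (Cmod p) (fun v => r < v)%R) by (apply open_gt; auto).
      apply filter_imp with (2 := filter_and _ _ (cut_plane_open s p Hp) (Lm _ L)).
      intros w [h1 h2]. symmetry. apply (regular_part_outside r); auto.
    + apply holo1_minus; [apply Hc; auto|]. apply holo1_mult; [apply holo1_Cinv; auto|].
      apply (holo1_comp Cinv); [apply holo1_Cinv; auto|].
      apply (holo1_pow_series M r); auto. rewrite Cmod_inv by auto.
      apply Rmult_lt_reg_r with (Cmod p); auto. rewrite Rmult_assoc, Rinv_l by lra. lra.
Qed.

(** With [u = w/p] one has [(u + 1)/(u - 1) = 1 + 2p/(w - p)]; the divided difference at [p]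
    and the residue [h p] make up the regular part. *)
Lemma integral_with_pole (p : C) : cut_plane s p -> (forall t, (0 <= t <= 1)%R -> g t <> p) ->
  path_int g (fun w => / (w - p)) 0 1 = two_pi_i ->
  path_int g (fun w => h w * ((/ p * w + 1) / (/ p * w - 1))) 0 1 = two_pi_i * (coef_neg g h 0 + 2 * p * regular_part p).
Proof.
  intros Hp Hav Hw. pose proof (cut_plane_nz s Hs p Hp) as Hpn. pose proof Hg as (Hpw & _ & HOm & _).
  assert (Hn : forall t, (0 <= t <= 1)%R -> g t - p <> 0).
  { intros t Ht e. apply (Hav t Ht). apply Ceq_minus. exact e. }
  assert (C1 : cont_on g (fun w => h w * w ^ 0) 0 1).
  { apply (loop_cont s _ Hg). intros z Hz. apply holo1_mult; [auto|apply holo1_pow, holo1_id]. }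
  assert (C2 : cont_on g (divdiff h p) 0 1) by (apply (loop_cont s _ Hg); intros; apply holo1_divdiff; auto).
  assert (C3 : cont_on g (fun w => / (w - p)) 0 1).
  { intros t Ht. apply (holo1_cont (fun w => / (w - p))), (holo1_inv (fun w => w - p)); [apply Hn; auto|]. apply holo1_minus; [apply holo1_id|apply holo1_const]. }
  assert (C4 : cont_on g (fun w => h p * / (w - p)) 0 1).
  { intros t Ht. apply Flim_mult; [apply locally_filter|apply Flim_const, locally_filter|apply C3; auto]. }
  assert (C5 : cont_on g (fun w => divdiff h p w + h p * / (w - p)) 0 1).
  { intros t Ht. apply Flim_plus; [apply locally_filter|apply C2; auto|apply C4; auto]. }
  assert (C6 : cont_on g (fun w => 2 * p * (divdiff h p w + h p * / (w - p))) 0 1).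
  { intros t Ht. apply Flim_mult; [apply locally_filter|apply Flim_const, locally_filter|apply C5; auto]. }
  transitivity (path_int g (fun w => h w * w ^ 0 + 2 * p * (divdiff h p w + h p * / (w - p))) 0 1).
  - apply path_int_ext; [lra|]. intros t Ht. specialize (Hn t Ht). rewrite divdiff_off by auto.
    set (w := g t) in *. simpl.
    replace (/ p * w - 1) with ((w - p) * / p) by (field; auto). field. auto.
  - rewrite path_int_plus by (apply path_ex; auto). rewrite path_int_scal by (apply path_ex; auto).
    rewrite path_int_plus by (apply path_ex; auto). rewrite path_int_scal by (apply path_ex; auto).
    rewrite Hw. unfold coef_neg, regular_part. field. apply two_pi_i_nz.
Qed.

End RegularPart.

(** * The double contour integral as a series of products of coefficients *)

(** After the inner integration the outer integrand is holomorphic in the cut plane. On the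
    unit circle the regular part of [h] at [1/w] is a series in powers of [1/w], which is
    integrated term by term against [f]. *)
Theorem double_contour (s : R) (g1 g2 : R -> C) (f h : C -> C) :
  (0 < s < 1)%R -> loop s g1 -> loop s g2 ->
  (forall z : C, cut_plane s z -> holo1 f z) -> (forall z : C, cut_plane s z -> holo2 h z) ->
  (forall t1 t2 : R, (0 <= t1 <= 1)%R -> (0 <= t2 <= 1)%R -> g2 t2 <> / g1 t1) ->
  (forall t : R, (0 <= t <= 1)%R -> path_int g2 (fun w => / (w - / g1 t)) 0 1 = two_pi_i) ->
  path_int g1 (fun w1 => f w1 * path_int g2 (fun w2 => h w2 * ((w1 * w2 + 1) / (w1 * w2 - 1))) 0 1) 0 1
  = two_pi_i * two_pi_i * (coef_neg g1 f 0 * coef_neg g2 h 0 + 2 * Cseries (fun j => coef_pos g1 f j * coef_pos g2 h j)).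
Proof.
  intros Hs Hg1 Hg2 Hf Hh Hav Hw. pose proof (inv_s s Hs) as Hi.
  assert (Hr : (s < 1 < / s)%R) by lra.
  pose proof (circle_loop s Hs g1 Hg1 1 Hr) as He.
  set (k := fun w => / w * regular_part g2 h (/ w)).
  assert (Hk : forall z : C, cut_plane s z -> holo1 k z).
  { intros z Hz. pose proof (cut_plane_nz s Hs z Hz). apply holo1_mult; [apply holo1_Cinv; auto|].
    apply (holo1_comp Cinv); [apply holo1_Cinv; auto|]. apply (regular_part_holo1 s); auto. apply cut_plane_inv; auto. }
  transitivity (path_int g1 (fun w => two_pi_i * coef_neg g2 h 0 * (f w * w ^ 0) + 2 * two_pi_i * (f w * k w)) 0 1).
  { apply path_int_ext; [lra|]. intros t Ht. set (w := g1 t).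
    assert (HO : cut_plane s w) by (apply Hg1; auto). pose proof (cut_plane_nz s Hs w HO) as Hn.
    pose proof (integral_with_pole s g2 h Hs Hg2 Hh (/ w) (cut_plane_inv s Hs w HO) (fun t2 Ht2 => Hav t t2 Ht Ht2) (Hw t Ht)) as E.
    replace (/ / w) with w in E by (field; auto). rewrite E. unfold k. simpl. ring. }
  assert (Cf : cont_on g1 (fun w => f w * w ^ 0) 0 1).
  { apply (loop_cont s _ Hg1). intros z Hz. apply holo1_mult; [auto|apply holo1_pow, holo1_id]. }
  assert (Hfk : forall z : C, cut_plane s z -> holo1 (fun w => f w * k w) z) by (intros; apply holo1_mult; auto).
  pose proof (loop_cont s _ Hg1 _ Hfk) as Cfk.
  assert (scal : forall c q, cont_on g1 q 0 1 -> cont_on g1 (fun w => c * q w) 0 1).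
  { intros c q Hq t Ht. apply Flim_mult; [apply locally_filter|apply Flim_const, locally_filter|apply Hq; auto]. }
  pose proof (proj1 Hg1) as Hpw.
  rewrite path_int_plus by (apply path_ex; auto).
  rewrite !path_int_scal by (apply path_ex; auto).
  (* a common geometric rate for the coefficients of [h] on the unit circle *)
  set (q := ((1 + / s) / 2)%R). assert (Hq1 : (1 < q)%R) by (unfold q; lra). assert (Hq2 : (q < / s)%R) by (unfold q; lra).
  clearbody q.
  destruct (coef_pos_geo s g2 h Hs Hg2 (fun z Hz => holo2_holo1 h z (Hh z Hz)) q ltac:(lra)) as [M HM].
  assert (Hrho : (0 < / q < 1)%R).
  { split; [apply Rinv_0_lt_compat; lra|]. rewrite <- Rinv_1. apply Rinv_lt_contravar; lra. }
  assert (ser : path_int g1 (fun w => f w * k w) 0 1 = two_pi_i * Cseries (fun j => coef_pos g1 f j * coef_pos g2 h j)).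
  { rewrite (loop_circle s Hs g1 Hg1 1 Hr _ Hfk).
    assert (HPS : forall t, (0 <= t <= 1)%R -> geo M (/ q) (fun j => coef_pos g2 h j * / on_circle 1 g1 t ^ S j) /\
      k (on_circle 1 g1 t) = Cseries (fun j => coef_pos g2 h j * / on_circle 1 g1 t ^ S j)).
    { intros t Ht. set (w := on_circle 1 g1 t).
      assert (HO : cut_plane s w) by (apply circle_cut_plane; auto). pose proof (cut_plane_nz s Hs w HO) as Hn.
      assert (Ew : Cmod w = 1%R) by (apply (circle_Cmod s Hs); auto).
      assert (Ei : Cmod (/ w) = 1%R) by (rewrite Cmod_inv, Ew by auto; apply Rinv_1).
      assert (Epow : forall j, / w ^ j = (/ w) ^ j) by (intros; symmetry; apply Cpow_inv; auto).
      split.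
      - intros j. rewrite Cmod_mult, Epow, Cmod_pow, Ei, pow1, Rmult_1_r. apply HM.
      - unfold k. rewrite (regular_part_inside s g2 h Hs Hg2 Hh q) by (auto using cut_plane_inv; lra).
        unfold pow_series. rewrite <- (Cseries_scal M (/ q)); auto.
        + f_equal. extensionality j. rewrite Epow. simpl. ring.
        + intros j. rewrite Cmod_mult, Cmod_pow, Ei, pow1, Rmult_1_r. apply HM. }
    rewrite (loop_series s _ He f (fun j w => coef_pos g2 h j * / w ^ S j) k M (/ q)); auto.
    - destruct (coef_pos_geo s g1 f Hs Hg1 Hf 1 Hr) as [M1 HM1].
      rewrite <- (Cseries_scal (M1 * M) (/ q)); auto.
      + f_equal. extensionality j.
        transitivity (coef_pos g2 h j * path_int (on_circle 1 g1) (fun w => f w * / w ^ S j) 0 1).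
        * rewrite <- path_int_scal.
          -- apply path_int_ext; [lra|]. intros; ring.
          -- apply path_ex; [apply He|]. apply (loop_cont s _ He). apply weighted_pos_holo1; auto.
        * rewrite (two_pi_i_coef_pos s g1 f Hs Hg1 Hf 1 j Hr). ring.
      + intros j. rewrite Cmod_mult, Rmult_assoc. apply Rmult_le_compat; try apply Cmod_ge_0; [|apply HM].
        specialize (HM1 j). rewrite Rinv_1, pow1, Rmult_1_r in HM1. exact HM1.
    - apply (loop_cont s _ He); auto.
    - apply (loop_cont s _ He); auto.
    - intros n. apply (loop_cont s _ He). intros z Hz. apply holo1_mult; [apply holo1_const|].
      apply holo1_inv; [apply Cpow_nz, (cut_plane_nz s Hs); auto|apply holo1_pow, holo1_id]. }
  rewrite ser. unfold coef_neg. field. apply two_pi_i_nz.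
Qed.

(** * Laurent coefficients of products of binomials *)

Definition symbol (s : R) (al ga : C) (w : C) : C := Cpowc (1 - w * RtoC s) al * Cpowc (1 - RtoC s / w) ga.

Lemma cut_plane_slit (s : R) (w : C) : (0 < s < 1)%R -> cut_plane s w -> slit (1 - w * RtoC s).
Proof.
  intros Hs H.
  assert (ER : Re (1 - w * RtoC s) = (1 - Re w * s)%R) by (destruct w; simpl; ring).
  assert (EI : Im (1 - w * RtoC s) = (- (Im w * s))%R) by (destruct w; simpl; ring).
  unfold slit. rewrite ER, EI. destruct (Req_dec (Im w) 0) as [Hi|Hi].
  - right. destruct H as [H|[H|[H1 H2]]]; [contradiction|nra|].
    apply Rmult_lt_compat_r with (r := s) in H2; [|lra]. rewrite Rinv_l in H2 by lra. lra.
  - left. apply Ropp_neq_0_compat. apply Rmult_integral_contrapositive_currified; lra.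
Qed.

Lemma holo2_symbol (s : R) (al ga : C) (w : C) : (0 < s < 1)%R -> cut_plane s w -> holo2 (symbol s al ga) w.
Proof.
  intros Hs H. unfold symbol.
  assert (A : forall (c : C) z, slit (1 - z * RtoC s) -> holo2 (fun w => Cpowc (1 - w * RtoC s) c) z).
  { intros c z Hz. apply (holo2_comp (fun w => 1 - w * RtoC s) (fun u => Cpowc u c)).
    - apply (holo2_ext (fun w => 1 + - RtoC s * w)); [intros; ring|apply holo2_affine].
    - apply holo2_Cpowc, Hz. }
  apply holo2_mult; [apply A, cut_plane_slit; auto|].
  apply (holo2_ext (fun w => Cpowc (1 - / w * RtoC s) ga)).
  { intros u. f_equal. unfold Cdiv. ring. }
  apply (holo2_comp Cinv (fun w => Cpowc (1 - w * RtoC s) ga)).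
  - apply holo2_Cinv, (cut_plane_nz s Hs), H.
  - apply A, cut_plane_slit, cut_plane_inv; auto.
Qed.

Lemma loop_monomial (s : R) (g : R -> C) (i n : nat) : (0 < s < 1)%R -> loop s g ->
  path_int g (fun w => / w ^ S n * w ^ i) 0 1 = if Nat.eq_dec i n then two_pi_i else 0.
Proof.
  intros Hs Hg.
  assert (Hn : forall t, (0 <= t <= 1)%R -> g t <> 0) by (intros t Ht; apply (cut_plane_nz s Hs), Hg; auto).
  destruct (Nat.eq_dec i n) as [->|Hne].
  - transitivity (path_int g (fun w => / w) 0 1); [|apply Hg].
    apply path_int_ext; [lra|]. intros t Ht. simpl. field. split; [auto|]. apply Cpow_nz; auto.
  - destruct (Nat.lt_ge_cases i n) as [Hlt|Hge].
    + destruct (Nat.le_exists_sub (S i) n Hlt) as [d [-> _]].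
      transitivity (path_int g (fun w => / w ^ S (S d)) 0 1); [|apply (loop_inv_pow s Hs); auto].
      apply path_int_ext; [lra|]. intros t Ht. replace (S (d + S i)) with (S (S d) + i)%nat by lia.
      rewrite Cpow_add_r. field. split; apply Cpow_nz; auto.
    + destruct (Nat.le_exists_sub (S n) i ltac:(lia)) as [d [-> _]].
      transitivity (path_int g (fun w => w ^ d) 0 1); [|apply (loop_pow s); auto].
      apply path_int_ext; [lra|]. intros t Ht. rewrite Cpow_add_r. field. apply Cpow_nz; auto.
Qed.

Lemma Cseries_single (u : nat -> C) (n : nat) : (forall i : nat, i <> n -> u i = 0) -> Cseries u = u n.
Proof.
  intros H. rewrite (Cseries_finite u (S n)) by (intros; apply H; lia).
  simpl. rewrite Csum_zero by (intros; apply H; lia). ring.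
Qed.

(** One geometric rate for all points of the unit circle. *)
Lemma binomial_terms (s : R) (al : C) : (0 < s < 1)%R ->
  exists K rho, (0 < rho < 1)%R /\ geo K rho (fun i => binom_coef al i * RtoC s ^ i) /\
    forall u : C, Cmod u = 1%R -> geo K rho (fun i => binom_coef al i * RtoC s ^ i * u ^ i) /\
    Cpowc (1 - u * RtoC s) al = Cseries (fun i => binom_coef al i * RtoC s ^ i * u ^ i).
Proof.
  intros Hs. destruct (geometric_room s ltac:(lra)) as (q & Hq & Hq1 & _).
  destruct (binom_coef_geo al q Hq) as [K HK].
  assert (G : geo K (s * q) (fun i => binom_coef al i * RtoC s ^ i)).
  { rewrite Rmult_comm. apply geo_pow_series; auto; [lra|]. rewrite Cmod_R, Rabs_pos_eq; lra. }
  exists K, (s * q)%R. split; [split; [nra|exact Hq1]|]. split; [exact G|]. intros v Hv. split.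
  - intros i. rewrite Cmod_mult, Cmod_pow, Hv, pow1, Rmult_1_r. apply G.
  - rewrite binomial_series.
    + unfold pow_series. f_equal. extensionality i. rewrite Cpow_mult_l. ring.
    + rewrite Cmod_mult, Hv, Cmod_R, Rabs_pos_eq; lra.
Qed.

(** On the unit circle both binomials expand, in powers of [w] and of [1/w], and orthogonality
    of the monomials leaves a single sum. *)
Lemma symbol_coefficient (s : R) (g : R -> C) (al ga : C) (m : nat) : (0 < s < 1)%R -> loop s g ->
  coef_pos g (symbol s al ga) m = Cseries (fun l => binom_coef ga l * RtoC s ^ l * (binom_coef al (m + l) * RtoC s ^ (m + l))).
Proof.
  intros Hs Hg. pose proof (inv_s s Hs) as Hi. assert (Hr : (s < 1 < / s)%R) by lra.
  pose proof (circle_loop s Hs g Hg 1 Hr) as He. set (e := on_circle 1 g) in *.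
  assert (He1 : forall t, (0 <= t <= 1)%R -> Cmod (e t) = 1%R) by (intros; apply (circle_Cmod s Hs); auto).
  assert (Hen : forall t, (0 <= t <= 1)%R -> e t <> 0) by (intros; apply (cut_plane_nz s Hs), He; auto).
  destruct (binomial_terms s al Hs) as (Ka & ra & Hra & Ga0 & Ga).
  destruct (binomial_terms s ga Hs) as (Kg & rg & Hrg & Gg0 & Gg).
  assert (Hsym : forall z : C, cut_plane s z -> holo1 (symbol s al ga) z) by (intros; apply holo2_holo1, holo2_symbol; auto).
  assert (CA : forall c n z, cut_plane s z -> holo1 (fun w => / w ^ S n * Cpowc (1 - w * RtoC s) c) z).
  { intros c n z Hz. apply holo1_mult.
    - apply holo1_inv; [apply Cpow_nz, (cut_plane_nz s Hs); auto|apply holo1_pow, holo1_id].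
    - apply (holo1_comp (fun w => 1 - w * RtoC s) (fun u => Cpowc u c)).
      + apply holo1_minus; [apply holo1_const|]. apply holo1_mult; [apply holo1_id|apply holo1_const].
      + apply holo1_Cpowc, cut_plane_slit; auto. }
  assert (CP : forall c z, cut_plane s z -> holo1 (fun w => Cpowc (1 - w * RtoC s) c) z).
  { intros c z Hz. apply (holo1_comp (fun w => 1 - w * RtoC s) (fun u => Cpowc u c)).
    - apply holo1_minus; [apply holo1_const|]. apply holo1_mult; [apply holo1_id|apply holo1_const].
    - apply holo1_Cpowc, cut_plane_slit; auto. }
  assert (Cinvp : forall n z, cut_plane s z -> holo1 (fun w => / w ^ S n) z).
  { intros n z Hz. apply holo1_inv; [apply Cpow_nz, (cut_plane_nz s Hs); auto|apply holo1_pow, holo1_id]. }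
  (* the inner series selects the single power compensating [w^-(n+1)] *)
  assert (inner : forall n, path_int e (fun w => / w ^ S n * Cpowc (1 - w * RtoC s) al) 0 1
    = two_pi_i * (binom_coef al n * RtoC s ^ n)).
  { intros n. rewrite (loop_series s e He (fun w => / w ^ S n) (fun i w => binom_coef al i * RtoC s ^ i * w ^ i)
      (fun w => Cpowc (1 - w * RtoC s) al) Ka ra); auto.
    - assert (E : forall i, path_int e (fun w => / w ^ S n * (binom_coef al i * RtoC s ^ i * w ^ i)) 0 1
        = binom_coef al i * RtoC s ^ i * (if Nat.eq_dec i n then two_pi_i else 0)).
      { intros i. rewrite <- (loop_monomial s e i n Hs He), <- path_int_scal.
        - apply path_int_ext; [lra|]. intros; ring.
        - apply path_ex; [apply He|]. apply (loop_cont s e He). intros z Hz.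
          apply holo1_mult; [apply Cinvp; auto|apply holo1_pow, holo1_id]. }
      rewrite (Cseries_single _ n).
      + rewrite E. destruct (Nat.eq_dec n n) as [_|h]; [ring|contradiction].
      + intros i Hin. rewrite E. destruct (Nat.eq_dec i n) as [h|_]; [contradiction|ring].
    - apply (loop_cont s e He), Cinvp.
    - apply (loop_cont s e He), CP.
    - intros i. apply (loop_cont s e He). intros z Hz. apply holo1_mult; [apply holo1_const|apply holo1_pow, holo1_id]. }
  assert (cancel : forall z w : C, two_pi_i * z = two_pi_i * w -> z = w).
  { intros z w H. transitivity (/ two_pi_i * (two_pi_i * z)); [field; apply two_pi_i_nz|]. rewrite H. field. apply two_pi_i_nz. }
  apply cancel. rewrite <- (two_pi_i_coef_pos s g (symbol s al ga) Hs Hg Hsym 1 m Hr). fold e.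
  transitivity (path_int e (fun w => / w ^ S m * Cpowc (1 - w * RtoC s) al * Cpowc (1 - / w * RtoC s) ga) 0 1).
  { apply path_int_ext; [lra|]. intros t Ht. unfold symbol, Cdiv. rewrite (Cmult_comm (RtoC s)). ring. }
  assert (inv1 : forall t, (0 <= t <= 1)%R -> Cmod (/ e t) = 1%R).
  { intros t Ht. rewrite Cmod_inv, He1 by auto. apply Rinv_1. }
  rewrite (loop_series s e He (fun w => / w ^ S m * Cpowc (1 - w * RtoC s) al) (fun l w => binom_coef ga l * RtoC s ^ l * (/ w) ^ l)
      (fun w => Cpowc (1 - / w * RtoC s) ga) Kg rg); auto.
  - rewrite <- (Cseries_scal (Kg * Ka) rg); auto.
    + f_equal. extensionality l.
      transitivity (binom_coef ga l * RtoC s ^ l * path_int e (fun w => / w ^ S (m + l) * Cpowc (1 - w * RtoC s) al) 0 1).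
      * rewrite <- path_int_scal.
        -- apply path_int_ext; [lra|]. intros t Ht. rewrite Cpow_inv by auto.
           replace (S (m + l)) with (S m + l)%nat by lia. rewrite Cpow_add_r. field. split; apply Cpow_nz; auto.
        -- apply path_ex; [apply He|]. apply (loop_cont s e He), CA.
      * rewrite inner. ring.
    + intros l. rewrite Cmod_mult.
      replace (Kg * Ka * rg ^ l)%R with (Kg * rg ^ l * Ka)%R by ring.
      apply Rmult_le_compat; try apply Cmod_ge_0; [apply Gg0|].
      eapply Rle_trans; [apply Ga0|]. rewrite <- (Rmult_1_r Ka) at 2.
      apply Rmult_le_compat_l; [apply (geo_M_nonneg Ka ra _ Ga0)|]. rewrite <- (pow1 (m + l)). apply pow_incr. lra.
  - apply (loop_cont s e He), CA.
  - apply (loop_cont s e He). intros z Hz. pose proof (cut_plane_nz s Hs z Hz).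
    apply (holo1_comp Cinv (fun w => Cpowc (1 - w * RtoC s) ga)); [apply holo1_Cinv; auto|]. apply CP, cut_plane_inv; auto.
  - intros l. apply (loop_cont s e He). intros z Hz. pose proof (cut_plane_nz s Hs z Hz).
    apply holo1_mult; [apply holo1_const|]. apply holo1_pow, holo1_Cinv; auto.
Qed.

(** Splitting the rising factorial of [a - x] and the factorial after their first [x] factors
    turns the binomial sum into a hypergeometric one. *)
Lemma symbol_coefficient_hyper (s xi : R) (g : R -> C) (a b : C) (x k : nat) : (0 < s < 1)%R -> (s * s)%R = xi -> a + b = 1 -> loop s g ->
  coef_pos g (symbol s (INR x - a) (- INR x - a)) (x + k)
  = RtoC s ^ (x + k) * ((- (1)) ^ x * rising b x / INR (fact x)) * eval_ps xi (hyper a k x).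
Proof.
  intros Hs Hxi Hab Hg. rewrite symbol_coefficient by auto.
  assert (Hx : (0 < xi < 1)%R) by nra.
  destruct (uniform_bounds a b xi Hx) as (K & r & HK & Hr & GU & _).
  unfold eval_ps. rewrite <- (Cseries_scal (K * (r / xi) ^ k) r ltac:(lra) _ (GU k x)).
  f_equal. extensionality l. unfold binom_coef, hyper.
  replace (- (- INR x - a)) with (a + INR x) by ring.
  replace (- (INR x - a)) with (1 - b - INR x) by (rewrite <- Hab; ring).
  rewrite <- Nat.add_assoc, (rising_add _ x (k + l)), rising_reflect.
  replace (1 - b - INR x + INR x) with a by (rewrite <- Hab; ring).
  rewrite <- (rising_succ_fact x (k + l)).
  assert (Es : RtoC s ^ l * RtoC s ^ (x + (k + l)) = RtoC s ^ (x + k) * RtoC (xi ^ l)).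
  { rewrite RtoC_pow, <- Hxi, RtoC_mult, Cpow_mult_l, !Cpow_add_r. ring. }
  assert (N1 := INRC_fact_nz l). assert (N2 := INRC_fact_nz x). assert (N3 := rising_succ_nz x (k + l)).
  transitivity (RtoC s ^ l * RtoC s ^ (x + (k + l)) * (rising (a + INR x) l / INR (fact l) *
    ((- (1)) ^ x * rising b x * rising a (k + l) / (rising (INR x + 1) (k + l) * INR (fact x))))); [field; auto|].
  rewrite Es. field. auto.
Qed.

(** * The contour integral and the kernel *)

Lemma sqrt_unit (xi : R) : (0 < xi < 1)%R -> (0 < sqrt xi < 1)%R.
Proof.
  intros H. split; [apply sqrt_lt_R0; lra|]. rewrite <- sqrt_1. apply sqrt_lt_1; lra.
Qed.

Lemma winding_one (g : R -> C) (p : C) : winding g p = 1 -> path_int g (fun w => / (w - p)) 0 1 = two_pi_i.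
Proof.
  unfold winding. fold two_pi_i. change (contour_int g (fun w => / (w - p))) with (path_int g (fun w => / (w - p)) 0 1).
  intros H. transitivity (two_pi_i * (/ two_pi_i * path_int g (fun w => / (w - p)) 0 1)); [field; apply two_pi_i_nz|].
  rewrite H. ring.
Qed.

Lemma admissible_loop (xi : R) (g : R -> C) : (0 < xi < 1)%R -> admissible_contour xi g -> loop (sqrt xi) g.
Proof.
  intros Hxi ((H1 & H2 & _) & (Ca & Cb) & (_ & Hw) & _).
  split; [apply piecewise_C1_pw_smooth; auto|]. split; [exact H2|]. split.
  - intros t Ht. destruct (Req_dec (Im (g t)) 0) as [Hi|Hi]; [|left; exact Hi]. right.
    assert (E : g t = RtoC (Re (g t))) by (apply C_ext; [reflexivity|exact Hi]).
    destruct (Rlt_le_dec (Re (g t)) 0) as [Hl|Hl]; [left; exact Hl|]. right.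
    split; apply Rnot_le_lt; intros Hle.
    + apply (Ca (Re (g t))); [lra|]. exists t. split; auto.
    + apply (Cb (Re (g t))); [lra|]. exists t. split; auto.
  - rewrite <- (winding_one g 0 Hw). apply path_int_ext; [lra|]. intros t _. f_equal. ring.
Qed.

(** In [symbol_coefficient_hyper], the residue is the case [k = 0] and the coefficient of
    [w^j] the case [k = j + 1]. *)
Lemma factor_coefficients (s xi : R) (g : R -> C) (a b : C) (x : nat) :
  (0 < s < 1)%R -> (s * s)%R = xi -> a + b = 1 -> loop s g ->
  let F := fun w => symbol s (INR x - a) (- INR x - a) w * / w ^ x * / w in
  let A := RtoC s ^ x * ((- (1)) ^ x * rising b x / INR (fact x)) in
  (forall z : C, cut_plane s z -> holo2 F z) /\
  coef_neg g F 0 = A * eval_ps xi (hyper a 0 x) /\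
  forall j : nat, coef_pos g F j = A * RtoC s ^ S j * eval_ps xi (hyper a (S j) x).
Proof.
  intros Hs Hxi Hab Hg F A.
  assert (Hn : forall t, (0 <= t <= 1)%R -> g t <> 0) by (intros t Ht; apply (cut_plane_nz s Hs), Hg; auto).
  split; [|split].
  - intros z Hz. pose proof (cut_plane_nz s Hs z Hz) as Hzn.
    assert (P : forall n, holo2 (fun w => / w ^ n) z).
    { induction n as [|n IH].
      - apply (holo2_ext (fun w => 1 + 0 * w)); [intros w; simpl; rewrite Cmult_0_l; field|apply holo2_affine].
      - apply (holo2_ext (fun w => / w * / w ^ n)).
        + intros w. simpl. destruct (Ceq_dec w 0) as [->|Hw].
          * replace (0 * 0 ^ n) with (RtoC 0) by ring. replace (/ 0) with (RtoC 0); [ring|].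
            unfold Cinv. apply C_ext; simpl; unfold Rdiv; ring.
          * field. split; auto. apply Cpow_nz; auto.
        + apply holo2_mult; auto. apply holo2_Cinv; auto. }
    apply holo2_mult; [apply holo2_mult; [apply holo2_symbol; auto|apply P]|apply holo2_Cinv; auto].
  - transitivity (coef_pos g (symbol s (INR x - a) (- INR x - a)) (x + 0)).
    + unfold coef_neg, coef_pos. f_equal. apply path_int_ext; [lra|]. intros t Ht. specialize (Hn t Ht).
      rewrite Nat.add_0_r. unfold F. simpl. field. split; auto. apply Cpow_nz; auto.
    + rewrite (symbol_coefficient_hyper s xi g a b) by auto. rewrite Nat.add_0_r. reflexivity.
  - intros j. transitivity (coef_pos g (symbol s (INR x - a) (- INR x - a)) (x + S j)).
    + unfold coef_pos. f_equal. apply path_int_ext; [lra|]. intros t Ht. specialize (Hn t Ht).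
      unfold F. replace (S (x + S j)) with (x + (1 + S j))%nat by lia. rewrite !Cpow_add_r. simpl. field.
      repeat split; auto; apply Cpow_nz; auto.
    + rewrite (symbol_coefficient_hyper s xi g a b) by auto. unfold A. rewrite Cpow_add_r. ring.
Qed.

(** The series of products of Laurent coefficients is the sum over [k] that represents the
    kernel, its first term being split off. *)
Lemma contour_integral_kernel_val (xi : R) (g1 g2 : R -> C) (a b : C) (x y : nat) :
  (0 < xi < 1)%R -> a + b = 1 -> (0 < x + y)%nat -> loop (sqrt xi) g1 -> loop (sqrt xi) g2 ->
  (forall t1 t2 : R, (0 <= t1 <= 1)%R -> (0 <= t2 <= 1)%R -> g2 t2 <> / g1 t1) ->
  (forall t : R, (0 <= t <= 1)%R -> path_int g2 (fun w => / (w - / g1 t)) 0 1 = two_pi_i) ->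
  2 * (1 - RtoC xi) *
  path_int g1 (fun w1 => symbol (sqrt xi) (INR x - a) (- INR x - a) w1 * / w1 ^ x * / w1 *
    path_int g2 (fun w2 => symbol (sqrt xi) (INR y - b) (- INR y - b) w2 * / w2 ^ y * / w2 *
      ((w1 * w2 + 1) / (w1 * w2 - 1))) 0 1) 0 1
  = two_pi_i * two_pi_i * RtoC (sqrt xi) ^ (x + y)
    * ((- (1)) ^ (x + y) * rising b x * rising a y / (INR (fact x) * INR (fact y)))
    * ((INR x + INR y) * kernel_val a b xi x y).
Proof.
  intros Hxi Hab Hxy H1 H2 Hav Hw. set (s := sqrt xi) in *.
  assert (Hs : (0 < s < 1)%R) by (apply sqrt_unit; auto).
  assert (Hss : (s * s)%R = xi) by (apply sqrt_sqrt; lra).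
  assert (Hba : b + a = 1) by (rewrite <- Hab; ring).
  destruct (factor_coefficients s xi g1 a b x Hs Hss Hab H1) as (F1 & F2 & F3).
  destruct (factor_coefficients s xi g2 b a y Hs Hss Hba H2) as (G1 & G2 & G3).
  cbv zeta in *.
  rewrite (double_contour s g1 g2 _ _ Hs H1 H2 (fun z Hz => holo2_holo1 _ z (F1 z Hz)) G1 Hav Hw).
  rewrite F2, G2.
  set (B := RtoC s ^ (x + y) * ((- (1)) ^ (x + y) * rising b x * rising a y / (INR (fact x) * INR (fact y)))).
  assert (N1 := INRC_fact_nz x). assert (N2 := INRC_fact_nz y).
  destruct (kernel_val_sum a b xi Hab Hxi x y Hxy) as ((M & r & Hr & G) & E). rewrite E.
  set (u := fun k => fold_weight k * RtoC (xi ^ k) * (eval_ps xi (hyper a k x) * eval_ps xi (hyper b k y))) in *.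
  rewrite (Cseries_first M r Hr u G).
  assert (G' : geo (M * r) r (fun j => u (S j))).
  { intros j. replace (M * r * r ^ j)%R with (M * r ^ S j)%R by (simpl; ring). apply G. }
  assert (ES : 2 * Cseries (fun j => coef_pos g1 (fun w => symbol s (INR x - a) (- INR x - a) w * / w ^ x * / w) j *
       coef_pos g2 (fun w => symbol s (INR y - b) (- INR y - b) w * / w ^ y * / w) j) = B * Cseries (fun j => u (S j))).
  { transitivity (2 * (B / 2 * Cseries (fun j => u (S j)))); [|field; intros e; apply RtoC_inj in e; lra].
    f_equal. rewrite <- (Cseries_scal (M * r) r Hr _ G'). f_equal. extensionality j.
    rewrite F3, G3. unfold u, B. simpl fold_weight.
    assert (Ep : RtoC s ^ S j * RtoC s ^ S j = RtoC (xi ^ S j)).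
    { rewrite RtoC_pow, <- Hss, RtoC_mult, Cpow_mult_l. reflexivity. }
    rewrite <- Ep, !Cpow_add_r. field. auto. }
  rewrite ES.
  assert (E0 : u 0%nat = eval_ps xi (hyper a 0 x) * eval_ps xi (hyper b 0 y)) by (unfold u; simpl; ring).
  rewrite E0. unfold B. rewrite !Cpow_add_r. field. auto.
Qed.

(** The resolvent equation in terms of [root_weight], whose decay follows from that of the
    residues [c_x xi^x]. *)
Lemma Kker_kernel_val (nu : C) (mu cv xi : R) (x y : nat) :
  RtoC mu = nu * nu -> (mu < 1 / 4)%R -> Ccos (PI * nu) = RtoC cv -> (0 < cv)%R ->
  is_lim_seq (fun m => cv * (INR m * INR (fact m) ^ 2 / half_prod mu (S m)))%R PI ->
  (- (1 / 2) < Re nu < 1 / 2)%R -> (0 < xi < 1)%R -> (0 < x)%nat -> (0 < y)%nat ->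
  Kker nu xi x y = RtoC (root_weight mu xi x * root_weight mu xi y) * kernel_val (1 / 2 - nu) (1 / 2 + nu) xi x y.
Proof.
  intros Hmu Hmu4 Hcos Hcv Hlim Hre Hxi Hx Hy.
  set (a := 1 / 2 - nu). set (b := 1 / 2 + nu).
  assert (Hab : a + b = 1) by (unfold a, b; field; intros e; apply RtoC_inj in e; lra).
  destruct (kernel_val_bound a b xi Hab Hxi) as (K & r & HK & Hr & HB & HC).
  assert (Hsr : (0 < sqrt r < 1)%R) by (apply sqrt_unit; auto).
  unfold Kker, Lop.
  apply (resolvent_matrix (root_weight mu xi) (sqrt K) (sqrt r) Hsr) with (Kb := K); auto.
  - intros n. split; [apply sqrt_pos|].
    specialize (HC n). unfold a, b in HC. rewrite (residue_coef_root_weight nu mu xi Hmu Hmu4 Hxi), Cmod_R in HC.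
    pose proof (sqrt_pos K). assert (0 <= sqrt r ^ n)%R by (apply pow_le; lra).
    assert (0 <= sqrt K * sqrt r ^ n)%R by (apply Rmult_le_pos; auto).
    pose proof (Rle_abs (2 * (root_weight mu xi n * root_weight mu xi n))).
    apply Rsqr_incr_0_var; auto. unfold Rsqr.
    replace (sqrt K * sqrt r ^ n * (sqrt K * sqrt r ^ n))%R with (K * r ^ n)%R.
    + assert (0 <= root_weight mu xi n * root_weight mu xi n)%R by apply Rle_0_sqr. lra.
    + rewrite <- (sqrt_sqrt K) at 1 by lra. rewrite <- (sqrt_sqrt r) at 1 by lra. rewrite Rpow_mult_distr. ring.
  - intros p q Hp Hq. apply (Lmat_eval nu mu cv xi); auto.
  - intros p q Hp Hq. apply HB. lia.
  - intros p q Hp Hq. rewrite <- (kernel_val_equation a b xi Hab Hxi p q Hp Hq). f_equal.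
    f_equal. extensionality n. unfold a, b. rewrite (residue_coef_root_weight nu mu xi Hmu Hmu4 Hxi). reflexivity.
Qed.

Theorem proposition4 (xi : R) (nu : C) (x y : nat) (g1 g2 : R -> C) :
  (0 < xi < 1)%R ->
  (exists r : R, (0 <= r < 1 / 2)%R /\ nu = RtoC r) \/ Re nu = 0%R ->
  (0 < x)%nat -> (0 < y)%nat ->
  admissible_contour xi g1 ->
  admissible_contour xi g2 ->
  (forall w1 : C, on_contour g1 w1 -> goes_around g2 (/ w1)) ->
  gfun nu (- Z.of_nat y) / gfun nu (- Z.of_nat x) * Kker nu xi x y =
  (sqrt (INR x * INR y) / (INR x + INR y))%R
  * ((1 - xi) / (2 * PI * Ci) ^ 2)
  * contour_int g1 (fun w1 => contour_int g2 (fun w2 =>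
      Cpowc (1 - w1 * sqrt xi) (- (1 / 2) + nu + INR x)
      * Cpowc (1 - sqrt xi / w1) (- (1 / 2) + nu - INR x)
      * Cpowc (1 - w2 * sqrt xi) (- (1 / 2) - nu + INR y)
      * Cpowc (1 - sqrt xi / w2) (- (1 / 2) - nu - INR y)
      * / (w1 ^ x) * / (w2 ^ y)
      * ((w1 * w2 + 1) / (w1 * w2 - 1))
      / (w1 * w2))).
Proof.
  intros Hxi Hnu Hx Hy A1 A2 Hgo.
  destruct (nu_data nu Hnu) as (mu & cv & Hmu & Hmu4 & Hcos & Hcv & Hlim & Hre).
  pose proof (admissible_loop xi g1 Hxi A1) as L1. pose proof (admissible_loop xi g2 Hxi A2) as L2.
  pose proof (sqrt_unit xi Hxi) as Hs.
  set (a := 1 / 2 - nu). set (b := 1 / 2 + nu).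
  assert (H2 : RtoC 2 <> 0) by (intros e; apply RtoC_inj in e; lra).
  assert (Hab : a + b = 1) by (unfold a, b; field; auto).
  assert (Hav : forall t1 t2 : R, (0 <= t1 <= 1)%R -> (0 <= t2 <= 1)%R -> g2 t2 <> / g1 t1).
  { intros t1 t2 Ht1 Ht2 e. destruct (Hgo (g1 t1)) as [Hn _]; [exists t1; auto|]. apply Hn. exists t2. auto. }
  assert (Hw : forall t : R, (0 <= t <= 1)%R -> path_int g2 (fun w => / (w - / g1 t)) 0 1 = two_pi_i).
  { intros t Ht. apply winding_one. apply Hgo. exists t. auto. }
  pose proof (contour_integral_kernel_val xi g1 g2 a b x y Hxi Hab ltac:(lia) L1 L2 Hav Hw) as E.
  rewrite (Kker_kernel_val nu mu cv xi x y), Cmult_assoc, (gauge_weight nu mu cv xi) by auto.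
  fold a. fold b. fold two_pi_i.
  set (I := path_int g1 _ 0 1) in E.
  match goal with |- _ = _ * _ * ?J => assert (EI : J = I) end.
  { apply path_int_ext; [lra|]. intros t Ht.
    assert (N1 : g1 t <> 0) by (apply (cut_plane_nz _ Hs), L1; auto).
    set (c := symbol (sqrt xi) (INR x - a) (- INR x - a) (g1 t) * / g1 t ^ x * / g1 t).
    rewrite <- path_int_scal.
    - apply path_int_ext; [lra|]. intros t2 Ht2.
      assert (N2 : g2 t2 <> 0) by (apply (cut_plane_nz _ Hs), L2; auto).
      unfold c, symbol.
      replace (- (1 / 2) + nu + INR x) with (INR x - a) by (unfold a; ring).
      replace (- (1 / 2) + nu - INR x) with (- INR x - a) by (unfold a; ring).
      replace (- (1 / 2) - nu + INR y) with (INR y - b) by (unfold b; ring).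
      replace (- (1 / 2) - nu - INR y) with (- INR y - b) by (unfold b; ring).
      assert (ED : / (g1 t * g2 t2) = / g1 t * / g2 t2) by (field; auto).
      unfold Cdiv at 4. unfold Cdiv at 3.
      unfold Cdiv. rewrite ED. ring.
    - apply path_ex; [apply L2|]. intros t2 Ht2.
      assert (HO : cut_plane (sqrt xi) (g2 t2)) by (apply L2; auto).
      assert (N2 : g2 t2 <> 0) by (apply (cut_plane_nz _ Hs); auto).
      apply Flim_mult; [apply locally_filter| |].
      + assert (hc := proj1 (factor_coefficients (sqrt xi) xi g2 b a y Hs (sqrt_sqrt xi ltac:(lra)) ltac:(rewrite <- Hab; ring) L2) _ HO).
        apply (holo1_cont _ _ (holo2_holo1 _ _ hc)).
      + apply (holo1_cont (fun w2 => (g1 t * w2 + 1) / (g1 t * w2 - 1))).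
        apply holo1_mult.
        * apply holo1_plus; [|apply holo1_const]. apply holo1_mult; [apply holo1_const|apply holo1_id].
        * apply (holo1_inv (fun w2 => g1 t * w2 - 1)).
          -- intros e. apply (Hav t t2 Ht Ht2).
             assert (N1' : g1 t <> 0) by exact N1.
             transitivity (/ g1 t * (g1 t * g2 t2 - 1) + / g1 t); [field; auto|]. rewrite e. ring.
          -- apply holo1_minus; [|apply holo1_const]. apply holo1_mult; [apply holo1_const|apply holo1_id]. }
  rewrite EI. clear EI.
  assert (Nxy := INRC_add_nz x y ltac:(lia)).
  assert (Nt := two_pi_i_nz).
  assert (Nxi : 1 - RtoC xi <> 0).
  { rewrite <- RtoC_minus. apply INRC_pos_nz. lra. }
  assert (Ek : kernel_val a b xi x y * (RtoC (sqrt xi) ^ (x + y)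
    * ((- (1)) ^ (x + y) * rising b x * rising a y / (INR (fact x) * INR (fact y)))) = 2 * (1 - RtoC xi) * I / (two_pi_i * two_pi_i * (INR x + INR y))).
  { rewrite E. field. repeat split; auto; apply INRC_fact_nz. }
  assert (Eq : RtoC (sqrt (INR x * INR y) / (INR x + INR y)) = RtoC (sqrt (INR x * INR y)) / (INR x + INR y)).
  { rewrite RtoC_div, RtoC_plus. reflexivity. intros e. apply Nxy. rewrite <- RtoC_plus, e. reflexivity. }
  rewrite Eq.
  transitivity (RtoC (sqrt (INR x * INR y)) / 2 * (kernel_val a b xi x y * (RtoC (sqrt xi) ^ (x + y)
    * ((- (1)) ^ (x + y) * rising b x * rising a y / (INR (fact x) * INR (fact y)))))).
  - field. repeat split; auto; apply INRC_fact_nz.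
  - rewrite Ek. simpl Cpow. field. auto.
Qed.
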